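(* Let $A>0$ and $0<\theta<\tfrac12$ be fixed, and let $\phi$ be a smooth function with compact support contained in $[1,2]$. For $T\ge 2$ let $B(s)=\sum_{n\le T^{\theta}} b(n)n^{-s}$, where the coefficients $b(n)$ (which may depend on $T$) are real and satisfy $|b(n)|\ll d_A(n)$ uniformly. Then for every fixed $C>0$, as $T\to\infty$, $$\sum_{\ell\in\mathbb{Z}} \big|\zeta(\tfrac12+i\ell)B(\tfrac12+i\ell)\big|^2\,\phi\Big(\frac{\ell}{T}\Big)=\int_{\mathbb{R}}\big|\zeta(\tfrac12+it)B(\tfrac12+it)\big|^2\,\phi\Big(\frac{t}{T}\Big)\,dt+O\big(T(\log T)^{-C}\big).$$
   Context: $d_A(n)$ denotes the $A$-fold divisor function (coefficients of $\zeta(s)^A$). $\zeta$ is the Riemann zeta function. *)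

(* Defs.v *)
From Stdlib Require Import Bool Reals Lra ZArith List ClassicalEpsilon.
Import ListNotations.
Open Scope R_scope.

Definition Cplx := (R * R)%type.
Definition Cadd (z w : Cplx) : Cplx := (fst z + fst w, snd z + snd w).
Definition Copp (z : Cplx) : Cplx := (- fst z, - snd z).
Definition Csub (z w : Cplx) : Cplx := Cadd z (Copp w).
Definition Cmul (z w : Cplx) : Cplx :=
  (fst z * fst w - snd z * snd w, fst z * snd w + snd z * fst w).
Definition Cnorm2 (z : Cplx) : R := fst z ^ 2 + snd z ^ 2.
Definition Cinv (z : Cplx) : Cplx := (fst z / Cnorm2 z, - snd z / Cnorm2 z).
Definition Cscale (r : R) (z : Cplx) : Cplx := (r * fst z, r * snd z).

Definition cpow_nat (n : nat) (s : Cplx) : Cplx :=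
  Cscale (Rpower (INR n) (fst s))
         (cos (snd s * ln (INR n)), sin (snd s * ln (INR n))).

Definition Csum (f : nat -> Cplx) (l : list nat) : Cplx :=
  fold_right (fun n acc => Cadd (f n) acc) (0, 0) l.

Definition Cconv (u : nat -> Cplx) (l : Cplx) : Prop :=
  Un_cv (fun N => fst (u N)) (fst l) /\ Un_cv (fun N => snd (u N)) (snd l).

(* Dirichlet eta function: eta(s) = sum_{n>=1} (-1)^(n-1) n^(-s), convergent for Re s > 0 *)
Definition eta_partial (s : Cplx) (N : nat) : Cplx :=
  Csum (fun n => Cscale ((-1) ^ (n - 1)%nat) (cpow_nat n (Copp s))) (seq 1 N).
Definition eta (s : Cplx) : Cplx :=
  epsilon (inhabits (0, 0)) (fun l => Cconv (eta_partial s) l).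

(* Riemann zeta function, via zeta(s) = eta(s) / (1 - 2^(1-s)); this is the
   analytic continuation of zeta on Re s > 0, s <> 1 (in particular on the
   critical line). *)
Definition zeta (s : Cplx) : Cplx :=
  Cmul (eta s) (Cinv (Csub (1, 0) (cpow_nat 2 (Csub (1, 0) s)))).

Fixpoint vp_aux (fuel p n : nat) : nat :=
  match fuel with
  | O => O
  | S f => if (andb (andb (Nat.ltb 1 p) (Nat.ltb 0 n)) (Nat.eqb (n mod p) 0))
           then S (vp_aux f p (n / p)) else O
  end.
Definition vp (p n : nat) : nat := vp_aux n p n.

Definition primeb (p : nat) : bool :=
  andb (Nat.leb 2 p) (forallb (fun d => negb (Nat.eqb (p mod d) 0)) (seq 2 (p - 2))).

(* generalized binomial coefficient  binom(A+k-1, k) = A(A+1)...(A+k-1)/k! *)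
Definition gbinom (A : R) (k : nat) : R :=
  fold_right Rmult 1 (map (fun j => A + INR j) (seq 0 k)) / INR (fact k).

(* d_A(n) = prod_{p^k || n} binom(A+k-1,k): the n-th Dirichlet coefficient of zeta(s)^A *)
Definition dA (A : R) (n : nat) : R :=
  fold_right Rmult 1
    (map (fun p => if primeb p then gbinom A (vp p n) else 1) (seq 2 (n - 1))).

Definition Bpoly (b : nat -> R) (T theta : R) (s : Cplx) : Cplx :=
  Csum (fun n => if Rle_dec (INR n) (Rpower T theta)
                 then Cscale (b n) (cpow_nat n (Copp s)) else (0, 0))
       (seq 1 (Z.to_nat (up (Rpower T theta)))).

Definition crit (t : R) : Cplx := (1 / 2, t).

Definition symsum (f : Z -> R) (N : nat) : R :=
  fold_right Rplus 0
    (map (fun k => f (Z.of_nat k - Z.of_nat N)%Z) (seq 0 (2 * N + 1))).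
Definition Zsum_is (f : Z -> R) (S : R) : Prop := Un_cv (symsum f) S.

Definition Rint_is (f : R -> R) (I : R) : Prop :=
  exists pr : forall M : R, Riemann_integrable f (- M) M,
    Un_cv (fun N => RiemannInt (pr (INR N))) I.

Definition smooth (f : R -> R) : Prop :=
  exists D : nat -> R -> R, D O = f /\
    forall k x, derivable_pt_lim (D k) x (D (S k) x).

(* Main.v *)
(** Replace zeta by a smoothly truncated Dirichlet polynomial and apply Poisson summation in [l]: the
    difference of the two sides becomes a sum over frequencies [nu >= 1] of twisted mean values, and
    opening the squares reduces each of them to sums over [a, c] of the double sums
    [sum_(m,n) (m n)^(-1/2) T C (T ln (n / (m x)))] with [x = (a / c) exp (2 pi nu)] and [C] the cosine
    transform of [phi].  Put [mu = sqrt (T / x)].  The terms with [m <= mu] force [n] to be close to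
    [m x]; for the other terms Poisson summation in [n] followed by Abel summation in [m] only leaves
    dual frequencies [k <= T^eps mu] with [k x] close to an integer.  Hence everything is controlled by
    the pairs [(k a, l c)] that are close to the line of slope [y = exp (2 pi nu)], weighted by divisor
    functions.  If [y] exceeds a power of [log T] a trivial count suffices; otherwise the difference of
    two such lattice points would be a very good rational approximation to [exp (2 pi nu)], which is
    excluded by an irrationality measure for [exp (2 pi nu)] proved with an interpolation determinant in
    the functions [z^j exp (2 pi k z)]. *)

From Stdlib Require Import Reals Lra Lia ZArith List Classical FunctionalExtensionality.
From mathcomp Require all_boot all_order all_algebra all_fingroup zify ring lra complex Rstruct.
From Coquelicot Require Import Coquelicot.
Require Import Defs.
Open Scope R_scope.

(** The hypothesis theta < 1/2 acts through the width of the strip around the line. For coefficients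
    [a], [c] its half-width is [c / mu = sqrt (a c y / T)] up to a small power of [T]; as
    [a c <= T^(2 theta)], this is [sqrt y] times a negative power of [T]. Only O(log T) frequencies
    [nu] matter, since beyond them every phase is far from stationary. A fixed power of log T must
    still be saved for each, while the divisor weights cost powers of log T. For [nu] of size log
    log T or less the saving can only be arithmetic: were exp (2 pi nu) extremely close to p / q
    with [q] a power of log T, the multiples of (q, p) would all lie in the strip. With denominators
    so small, even a gap of exp (- (log q)^50) is ample, because (log log T)^50 is negligible
    against log T; but the measure must be uniform in [nu]. The two copies of zeta are replaced by
    polynomials of different lengths, the second far longer, so that for each [m] of the first every
    [n] near [m x] occurs in the second. *)

(** * Finite sums over 1, ..., n *)

Fixpoint sum1 (f : nat -> R) (n : nat) : R :=
  match n with O => 0 | S k => sum1 f k + f (S k) end.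

Lemma sum1_ext f g n : (forall k, (1 <= k <= n)%nat -> f k = g k) -> sum1 f n = sum1 g n.
Proof. induction n; intros H; simpl; auto. rewrite IHn, H; auto; try lia. intros; apply H; lia. Qed.

Lemma sum1_le f g n : (forall k, (1 <= k <= n)%nat -> f k <= g k) -> sum1 f n <= sum1 g n.
Proof.
  induction n; intros H; simpl; [lra|].
  apply Rplus_le_compat; [apply IHn; intros; apply H | apply H]; lia.
Qed.

Lemma sum1_zero n : sum1 (fun _ => 0) n = 0.
Proof. induction n; simpl; lra. Qed.

Lemma sum1_ge0 f n : (forall k, (1 <= k <= n)%nat -> 0 <= f k) -> 0 <= sum1 f n.
Proof. intros H. rewrite <- (sum1_zero n). apply sum1_le; auto. Qed.

Lemma sum1_const c n : sum1 (fun _ => c) n = INR n * c.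
Proof. induction n; simpl sum1; [simpl; lra | rewrite IHn, S_INR; ring]. Qed.

Lemma sum1_plus f g n : sum1 (fun k => f k + g k) n = sum1 f n + sum1 g n.
Proof. induction n; simpl; [lra | rewrite IHn; ring]. Qed.

Lemma sum1_minus f g n : sum1 (fun k => f k - g k) n = sum1 f n - sum1 g n.
Proof. induction n; simpl; [lra | rewrite IHn; ring]. Qed.

Lemma sum1_scal c f n : sum1 (fun k => c * f k) n = c * sum1 f n.
Proof. induction n; simpl; [lra | rewrite IHn; ring]. Qed.

Lemma sum1_scal_r c f n : sum1 (fun k => f k * c) n = sum1 f n * c.
Proof. induction n; simpl; [lra | rewrite IHn; ring]. Qed.

Lemma sum1_abs f n : Rabs (sum1 f n) <= sum1 (fun k => Rabs (f k)) n.
Proof.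
  induction n; simpl; [rewrite Rabs_R0; lra|].
  eapply Rle_trans; [apply Rabs_triang|]. lra.
Qed.

Lemma sum1_abs_bound f n M :
  (forall k, (1 <= k <= n)%nat -> Rabs (f k) <= M) -> Rabs (sum1 f n) <= INR n * M.
Proof.
  intros H. eapply Rle_trans; [apply sum1_abs|]. rewrite <- sum1_const. apply sum1_le; auto.
Qed.

Lemma sum1_swap (f : nat -> nat -> R) n m :
  sum1 (fun i => sum1 (fun j => f i j) m) n = sum1 (fun j => sum1 (fun i => f i j) n) m.
Proof.
  induction n; simpl.
  - symmetry. apply sum1_zero.
  - rewrite IHn, <- sum1_plus. reflexivity.
Qed.

Lemma sum1_mult f g n m :
  sum1 f n * sum1 g m = sum1 (fun i => sum1 (fun j => f i * g j) m) n.
Proof.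
  rewrite <- sum1_scal_r. apply sum1_ext. intros i _. rewrite sum1_scal. reflexivity.
Qed.

Lemma sum1_extend f n m : (n <= m)%nat ->
  (forall k, (n < k <= m)%nat -> f k = 0) -> sum1 f m = sum1 f n.
Proof.
  intros H; induction H; intros Hz; auto.
  simpl. rewrite IHle, Hz; [ring | lia | intros; apply Hz; lia].
Qed.

Lemma sum1_le_extend f n m : (n <= m)%nat ->
  (forall k, (n < k <= m)%nat -> 0 <= f k) -> sum1 f n <= sum1 f m.
Proof.
  intros H; induction H; intros Hz; [lra|].
  simpl. assert (0 <= f (S m)) by (apply Hz; lia).
  assert (sum1 f n <= sum1 f m) by (apply IHle; intros; apply Hz; lia). lra.
Qed.

Lemma sum1_delta (g : nat -> R) j n :
  sum1 (fun k => if Nat.eqb k j then g k else 0) n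
  = if andb (Nat.leb 1 j) (Nat.leb j n) then g j else 0.
Proof.
  induction n as [|n IH].
  - destruct j; reflexivity.
  - change (sum1 ?h (S n)) with (sum1 h n + h (S n)). cbv beta. rewrite IH.
    destruct (Nat.eqb_spec (S n) j) as [<-|Hne].
    + replace (Nat.leb (S n) n) with false by (symmetry; apply Nat.leb_gt; lia).
      replace (Nat.leb (S n) (S n)) with true by (symmetry; apply Nat.leb_le; lia).
      rewrite Bool.andb_false_r. simpl. ring.
    + destruct (Nat.leb_spec j n), (Nat.leb_spec j (S n)); try lia; ring.
Qed.

Lemma sum1_recl f n : sum1 f (S n) = f 1%nat + sum1 (fun k => f (S k)) n.
Proof. induction n; simpl in *; [lra | rewrite IHn; lra]. Qed.

Lemma sum1_add f n m : sum1 f (n + m) = sum1 f n + sum1 (fun k => f (n + k)%nat) m.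
Proof.
  induction m; simpl.
  - rewrite Nat.add_0_r. ring.
  - replace (n + S m)%nat with (S (n + m)) by lia. simpl. rewrite IHm. ring.
Qed.

Lemma sum1_mul_blocks f J M :
  sum1 f (J * M) = sum1 (fun j => sum1 (fun i => f ((j - 1) * M + i)%nat) M) J.
Proof.
  induction J; [reflexivity|].
  change (sum1 ?h (S J)) with (sum1 h J + h (S J)). cbv beta.
  replace (S J * M)%nat with (J * M + M)%nat by lia.
  rewrite sum1_add, IHJ. simpl. rewrite Nat.sub_0_r. reflexivity.
Qed.

Lemma ln_ge_1_minus_inv x : 0 < x -> 1 - / x <= ln x.
Proof.
  intros Hx. assert (H := exp_ineq1_le (- ln x)).
  rewrite exp_Ropp, exp_ln in H by auto. lra.
Qed.

Lemma harmonic_sum_le n : (1 <= n)%nat -> sum1 (fun k => / INR k) n <= 1 + ln (INR n).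
Proof.
  induction n as [|n IH]; intros Hn; [lia|].
  destruct n as [|n].
  - simpl. rewrite ln_1. lra.
  - change (sum1 (fun k => / INR k) (S n) + / INR (S (S n)) <= 1 + ln (INR (S (S n)))).
    assert (IH' := IH ltac:(lia)).
    set (u := INR (S n)) in *.
    assert (u0 : 0 < u) by (apply lt_0_INR; lia).
    assert (E : INR (S (S n)) = u + 1) by (unfold u; rewrite <- S_INR; auto).
    rewrite E.
    assert (H := ln_ge_1_minus_inv ((u + 1) / u)).
    rewrite ln_div in H by lra.
    assert (1 - / ((u + 1) / u) = / (u + 1)) by (field; lra).
    assert (0 < (u + 1) / u) by (apply Rdiv_lt_0_compat; lra).
    specialize (H H1). lra.
Qed.

(** * An irrationality measure for exp (2 pi nu) *)

Fixpoint sum0 (f : nat -> R) (n : nat) : R :=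
  match n with O => 0 | S k => sum0 f k + f k end.

Lemma nonneg_derivative_le (f df : R -> R) (a b : R) :
  a <= b -> (forall t, a <= t <= b -> is_derive f t (df t)) ->
  (forall t, a <= t <= b -> 0 <= df t) -> f a <= f b.
Proof.
  intros Hab Hd Hp.
  destruct (MVT_gen f a b df) as [c [Hc Heq]].
  - rewrite Rmin_left, Rmax_right by lra. intros x Hx. apply Hd. lra.
  - rewrite Rmin_left, Rmax_right by lra. intros x Hx.
    apply continuity_pt_filterlim. apply (ex_derive_continuous f x).
    exists (df x). apply Hd. lra.
  - rewrite Rmin_left, Rmax_right in Hc by lra.
    assert (0 <= df c * (b - a)) by (apply Rmult_le_pos; [apply Hp; lra | lra]).
    lra.
Qed.

Lemma is_derive_sum0 (f : nat -> R -> R) (df : nat -> R) (n : nat) (x : R) :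
  (forall k, (k < n)%nat -> is_derive (f k) x (df k)) ->
  is_derive (fun t => sum0 (fun k => f k t) n) x (sum0 df n).
Proof.
  induction n as [|n IH]; intros H; simpl.
  - apply (is_derive_const (V := R_NormedModule)).
  - apply (is_derive_plus (V := R_NormedModule)).
    + apply IH. intros; apply H; lia.
    + apply H; lia.
Qed.

Lemma sum0_ext f g n : (forall k, (k < n)%nat -> f k = g k) -> sum0 f n = sum0 g n.
Proof.
  induction n; intros H; simpl; auto. rewrite IHn, H; auto.
Qed.

Lemma sum0_recl f n : sum0 f (S n) = f O + sum0 (fun k => f (S k)) n.
Proof. induction n; simpl in *; [lra | rewrite IHn; lra]. Qed.

Lemma is_derive_pow_fact (c : R) (k : nat) (t : R) :
  is_derive (fun t => c * t ^ S k / INR (fact (S k))) t (c * t ^ k / INR (fact k)).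
Proof.
  auto_derive; auto.
  change (match k with 0%nat => 1 | S _ => INR k + 1 end) with (INR (S k)).
  replace (INR (fact k + k * fact k)) with (INR (S k) * INR (fact k))
    by (rewrite S_INR, plus_INR, mult_INR; ring).
  assert (INR (fact k) <> 0) by apply INR_fact_neq_0.
  assert (INR (S k) <> 0) by (apply not_0_INR; lia).
  field. auto.
Qed.

(** The family [f] carries a function together with all its derivatives, so the induction can pass
    to [fun k => f (S k)]. The bound for the derivative is then integrated by the monotonicity of
    [h + (f - P)] and [h - (f - P)]. *)
Lemma taylor_remainder_le (n : nat) : forall (f : nat -> R -> R) (s M : R),
  0 <= s -> (forall k t, is_derive (f k) t (f (S k) t)) ->
  (forall t, 0 <= t <= s -> Rabs (f n t) <= M) ->
  Rabs (f O s - sum0 (fun k => f k 0 * s ^ k / INR (fact k)) n)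
    <= M * s ^ n / INR (fact n).
Proof.
  induction n as [|n IH]; intros f s M Hs Hd HM.
  - simpl. rewrite Rminus_0_r. unfold Rdiv. rewrite Rinv_1, !Rmult_1_r. apply HM. lra.
  - set (P := fun t => sum0 (fun k => f k 0 * t ^ k / INR (fact k)) (S n)).
    set (P' := fun t => sum0 (fun k => f (S k) 0 * t ^ k / INR (fact k)) n).
    assert (HP : forall t, is_derive P t (P' t)).
    { intros t. unfold P.
      apply is_derive_ext with
        (fun t => f O 0 + sum0 (fun k => f (S k) 0 * t ^ S k / INR (fact (S k))) n).
      - intros u. rewrite sum0_recl. f_equal. change (fact 0) with 1%nat. simpl. field.
      - replace (P' t) with (0 + P' t) by ring.
        apply (is_derive_plus (V := R_NormedModule)).
        + apply (is_derive_const (V := R_NormedModule)).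
        + apply is_derive_sum0. intros k _. apply is_derive_pow_fact. }
    assert (Hb : forall t, 0 <= t <= s -> Rabs (f 1%nat t - P' t) <= M * t ^ n / INR (fact n)).
    { intros t Ht. apply (IH (fun k => f (S k))); [lra | intros; apply Hd | ].
      intros u Hu. apply HM. lra. }
    set (h := fun t => M * t ^ S n / INR (fact (S n))).
    assert (Hh : forall t, is_derive h t (M * t ^ n / INR (fact n)))
      by (intros t; apply is_derive_pow_fact).
    assert (P0 : P 0 = f O 0).
    { unfold P. rewrite sum0_recl. rewrite (sum0_ext _ (fun _ => 0)).
      - assert (forall m, sum0 (fun _ => 0) m = 0) as -> by (induction m; simpl; lra).
        simpl. field.
      - intros k _. rewrite pow_i by lia. unfold Rdiv. ring. }
    assert (h0 : h 0 = 0) by (unfold h; rewrite pow_i by lia; unfold Rdiv; ring).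
    change (Rabs (f O s - P s) <= h s).
    apply Rabs_le. split.
    + assert (h 0 + (f O 0 - P 0) <= h s + (f O s - P s)); [|lra].
      apply (nonneg_derivative_le (fun t => h t + (f O t - P t))
               (fun t => M * t ^ n / INR (fact n) + (f 1%nat t - P' t)) 0 s Hs).
      * intros t _. apply (is_derive_plus (V := R_NormedModule)); auto.
        apply (is_derive_minus (V := R_NormedModule)); auto.
      * intros t Ht. specialize (Hb t Ht). apply Rabs_le_between in Hb. lra.
    + assert (h 0 - (f O 0 - P 0) <= h s - (f O s - P s)); [|lra].
      apply (nonneg_derivative_le (fun t => h t - (f O t - P t))
               (fun t => M * t ^ n / INR (fact n) - (f 1%nat t - P' t)) 0 s Hs).
      * intros t _. apply (is_derive_minus (V := R_NormedModule)); auto.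
        apply (is_derive_minus (V := R_NormedModule)); auto.
      * intros t Ht. specialize (Hb t Ht). apply Rabs_le_between in Hb. lra.
Qed.

(** Powers of the complex number x + i y in real coordinates, so that the analytic estimates stay
    over the Stdlib reals; [zpowE] identifies them with powers in [R[i]]. *)
Fixpoint zpow (x y : R) (n : nat) : R * R :=
  match n with
  | O => (1, 0)
  | S k => (x * fst (zpow x y k) - y * snd (zpow x y k),
            x * snd (zpow x y k) + y * fst (zpow x y k))
  end.

Lemma zpow_le x y n :
  Rabs (fst (zpow x y n)) + Rabs (snd (zpow x y n)) <= (Rabs x + Rabs y) ^ n.
Proof.
  induction n as [|n IH]; simpl.
  - rewrite Rabs_R1, Rabs_R0. lra.
  - destruct (zpow x y n) as [u v]. simpl in *.
    apply Rle_trans with ((Rabs x + Rabs y) * (Rabs u + Rabs v)).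
    + apply Rle_trans with ((Rabs (x * u) + Rabs (y * v)) + (Rabs (x * v) + Rabs (y * u))).
      * apply Rplus_le_compat; [|apply Rabs_triang].
        unfold Rminus. rewrite <- (Rabs_Ropp (y * v)). apply Rabs_triang.
      * rewrite !Rabs_mult. right. ring.
    + apply Rmult_le_compat_l; auto.
      generalize (Rabs_pos x) (Rabs_pos y). lra.
Qed.

Lemma cos_sin_combination_le a b t : Rabs (a * cos t - b * sin t) <= Rabs a + Rabs b.
Proof.
  unfold Rminus. eapply Rle_trans; [apply Rabs_triang|].
  rewrite Rabs_Ropp, !Rabs_mult.
  assert (Rabs (cos t) <= 1) by (apply Rabs_le; apply COS_bound).
  assert (Rabs (sin t) <= 1) by (apply Rabs_le; apply SIN_bound).
  generalize (Rabs_pos a) (Rabs_pos b). nra.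
Qed.

(** Both coordinates of exp (s (x + i y)) are functions of [s] whose k-th derivatives combine cos
    and sin with the coordinates of (x + i y)^k, of total size at most (|x| + |y|)^k. *)
Lemma complex_exp_taylor (s x y : R) (n : nat) : 0 <= s ->
  Rabs (exp (s * x) * cos (s * y)
        - sum0 (fun k => s ^ k / INR (fact k) * fst (zpow x y k)) n)
    <= exp (s * Rabs x) * (Rabs x + Rabs y) ^ n * s ^ n / INR (fact n) /\
  Rabs (exp (s * x) * sin (s * y)
        - sum0 (fun k => s ^ k / INR (fact k) * snd (zpow x y k)) n)
    <= exp (s * Rabs x) * (Rabs x + Rabs y) ^ n * s ^ n / INR (fact n).
Proof.
  intros Hs.
  assert (Hexp : forall t, 0 <= t <= s -> 0 < exp (x * t) <= exp (s * Rabs x)).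
  { intros t Ht. split; [apply exp_pos|].
    destruct (Req_dec (x * t) (s * Rabs x)) as [->|Hne]; [lra|].
    left. apply exp_increasing.
    assert (x * t <= s * Rabs x) by (generalize (Rle_abs x) (Rabs_pos x); nra). lra. }
  assert (gen : forall a b t, 0 <= t <= s ->
     Rabs a + Rabs b <= (Rabs x + Rabs y) ^ n ->
     Rabs (exp (x * t) * (a * cos (y * t) - b * sin (y * t)))
      <= exp (s * Rabs x) * (Rabs x + Rabs y) ^ n).
  { intros a b t Ht Hab. rewrite Rabs_mult, (Rabs_right (exp _)) by (left; apply exp_pos).
    apply Rmult_le_compat; [left; apply exp_pos | apply Rabs_pos | apply Hexp; auto | ].
    eapply Rle_trans; [apply cos_sin_combination_le | auto]. }
  split.
  - set (f := fun k t => exp (x * t) * (fst (zpow x y k) * cos (y * t)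
                                        - snd (zpow x y k) * sin (y * t))).
    replace (exp (s * x) * cos (s * y)) with (f O s)
      by (unfold f; simpl; rewrite (Rmult_comm x s), (Rmult_comm y s); ring).
    rewrite (sum0_ext _ (fun k => f k 0 * s ^ k / INR (fact k))).
    2:{ intros k _. unfold f. rewrite !Rmult_0_r, exp_0, cos_0, sin_0. field.
        apply INR_fact_neq_0. }
    apply taylor_remainder_le; auto.
    + intros k t. unfold f. auto_derive; auto. simpl. ring.
    + intros t Ht. apply gen; auto. apply zpow_le.
  - set (f := fun k t => exp (x * t) * (snd (zpow x y k) * cos (y * t)
                                        - - fst (zpow x y k) * sin (y * t))).
    replace (exp (s * x) * sin (s * y)) with (f O s)
      by (unfold f; simpl; rewrite (Rmult_comm x s), (Rmult_comm y s); ring).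
    rewrite (sum0_ext _ (fun k => f k 0 * s ^ k / INR (fact k))).
    2:{ intros k _. unfold f. rewrite !Rmult_0_r, exp_0, cos_0, sin_0. field.
        apply INR_fact_neq_0. }
    apply taylor_remainder_le; auto.
    + intros k t. unfold f. auto_derive; auto. simpl. ring.
    + intros t Ht. apply gen; auto. rewrite Rabs_Ropp, Rplus_comm. apply zpow_le.
Qed.

(** * Interpolation determinants and a zero estimate *)

Module DeterminantExpansion.
Import all_boot all_order all_algebra all_fingroup zify ring lra.
Set Implicit Arguments. Unset Strict Implicit. Unset Printing Implicit Defensive.
Import Order.TTheory GRing.Theory Num.Theory.
Local Open Scope ring_scope.

Lemma sorted_ltn_nth_ge (s : seq nat) i :
  sorted ltn s -> (i < size s)%N -> (i <= nth 0%N s i)%N.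
Proof.
move=> ss; elim: i => // i IHi ltis.
have /IHi le1 : (i < size s)%N by exact: ltnW.
apply: leq_ltn_trans le1 _.
by apply: (sorted_ltn_nth ltn_trans) => //; rewrite inE; exact: ltnW.
Qed.

(** Once sorted, [N] distinct naturals dominate 0, 1, ..., N - 1 term by term. *)
Lemma sum_inj_ge N (f : 'I_N -> nat) :
  injective f -> (\sum_(i < N) i <= \sum_(i < N) f i)%N.
Proof.
move=> injf; pose s := sort leq [seq f i | i <- enum 'I_N].
have sz : size s = N by rewrite size_sort size_map size_enum_ord.
have us : sorted ltn s.
  by rewrite ltn_sorted_uniq_leq sort_uniq map_inj_uniq ?enum_uniq ?sort_sorted //; exact: leq_total.
have -> : (\sum_(i < N) f i = \sum_(x <- s) x)%N.
  have ps : perm_eq s [seq f i | i <- enum 'I_N] by rewrite perm_sort.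
  by rewrite (perm_big _ ps) big_map big_enum.
rewrite (big_nth 0%N) sz big_mkord; apply: leq_sum => i _.
by apply: sorted_ltn_nth_ge => //; rewrite sz.
Qed.

Lemma norm_det_le (F : numDomainType) N (A : 'M[F]_N) (g : 'I_N -> F) :
  (forall i j, `|A i j| <= g i) -> `|\det A| <= N`!%:R * \prod_i g i.
Proof.
move=> leA; apply: le_trans (ler_norm_sum _ _ _) _.
have le1 (s : 'S_N) : true -> `|(-1) ^+ s * \prod_i A i (s i)| <= \prod_i g i.
  move=> _; rewrite normrM normrX normrN1 expr1n mul1r normr_prod.
  by apply: ler_prod => i _; rewrite normr_ge0 leA.
apply: le_trans (ler_sum _ le1) _.
by rewrite sumr_const card_Sn mulr_natl.
Qed.

(* Multilinear expansion of the determinant: only injective choices of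
   exponents survive, and their sum is at least [N (N - 1) / 2]. *)
Lemma interpolation_det_le (F : numFieldType) N D (c : 'I_N -> 'I_D -> F)
    (z : 'I_N -> F) (r E : F) :
  0 <= r -> 1 <= E -> (forall j, `|z j| <= r) ->
  `|\det (\matrix_(i, j) \sum_(n < D) c i n * z j ^+ n)|
     * E ^+ (\sum_(i < N) i)%N
  <= N`!%:R * \prod_i \sum_(n < D) `|c i n| * (E * r) ^+ n.
Proof.
move=> r0 E1 lez.
have E0 : 0 <= E by exact: le_trans E1.
have -> : \det (\matrix_(i, j) \sum_(n < D) c i n * z j ^+ n) =
  \sum_(f : {ffun 'I_N -> 'I_D}) (\prod_i c i (f i)) *
     \det (\matrix_(i, j) z j ^+ f i).
  rewrite /determinant.
  under eq_bigr => s _ do [under eq_bigr => i _ do rewrite mxE;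
     rewrite bigA_distr_bigA /= mulr_sumr].
  rewrite exchange_big /=; apply: eq_bigr => f _; rewrite mulr_sumr.
  apply: eq_bigr => s _; rewrite mulrCA -big_split /=; congr (_ * _).
  by apply: eq_bigr => i _; rewrite mxE.
rewrite bigA_distr_bigA /= mulr_sumr.
apply: (@le_trans _ _ (\sum_(f : {ffun 'I_N -> 'I_D})
   `|(\prod_i c i (f i)) * \det (\matrix_(i, j) z j ^+ f i)| * E ^+ (\sum_(i < N) i)%N)).
  by rewrite -mulr_suml ler_wpM2r ?exprn_ge0 // ler_norm_sum.
apply: ler_sum => f _; rewrite big_split /= normrM normr_prod.
have [/injectiveP injf|/injectivePn [i1 [i2 ne12 eq12]]] := boolP (injectiveb f); last first.
  rewrite (@determinant_alternate _ _ _ i1 i2) //; last by move=> j; rewrite !mxE eq12.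
  rewrite normr0 mulr0 mul0r mulr_ge0 // mulr_ge0 // prodr_ge0 // => i _; rewrite ?exprn_ge0 //.
  by rewrite mulr_ge0.
have le1 : `|\det (\matrix_(i, j) z j ^+ f i)| <= N`!%:R * \prod_i r ^+ f i.
  by apply: norm_det_le => i j; rewrite mxE normrX lerXn2r // ?nnegrE.
rewrite [X in _ <= X]mulrCA -mulrA ler_wpM2l ?prodr_ge0 //.
apply: (@le_trans _ _ ((N`!%:R * \prod_i r ^+ f i) * E ^+ (\sum_(i < N) i)%N)).
  by rewrite ler_wpM2r // exprn_ge0.
rewrite -mulrA ler_wpM2l //.
under [X in _ <= X]eq_bigr => i _ do rewrite exprMn.
rewrite big_split /= mulrC ler_wpM2r //; first by rewrite prodr_ge0 // => i _; rewrite exprn_ge0.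
rewrite -expr_sum ler_weXn2l //.
have := @sum_inj_ge N (fun i => f i); apply => i j /val_inj; exact: injf.
Qed.

Lemma norm_prodB_le (F : numDomainType) N (a b : 'I_N -> F) (G e : F) :
  1 <= G -> 0 <= e -> (forall i, `|a i| <= G) -> (forall i, `|b i| <= G) ->
  (forall i, `|a i - b i| <= e) ->
  `|\prod_i a i - \prod_i b i| <= N%:R * e * G ^+ N.
Proof.
move=> G1 e0; have G0 : 0 <= G by exact: le_trans G1.
elim: N a b => [|N IHN] a b lea leb leab.
  by rewrite !big_ord0 subrr normr0 !mul0r.
rewrite !big_ord_recl /=.
set P := \prod_(i < N) a _; set Q := \prod_(i < N) b _.
have -> : a ord0 * P - b ord0 * Q = (a ord0 - b ord0) * P + b ord0 * (P - Q) by ring.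
apply: le_trans (ler_normD _ _) _; rewrite !normrM.
have leP : `|P| <= G ^+ N.
  have : \prod_(i < N) `|a (lift ord0 i)| <= \prod_(i < N) G.
    by apply: ler_prod => i _; rewrite normr_ge0; exact: lea.
  by rewrite normr_prod prodr_const card_ord.
have leq1 : `|a ord0 - b ord0| * `|P| <= e * G ^+ N by rewrite ler_pM.
have leq2 : `|b ord0| * `|P - Q| <= G * (N%:R * e * G ^+ N).
  by rewrite ler_pM // IHN.
apply: le_trans (lerD leq1 leq2) _.
have -> : N.+1%:R * e * G ^+ N.+1 = e * G ^+ N * G + G * (N%:R * e * G ^+ N).
  by rewrite -natr1 exprS; ring.
by rewrite lerD2r ler_peMr // mulr_ge0 // exprn_ge0.
Qed.

Lemma norm_detB_le (F : numDomainType) N (A B : 'M[F]_N) (G e : F) :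
  1 <= G -> 0 <= e -> (forall i j, `|A i j| <= G) -> (forall i j, `|B i j| <= G) ->
  (forall i j, `|A i j - B i j| <= e) ->
  `|\det A - \det B| <= N`!%:R * (N%:R * e * G ^+ N).
Proof.
move=> G1 e0 leA leB leAB; rewrite -sumrB.
apply: le_trans (ler_norm_sum _ _ _) _.
have le1 (s : 'S_N) : true ->
    `|(-1) ^+ s * \prod_i A i (s i) - (-1) ^+ s * \prod_i B i (s i)|
    <= N%:R * e * G ^+ N.
  move=> _; rewrite -mulrBr normrM normrX normrN1 expr1n mul1r.
  exact: norm_prodB_le.
apply: le_trans (ler_sum _ le1) _.
by rewrite sumr_const card_Sn -[X in X <= _]mulr_natl.
Qed.

(** A trivial kernel means full column rank, and then some selection of rows is an invertible square
    matrix. *)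
Lemma exists_nonzero_minor (F : fieldType) m n (A : 'M[F]_(m, n)) :
  (forall v : 'cV_n, A *m v = 0 -> v = 0) ->
  exists f : 'I_n -> 'I_m, \det (rowsub f A) != 0.
Proof.
move=> inj; have fullA : row_full A.
  rewrite -cokermx_eq0; apply/eqP/matrixP => i j.
  have /inj /matrixP /(_ i 0) : A *m col j (cokermx A) = 0.
    by rewrite colE mulmxA mulmx_coker mul0mx.
  by rewrite !mxE.
exists (fullrankfun fullA); rewrite -unitfE -unitmxE.
exact: fullrowsub_unit.
Qed.

Lemma poly_neq0_nonroot (F : numFieldType) (v : {poly F}) :
  v != 0 -> exists x, v.[x] != 0.
Proof.
move=> v0.
have /hasP [x _ vx] : has (fun x => v.[x] != 0) [seq n%:R : F | n <- iota 0 (size v)].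
  rewrite -[has _ _]negbK -all_predC; apply: contraNN v0 => /allP a0.
  apply/eqP/(@roots_geq_poly_eq0 _ _ [seq n%:R | n <- iota 0 (size v)]).
  - by apply/allP => x /a0 /=; rewrite negbK.
  - by rewrite map_inj_uniq ?iota_uniq // => a b /eqP; rewrite eqr_nat => /eqP.
  - by rewrite size_map size_iota.
by exists x.
Qed.

(** The rational function u / v has period [h]. With [x0] a point where [v] does not vanish and [c]
    the ratio there, [u - c v] has all the roots x0 + n h, which are distinct in characteristic
    zero. *)
Lemma shift_periodic_ratio (F : numFieldType) (h : F) (u v : {poly F}) :
  h != 0 -> v != 0 -> (u \Po ('X + h%:P)) * v = u * (v \Po ('X + h%:P)) ->
  exists c, u = c *: v.
Proof.
move=> h0 v0 eq_uv.
pose sh n (p : {poly F}) := p \Po ('X + (h *+ n)%:P).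
have shS n p : sh n.+1 p = (sh n p) \Po ('X + h%:P).
  rewrite /sh -comp_polyA comp_polyD comp_polyX comp_polyC.
  by rewrite -addrA -polyCD -mulrS.
have shM n p : sh n (p \Po ('X + h%:P)) = (sh n p) \Po ('X + h%:P).
  rewrite /sh -!comp_polyA !comp_polyD !comp_polyX !comp_polyC.
  by rewrite -!addrA [X in _ \Po (_ + X)]addrC.
have sh0 n p : p != 0 -> sh n p != 0.
  by rewrite /sh comp_poly2_eq0 // size_XaddC.
have ratio n : sh n u * v = u * sh n v.
  elim: n => [|n IHn]; first by rewrite /sh mulr0n polyC0 addr0 !comp_polyXr.
  have := congr1 (comp_poly ('X + h%:P)) IHn.
  rewrite !comp_polyM -!shS => eqn.
  have v'0 : v \Po ('X + h%:P) != 0 by have := sh0 1%N v v0; rewrite /sh mulr1n.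
  apply: (mulIf v'0).
  by rewrite mulrAC eqn mulrAC eq_uv mulrAC.
have [x0 vx0] := poly_neq0_nonroot v0.
exists (u.[x0] / v.[x0]).
apply/eqP; rewrite -subr_eq0; apply/eqP.
set p := u - _.
apply: (@roots_geq_poly_eq0 _ p [seq x0 + h *+ n | n <- iota 0 (size p)]).
- apply/allP => _ /mapP [n _ ->]; rewrite rootE /p !hornerE.
  have := congr1 (fun p => p.[x0]) (ratio n).
  rewrite /sh !hornerM !horner_comp !hornerE => eqn.
  by rewrite mulrAC -eqn mulfK // subrr.
- rewrite map_inj_uniq ?iota_uniq // => a b /addrI/eqP.
  by rewrite -subr_eq0 -!(mulr_natr h) -mulrBr mulf_eq0 (negPf h0) /= subr_eq0 eqr_nat => /eqP.
- by rewrite size_map size_iota.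
Qed.

Lemma grid_roots_poly_eq0 (F : idomainType) (Z : nat -> nat -> F) (p : {poly F})
    (s : seq nat) (B : nat) :
  (forall a b a' b', Z a b = Z a' b' -> a = a' /\ b = b') -> uniq s ->
  (forall a b, a \in s -> (b < B)%N -> p.[Z a b] = 0) ->
  (size p <= size s * B)%N -> p = 0.
Proof.
move=> injZ us p0 szp.
apply: (@roots_geq_poly_eq0 _ p [seq Z a b | a <- s, b <- iota 0 B]).
- apply/allP => _ /allpairsP [[a b] /= [ain bin ->]]; rewrite rootE p0 //.
  by move: bin; rewrite mem_iota.
- apply: allpairs_uniq; rewrite ?iota_uniq // => -[a b] [a' b'] _ _ /=.
  by move=> /injZ [-> ->].
- by rewrite size_allpairs size_iota.
Qed.

(** * Polynomials in X and Y vanishing at the points (Z a b, rho^a) of a grid *)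

Section ZeroEstimate.
Variables (F : numFieldType) (Z : nat -> nat -> F) (h rho : F) (A : nat).
Hypothesis h0 : h != 0.
Hypothesis injZ : forall a b a' b', Z a b = Z a' b' -> a = a' /\ b = b'.
Hypothesis ZS : forall a b, Z a b.+1 = Z a b + h.
Hypothesis rho_inj : forall a b, rho ^+ a = rho ^+ b -> a = b.
Let sh (p : {poly F}) : {poly F} := p \Po ('X + h%:P).

Let shE (p : {poly F}) a b : (sh p).[Z a b] = p.[Z a b.+1].
Proof. by rewrite /sh horner_comp !hornerE ZS. Qed.

Let size_sh (p : {poly F}) : size (sh p) = size p.
Proof. by rewrite /sh size_comp_poly2 // size_XaddC. Qed.

Let size_casorati J (p q : {poly F}) : (size p <= J)%N -> (size q <= J)%N ->
  (size (sh p * q - p * sh q)%R <= J + J)%N.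
Proof.
move=> szp szq; rewrite (leq_trans (size_polyD _ _)) // geq_max size_polyN.
by apply/andP; split; apply: (leq_trans (size_polyMleq _ _)); rewrite size_sh;
  apply: leq_trans (leq_pred _) _; exact: leq_add.
Qed.

Let good (w : {poly F}) := [seq a <- iota 0 A | ~~ root w (rho ^+ a)].

Let size_good w : w != 0 -> (A <= size (good w) + (size w).-1)%N.
Proof.
move=> w0; pose bad := [seq a <- iota 0 A | root w (rho ^+ a)].
have : (size bad < size w)%N.
  rewrite -(size_map (fun a => rho ^+ a) bad); apply: max_poly_roots => //.
    by apply/allP => _ /mapP [a + ->]; rewrite mem_filter => /andP[].
  rewrite map_inj_uniq; last by move=> a b; exact: rho_inj.
  by rewrite filter_uniq // iota_uniq.
have := count_predC (fun a => root w (rho ^+ a)) (iota 0 A).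
rewrite size_iota -!size_filter -/bad.
have -> : filter (predC (fun a => root w (rho ^+ a))) (iota 0 A) = good w by [].
lia.
Qed.

(** A factor [w] in Y alone can be cancelled at the price of deg w rows of the grid, because the
    powers of [rho] are distinct. The rows that remain still hold enough points for the degree of
    [q]. *)
Let good_vanish (w q : {poly F}) B : w != 0 ->
  (size q <= (A - (size w).-1) * B)%N ->
  (forall a b, (a < A)%N -> (b < B)%N -> w.[rho ^+ a] * q.[Z a b] = 0) -> q = 0.
Proof.
move=> w0 szq van; apply: (@grid_roots_poly_eq0 _ Z _ (good w) B) => //.
- by rewrite filter_uniq // iota_uniq.
- move=> a b; rewrite mem_filter mem_iota /= => /andP[nr lta] ltb.
  by have /eqP := van a b lta ltb; rewrite mulf_eq0 -rootE (negPf nr) => /eqP.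
- by apply: leq_trans szq _; rewrite leq_mul // leq_subLR addnC size_good.
Qed.

(** Moving [b] to [b + 1] shifts X by [h] and leaves Y = rho^a unchanged. Two relations at
    consecutive points make the Casorati determinant of [q0], [q1] vanish on the grid, hence
    identically. Then [q0] is a constant multiple of [q1], and a factor Y + c can be cancelled. *)
Lemma zero_estimate1 (J B : nat) (q0 q1 : {poly F}) :
  (size q0 <= J)%N -> (size q1 <= J)%N -> (J + J <= (A - 1) * (B - 1))%N ->
  (forall a b, (a < A)%N -> (b < B)%N -> q0.[Z a b] + q1.[Z a b] * rho ^+ a = 0) ->
  q0 = 0 /\ q1 = 0.
Proof.
move=> sz0 sz1 leJ van.
have leAB : ((A - 1) * (B - 1) <= A * (B - 1))%N by rewrite leq_mul // leq_subr.
have leAB' : ((A - 1) * (B - 1) <= (A - 1) * B)%N by rewrite leq_mul // leq_subr.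
have sz1C : size (1 : {poly F}) = 1%N by rewrite size_poly1.
have q10 : q1 = 0.
  apply/eqP; apply/negPn/negP => q1nz.
  have per : sh q0 * q1 = q0 * sh q1.
    apply/eqP; rewrite -subr_eq0; apply/eqP.
    apply: (@good_vanish 1 _ (B - 1)); rewrite ?oner_neq0 //.
      by rewrite sz1C subn0; exact: leq_trans (size_casorati sz0 sz1) (leq_trans leJ leAB).
    move=> a b lta ltb; rewrite hornerC mul1r !hornerE !shE.
    have ltb1 : (b < B)%N by lia.
    have ltb2 : (b.+1 < B)%N by lia.
    have /eqP := van a b lta ltb1; rewrite addr_eq0 => /eqP ->.
    have /eqP := van a b.+1 lta ltb2; rewrite addr_eq0 => /eqP ->.
    by ring.
  have [c q0E] := shift_periodic_ratio h0 q1nz per.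
  case/eqP: q1nz; apply: (@good_vanish ('X + c%:P) _ B).
  - by rewrite -size_poly_gt0 size_XaddC.
  - by rewrite size_XaddC; exact: leq_trans sz1 (leq_trans (leq_addr J J) (leq_trans leJ leAB')).
  - move=> a b lta ltb; rewrite -(van a b lta ltb) q0E !hornerE; ring.
split => //; apply: (@good_vanish 1 _ B); rewrite ?oner_neq0 //.
  rewrite sz1C subn0.
  have : ((A - 1) * (B - 1) <= A * B)%N by rewrite leq_mul // leq_subr.
  by move=> le; exact: leq_trans sz0 (leq_trans (leq_addr J J) (leq_trans leJ le)).
by move=> a b lta ltb; rewrite hornerC mul1r -(van a b lta ltb) q10 !hornerE.
Qed.

(* Eliminating the top coefficient between [P (X, Y)] and [P (X + h, Y)]
   lowers the degree in [Y] and only doubles the degree in [X]. *)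
Lemma zero_estimate2 (J B : nat) (q0 q1 q2 : {poly F}) :
  (size q0 <= J)%N -> (size q1 <= J)%N -> (size q2 <= J)%N ->
  (4 * J <= (A - 2) * (B - 2))%N ->
  (forall a b, (a < A)%N -> (b < B)%N ->
     q0.[Z a b] + q1.[Z a b] * rho ^+ a + q2.[Z a b] * (rho ^+ a) ^+ 2 = 0) ->
  [/\ q0 = 0, q1 = 0 & q2 = 0].
Proof.
move=> sz0 sz1 sz2 leJ van.
have le1 : ((A - 2) * (B - 2) <= (A - 1) * (B - 1 - 1))%N by rewrite leq_mul //; lia.
have le2 : ((A - 2) * (B - 2) <= (A - 1) * (B - 1))%N by rewrite leq_mul //; lia.
have le3 : ((A - 2) * (B - 2) <= (A - 2) * B)%N by rewrite leq_mul //; lia.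
have J4 : (J <= 4 * J)%N by lia.
have J2 : (J + J <= 4 * J)%N by lia.
have q20 : q2 = 0.
  apply/eqP; apply/negPn/negP => q2nz.
  have [r00 r10] : sh q0 * q2 - q0 * sh q2 = 0 /\ sh q1 * q2 - q1 * sh q2 = 0.
    apply: (@zero_estimate1 (J + J) (B - 1)); rewrite ?size_casorati //.
      by apply: leq_trans (leq_trans _ leJ) le1; lia.
    move=> a b lta ltb; rewrite !hornerE !shE.
    have ltb1 : (b < B)%N by lia.
    have ltb2 : (b.+1 < B)%N by lia.
    have e1 := van a b lta ltb1; have e2 := van a b.+1 lta ltb2.
    move/eqP: e1; rewrite -addrA addr_eq0 => /eqP ->.
    move/eqP: e2; rewrite -addrA addr_eq0 => /eqP ->.
    by ring.
  move/eqP: r00; rewrite subr_eq0 => /eqP /(shift_periodic_ratio h0 q2nz) [c0 q0E].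
  move/eqP: r10; rewrite subr_eq0 => /eqP /(shift_periodic_ratio h0 q2nz) [c1 q1E].
  (* Now the relation reads [q2] times the quadratic Y^2 + c1 Y + c0. At most two rows of the grid
     are roots of the quadratic, which is the source of [A - 2]. *)
  have szw : size ('X^2 + (c1 *: 'X + c0%:P) : {poly F}) = 3%N.
    rewrite size_polyDl size_polyXn // (leq_ltn_trans (size_polyD _ _)) // gtn_max.
    rewrite (leq_ltn_trans (size_scale_leq _ _)) ?size_polyX //.
    by rewrite (leq_ltn_trans (size_polyC_leq1 _)).
  case/eqP: q2nz; apply: (@good_vanish ('X^2 + (c1 *: 'X + c0%:P)) _ B).
  - by rewrite -size_poly_gt0 szw.
  - by rewrite szw; exact: leq_trans sz2 (leq_trans J4 (leq_trans leJ le3)).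
  - move=> a b lta ltb; rewrite -(van a b lta ltb) q0E q1E.
    move: (rho ^+ a) => t; rewrite !(hornerD, hornerZ, hornerXn, hornerX, hornerC).
    by move: (q2.[_]) => s; ring.
have [|-> ->] := zero_estimate1 sz0 sz1 (leq_trans J2 (leq_trans leJ le2)); last by [].
by move=> a b lta ltb; rewrite -(van a b lta ltb) q20 hornerC mul0r addr0.
Qed.
End ZeroEstimate.
End DeterminantExpansion.

(** * Lower and upper bounds for a minor at Gaussian integer points *)

Module GaussianDeterminant.
Import all_boot all_order all_algebra all_fingroup zify ring lra complex.
Import DeterminantExpansion.
Set Implicit Arguments. Unset Strict Implicit. Unset Printing Implicit Defensive.
Import Order.TTheory GRing.Theory Num.Theory.
Local Open Scope ring_scope.
Local Open Scope complex_scope.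

Section GaussianDeterminant.
Variable (R : rcfType).
Local Notation C := R[i].

Definition gaussian_int (z : C) := exists m n : int, z = m%:~R +i* n%:~R.

Lemma gaussian_intD z w : gaussian_int z -> gaussian_int w -> gaussian_int (z + w).
Proof.
move=> [m [n ->]] [m' [n' ->]]; exists (m + m'), (n + n').
by rewrite !rmorphD.
Qed.

Lemma gaussian_intM z w : gaussian_int z -> gaussian_int w -> gaussian_int (z * w).
Proof.
move=> [m [n ->]] [m' [n' ->]]; exists (m * m' - n * n'), (m * n' + n * m').
by rewrite !(rmorphD, rmorphN, rmorphM) /=; apply/eqP; rewrite eq_complex /= !eqxx.
Qed.

Lemma gaussian_int_nat n : gaussian_int n%:R.
Proof. by exists n%:Z, 0; rewrite -[LHS](rmorph_nat (real_complex R)). Qed.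

Lemma gaussian_int_prod (I : finType) (f : I -> C) :
  (forall i, gaussian_int (f i)) -> gaussian_int (\prod_i f i).
Proof.
move=> gf; apply: (big_ind gaussian_int) => //; last exact: gaussian_intM.
exact: (gaussian_int_nat 1).
Qed.

Lemma gaussian_int_exp z n : gaussian_int z -> gaussian_int (z ^+ n).
Proof.
move=> gz; elim: n => [|n IHn]; first exact: (gaussian_int_nat 1).
by rewrite exprS; exact: gaussian_intM.
Qed.

Lemma gaussian_int_det N (A : 'M[C]_N) :
  (forall i j, gaussian_int (A i j)) -> gaussian_int (\det A).
Proof.
move=> gA; apply: (big_ind gaussian_int); [exact: (gaussian_int_nat 0)|exact: gaussian_intD|].
move=> s _; apply: gaussian_intM; last exact: gaussian_int_prod.
apply: gaussian_int_exp; exists (-1), 0; rewrite rmorphN.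
by apply/eqP; rewrite eq_complex /= !oppr0 !eqxx.
Qed.

Lemma gaussian_int_norm_ge1 z : gaussian_int z -> z != 0 -> 1 <= `|z|.
Proof.
move=> [m [n ->]] nz.
have : 1 <= `|m%:~R +i* n%:~R : C| ^+ 2.
  rewrite -add_Re2_Im2 /= -[X in X <= _]/((1 : R)%:C) lecR.
  rewrite -!rmorphXn -rmorphD /= -[X in X <= _]/(1%:~R) ler_int.
  have : (m != 0) || (n != 0).
    apply: contraR nz; rewrite negb_or !negbK => /andP[/eqP-> /eqP->].
    by apply/eqP; apply/eqP; rewrite eq_complex /= !eqxx.
  by case/orP => nz0; nia.
by rewrite expr_ge1.
Qed.

(** The points nu a + i b. Their imaginary part is an integer, so exp (2 pi k z) takes the real
    value exp (2 pi nu)^(a k) there: this is how a single number exp (2 pi nu) governs a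
    two-dimensional grid. *)
Definition gpoint (nu a b : nat) : C := (nu * a)%:R +i* b%:R.

Lemma gpoint_inj nu a b a' b' : (0 < nu)%N ->
  gpoint nu a b = gpoint nu a' b' -> a = a' /\ b = b'.
Proof.
move=> nu0 [/eqP + /eqP]; rewrite !eqr_nat eqn_pmul2l // => /eqP-> /eqP->.
by [].
Qed.

Lemma gpointS nu a b : gpoint nu a b.+1 = gpoint nu a b + 'i.
Proof. by apply/eqP; rewrite eq_complex /= addr0 eqxx -natr1 eqxx. Qed.

(** Column [j] stands for the function z^(j / 3) exp (2 pi (j mod 3) z), with [rho] in place of exp
    (2 pi nu) in its values. *)
Definition exponential_mx (nu J A B : nat) (rho : R)
    (f : 'I_(3 * J) -> 'I_A * 'I_B) : 'M[C]_(3 * J) :=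
  \matrix_(i, j) (gpoint nu (f i).1 (f i).2 ^+ (j %/ 3)
                    * (rho%:C ^+ (f i).1) ^+ (j %% 3)).

(** A vector in the kernel of the matrix built on the whole grid is a polynomial of degree below [J]
    in z and at most 2 in rho^a that vanishes at all grid points. The zero estimate leaves only the
    zero vector. *)
Lemma exponential_minor_neq0 (nu J A B : nat) (rho : R) :
  (0 < nu)%N -> 1 < rho -> (4 * J <= (A - 2) * (B - 2))%N ->
  exists f : 'I_(3 * J) -> 'I_A * 'I_B, \det (exponential_mx nu rho f) != 0.
Proof.
move=> nu0 rho1 leJ.
pose e (i : 'I_#|{: 'I_A * 'I_B}|) := enum_val i : 'I_A * 'I_B.
pose Mx : 'M[C]_(#|{: 'I_A * 'I_B}|, 3 * J) := \matrix_(i, j)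
   (gpoint nu (e i).1 (e i).2 ^+ (j %/ 3) * (rho%:C ^+ (e i).1) ^+ (j %% 3)).
have [v Mv|f nz] := @exists_nonzero_minor _ _ _ Mx; last first.
  exists (fun i => e (f i)); apply: contra_neq nz => <-; congr (\det _).
  by apply/matrixP => i j; rewrite !mxE.
pose w (n : nat) : C := if insub n is Some i then v i 0 else 0.
have wE (i : 'I_(3 * J)) : w i = v i 0 by rewrite /w valK.
pose q k : {poly C} := \poly_(j < J) w (3 * j + k)%N.
have szq k : (size (q k) <= J)%N by exact: size_poly.
have i0 : 'i != 0 :> C by rewrite eq_complex /= oner_eq0 andbF.
have rho_inj a b : rho%:C ^+ a = rho%:C ^+ b -> a = b.
  rewrite -!rmorphXn => /complexI.
  have rho0 : 0 < rho by exact: lt_trans rho1.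
  by move/(ieexprIn rho0); apply; rewrite gt_eqF.
have van a b : (a < A)%N -> (b < B)%N -> (q 0%N).[gpoint nu a b]
   + (q 1%N).[gpoint nu a b] * rho%:C ^+ a + (q 2%N).[gpoint nu a b] * (rho%:C ^+ a) ^+ 2 = 0.
  move=> lta ltb.
  pose i := enum_rank (Ordinal lta, Ordinal ltb).
  move/matrixP: (Mv) => /(_ i 0); rewrite !mxE.
  under eq_bigr => j _ do rewrite mxE /e enum_rankK /= -wE.
  rewrite -(big_mkord xpredT (fun j => gpoint nu a b ^+ (j %/ 3) * (rho%:C ^+ a) ^+ (j %% 3) * w j)).
  have split3 (g : nat -> C) n : \sum_(0 <= j < 3 * n) g j =
      \sum_(0 <= j < n) (g (3 * j)%N + g (3 * j).+1 + g (3 * j).+2).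
    elim: n => [|n IHn]; first by rewrite muln0 !big_geq.
    have -> : (3 * n.+1 = (3 * n).+3)%N by lia.
    by rewrite !big_nat_recr //= IHn !addrA.
  rewrite split3 => <-.
  rewrite !horner_poly !mulr_suml -!big_split /= big_mkord; apply: eq_bigr => j _.
  have d0 : ((3 * j) %/ 3 = j)%N by lia.
  have d1 : ((3 * j).+1 %/ 3 = j)%N by lia.
  have d2 : ((3 * j).+2 %/ 3 = j)%N by lia.
  have m0 : ((3 * j) %% 3 = 0)%N by lia.
  have m1 : ((3 * j).+1 %% 3 = 1)%N by lia.
  have m2 : ((3 * j).+2 %% 3 = 2)%N by lia.
  rewrite d0 d1 d2 m0 m1 m2 addn0 addn1 addn2.
  by move: (rho%:C ^+ a) (gpoint nu a b ^+ j) => t z; rewrite expr0 expr1; ring.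
have [q00 q10 q20] := zero_estimate2 i0 (fun a b a' b' => @gpoint_inj nu a b a' b' nu0)
  (gpointS nu) rho_inj (szq 0%N) (szq 1%N) (szq 2%N) leJ van.
apply/matrixP => i o; rewrite ord1 mxE -wE.
have : (q (i %% 3)%N)`_(i %/ 3) = 0.
  have := ltn_pmod i (isT : (0 < 3)%N).
  by case: (i %% 3)%N => [|[|[|]]] // _; rewrite ?q00 ?q10 ?q20 coef0.
have lti : (i %/ 3 < J)%N by rewrite ltn_divLR // [X in (_ < X)%N]mulnC.
by rewrite coef_poly lti => <-; congr w; lia.
Qed.

(** The row of (a, b) contains powers of p / q up to 2 a, so q^(2 a) clears its denominators and the
    scaled determinant is a nonzero Gaussian integer, of modulus at least 1. *)
Lemma exponential_minor_ge (nu J A B p q : nat) (f : 'I_(3 * J) -> 'I_A * 'I_B) :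
  (0 < q)%N -> \det (exponential_mx nu (p%:R / q%:R) f) != 0 ->
  1 <= (q%:R : C) ^+ (2 * A * (3 * J)) * `|\det (exponential_mx nu (p%:R / q%:R) f)|.
Proof.
move=> q0; set Mx := exponential_mx _ _ _ => nz.
have qC0 : q%:R != 0 :> C by rewrite pnatr_eq0 -lt0n.
pose d : 'rV[C]_(3 * J) := \row_i q%:R ^+ (2 * (f i).1)%N.
have gd : gaussian_int (\det (diag_mx d *m Mx)).
  apply: gaussian_int_det => i j; rewrite mul_diag_mx !mxE.
  rewrite mulrCA; apply: gaussian_intM.
    by apply: gaussian_int_exp; exists (nu * (f i).1)%N%:Z, ((f i).2 : nat)%:Z.
  rewrite rmorphM fmorphV !rmorph_nat.
  have ltj : (j %% 3 <= 2)%N by rewrite -ltnS ltn_pmod.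
  have -> : q%:R ^+ (2 * (f i).1) * ((p%:R / q%:R) ^+ (f i).1) ^+ (j %% 3)
     = q%:R ^+ ((f i).1 * (2 - j %% 3)) * p%:R ^+ ((f i).1 * (j %% 3)) :> C.
    rewrite [(2 * (f i).1)%N]mulnC !exprM expr_div_n.
    have := expf_neq0 (f i).1 qC0.
    move: (q%:R ^+ (f i).1) (p%:R ^+ (f i).1) => Q P Q0.
    by case: (j %% 3)%N ltj => [|[|[|//]]] _ /=; rewrite ?subn0 ?subn1 ?subnn /=; field.
  by apply: gaussian_intM; apply: gaussian_int_exp; exact: gaussian_int_nat.
have dnz : \det (diag_mx d) != 0.
  by rewrite det_diag prodf_seq_neq0; apply/allP => i _; rewrite /= mxE expf_neq0.
have := gaussian_int_norm_ge1 gd; rewrite det_mulmx mulf_neq0 // => /(_ isT) /le_trans; apply.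
rewrite normrM ler_wpM2r // det_diag normr_prod.
have q1 : 1 <= q%:R :> C by rewrite ler1n.
apply: (@le_trans _ _ (\prod_(i < 3 * J) (q%:R : C) ^+ (2 * A)%N)).
  apply: ler_prod => i _; rewrite normr_ge0 mxE normrX normr_nat ler_weXn2l //.
  by rewrite leq_mul2l ltnW ?ltn_ord ?orbT.
by rewrite prodr_const card_ord -exprM.
Qed.

(** The transposed matrix is compared with the one where rho^(a k) is replaced by the value of [P k]
    at z. The latter is an interpolation determinant; as the coefficients of [P k] are nonnegative,
    the sums of absolute values in [interpolation_det_le] are plain values at [E r]. The replacement
    costs the second summand. *)
Lemma exponential_minor_le (nu J A B D : nat) (rho r E M dlt G : R)
    (P : nat -> {poly C}) (f : 'I_(3 * J) -> 'I_A * 'I_B) :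
  1 <= r -> 1 <= E -> 0 <= dlt -> 1 <= rho -> 1 <= G ->
  (forall k, (size (P k) <= D)%N) ->
  (forall k n, 0 <= (P k)`_n) ->
  (forall k, (k < 3)%N -> (P k).[(E * r)%:C] <= M%:C) ->
  (forall a b, (a < A)%N -> (b < B)%N -> `|gpoint nu a b| <= r%:C) ->
  (forall a b k, (a < A)%N -> (b < B)%N -> (k < 3)%N ->
     `|(P k).[gpoint nu a b] - (rho%:C ^+ a) ^+ k| <= dlt%:C) ->
  r ^+ J * (rho ^+ (2 * A) + dlt) <= G ->
  `|\det (exponential_mx nu rho f)| <= ((3 * J)`!%:R * (E * r) ^+ (\sum_(i < 3 * J) i %/ 3) * M ^+ (3 * J)
                   / E ^+ (\sum_(i < 3 * J) i)
         + (3 * J)`!%:R * ((3 * J)%:R * (r ^+ J * dlt) * G ^+ (3 * J)))%:C.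
Proof.
move=> r1 E1 d0 rho1 G1 szP P0 PM ler lePd leG.
set Mx := exponential_mx _ _ _.
set N := (3 * J)%N in f Mx *.
have r0 : 0 <= r by exact: le_trans r1.
have E0 : 0 < E by exact: lt_le_trans E1.
pose z (i : 'I_N) : C := gpoint nu (f i).1 (f i).2.
pose c (i : 'I_N) (n : 'I_(D + J)) : C := (P (i %% 3)%N * 'X^(i %/ 3))`_n.
have ltJ (i : 'I_N) : (i %/ 3 < J)%N by rewrite ltn_divLR // mulnC.
have szQ (i : 'I_N) : (size (P (i %% 3)%N * 'X^(i %/ 3))%R <= D + J)%N.
  apply: leq_trans (size_polyMleq _ _) _; rewrite size_polyXn addnS /=.
  by rewrite leq_add // ltnW.
pose B1 : 'M[C]_N := \matrix_(i, j) \sum_(n < D + J) c i n * z j ^+ n.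
have B1E i j : B1 i j = (P (i %% 3)%N).[z j] * z j ^+ (i %/ 3).
  rewrite mxE -(horner_coef_wide _ (szQ i)) hornerM hornerXn.
  by [].
have lez j : `|z j| <= r%:C by exact: ler.
have zX j k : (k <= J)%N -> `|z j ^+ k| <= (r ^+ J)%:C.
  move=> lek; rewrite normrX; apply: (@le_trans _ _ (r%:C ^+ k)).
    by apply: lerXn2r; [rewrite nnegrE|rewrite nnegrE ler0c|exact: lez].
  by rewrite -rmorphXn lecR ler_weXn2l.
have lt3 (i : 'I_N) : (i %% 3 < 3)%N by rewrite ltn_pmod.
have detB1 : `|\det B1| <= (N`!%:R * (E * r) ^+ (\sum_(i < N) i %/ 3) * M ^+ N
                   / E ^+ (\sum_(i < N) i))%:C.
  rewrite rmorphM fmorphV /= rmorphXn /= ler_pdivlMr; last first.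
    by rewrite exprn_gt0 // ltcR.
  have E1C : 1 <= E%:C by rewrite -[1]/((1 : R)%:C) lecR.
  have r0C : 0 <= r%:C by rewrite ler0c.
  apply: le_trans (interpolation_det_le c r0C E1C lez) _.
  rewrite 2!rmorphM /= rmorph_nat -mulrA ler_wpM2l //.
  rewrite !rmorphXn /= -[M%:C ^+ N](_ : \prod_(i < N) M%:C = _); last by rewrite prodr_const card_ord.
  rewrite expr_sum -big_split /=; apply: ler_prod => i _; apply/andP; split.
    by apply: sumr_ge0 => n _; rewrite mulr_ge0 // exprn_ge0 // mulr_ge0 // ler0c ltW.
  have -> : \sum_(n < D + J) `|c i n| * (E%:C * r%:C) ^+ n
     = (P (i %% 3)%N * 'X^(i %/ 3)).[(E * r)%:C].
    rewrite (horner_coef_wide _ (szQ i)) rmorphM; apply: eq_bigr => n _.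
    rewrite ger0_norm // /c coefMXn; case: ifP => // _; exact: P0.
  rewrite hornerM hornerXn mulrC ler_wpM2l ?PM //.
  by rewrite exprn_ge0 // ler0c mulr_ge0 // ltW.
have GJ : r ^+ J * rho ^+ (2 * A) <= G.
  by apply: le_trans leG; rewrite ler_wpM2l ?exprn_ge0 // lerDl.
have MxE (i j : 'I_N) : Mx^T i j = (rho%:C ^+ (f j).1) ^+ (i %% 3) * z j ^+ (i %/ 3).
  by rewrite !mxE mulrC.
have leMx (i j : 'I_N) : `|Mx^T i j| <= G%:C.
  rewrite MxE normrM mulrC; apply: (@le_trans _ _ ((r ^+ J)%:C * (rho ^+ (2 * A))%:C)).
    rewrite ler_pM //; first exact/zX/ltnW.
    rewrite -exprM -rmorphXn normc_def /= expr0n addr0 sqrtr_sqr lecR ger0_norm; last first.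
      by rewrite exprn_ge0 // (le_trans _ rho1).
    rewrite ler_weXn2l // mulnC leq_mul //; last by rewrite ltnW.
    by rewrite -ltnS.
  by rewrite -rmorphM lecR.
have leB (i j : 'I_N) : `|Mx^T i j - B1 i j| <= (r ^+ J * dlt)%:C.
  rewrite MxE B1E -mulrBl normrM mulrC rmorphM ler_pM //; first exact/zX/ltnW.
  by rewrite distrC lePd.
have leB1 (i j : 'I_N) : `|B1 i j| <= G%:C.
  rewrite B1E normrM mulrC.
  apply: (@le_trans _ _ ((r ^+ J)%:C * (rho ^+ (2 * A) + dlt)%:C)).
    rewrite ler_pM //; first exact/zX/ltnW.
    rewrite -[(P _).[_]](subrK ((rho%:C ^+ (f j).1) ^+ (i %% 3))) addrC.
    apply: le_trans (ler_normD _ _) _; rewrite rmorphD lerD ?lePd //.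
    rewrite -exprM -rmorphXn normc_def /= expr0n addr0 sqrtr_sqr lecR ger0_norm; last first.
      by rewrite exprn_ge0 // (le_trans _ rho1).
    rewrite ler_weXn2l // mulnC leq_mul //; last by rewrite ltnW.
    by rewrite -ltnS.
  by rewrite -rmorphM lecR.
have G1C : 1 <= G%:C by rewrite -[1]/((1 : R)%:C) lecR.
have e0C : 0 <= (r ^+ J * dlt)%:C by rewrite ler0c mulr_ge0 // exprn_ge0.
have := norm_detB_le G1C e0C leMx leB1 leB; rewrite det_tr => dB.
rewrite -[\det Mx](subrK (\det B1)) addrC.
apply: le_trans (ler_normD _ _) _; rewrite rmorphD lerD //.
have eqE : N`!%:R * (N%:R * (r ^+ J * dlt)%:C * G%:C ^+ N)
   = (N`!%:R * (N%:R * (r ^+ J * dlt) * G ^+ N))%:C.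
  by rewrite -!(rmorph_nat (real_complex R)) -rmorphXn -!rmorphM.
by move: dB; rewrite eqE.
Qed.
End GaussianDeterminant.
End GaussianDeterminant.

Module InterpolationInequality.
Import all_boot all_order all_algebra all_fingroup zify ring lra complex Rstruct.
Import DeterminantExpansion GaussianDeterminant.
Set Implicit Arguments. Unset Strict Implicit. Unset Printing Implicit Defensive.
Import Order.TTheory GRing.Theory Num.Theory.
Local Open Scope ring_scope.
Local Open Scope complex_scope.
Local Notation RR := Rdefinitions.R.

Lemma zpowE (x y : RR) n : (x +i* y) ^+ n = (fst (zpow x y n)) +i* (snd (zpow x y n)).
Proof.
elim: n => [|n IHn]; first by [].
rewrite exprS IHn /=; apply/eqP; rewrite eq_complex /=.
by apply/andP; split; apply/eqP; rewrite ?RminusE ?RplusE ?RmultE //.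
Qed.

Lemma sum0E (f : nat -> RR) n : sum0 f n = \sum_(i < n) f i.
Proof. by elim: n => [|n IHn] /=; rewrite ?big_ord0 // big_ord_recr /= IHn. Qed.

Lemma sum_ord_double n : (2 * (\sum_(i < n) i) = n * n.-1)%N.
Proof.
elim: n => [|n IHn]; first by rewrite big_ord0.
by rewrite big_ord_recr /= mulnDr IHn; case: n {IHn} => //= n; lia.
Qed.

Lemma sum_ord_div3_double J : (2 * (\sum_(i < 3 * J) i %/ 3) = 3 * (J * J.-1))%N.
Proof.
elim: J => [|J IHJ]; first by rewrite big_ord0.
have -> : (3 * J.+1 = (3 * J).+3)%N by lia.
have -> : (J.+1 * J.+1.-1 = J * J.-1 + 2 * J)%N by case: J {IHJ} => //= J; lia.
rewrite !big_ord_recr /= !mulnDr IHJ.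
have d0 : ((3 * J) %/ 3 = J)%N by lia.
have d1 : ((3 * J).+1 %/ 3 = J)%N by lia.
have d2 : ((3 * J).+2 %/ 3 = J)%N by lia.
by rewrite d0 d1 d2; lia.
Qed.

Local Open Scope R_scope.

(** The lower and the upper bound for one minor put together, over the Stdlib reals, with Taylor
    polynomials of exp (2 pi k z) as [P k]. The numbers [s1] and [s2] are the sums of j / 3 and of j
    over the 3 J columns. Too good an approximation p / q will violate the conclusion. *)
Lemma interpolation_inequality (nu J A B D p q : nat) (s1 s2 : nat) (r E M dlt G : RR) :
  (0 < nu)%coq_nat -> (0 < q)%coq_nat -> 1 < INR p / INR q ->
  (4 * J <= (A - 2) * (B - 2))%coq_nat ->
  (2 * s1 = 3 * (J * (J - 1)))%coq_nat -> (2 * s2 = 3 * J * (3 * J - 1))%coq_nat ->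
  1 <= r -> 1 <= E -> 0 <= dlt -> 1 <= G ->
  INR nu * INR A + INR B <= r ->
  (forall k, (k < 3)%coq_nat ->
     sum0 (fun n => (2 * PI * INR k) ^ n / INR (fact n) * (E * r) ^ n) D <= M) ->
  (forall a b k, (a < A)%coq_nat -> (b < B)%coq_nat -> (k < 3)%coq_nat ->
     Rabs (((INR p / INR q) ^ a) ^ k - sum0 (fun n => (2 * PI * INR k) ^ n / INR (fact n)
        * fst (zpow (INR nu * INR a) (INR b) n)) D) <= dlt / 2 /\
     Rabs (sum0 (fun n => (2 * PI * INR k) ^ n / INR (fact n)
        * snd (zpow (INR nu * INR a) (INR b) n)) D) <= dlt / 2) ->
  r ^ J * ((INR p / INR q) ^ (2 * A) + dlt) <= G ->
  1 <= INR q ^ (2 * A * (3 * J)) *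
     (INR (fact (3 * J)) * (E * r) ^ s1 * M ^ (3 * J) / E ^ s2
      + INR (fact (3 * J)) * (INR (3 * J) * (r ^ J * dlt) * G ^ (3 * J))).
Proof.
move=> /ssrnat.ltP nu0 /ssrnat.ltP q0 /RltP rho1 /ssrnat.leP leJ s1E s2E /RleP r1 /RleP E1 /RleP d0 /RleP G1 ler PM Pd /RleP leG.
set rho := INR p / INR q in rho1 Pd leG.
have rhoE : rho = (p%:R / q%:R)%R by rewrite /rho RdivE !INRE.
have [f nz] := exponential_minor_neq0 nu0 rho1 leJ.
have low := @exponential_minor_ge (RR : rcfType) nu J A B p q f q0.
rewrite -rhoE in low; move/(_ nz): low => low.
pose cf k n : RR := (2 * PI * INR k) ^ n / INR (fact n).
have cf0 k n : (0 <= cf k n)%R.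
  apply/RleP; apply: Rmult_le_pos.
    apply: pow_le; apply: Rmult_le_pos; last exact: pos_INR.
    by have := PI_RGT_0; Lra.lra.
  by left; apply: Rinv_0_lt_compat; exact: INR_fact_lt_0.
pose P k : {poly RR[i]} := \poly_(n < D) (cf k n)%:C%C.
have PE k (x y : RR) : (P k).[(x +i* y)%C] =
   ((sum0 (fun n => cf k n * fst (zpow x y n)) D) +i* (sum0 (fun n => cf k n * snd (zpow x y n)) D))%C.
  rewrite horner_poly !sum0E.
  under eq_bigr => n _ do rewrite zpowE.
  elim: D {PM Pd P} => [|D' IH]; first by rewrite !big_ord0.
  rewrite !big_ord_recr /= IH; apply/eqP; rewrite eq_complex /=.
  by rewrite !mul0r subr0 addr0 !RmultE !eqxx.
refine (_ (@exponential_minor_le (RR : rcfType) nu J A B D rho r E M dlt G P f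
  r1 E1 d0 (ltW rho1) G1 _ _ _ _ _ _)); first last.
- by move: leG; rewrite RmultE RplusE !RpowE.
- move=> a b k /ssrnat.ltP lta /ssrnat.ltP ltb /ssrnat.ltP ltk.
  have [] := Pd a b k lta ltb ltk.
  have gE : gpoint (RR : rcfType) nu a b = ((INR nu * INR a) +i* INR b)%C :> RR[i].
    by rewrite /gpoint natrM -!INRE.
  rewrite gE PE.
  set u := sum0 _ _; set v := sum0 _ _ => leu lev.
  pose w : RR := pow (pow rho a) k.
  have -> : ((rho%:C%C ^+ a) ^+ k)%R = w%:C%C :> RR[i] by rewrite /w !RpowE !rmorphXn.
  rewrite -/w in leu.
  have -> : ((u +i* v)%C - w%:C%C)%R = ((u - w)%R%:C + v%:C * 'i)%C%R :> RR[i].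
    by apply/eqP; rewrite eq_complex /= !(mulr0, mulr1, mul0r, subr0, addr0, add0r) !eqxx.
  apply: le_trans (ler_normD _ _) _.
  have ni : `|('i)%C : RR[i]|%R = 1%R.
    by rewrite normc_def /= expr0n /= add0r expr1n sqrtr1.
  rewrite normrM ni mulr1 !normc_def /= expr0n !addr0 !sqrtr_sqr -rmorphD lecR.
  have -> : `|u - w|%R = Rabs (w - u) by rewrite RabsE distrC RminusE.
  by rewrite -RabsE; apply/RleP; rewrite -RplusE; Lra.lra.
- move=> a b lta ltb.
  have -> : r%:C%C = (r%:C%C : RR[i]) by [].
  apply: le_trans (_ : `|((nu * a)%:R : RR)%:C%C| + `|(b%:R : RR)%:C%C * ('i)%C| <= _)%R.
    have -> : gpoint (RR : rcfType) nu a b = (((nu * a)%:R : RR)%:C%C + (b%:R : RR)%:C%C * ('i)%C)%R :> RR[i].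
      by apply/eqP; rewrite eq_complex /= !(mulr0, mulr1, mul0r, subr0, addr0, add0r) !eqxx.
    exact: ler_normD.
  have ni : `|('i)%C : RR[i]|%R = 1%R.
    by rewrite normc_def /= expr0n /= add0r expr1n sqrtr1.
  rewrite normrM ni mulr1 !normc_def /= expr0n !addr0 !sqrtr_sqr !ger0_norm ?ler0n //.
  rewrite -rmorphD lecR; apply/RleP; apply: Rle_trans ler.
  rewrite -RplusE natrM -RmultE -!INRE.
  have /ssrnat.leP/le_INR := ltnW lta; have /ssrnat.leP/le_INR := ltnW ltb.
  by have := pos_INR nu; Psatz.nra.
- move=> k /ssrnat.ltP /PM /RleP leM; rewrite -[((E * r)%R)%:C%C]/(((E * r)%R) +i* 0)%C PE.
  have zr n : zpow (E * r)%R 0 n = ((E * r) ^ n, 0).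
    by elim: n => //= n ->; rewrite /= !Rmult_0_r Rmult_0_l Rminus_0_r Rplus_0_l.
  rewrite lecE /=; apply/andP; split.
    apply/eqP/esym; rewrite sum0E big1 // => n _; rewrite zr /=; exact: Rmult_0_r.
  apply: le_trans leM; rewrite le_eqVlt; apply/orP; left; apply/eqP; rewrite !sum0E.
  by apply: eq_bigr => n _; rewrite zr.
- by move=> k n; rewrite coef_poly; case: ifP => // _; rewrite ler0c.
- by move=> k; exact: size_poly.
move=> up.
have s1E' : (2 * s1 = 3 * (J * J.-1))%N by rewrite -subn1; exact: s1E.
have s2E' : (2 * s2 = 3 * J * (3 * J).-1)%N by rewrite -subn1; exact: s2E.
have e1 : s1 = (\sum_(i < 3 * J) i %/ 3)%N.
  by apply/eqP; rewrite -(eqn_pmul2l (isT : (0 < 2)%N)) sum_ord_div3_double s1E'.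
have e2 : s2 = (\sum_(i < 3 * J) i)%N.
  by apply/eqP; rewrite -(eqn_pmul2l (isT : (0 < 2)%N)) sum_ord_double s2E'.
apply/RleP; rewrite e1 e2 !(RplusE, RmultE, RdivE, RpowE) !factE !INRE -lecR rmorphM rmorphXn rmorph_nat.
apply: le_trans low _.
by rewrite ler_wpM2l // exprn_ge0 // ler0n.
Qed.
End InterpolationInequality.
Import InterpolationInequality.

Lemma exp_partial_sum_le (n : nat) : forall x, 0 <= x ->
  sum0 (fun k => x ^ k / INR (fact k)) n <= exp x.
Proof.
  induction n as [|n IH]; intros x Hx.
  - simpl. left. apply exp_pos.
  - rewrite sum0_recl.
    assert (H : exp 0 - sum0 (fun k => 1 * 0 ^ S k / INR (fact (S k))) n
              <= exp x - sum0 (fun k => 1 * x ^ S k / INR (fact (S k))) n).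
    { apply (nonneg_derivative_le
        (fun t => exp t - sum0 (fun k => 1 * t ^ S k / INR (fact (S k))) n)
        (fun t => exp t - sum0 (fun k => 1 * t ^ k / INR (fact k)) n) 0 x Hx).
      - intros t _. apply (is_derive_minus (V := R_NormedModule)).
        + auto_derive; auto; ring.
        + apply is_derive_sum0. intros k _. apply is_derive_pow_fact.
      - intros t Ht. specialize (IH t (proj1 Ht)).
        rewrite (sum0_ext _ (fun k => t ^ k / INR (fact k))); [lra|].
        intros; unfold Rdiv; ring. }
    rewrite exp_0 in H.
    rewrite (sum0_ext (fun k => 1 * 0 ^ S k / INR (fact (S k))) (fun _ => 0)) in H
      by (intros k _; rewrite pow_i by lia; unfold Rdiv; ring).
    assert (Z : forall j, sum0 (fun _ => 0) j = 0) by (induction j; simpl; lra).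
    rewrite Z in H.
    rewrite (sum0_ext (fun k => x ^ S k / INR (fact (S k)))
                      (fun k => 1 * x ^ S k / INR (fact (S k))))
      by (intros; unfold Rdiv; ring).
    change (fact 0) with 1%nat. simpl (x ^ 0). simpl (INR 1). lra.
Qed.

Lemma pow_diff_le (a b Y : R) (n : nat) : 1 <= Y -> Rabs a <= Y -> Rabs b <= Y ->
  Rabs (a ^ n - b ^ n) <= INR n * Rabs (a - b) * Y ^ n.
Proof.
  intros HY Ha Hb. induction n as [|n IH].
  - simpl. rewrite Rminus_diag, Rabs_R0. lra.
  - replace (a ^ S n - b ^ S n) with ((a - b) * a ^ n + b * (a ^ n - b ^ n)) by (simpl; ring).
    eapply Rle_trans; [apply Rabs_triang|]. rewrite !Rabs_mult, S_INR.
    assert (Han : Rabs (a ^ n) <= Y ^ n)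
      by (rewrite <- RPow_abs; apply pow_incr; split; [apply Rabs_pos|auto]).
    assert (0 <= Y ^ n) by (apply pow_le; lra).
    assert (Rabs (a - b) * Rabs (a ^ n) <= Rabs (a - b) * Y ^ n)
      by (apply Rmult_le_compat_l; [apply Rabs_pos|auto]).
    assert (Rabs b * Rabs (a ^ n - b ^ n) <= Y * (INR n * Rabs (a - b) * Y ^ n))
      by (apply Rmult_le_compat; auto using Rabs_pos).
    assert (Rabs (a - b) * Y ^ n <= Rabs (a - b) * Y ^ S n).
    { apply Rmult_le_compat_l; [apply Rabs_pos|]. simpl. nra. }
    simpl in *. lra.
Qed.

Lemma exp_INR_pow (x : R) (n : nat) : exp x ^ n = exp (INR n * x).
Proof.
  induction n as [|n IH].
  - simpl. rewrite Rmult_0_l, exp_0. reflexivity.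
  - simpl pow. rewrite IH, <- exp_plus, S_INR. f_equal. ring.
Qed.

Lemma exp_le (x y : R) : x <= y -> exp x <= exp y.
Proof. intros [H| ->]; [left; apply exp_increasing; auto | right; auto]. Qed.

Lemma fact_le_pow (n : nat) : INR (fact n) <= INR n ^ n.
Proof.
  assert (H : forall k, (k <= n)%nat -> INR (fact k) <= INR n ^ k).
  { induction k as [|k IH]; intros Hk; [simpl; lra|].
    change (fact (S k)) with (S k * fact k)%nat. rewrite mult_INR.
    simpl pow. apply Rmult_le_compat; try apply pos_INR.
    - apply le_INR; auto.
    - apply IH; lia. }
  apply H; auto.
Qed.

Lemma sin_cos_2PI_nat (n : nat) : cos (2 * PI * INR n) = 1 /\ sin (2 * PI * INR n) = 0.
Proof.
  replace (2 * PI * INR n) with (0 + 2 * INR n * PI) by ring.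
  rewrite cos_period, sin_period, cos_0, sin_0. auto.
Qed.

(* Logarithmic sizes of the two terms of [interpolation_inequality] for
   [J = m^20], [A = B = m^11], [r = m^12], [E = m^8], [dlt = exp (- m^42)]. *)
Lemma interpolation_numerics (m J : nat) (q : R) (s1 s2 : nat) :
  exp 20 <= INR m -> J = (m ^ 20)%nat -> 0 < q -> q <= exp (INR m) ->
  (2 * s1 = 3 * (J * (J - 1)))%nat -> (2 * s2 = 3 * J * (3 * J - 1))%nat ->
  q ^ (2 * m ^ 11 * (3 * J)) *
     (INR (fact (3 * J)) * (INR m ^ 8 * INR m ^ 12) ^ s1 * exp (16 * INR J) ^ (3 * J)
         / (INR m ^ 8) ^ s2
      + INR (fact (3 * J)) * (INR (3 * J) * ((INR m ^ 12) ^ J * exp (- INR m ^ 42))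
          * exp (15 * INR m * INR J) ^ (3 * J))) < 1.
Proof.
  intros Hm HJ Hq0 Hq Hs1 Hs2.
  set (l := ln (INR m)).
  assert (e20 : 1000 <= exp 20).
  { replace 20 with (INR 10 * 2) by (simpl; ring). rewrite <- exp_INR_pow.
    assert (2 <= exp 2) by (generalize (exp_ineq1_le 2); lra).
    assert (2 ^ 10 <= exp 2 ^ 10) by (apply pow_incr; lra). simpl in *. lra. }
  assert (m1 : 1000 <= INR m) by lra.
  assert (El : INR m = exp l) by (unfold l; rewrite exp_ln; lra).
  assert (l20 : 20 <= l).
  { unfold l. rewrite <- (ln_exp 20). apply ln_le; [apply exp_pos|lra]. }
  assert (lm : l <= INR m) by (rewrite El; generalize (exp_ineq1_le l); lra).
  set (j := INR J).
  assert (Ej : j = INR m ^ 20) by (unfold j; rewrite HJ, pow_INR; auto).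
  assert (Ejl : j = exp (20 * l)).
  { rewrite Ej, El, exp_INR_pow. f_equal. simpl. ring. }
  assert (p12 : INR m ^ 12 <= j) by (rewrite Ej; apply Rle_pow; lra || lia).
  assert (pj : INR m <= j).
  { rewrite Ej. rewrite <- (pow_1 (INR m)) at 1. apply Rle_pow; lra || lia. }
  assert (j1 : 1000 <= j) by lra.
  assert (J1 : (1 <= J)%nat) by (apply INR_le; fold j; simpl; lra).
  assert (Es1 : 2 * INR s1 = 3 * (j * (j - 1))).
  { replace (2 * INR s1) with (INR (2 * s1)) by (rewrite mult_INR; simpl; ring).
    rewrite Hs1, !mult_INR, minus_INR by auto. simpl. unfold j. ring. }
  assert (E3 : INR (3 * J) = 3 * j) by (rewrite mult_INR; simpl; unfold j; ring).
  assert (Es2 : 2 * INR s2 = 3 * j * (3 * j - 1)).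
  { replace (2 * INR s2) with (INR (2 * s2)) by (rewrite mult_INR; simpl; ring).
    rewrite Hs2, mult_INR, minus_INR by lia. rewrite E3. simpl. ring. }
  assert (Bq : q ^ (2 * m ^ 11 * (3 * J)) <= exp (6 * j * j)).
  { apply Rle_trans with (exp (INR m) ^ (2 * m ^ 11 * (3 * J))).
    - apply pow_incr. lra.
    - rewrite exp_INR_pow. apply exp_le.
      rewrite !mult_INR, pow_INR. fold j. change (INR 2) with 2. change (INR 3) with (2 + 1).
      replace (2 * INR m ^ 11 * ((2 + 1) * j) * INR m) with (6 * (j * INR m ^ 12)) by ring.
      nra. }
  assert (Bf : INR (fact (3 * J)) <= exp (66 * j * l)).
  { eapply Rle_trans; [apply fact_le_pow|]. rewrite E3.
    assert (3 * j <= exp (22 * l)).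
    { replace (22 * l) with (20 * l + 2 * l) by ring. rewrite exp_plus, <- Ejl.
      assert (3 <= exp (2 * l)) by (generalize (exp_ineq1_le (2 * l)); lra).
      nra. }
    eapply Rle_trans; [apply pow_incr; split; [lra|apply H]|].
    rewrite exp_INR_pow, E3. apply exp_le. right; ring. }
  assert (Bf0 : 0 <= INR (fact (3 * J))) by apply pos_INR.
  assert (Bq0 : 0 <= q ^ (2 * m ^ 11 * (3 * J))) by (apply pow_le; lra).
  assert (half : exp (-1) <= 1 / 2).
  { replace (exp (-1)) with (/ exp 1) by (rewrite <- exp_Ropp; f_equal; ring).
    assert (2 <= exp 1) by (generalize (exp_ineq1_le 1); lra).
    unfold Rdiv. rewrite Rmult_1_l. apply Rinv_le_contravar; lra. }
  rewrite Rmult_plus_distr_l.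
  (* Exponents in units of l j^2: the numerator (E r)^s1 contributes 20 times 3/2, that is 30, and
     the denominator E^s2 contributes 8 times 9/2, that is 36. The margin 6 l is at least 120 and
     absorbs the 6 + 48 coming from the powers of [q] and from [M]. With two exponentials in place
     of three the corresponding numbers would be 20 against 16. *)
  assert (T1 : q ^ (2 * m ^ 11 * (3 * J)) *
     (INR (fact (3 * J)) * (INR m ^ 8 * INR m ^ 12) ^ s1 * exp (16 * INR J) ^ (3 * J)
         / (INR m ^ 8) ^ s2) <= exp (-46 * j * j)).
  { replace (INR m ^ 8 * INR m ^ 12) with (exp (20 * l)) by (rewrite <- Ejl, Ej; ring).
    replace (INR m ^ 8) with (exp (8 * l))
      by (rewrite El, exp_INR_pow; f_equal; simpl; ring).
    rewrite !exp_INR_pow, E3. fold j. unfold Rdiv. rewrite <- exp_Ropp.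
    apply Rle_trans with (exp (6 * j * j) *
      (exp (66 * j * l) * exp (INR s1 * (20 * l)) * exp (3 * j * (16 * j))
        * exp (- (INR s2 * (8 * l))))).
    - apply Rmult_le_compat; auto.
      + repeat apply Rmult_le_pos; auto; left; apply exp_pos.
      + repeat (apply Rmult_le_compat_r; [left; apply exp_pos|]). auto.
    - rewrite <- !exp_plus. apply exp_le.
      replace (INR s1 * (20 * l)) with (10 * l * (3 * (j * (j - 1)))) by (rewrite <- Es1; ring).
      replace (INR s2 * (8 * l)) with (4 * l * (3 * j * (3 * j - 1))) by (rewrite <- Es2; ring).
      assert (lj : 0 <= l * j) by (apply Rmult_le_pos; lra).
      assert (jj : 0 <= j * j) by (apply Rmult_le_pos; lra).
      assert (48 * (l * j) <= j * (l * j)) by (apply Rmult_le_compat_r; lra).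
      assert (20 * (j * j) <= l * (j * j)) by (apply Rmult_le_compat_r; lra).
      clear - H H0 lj jj. nra. }
  (* Here [dlt] is exp (- m^2 j^2), and the largest competing factor is the power of [G], with
     exponent 45 m j^2. *)
  assert (T2 : q ^ (2 * m ^ 11 * (3 * J)) * (INR (fact (3 * J)) *
      (INR (3 * J) * ((INR m ^ 12) ^ J * exp (- INR m ^ 42))
          * exp (15 * INR m * INR J) ^ (3 * J))) <= exp (- (j * j))).
  { replace (INR m ^ 12) with (exp (12 * l))
      by (rewrite El, exp_INR_pow; f_equal; simpl; ring).
    rewrite !exp_INR_pow, E3. fold j.
    assert (Bj : 3 * j <= exp (3 * j)) by (generalize (exp_ineq1_le (3 * j)); lra).
    apply Rle_trans with (exp (6 * j * j) * (exp (66 * j * l) *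
      (exp (3 * j) * (exp (j * (12 * l)) * exp (- INR m ^ 42))
         * exp (3 * j * (15 * INR m * j))))).
    - apply Rmult_le_compat; auto.
      + repeat apply Rmult_le_pos; auto; try (left; apply exp_pos); lra.
      + apply Rmult_le_compat; auto.
        * repeat apply Rmult_le_pos; auto; try (left; apply exp_pos); lra.
        * repeat (apply Rmult_le_compat_r; [left; apply exp_pos; apply Rmult_lt_0_compat|]); auto.
          apply Rmult_le_compat_r; auto. left. apply Rmult_lt_0_compat; apply exp_pos.
    - rewrite <- !exp_plus. apply exp_le.
      replace (INR m ^ 42) with (INR m * INR m * (j * j)) by (rewrite Ej; ring).
      assert (j * l <= INR m * (j * j)) by nra.
      assert (j * j <= INR m * (j * j)) by nra.
      assert (j <= INR m * (j * j)) by nra.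
      assert (1000 * (INR m * (j * j)) <= INR m * INR m * (j * j)) by nra.
      nra. }
  assert (Q1 : exp (-46 * j * j) <= exp (-1)) by (apply exp_le; nra).
  assert (Q2 : exp (- (j * j)) < exp (-1)) by (apply exp_increasing; nra).
  fold j in T1, T2. lra.
Qed.

(** For a closer fraction, all powers of p / q up to 2 A agree with those of exp (2 pi nu) within
    exp (- m^42) / 4, and [interpolation_numerics] contradicts [interpolation_inequality]. The
    exponent 50 leaves room over 42 for the growth of these powers. The bound on [nu] by [m] keeps
    the grid points in the disc of radius m^12, which makes the measure uniform. *)
Lemma exp_2PI_irrationality_measure : exists m0 : nat, forall m nu p q : nat,
  (m0 <= m)%nat -> (1 <= nu)%nat -> (nu + 1 <= m)%nat -> (1 <= p)%nat -> (1 <= q)%nat ->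
  INR p <= exp (INR m) -> INR q <= exp (INR m) ->
  exp (- INR m ^ 50) <= Rabs (exp (2 * PI * INR nu) - INR p / INR q).
Proof.
  exists (Z.to_nat (up (exp 20))).
  intros m nu p q Hm Hnu Hnum Hp Hq Hpm Hqm.
  assert (m20 : exp 20 <= INR m).
  { apply Rle_trans with (INR (Z.to_nat (up (exp 20)))); [|apply le_INR; auto].
    rewrite INR_IZR_INZ, Z2Nat.id.
    - left. destruct (archimed (exp 20)); lra.
    - apply le_IZR. destruct (archimed (exp 20)). generalize (exp_pos 20). lra. }
  assert (e20 : 21 <= exp 20) by (generalize (exp_ineq1_le 20); lra).
  assert (m1 : 21 <= INR m) by lra.
  assert (mN : (21 <= m)%nat) by (apply INR_le; simpl; lra).
  apply Rnot_lt_le. intros Hlt.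
  set (y := exp (2 * PI * INR nu)) in *. set (rho := INR p / INR q) in *.
  assert (q1 : 1 <= INR q) by (apply (le_INR 1); auto).
  assert (pi3 : 3 < PI) by (generalize PI2_3_2; lra).
  assert (pi4 : PI <= 4) by apply PI_4.
  assert (nu1 : 1 <= INR nu) by (apply (le_INR 1); auto).
  assert (y7 : 7 <= y).
  { unfold y. generalize (exp_ineq1_le (2 * PI * INR nu)). nra. }
  assert (small : exp (- INR m ^ 50) < 1).
  { rewrite <- exp_0. apply exp_increasing.
    assert (0 < INR m ^ 50) by (apply pow_lt; lra). lra. }
  assert (ab := Hlt). apply Rabs_lt_between in ab.
  assert (rho1 : 1 < rho) by lra.
  assert (rhom : rho <= exp (INR m)).
  { unfold rho. apply Rle_trans with (INR p); auto.
    apply Rmult_le_reg_r with (INR q); [lra|]. unfold Rdiv.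
    rewrite Rmult_assoc, Rinv_l, Rmult_1_r by lra.
    generalize (pos_INR p). nra. }
  set (J := (m ^ 20)%nat).
  set (A := (m ^ 11)%nat).
  assert (EA : INR A = INR m ^ 11) by (unfold A; apply pow_INR).
  assert (EJ : INR J = INR m ^ 20) by (unfold J; apply pow_INR).
  assert (even : forall n, exists s, (2 * s = n * (n - 1))%nat).
  { induction n as [|n [s IH]]; [exists O; auto|].
    exists (s + n)%nat. destruct n; simpl in *; nia. }
  destruct (even J) as [s0 Hs0]. destruct (even (3 * J)%nat) as [s2 Hs2].
  assert (Hs1 : (2 * (3 * s0) = 3 * (J * (J - 1)))%nat) by lia.
  set (dlt := exp (- INR m ^ 42)).
  assert (dlt0 : 0 < dlt) by apply exp_pos.
  assert (numu : INR nu + 1 <= INR m) by (rewrite <- S_INR; apply le_INR; lia).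
  assert (rR : INR nu * INR A + INR A <= INR m ^ 12).
  { rewrite EA. replace (INR m ^ 12) with (INR m * INR m ^ 11) by ring.
    assert (0 <= INR m ^ 11) by (apply pow_le; lra). nra. }
  assert (rhoy : forall n, (n <= 2 * A)%nat -> Rabs (rho ^ n - y ^ n) <= dlt / 4).
  { intros n Hn.
    assert (Y : exp (INR m) + 1 <= exp (INR m + 1)).
    { rewrite exp_plus. assert (2 <= exp 1) by (generalize (exp_ineq1_le 1); lra).
      assert (1 <= exp (INR m)) by (generalize (exp_ineq1_le (INR m)); lra). nra. }
    assert (Y1 : 1 <= exp (INR m + 1)) by (generalize (exp_ineq1_le (INR m + 1)); lra).
    eapply Rle_trans; [apply (pow_diff_le rho y (exp (INR m + 1)) n Y1)|].
    - rewrite Rabs_right; lra.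
    - rewrite Rabs_right; lra.
    - rewrite Rabs_minus_sym.
      assert (Hn' : INR n <= 2 * INR m ^ 11)
        by (rewrite <- EA; change 2 with (INR 2); rewrite <- mult_INR; apply le_INR; auto).
      apply Rle_trans with (exp (2 * INR m ^ 11) * exp (- INR m ^ 50)
                             * exp (2 * INR m ^ 11 * (INR m + 1))).
      + assert (P11 : 0 <= INR m ^ 11) by (apply pow_le; lra).
        apply Rmult_le_compat.
        * apply Rmult_le_pos; [apply pos_INR|apply Rabs_pos].
        * apply pow_le; lra.
        * apply Rmult_le_compat; [apply pos_INR|apply Rabs_pos| |lra].
          generalize (exp_ineq1_le (2 * INR m ^ 11)). lra.
        * rewrite exp_INR_pow. apply exp_le. apply Rmult_le_compat_r; lra.
      + apply Rle_trans with (exp (- INR m ^ 42 - 3)).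
        * rewrite <- !exp_plus. apply exp_le.
          replace (INR m ^ 50) with (INR m ^ 11 * INR m ^ 31 * INR m ^ 8) by ring.
          replace (INR m ^ 42) with (INR m ^ 11 * INR m ^ 31) by ring.
          assert (1 <= INR m ^ 11) by (apply pow_R1_Rle; lra).
          assert (INR m <= INR m ^ 31).
          { rewrite <- (pow_1 (INR m)) at 1. apply Rle_pow; lra || lia. }
          assert (INR m <= INR m ^ 8).
          { rewrite <- (pow_1 (INR m)) at 1. apply Rle_pow; lra || lia. }
          assert (21 * (INR m ^ 11 * INR m ^ 31) <= INR m ^ 11 * INR m ^ 31 * INR m ^ 8) by nra.
          assert (INR m ^ 11 * INR m <= INR m ^ 11 * INR m ^ 31) by nra.
          nra.
        * unfold Rminus. rewrite exp_plus. fold dlt.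
          replace (exp (- (3))) with (/ exp 3) by (rewrite <- exp_Ropp; f_equal; ring).
          assert (/ exp 3 <= / 4); [|unfold Rdiv; apply Rmult_le_compat_l; lra].
          assert (4 <= exp 3) by (generalize (exp_ineq1_le 3); lra).
          apply Rinv_le_contravar; lra. }
  (* The number [D] of Taylor terms does not occur in the final inequality, so it is simply taken
     large enough for the remainder to be below [dlt / 4] on the grid. There |z| <= m^12 and 2 pi k
     <= 16, which explains the base. *)
  destruct (cv_speed_pow_fact (16 * INR m ^ 12) (dlt / 4 * exp (- (16 * INR m ^ 12)))) as [D HD].
  { apply Rmult_lt_0_compat; [lra|apply exp_pos]. }
  specialize (HD D (le_n D)). unfold Rdist in HD. rewrite Rminus_0_r in HD.
  assert (P12 : 0 < INR m ^ 12) by (apply pow_lt; lra).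
  assert (fD : 0 < INR (fact D)) by apply INR_fact_lt_0.
  rewrite Rabs_right in HD.
  2:{ apply Rle_ge. apply Rmult_le_pos; [apply pow_le; lra|].
      left. apply Rinv_0_lt_compat. auto. }
  assert (tail : forall a b k, (a < A)%nat -> (b < A)%nat -> (k < 3)%nat ->
     exp (2 * PI * INR k * Rabs (INR nu * INR a)) * (Rabs (INR nu * INR a) + Rabs (INR b)) ^ D
       * (2 * PI * INR k) ^ D / INR (fact D) <= dlt / 4).
  { intros a b k Ha Hb Hk.
    rewrite !Rabs_right by (apply Rle_ge; try apply Rmult_le_pos; apply pos_INR).
    assert (a' : 0 <= INR a <= INR A) by (split; [apply pos_INR|apply le_INR; lia]).
    assert (b' : 0 <= INR b <= INR A) by (split; [apply pos_INR|apply le_INR; lia]).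
    assert (k' : 0 <= INR k <= 2)
      by (split; [apply pos_INR|change 2 with (INR 2); apply le_INR; lia]).
    assert (z0 : 0 <= INR nu * INR a) by nra.
    assert (z1 : INR nu * INR a + INR b <= INR m ^ 12) by nra.
    assert (w0 : 0 <= 2 * PI * INR k <= 16) by nra.
    apply Rle_trans with (exp (16 * INR m ^ 12) * ((16 * INR m ^ 12) ^ D / INR (fact D))).
    - unfold Rdiv. rewrite <- (Rmult_assoc (exp (16 * _))).
      apply Rmult_le_compat_r; [left; apply Rinv_0_lt_compat; auto|].
      rewrite Rmult_assoc, <- Rpow_mult_distr.
      apply Rmult_le_compat.
      + left; apply exp_pos.
      + apply pow_le. apply Rmult_le_pos; lra.
      + apply exp_le. nra.
      + apply pow_incr. split; [apply Rmult_le_pos; lra|]. nra.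
    - apply Rle_trans with (exp (16 * INR m ^ 12) * (dlt / 4 * exp (- (16 * INR m ^ 12)))).
      + apply Rmult_le_compat_l; [left; apply exp_pos|lra].
      + rewrite exp_Ropp. right. field. apply Rgt_not_eq, exp_pos. }
  assert (key := @interpolation_inequality nu J A A D p q (3 * s0) s2 (INR m ^ 12) (INR m ^ 8)
     (exp (16 * INR J)) dlt (exp (15 * INR m * INR J))).
  assert (num := interpolation_numerics m J (INR q) (3 * s0) s2 m20 eq_refl ltac:(lra) Hqm Hs1 Hs2).
  revert num. apply Rle_not_lt. apply key; clear key.
  - lia.
  - lia.
  - exact rho1.
  - unfold J, A. change (4 * m ^ 20 <= (m ^ 11 - 2) * (m ^ 11 - 2))%nat.
    assert (H1 : (m ^ 20 = m ^ 10 * m ^ 10)%nat) by (rewrite <- Nat.pow_add_r; auto).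
    assert (H2 : (m ^ 11 = m * m ^ 10)%nat) by reflexivity.
    assert (H3 : (1 <= m ^ 10)%nat) by (apply Nat.neq_0_lt_0, Nat.pow_nonzero; lia).
    assert (H4 : (2 * m ^ 10 <= m ^ 11 - 2)%nat) by (rewrite H2; nia).
    rewrite H1. nia.
  - exact Hs1.
  - exact Hs2.
  - apply pow_R1_Rle; lra.
  - apply pow_R1_Rle; lra.
  - lra.
  - rewrite <- exp_0. apply exp_le.
    apply Rmult_le_pos; [lra|apply pos_INR].
  - exact rR.
  - intros k Hk.
    assert (k' : 0 <= INR k <= 2)
      by (split; [apply pos_INR|change 2 with (INR 2); apply le_INR; lia]).
    rewrite (sum0_ext _ (fun n => (2 * PI * INR k * (INR m ^ 8 * INR m ^ 12)) ^ n / INR (fact n))).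
    2:{ intros n _. rewrite (Rpow_mult_distr (2 * PI * INR k)). unfold Rdiv. ring. }
    assert (P20 : 0 < INR m ^ 20) by (apply pow_lt; lra).
    replace (INR m ^ 8 * INR m ^ 12) with (INR m ^ 20) by ring.
    eapply Rle_trans; [apply exp_partial_sum_le|].
    + apply Rmult_le_pos; nra.
    + apply exp_le. rewrite EJ. apply Rmult_le_compat_r; nra.
  - intros a b k Ha Hb Hk.
    destruct (complex_exp_taylor (2 * PI * INR k) (INR nu * INR a) (INR b) D) as [T1 T2].
    { apply Rmult_le_pos; [nra|apply pos_INR]. }
    specialize (tail a b k Ha Hb Hk).
    destruct (sin_cos_2PI_nat (k * b)) as [Hc Hsn].
    rewrite mult_INR, <- Rmult_assoc in Hc, Hsn.
    rewrite Hc, Rmult_1_r in T1. rewrite Hsn, Rmult_0_r in T2.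
    assert (Ey : exp (2 * PI * INR k * (INR nu * INR a)) = y ^ (a * k)).
    { unfold y. rewrite exp_INR_pow, mult_INR. f_equal. ring. }
    rewrite Ey in T1. split.
    + rewrite <- pow_mult.
      assert (R1 := rhoy (a * k)%nat ltac:(nia)).
      match goal with |- Rabs (?u - ?v) <= _ =>
        replace (u - v) with ((u - y ^ (a * k)) + (y ^ (a * k) - v)) by ring end.
      eapply Rle_trans; [apply Rabs_triang|].
      change (INR p / INR q) with rho. lra.
    + rewrite Rminus_0_l, Rabs_Ropp in T2. lra.
  - change (INR p / INR q) with rho.
    apply Rle_trans with (exp (12 * INR m * INR J) * exp (2 * INR m ^ 12 + 1)).
    + apply Rmult_le_compat.
      * apply pow_le. lra.
      * apply Rplus_le_le_0_compat; [apply pow_le|]; lra.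
      * apply Rle_trans with (exp (12 * INR m) ^ J).
        -- apply pow_incr. split; [lra|].
           replace (12 * INR m) with (INR 12 * INR m) by (simpl; ring).
           rewrite <- exp_INR_pow. apply pow_incr. split; [lra|].
           generalize (exp_ineq1_le (INR m)). lra.
        -- rewrite exp_INR_pow. apply exp_le. right; ring.
      * rewrite exp_plus.
        assert (B1 : rho ^ (2 * A) <= exp (2 * INR m ^ 12)).
        { apply Rle_trans with (exp (INR m) ^ (2 * A)).
          - apply pow_incr. lra.
          - rewrite exp_INR_pow, mult_INR, EA. apply exp_le. simpl (INR 2). right. ring. }
        assert (B2 : dlt <= 1).
        { unfold dlt. rewrite <- exp_0. apply exp_le.
          assert (0 <= INR m ^ 42) by (apply pow_le; lra). lra. }
        assert (1 <= exp (2 * INR m ^ 12)) by (generalize (exp_ineq1_le (2 * INR m ^ 12)); lra).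
        assert (2 <= exp 1) by (generalize (exp_ineq1_le 1); lra).
        change (rho ^ (2 * A) + dlt <= exp (2 * INR m ^ 12) * exp 1). nra.
    + rewrite <- exp_plus. apply exp_le.
      rewrite EJ. assert (INR m ^ 12 <= INR m ^ 20) by (apply Rle_pow; lra || lia).
      assert (1 <= INR m ^ 20) by (apply pow_R1_Rle; lra). nra.
Qed.

(** * Divisor sums *)

Module DivisorCount.
Import all_boot zify.
Set Implicit Arguments. Unset Strict Implicit. Unset Printing Implicit Defensive.
Local Open Scope nat_scope.

Definition ndiv (n : nat) : nat := size (divisors n).

Lemma Nat_moduloE n d : 0 < d -> PeanoNat.Nat.modulo n d = n %% d.
Proof.
move=> d0; apply/esym/(PeanoNat.Nat.mod_unique _ _ (n %/ d)); first exact/ltP/ltn_pmod.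
by rewrite {1}(divn_eq n d) mulnC.
Qed.

Lemma Nat_divE n d : 0 < d -> PeanoNat.Nat.div n d = n %/ d.
Proof.
move=> d0; apply/esym/(PeanoNat.Nat.div_unique _ _ _ (n %% d)); first exact/ltP/ltn_pmod.
by rewrite {1}(divn_eq n d) mulnC.
Qed.

Lemma primebE p : primeb p = prime p.
Proof.
rewrite /primeb; case: p => [|[|p]] //.
apply/idP/idP.
  move=> /andP[_ /forallb_forall fa]; apply/primeP; split => // d ddvd.
  have d0 : 0 < d by apply: dvdn_gt0 ddvd.
  have dle : d <= p.+2 by apply: dvdn_leq ddvd.
  case: (ltnP 1 d) => [d1|]; last by move=> d1; apply/orP; left; apply/eqP; lia.
  case: (ltnP d p.+2) => [ltd|]; last by move=> led; apply/orP; right; apply/eqP; lia.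
  have : List.In d (List.seq 2 (p.+2 - 2)) by apply/in_seq; split; apply/leP; lia.
  move/fa => /negP; case; apply/PeanoNat.Nat.eqb_spec.
  by rewrite Nat_moduloE //; exact/eqP.
move=> pp; apply/andP; split => //; apply/forallb_forall => d /in_seq [/leP d2 /leP dp].
apply/negP => /PeanoNat.Nat.eqb_spec.
rewrite Nat_moduloE; last by lia.
move/eqP; case/primeP: pp => _ /[apply] /orP[] /eqP; lia.
Qed.

Lemma vpE p n : prime p -> 0 < n -> vp p n = logn p n.
Proof.
move=> pp; have p1 := prime_gt1 pp; rewrite /vp.
suff: forall fuel n, n <= fuel -> 0 < n -> vp_aux fuel p n = logn p n by apply.
elim=> [|fuel IH] {}n lef n0; first by lia.
rewrite /= lognE pp n0 /=.
have -> : Nat.ltb 1 p by apply/PeanoNat.Nat.ltb_spec0; apply/ltP.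
have -> : Nat.ltb 0 n by apply/PeanoNat.Nat.ltb_spec0; apply/ltP.
rewrite /=.
have p0 := prime_gt0 pp.
have -> : PeanoNat.Nat.eqb (PeanoNat.Nat.modulo n p) 0 = (p %| n).
  by rewrite Nat_moduloE //; apply/PeanoNat.Nat.eqb_spec/eqP.
case: ifP => // pn.
rewrite Nat_divE // IH //; last by rewrite divn_gt0 // dvdn_leq.
by have := ltn_Pdiv p1 n0; lia.
Qed.

Lemma ndivE n : ndiv n = \prod_(p <- primes n) (logn p n).+1.
Proof.
rewrite /ndiv /divisors.
have szadd f s : size (PrimeDecompAux.add_divisors f s) = size s * f.2.+1.
  case: f => p e /=; elim: e => [|e IHe] /=; first by rewrite muln1.
  by rewrite size_merge size_cat size_map IHe mulnSr [in RHS]mulnSr; lia.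
have -> : forall l, size (foldr PrimeDecompAux.add_divisors [:: 1] l) = \prod_(f <- l) f.2.+1.
  elim=> [|f l IHl]; first by rewrite big_nil.
  by rewrite big_cons /= szadd IHl mulnC.
by rewrite prime_decompE big_map.
Qed.

(** The left side has the shape of the product defining [dA], with vp + 1 in place of the binomial
    coefficient, so that the two can be compared prime by prime. *)
Lemma prod_vp_le_ndiv n :
  0 < n ->
  fold_right Nat.mul 1 (List.map (fun p => if primeb p then S (vp p n) else 1)
     (List.seq 2 (n - 1))) = ndiv n.
Proof.
move=> n0.
have seqE k l : List.seq k l = iota k l by elim: l k => //= l IHl k; rewrite IHl.
have -> : forall l : seq nat, fold_right Nat.mul 1 (List.map
    (fun p => if primeb p then S (vp p n) else 1) l)
    = \prod_(p <- l | prime p) (logn p n).+1.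
  elim=> [|p l IHl]; first by rewrite big_nil.
  rewrite big_cons /= IHl primebE; case: ifP => [pp|_]; first by rewrite vpE.
  by rewrite PeanoNat.Nat.mul_1_l.
rewrite seqE ndivE.
rewrite (bigID (fun p => p \in primes n)) /= [X in _ * X]big1 ?muln1; last first.
  move=> p /andP[pp]; rewrite mem_primes pp n0 /= => np.
  by rewrite lognE pp n0 (negPf np).
rewrite -big_filter; apply: perm_big; apply: uniq_perm.
- by rewrite filter_uniq // iota_uniq.
- exact: primes_uniq.
move=> p; rewrite mem_filter mem_iota; apply/idP/idP => [/andP[/andP[]]//|pin].
rewrite pin; move: pin; rewrite mem_primes => /and3P[pp _ pd].
by rewrite pp (prime_gt1 pp) /=; have := dvdn_leq n0 pd; lia.
Qed.

Lemma ndiv_gt0 n : 0 < ndiv n.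
Proof. by rewrite ndivE prodn_gt0. Qed.

Lemma ndiv_dvd_le a n : a %| n -> 0 < n -> ndiv a <= ndiv n.
Proof.
move=> an n0; apply: uniq_leq_size; first exact: divisors_uniq.
move=> d; rewrite -!dvdn_divisors ?(dvdn_gt0 n0 an) // => da.
exact: dvdn_trans an.
Qed.

(** A divisor d of m n is sent to the pair (gcd (d, m), d / gcd (d, m)). This is injective, and the
    second entry divides n by coprimality. *)
Lemma ndivM_le m n : 0 < m -> 0 < n -> ndiv (m * n) <= ndiv m * ndiv n.
Proof.
move=> m0 n0; rewrite /ndiv -(size_allpairs pair).
rewrite -(size_map (fun d => (gcdn d m, d %/ gcdn d m))).
apply: uniq_leq_size.
  rewrite map_inj_in_uniq ?divisors_uniq // => d d' _ _ [eg eq].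
  by rewrite -(divnK (dvdn_gcdl d m)) -(divnK (dvdn_gcdl d' m)) eq eg.
move=> _ /mapP[d + ->]; rewrite -dvdn_divisors ?muln_gt0 ?m0 // => dmn.
have d0 : 0 < d by apply: dvdn_gt0 dmn; rewrite muln_gt0 m0.
have g0 : 0 < gcdn d m by rewrite gcdn_gt0 d0.
apply/allpairsP; exists (gcdn d m, d %/ gcdn d m); split => //=.
  by rewrite -dvdn_divisors // dvdn_gcdr.
rewrite -dvdn_divisors // -(@Gauss_dvdr _ (m %/ gcdn d m)).
  rewrite -(dvdn_pmul2r g0) divnK ?dvdn_gcdl // mulnAC divnK ?dvdn_gcdr //.
rewrite /coprime -(eqn_pmul2r g0) muln_gcdl !divnK ?dvdn_gcdl ?dvdn_gcdr //.
by rewrite mul1n.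
Qed.

Lemma ndiv_count n X : 0 < n -> n <= X ->
  ndiv n = count (fun d => n %% d == 0) (iota 1 X).
Proof.
move=> n0 nX; rewrite -size_filter; apply: perm_size; apply: uniq_perm.
- exact: divisors_uniq.
- by rewrite filter_uniq // iota_uniq.
move=> d; rewrite -dvdn_divisors // mem_filter mem_iota.
apply/idP/andP => [dn|[]//]; split => //.
by rewrite (dvdn_gt0 n0 dn) /=; have := dvdn_leq n0 dn; lia.
Qed.
End DivisorCount.
Import DivisorCount.

Definition dvdb (d n : nat) : R := if Nat.eqb (n mod d) 0 then 1 else 0.

Lemma dvdb_bounds d n : 0 <= dvdb d n <= 1.
Proof. unfold dvdb. destruct (Nat.eqb _ _); lra. Qed.

Lemma ndiv_ge1 n : 1 <= INR (ndiv n).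
Proof. apply (le_INR 1). generalize (ndiv_gt0 n). intros H. apply (ssrbool.elimT ssrnat.ltP H). Qed.

Lemma ndiv_mult_le m n : (1 <= m)%nat -> (1 <= n)%nat ->
  INR (ndiv (m * n)) <= INR (ndiv m) * INR (ndiv n).
Proof.
  intros Hm Hn. rewrite <- mult_INR. apply le_INR.
  apply (ssrbool.elimT ssrnat.leP). apply ndivM_le; apply (ssrbool.introT ssrnat.ltP); lia.
Qed.

Lemma ndiv_eq_sum n X : (1 <= n <= X)%nat -> INR (ndiv n) = sum1 (fun d => dvdb d n) X.
Proof.
  intros Hn.
  rewrite (@ndiv_count n X); try (apply (ssrbool.introT ssrnat.leP); lia).
  assert (H : forall k m, (1 <= m)%nat -> INR (seq.count (fun d => eqtype.eq_op (div.modn n d) 0%nat) (seq.iota m k))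
     = sum1 (fun d => dvdb (m - 1 + d) n) k).
  { induction k as [|k IH]; intros m Hm; [reflexivity|].
    rewrite sum1_recl. simpl seq.count. rewrite plus_INR, IH by lia.
    f_equal.
    - unfold dvdb. replace (m - 1 + 1)%nat with m by lia.
      rewrite <- Nat_moduloE by (apply (ssrbool.introT ssrnat.leP); lia).
      destruct (Nat.eqb_spec (n mod m) 0) as [->|Hne]; [reflexivity|].
      destruct (eqtype.eqP (x := (n mod m)%nat) (y := 0%nat)); [lia|reflexivity].
    - apply sum1_ext. intros d _. f_equal. lia. }
  rewrite H by lia. reflexivity.
Qed.

Lemma sum_dvdb_le (X n : nat) : (1 <= n)%nat -> sum1 (fun d => dvdb d n) X <= INR (ndiv n).
Proof.
  intros Hn. rewrite (ndiv_eq_sum n (max n X)) by lia.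
  apply sum1_le_extend; [lia|]. intros; apply dvdb_bounds.
Qed.

Lemma dvdb_eq_sum d n X : (1 <= d)%nat -> (1 <= n <= X)%nat ->
  dvdb d n = sum1 (fun e => if Nat.eqb e (n / d) then (if Nat.eqb (n mod d) 0 then 1 else 0) else 0) X.
Proof.
  intros Hd Hn. rewrite (sum1_delta (fun _ => if Nat.eqb (n mod d) 0 then 1 else 0)).
  unfold dvdb. destruct (Nat.eqb_spec (n mod d) 0) as [H0|].
  - assert (E := Nat.div_mod n d ltac:(lia)).
    assert (1 <= n / d <= X)%nat by (rewrite H0 in E; nia).
    rewrite (proj2 (Nat.leb_le _ _) (proj1 H)), (proj2 (Nat.leb_le _ _) (proj2 H)). reflexivity.
  - destruct (andb _ _); reflexivity.
Qed.

Lemma sum_multiples_le (g : nat -> R) d X : (1 <= d)%nat -> (forall n, 0 <= g n) ->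
  sum1 (fun n => dvdb d n * g n) X <= sum1 (fun e => g (d * e)%nat) X.
Proof.
  intros Hd Hg.
  apply Rle_trans with (sum1 (fun n => sum1 (fun e => if Nat.eqb n (d * e) then g n else 0) X) X).
  - apply sum1_le. intros n Hn. rewrite (dvdb_eq_sum d n X) by lia.
    rewrite <- sum1_scal_r. apply sum1_le. intros e _.
    destruct (Nat.eqb_spec n (d * e)) as [->|Hne].
    + specialize (Hg (d * e)%nat).
      destruct (Nat.eqb e (d * e / d)), (Nat.eqb ((d * e) mod d) 0); lra.
    + destruct (Nat.eqb_spec e (n / d)) as [He|]; [|specialize (Hg n); lra].
      destruct (Nat.eqb_spec (n mod d) 0) as [H0|]; [|specialize (Hg n); lra].
      exfalso. apply Hne. rewrite He. rewrite (Nat.div_mod n d) at 1 by lia. lia.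
  - rewrite sum1_swap. apply sum1_le. intros e He. rewrite sum1_delta.
    destruct (andb _ _); [lra|apply Hg].
Qed.

(** One factor [ndiv n] is opened as a sum over the divisors d of n, then n is written d e and
    submultiplicativity separates d from e. Each step squares the bound, hence the exponent 2^p. *)
Lemma ndiv_moment_le (p X : nat) : (1 <= X)%nat ->
  sum1 (fun n => INR (ndiv n) ^ p / INR n) X <= (1 + ln (INR X)) ^ (2 ^ p).
Proof.
  intros HX. induction p as [|p IH].
  - simpl (2 ^ 0)%nat. rewrite pow_1. eapply Rle_trans; [|apply harmonic_sum_le; auto].
    apply sum1_le. intros k _. simpl. unfold Rdiv. lra.
  - set (S := sum1 (fun n => INR (ndiv n) ^ p / INR n) X) in *.
    assert (nn : forall n, 0 <= INR (ndiv n) ^ p / INR n).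
    { intros n. destruct n; [simpl INR at 2; unfold Rdiv; rewrite Rinv_0; lra|].
      apply Rmult_le_pos; [apply pow_le, pos_INR|].
      left; apply Rinv_0_lt_compat, lt_0_INR; lia. }
    apply Rle_trans with (S * S).
    + apply Rle_trans with
        (sum1 (fun n => sum1 (fun d => dvdb d n * (INR (ndiv n) ^ p / INR n)) X) X).
      * apply sum1_le. intros n Hn. rewrite sum1_scal_r, <- (ndiv_eq_sum n X) by lia.
        simpl. right. unfold Rdiv. ring.
      * rewrite sum1_swap.
        apply Rle_trans with (sum1 (fun d => sum1 (fun e =>
          INR (ndiv (d * e)) ^ p / INR (d * e)) X) X).
        -- apply sum1_le. intros d Hd.
           apply (sum_multiples_le (fun n => INR (ndiv n) ^ p / INR n)); auto; lia.
        -- unfold S. rewrite sum1_mult. apply sum1_le. intros d Hd. apply sum1_le. intros e He.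
           assert (0 < INR d) by (apply lt_0_INR; lia).
           assert (0 < INR e) by (apply lt_0_INR; lia).
           rewrite mult_INR.
           replace (INR (ndiv d) ^ p / INR d * (INR (ndiv e) ^ p / INR e))
             with ((INR (ndiv d) * INR (ndiv e)) ^ p / (INR d * INR e))
             by (rewrite Rpow_mult_distr; field; lra).
           apply Rmult_le_compat_r; [left; apply Rinv_0_lt_compat; nra|].
           apply pow_incr. split; [apply pos_INR|apply ndiv_mult_le; lia].
    + assert (S0 : 0 <= S) by (apply sum1_ge0; intros; apply nn).
      replace (2 ^ Datatypes.S p)%nat with (2 ^ p + 2 ^ p)%nat by (simpl; lia).
      rewrite pow_add. apply Rmult_le_compat; auto.
Qed.

(** The pairs (a, k) are collected by their product n = a k. Nonnegativity allows every divisor a <=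
    X of n to be counted, whatever the size of n / a. *)
Lemma dirichlet_regroup_le (f G : nat -> R) (X Y : nat) :
  (forall a, 0 <= f a) -> (forall n, 0 <= G n) ->
  sum1 (fun a => sum1 (fun k => f a * G (a * k)%nat) Y) X
  <= sum1 (fun n => sum1 (fun a => dvdb a n * f a) X * G n) (X * Y).
Proof.
  intros Hf HG.
  rewrite (sum1_ext (fun n => sum1 (fun a => dvdb a n * f a) X * G n)
             (fun n => sum1 (fun a => f a * (dvdb a n * G n)) X)).
  2:{ intros n _. rewrite <- sum1_scal_r. apply sum1_ext. intros; ring. }
  rewrite (sum1_swap (fun n a => f a * (dvdb a n * G n))).
  apply sum1_le. intros a Ha. rewrite !sum1_scal. apply Rmult_le_compat_l; auto.
  assert (H : forall Z, (Z <= Y)%nat ->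
    sum1 (fun k => G (a * k)%nat) Z <= sum1 (fun n => dvdb a n * G n) (a * Z)).
  { induction Z as [|Z IH]; intros HZ; [rewrite Nat.mul_0_r; simpl; lra|].
    replace (a * S Z)%nat with (a * Z + a)%nat by lia.
    rewrite sum1_add. simpl sum1.
    assert (G (a * S Z)%nat <= sum1 (fun k => dvdb a (a * Z + k) * G (a * Z + k)%nat) a).
    { destruct a as [|a]; [lia|].
      change (sum1 ?h (S a)) with (sum1 h a + h (S a)). cbv beta.
      replace (S a * Z + S a)%nat with (S a * S Z)%nat by lia.
      assert (dvdb (S a) (S a * S Z) = 1) as ->.
      { unfold dvdb. rewrite Nat.mul_comm, Nat.Div0.mod_mul. reflexivity. }
      assert (0 <= sum1 (fun k => dvdb (S a) (S a * Z + k) * G (S a * Z + k)%nat) a).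
      { apply sum1_ge0. intros. apply Rmult_le_pos; auto. apply dvdb_bounds. }
      lra. }
    assert (IH' := IH ltac:(lia)). lra. }
  eapply Rle_trans; [apply (H Y (le_n Y))|].
  apply sum1_le_extend; [nia|]. intros. apply Rmult_le_pos; auto. apply dvdb_bounds.
Qed.

Lemma sum_dvdb_ndiv_pow_le (k X n : nat) : (1 <= n)%nat ->
  sum1 (fun a => dvdb a n * INR (ndiv a) ^ k) X <= INR (ndiv n) ^ S k.
Proof.
  intros Hn.
  apply Rle_trans with (sum1 (fun a => dvdb a n * INR (ndiv n) ^ k) X).
  - apply sum1_le. intros a Ha. unfold dvdb.
    destruct (Nat.eqb_spec (n mod a) 0) as [H0|]; [|lra].
    rewrite !Rmult_1_l. apply pow_incr. split; [apply pos_INR|]. apply le_INR.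
    apply (ssrbool.elimT ssrnat.leP). apply ndiv_dvd_le.
    + unfold div.dvdn. rewrite <- Nat_moduloE by (apply (ssrbool.introT ssrnat.ltP); lia).
      rewrite H0. reflexivity.
    + apply (ssrbool.introT ssrnat.ltP). lia.
  - rewrite sum1_scal_r. simpl pow. apply Rmult_le_compat_r; [apply pow_le, pos_INR|].
    apply sum_dvdb_le; auto.
Qed.

Lemma gbinom_ge0 A k : 0 < A -> 0 <= gbinom A k.
Proof.
  intros HA. unfold gbinom. apply Rmult_le_pos.
  - generalize (seq 0 k). induction l as [|j l IH]; simpl; [lra|].
    apply Rmult_le_pos; auto. generalize (pos_INR j). lra.
  - left. apply Rinv_0_lt_compat, INR_fact_lt_0.
Qed.

Lemma bernoulli_pow_le x k : 0 <= x -> 1 + INR k * x <= (1 + x) ^ k.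
Proof.
  intros Hx. induction k as [|k IH]; [simpl; lra|].
  rewrite S_INR. simpl. assert (0 <= INR k) by apply pos_INR. nra.
Qed.

(** Passing from k to k + 1 multiplies the left side by (A + k) / (k + 1), which by Bernoulli is at
    most the factor (1 + 1 / (k + 1))^m gained on the right. *)
Lemma gbinom_le A k m : 0 < A -> A <= INR m -> gbinom A k <= INR (S k) ^ m.
Proof.
  intros HA Hm. induction k as [|k IH].
  - unfold gbinom. simpl. rewrite pow1. lra.
  - assert (E : gbinom A (S k) = gbinom A k * ((A + INR k) / INR (S k))).
    { unfold gbinom. rewrite seq_S, map_app, fold_right_app. simpl map. simpl fold_right.
      change (fact (S k)) with (S k * fact k)%nat. rewrite mult_INR.
      assert (H : forall l c, fold_right Rmult c l = fold_right Rmult 1 l * c).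
      { induction l; intros c; simpl; [ring|rewrite IHl; ring]. }
      rewrite H. rewrite Rmult_1_r. simpl (0 + k)%nat.
      field. split; [apply not_0_INR; lia|apply INR_fact_neq_0]. }
    rewrite E.
    assert (k0 : 0 < INR (S k)) by (apply lt_0_INR; lia).
    assert (k1 : INR (S k) = INR k + 1) by apply S_INR.
    assert (kp : 0 <= INR k) by apply pos_INR.
    replace (INR (S (S k)) ^ m) with (INR (S k) ^ m * (1 + / INR (S k)) ^ m).
    2:{ rewrite <- Rpow_mult_distr. f_equal. rewrite (S_INR (S k)). field. lra. }
    apply Rmult_le_compat; auto.
    + apply gbinom_ge0; auto.
    + apply Rmult_le_pos; [lra|left; apply Rinv_0_lt_compat; auto].
    + eapply Rle_trans; [|apply bernoulli_pow_le; left; apply Rinv_0_lt_compat; auto].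
      apply Rmult_le_reg_r with (INR (S k)); auto.
      unfold Rdiv. rewrite Rmult_assoc, Rinv_l, Rmult_1_r by lra.
      rewrite Rmult_plus_distr_r, Rmult_assoc, Rinv_l by lra. lra.
Qed.

Lemma dA_le_ndiv_pow A m n : 0 < A -> A <= INR m -> (1 <= n)%nat ->
  0 <= dA A n <= INR (ndiv n) ^ m.
Proof.
  intros HA Hm Hn.
  rewrite <- (@prod_vp_le_ndiv n) by (apply (ssrbool.introT ssrnat.ltP); lia).
  unfold dA. change (ssrnat.subn n 1) with (n - 1)%nat. generalize (seq 2 (n - 1)).
  induction l as [|p l [IH1 IH2]]; [simpl; rewrite pow1; lra|].
  simpl map. simpl fold_right. rewrite mult_INR, Rpow_mult_distr.
  assert (0 <= (if primeb p then gbinom A (vp p n) else 1)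
     <= INR (if primeb p then S (vp p n) else 1%nat) ^ m).
  { destruct (primeb p).
    - split; [apply gbinom_ge0|apply gbinom_le]; auto.
    - simpl. rewrite pow1. lra. }
  split; [apply Rmult_le_pos; lra|apply Rmult_le_compat; lra].
Qed.

(** * Lattice points near a line of slope exp (2 pi nu) *)

Definition nearb (z t : R) (l : nat) : R := if Rle_dec (Rabs (INR l - z)) t then 1 else 0.

Lemma nearb_bounds z t l : 0 <= nearb z t l <= 1.
Proof. unfold nearb. destruct (Rle_dec _ _); lra. Qed.

Lemma count_near_le (z t : R) (X : nat) : 0 <= t -> sum1 (nearb z t) X <= 2 * t + 1.
Proof.
  intros Ht.
  (* The stronger bound measures only the part of the interval already passed, which lets the
     induction close. *)
  assert (H : sum1 (nearb z t) X <= Rmax 0 (Rmin (INR X) (z + t) - (z - t) + 1)).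
  { induction X as [|X IH]; [simpl; apply Rmax_l|].
    change (sum1 (nearb z t) (S X)) with (sum1 (nearb z t) X + nearb z t (S X)).
    unfold nearb at 2. rewrite S_INR.
    destruct (Rle_dec (Rabs (INR X + 1 - z)) t) as [Hle|_].
    - apply Rabs_le_between in Hle.
      rewrite Rmin_left in IH by lra. rewrite Rmin_left by lra.
      rewrite Rmax_right in IH by lra. rewrite Rmax_right by lra. lra.
    - rewrite Rplus_0_r. eapply Rle_trans; [apply IH|].
      apply Rmax_le_compat; [lra|].
      assert (Rmin (INR X) (z + t) <= Rmin (INR X + 1) (z + t)).
      { apply Rmin_glb; [|apply Rmin_r]. eapply Rle_trans; [apply Rmin_l|lra]. }
      lra. }
  eapply Rle_trans; [apply H|]. apply Rmax_lub; [lra|].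
  assert (Rmin (INR X) (z + t) <= z + t) by apply Rmin_r. lra.
Qed.

Lemma sum1_at_most_one (f : nat -> R) (c : R) (M : nat) :
  0 <= c -> (forall i, (1 <= i <= M)%nat -> 0 <= f i <= c) ->
  (forall i j, (1 <= i)%nat -> (i < j <= M)%nat -> f i = 0 \/ f j = 0) -> sum1 f M <= c.
Proof.
  intros Hc. induction M as [|M IH]; intros Hf H1; [simpl; lra|].
  change (sum1 f (S M)) with (sum1 f M + f (S M)).
  destruct (Req_dec (f (S M)) 0) as [->|Hne].
  - rewrite Rplus_0_r. apply IH; intros; [apply Hf | apply H1]; lia.
  - rewrite (sum1_ext f (fun _ => 0)).
    + rewrite sum1_zero, Rplus_0_l. apply Hf. lia.
    + intros k Hk. destruct (H1 k (S M)); try lia; tauto.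
Qed.

(** If Q > V then (Q / V)^p >= 1. Large values of a divisor weight are thus charged to a higher
    moment, divided by a power of the truncation level that can be chosen freely. *)
Lemma truncation_le (Q V : R) (p : nat) : 0 <= Q -> 0 < V -> Q <= V + Q ^ S p / V ^ p.
Proof.
  intros HQ HV.
  assert (0 < V ^ p) by (apply pow_lt; auto).
  assert (P : 0 <= Q ^ S p / V ^ p).
  { apply Rmult_le_pos; [apply pow_le; auto|left; apply Rinv_0_lt_compat; auto]. }
  destruct (Rle_dec Q V) as [H1|H1]; [lra|].
  assert (V ^ p <= Q ^ p) by (apply pow_incr; lra).
  assert (Q <= Q ^ S p / V ^ p); [|lra].
  apply Rmult_le_reg_r with (V ^ p); auto.
  unfold Rdiv. rewrite Rmult_assoc, Rinv_l, Rmult_1_r by lra. simpl. nra.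
Qed.

Section LatticeSum.
Variables (y tau : R) (X : nat).
Hypothesis y1 : 1 <= y.
Hypothesis tau0 : 0 <= tau.
Hypothesis tauy : tau <= sqrt y.
Hypothesis X1 : (1 <= X)%nat.

(** Near the line [l] is about [k y], so the weight is about 1 / sqrt (k l), the size of a term of
    the double sum. *)
Definition lattice_weight (k l : nat) : R := nearb (INR k * y) tau l / (INR k * sqrt y).

Let sy1 : 1 <= sqrt y.
Proof. rewrite <- sqrt_1. apply sqrt_le_1; lra. Qed.
Let syy : sqrt y * sqrt y = y.
Proof. apply sqrt_sqrt; lra. Qed.
Let LX := 1 + ln (INR X).

Let wpos k l : (1 <= k)%nat -> 0 <= lattice_weight k l.
Proof.
  intros Hk. unfold lattice_weight. apply Rmult_le_pos; [apply nearb_bounds|].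
  left. apply Rinv_0_lt_compat, Rmult_lt_0_compat; [apply lt_0_INR; lia|lra].
Qed.

Lemma lattice_weight_sum_trivial :
  sum1 (fun k => sum1 (fun l => lattice_weight k l) X) X
  <= (1 + ln (INR X)) * ((2 * tau + 1) / sqrt y).
Proof.
  fold LX. apply Rle_trans with (sum1 (fun k => / INR k * ((2 * tau + 1) / sqrt y)) X).
  - apply sum1_le. intros k Hk.
    assert (k0 : 0 < INR k) by (apply lt_0_INR; lia).
    unfold lattice_weight, Rdiv. rewrite sum1_scal_r, Rinv_mult.
    apply Rle_trans with ((2 * tau + 1) * (/ INR k * / sqrt y)); [|right; ring].
    apply Rmult_le_compat_r.
    + apply Rmult_le_pos; left; apply Rinv_0_lt_compat; lra.
    + apply count_near_le; auto.
  - rewrite sum1_scal_r. apply Rmult_le_compat_r.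
    + apply Rmult_le_pos; [lra|left; apply Rinv_0_lt_compat; lra].
    + apply harmonic_sum_le; auto.
Qed.

(** The inequality (u v)^n <= u^(2 n) + v^(2 n) separates the weights. For fixed [k] there are
    O(sqrt y) values of [l]. For fixed [l] there are at most three [k], the strip having horizontal
    half-width tau / y <= 1, and l <= 2 k y turns 1 / (k sqrt y) into 2 sqrt y / l. The loss of sqrt
    y is repaid by the truncation level. *)
Lemma lattice_moment_le (n : nat) :
  sum1 (fun k => sum1 (fun l =>
     lattice_weight k l * (INR (ndiv k) * INR (ndiv l)) ^ n) X) X
  <= 9 * sqrt y * (1 + ln (INR X)) ^ (2 ^ (2 * n)).
Proof.
  set (M := sum1 (fun k => INR (ndiv k) ^ (2 * n) / INR k) X).
  assert (HM : M <= (1 + ln (INR X)) ^ (2 ^ (2 * n))) by (apply ndiv_moment_le; auto).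
  assert (M0 : 0 <= M).
  { apply sum1_ge0. intros k Hk. apply Rmult_le_pos; [apply pow_le, pos_INR|].
    left; apply Rinv_0_lt_compat, lt_0_INR; lia. }
  apply Rle_trans with
    (sum1 (fun k => sum1 (fun l => lattice_weight k l * INR (ndiv k) ^ (2 * n)) X) X
     + sum1 (fun k => sum1 (fun l => lattice_weight k l * INR (ndiv l) ^ (2 * n)) X) X).
  { rewrite <- sum1_plus. apply sum1_le. intros k Hk. rewrite <- sum1_plus.
    apply sum1_le. intros l Hl. rewrite <- Rmult_plus_distr_l.
    apply Rmult_le_compat_l; [apply wpos; lia|].
    rewrite Rpow_mult_distr.
    replace (2 * n)%nat with (n + n)%nat by lia. rewrite !pow_add.
    assert (0 <= INR (ndiv k) ^ n) by (apply pow_le, pos_INR).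
    assert (0 <= INR (ndiv l) ^ n) by (apply pow_le, pos_INR). nra. }
  assert (A1 : sum1 (fun k => sum1 (fun l => lattice_weight k l * INR (ndiv k) ^ (2 * n)) X) X
     <= 3 * M).
  { unfold M. rewrite <- sum1_scal. apply sum1_le. intros k Hk.
    assert (k0 : 0 < INR k) by (apply lt_0_INR; lia).
    rewrite sum1_scal_r. unfold lattice_weight, Rdiv. rewrite sum1_scal_r.
    assert (c := count_near_le (INR k * y) tau X tau0).
    assert (p0 : 0 <= INR (ndiv k) ^ (2 * n)) by (apply pow_le, pos_INR).
    apply Rle_trans with ((2 * sqrt y + 1) * / (INR k * sqrt y) * INR (ndiv k) ^ (2 * n)).
    - apply Rmult_le_compat_r; auto. apply Rmult_le_compat_r; [|lra].
      left. apply Rinv_0_lt_compat, Rmult_lt_0_compat; lra.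
    - apply Rle_trans with ((3 * sqrt y) * / (INR k * sqrt y) * INR (ndiv k) ^ (2 * n)).
      + apply Rmult_le_compat_r; auto. apply Rmult_le_compat_r; [|lra].
        left. apply Rinv_0_lt_compat, Rmult_lt_0_compat; lra.
      + right. field. lra. }
  assert (A2 : sum1 (fun k => sum1 (fun l => lattice_weight k l * INR (ndiv l) ^ (2 * n)) X) X
     <= 6 * sqrt y * M).
  { rewrite sum1_swap. unfold M. rewrite <- sum1_scal. apply sum1_le. intros l Hl.
    assert (l0 : 0 < INR l) by (apply lt_0_INR; lia).
    rewrite sum1_scal_r.
    assert (p0 : 0 <= INR (ndiv l) ^ (2 * n)) by (apply pow_le, pos_INR).
    replace (6 * sqrt y * (INR (ndiv l) ^ (2 * n) / INR l))
      with (6 * sqrt y / INR l * INR (ndiv l) ^ (2 * n)) by (field; lra).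
    apply Rmult_le_compat_r; auto.
    apply Rle_trans with (sum1 (fun k => nearb (INR l / y) (tau / y) k * (2 * sqrt y / INR l)) X).
    - apply sum1_le. intros k Hk. unfold lattice_weight, nearb.
      assert (k0 : 1 <= INR k) by (apply (le_INR 1); lia).
      destruct (Rle_dec (Rabs (INR l - INR k * y)) tau) as [Hle|_].
      + destruct (Rle_dec (Rabs (INR k - INR l / y)) (tau / y)) as [_|Hn].
        * apply Rabs_le_between in Hle. unfold Rdiv. rewrite !Rmult_1_l.
          apply Rmult_le_reg_r with (INR k * sqrt y * INR l).
          { repeat apply Rmult_lt_0_compat; lra. }
          replace (/ (INR k * sqrt y) * (INR k * sqrt y * INR l)) with (INR l) by (field; lra).
          replace (2 * sqrt y * / INR l * (INR k * sqrt y * INR l))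
            with (2 * INR k * (sqrt y * sqrt y)) by (field; lra).
          rewrite syy. nra.
        * exfalso. apply Hn.
          replace (INR k - INR l / y) with (- ((INR l - INR k * y) / y)) by (field; lra).
          rewrite Rabs_Ropp. unfold Rdiv. rewrite Rabs_mult, (Rabs_right (/ y)).
          -- apply Rmult_le_compat_r; [left; apply Rinv_0_lt_compat; lra|auto].
          -- left. apply Rinv_0_lt_compat; lra.
      + unfold Rdiv at 1. rewrite Rmult_0_l.
        apply Rmult_le_pos; [destruct (Rle_dec _ _); lra|].
        apply Rmult_le_pos; [lra|left; apply Rinv_0_lt_compat; lra].
    - rewrite sum1_scal_r.
      assert (ty : 0 <= tau / y <= 1).
      { split; [apply Rmult_le_pos; [auto|left; apply Rinv_0_lt_compat; lra]|].
        apply Rmult_le_reg_r with y; [lra|]. unfold Rdiv.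
        rewrite Rmult_assoc, Rinv_l, Rmult_1_r by lra. nra. }
      assert (c := count_near_le (INR l / y) (tau / y) X (proj1 ty)).
      apply Rle_trans with (3 * (2 * sqrt y / INR l)); [|right; field; lra].
      apply Rmult_le_compat_r; [|lra].
      apply Rmult_le_pos; [lra|left; apply Rinv_0_lt_compat; lra]. }
  assert (3 * M + 6 * sqrt y * M <= 9 * sqrt y * M) by nra.
  assert (9 * sqrt y * M <= 9 * sqrt y * (1 + ln (INR X)) ^ (2 ^ (2 * n)))
    by (apply Rmult_le_compat_l; lra).
  lra.
Qed.

Lemma lattice_truncated_le (B p : nat) (V W : R) : 0 < V ->
  sum1 (fun k => sum1 (fun l => lattice_weight k l) X) X <= W ->
  sum1 (fun k => sum1 (fun l => lattice_weight k l * (INR (ndiv k) * INR (ndiv l)) ^ B) X) X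
  <= V * W + 9 * sqrt y * (1 + ln (INR X)) ^ (2 ^ (2 * (B * S p))) / V ^ p.
Proof.
  intros HV HW.
  assert (Vp : 0 < V ^ p) by (apply pow_lt; auto).
  apply Rle_trans with
   (V * sum1 (fun k => sum1 (fun l => lattice_weight k l) X) X +
    sum1 (fun k => sum1 (fun l => lattice_weight k l
       * (INR (ndiv k) * INR (ndiv l)) ^ (B * S p)) X) X * / V ^ p).
  - rewrite <- sum1_scal, <- sum1_scal_r, <- sum1_plus. apply sum1_le. intros k Hk.
    rewrite <- sum1_scal, <- sum1_scal_r, <- sum1_plus. apply sum1_le. intros l Hl.
    assert (w := wpos k l ltac:(lia)).
    assert (Q0 : 0 <= (INR (ndiv k) * INR (ndiv l)) ^ B)
      by (apply pow_le, Rmult_le_pos; apply pos_INR).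
    assert (t := truncation_le _ V p Q0 HV). rewrite <- pow_mult in t.
    unfold Rdiv in t. nra.
  - apply Rplus_le_compat.
    + apply Rmult_le_compat_l; lra.
    + apply Rmult_le_compat_r; [left; apply Rinv_0_lt_compat; auto|].
      apply lattice_moment_le.
Qed.

(* The difference of two lattice points near the line is again near the line, so the
   hypothesis keeps these points apart. *)
Lemma lattice_weight_sum_gap (G : nat) : (1 <= G)%nat -> tau < / 2 ->
  (forall d e : nat, (1 <= d <= G)%nat -> (1 <= e)%nat -> 2 * tau < Rabs (INR e - INR d * y)) ->
  sum1 (fun k => sum1 (fun l => lattice_weight k l) X) X <= 2 * (1 + ln (INR X)) / INR G.
Proof.
  intros HG Ht Hgap.
  assert (G0 : 0 < INR G) by (apply lt_0_INR; lia).
  set (a := fun k => sum1 (nearb (INR k * y) tau) X).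
  assert (a2 : forall k, 0 <= a k <= 2).
  { intros k. split; [apply sum1_ge0; intros; apply nearb_bounds|].
    eapply Rle_trans; [apply count_near_le; auto|lra]. }
  assert (anz : forall k, a k <> 0 -> exists l, (1 <= l)%nat /\ Rabs (INR l - INR k * y) <= tau).
  { intros k Ha. apply Classical_Prop.NNPP. intros Hn. apply Ha. unfold a.
    rewrite (sum1_ext _ (fun _ => 0)); [apply sum1_zero|]. intros l Hl. unfold nearb.
    destruct (Rle_dec _ _); auto. exfalso. apply Hn. exists l. split; auto; lia. }
  assert (afirst : forall k, (1 <= k <= G)%nat -> a k = 0).
  { intros k Hk. apply Classical_Prop.NNPP. intros Hn. destruct (anz k Hn) as [l [Hl1 Hl2]].
    specialize (Hgap k l Hk Hl1). lra. }
  assert (aspace : forall k k', (k < k' <= k + G)%nat -> a k = 0 \/ a k' = 0).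
  { intros k k' Hk. destruct (Req_dec (a k) 0) as [|Hn]; auto.
    destruct (Req_dec (a k') 0) as [|Hn']; auto. exfalso.
    destruct (anz k Hn) as [l [Hl1 Hl2]]. destruct (anz k' Hn') as [l' [Hl1' Hl2']].
    apply Rabs_le_between in Hl2. apply Rabs_le_between in Hl2'.
    assert (d1 : 1 <= INR (k' - k)) by (apply (le_INR 1); lia).
    assert (dE : INR (k' - k) = INR k' - INR k) by (apply minus_INR; lia).
    assert (ll : INR l < INR l') by nra.
    apply INR_lt in ll.
    assert (eE : INR (l' - l) = INR l' - INR l) by (apply minus_INR; lia).
    specialize (Hgap (k' - k)%nat (l' - l)%nat ltac:(lia) ltac:(lia)).
    rewrite dE, eE in Hgap. revert Hgap. apply Rle_not_lt. apply Rabs_le. lra. }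
  assert (E : sum1 (fun k => sum1 (fun l => lattice_weight k l) X) X
      = sum1 (fun k => a k / INR k) X * / sqrt y).
  { rewrite <- sum1_scal_r. apply sum1_ext. intros k Hk.
    assert (0 < INR k) by (apply lt_0_INR; lia).
    unfold lattice_weight, a, Rdiv. rewrite sum1_scal_r, Rinv_mult. ring. }
  rewrite E.
  assert (pos : forall k, (1 <= k)%nat -> 0 <= a k / INR k).
  { intros k Hk. apply Rmult_le_pos; [apply a2|left; apply Rinv_0_lt_compat, lt_0_INR; lia]. }
  (* The range of [k] is cut into blocks of length [G]. The first block contributes nothing, by the
     gap hypothesis for d = k, and each later block has at most one [k] with a nonzero count, so a
     harmonic sum divided by [G] remains. *)
  assert (main : sum1 (fun k => a k / INR k) X <= 2 * (1 + ln (INR X)) / INR G).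
  { apply Rle_trans with (sum1 (fun k => a k / INR k) (S X * G)).
    { apply sum1_le_extend; [nia|]. intros k Hk. apply pos. lia. }
    rewrite sum1_mul_blocks.
    rewrite sum1_recl.
    assert (first : sum1 (fun i => a ((1 - 1) * G + i)%nat / INR ((1 - 1) * G + i)) G = 0).
    { rewrite (sum1_ext _ (fun _ => 0)); [apply sum1_zero|]. intros i Hi.
      simpl. rewrite afirst by lia. unfold Rdiv; ring. }
    rewrite first, Rplus_0_l.
    apply Rle_trans with (sum1 (fun j => / INR j * (2 / INR G)) X).
    - apply sum1_le. intros j Hj. replace (S j - 1)%nat with j by lia.
      assert (j0 : 0 < INR j) by (apply lt_0_INR; lia).
      apply sum1_at_most_one.
      + apply Rmult_le_pos; [left; apply Rinv_0_lt_compat; auto|].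
        apply Rmult_le_pos; [lra|left; apply Rinv_0_lt_compat; auto].
      + intros i Hi. split; [apply pos; nia|].
        replace (/ INR j * (2 / INR G)) with (2 * / (INR j * INR G)) by (field; lra).
        apply Rmult_le_compat; [apply a2| |apply a2|].
        * left; apply Rinv_0_lt_compat, lt_0_INR; nia.
        * apply Rinv_le_contravar; [nra|]. rewrite <- mult_INR. apply le_INR; lia.
      + intros i i' Hi Hi'. destruct (aspace (j * G + i)%nat (j * G + i')%nat ltac:(lia)) as [-> | ->];
          [left|right]; unfold Rdiv; ring.
    - rewrite sum1_scal_r.
      apply Rle_trans with ((1 + ln (INR X)) * (2 / INR G)); [|right; field; lra].
      apply Rmult_le_compat_r; [|apply harmonic_sum_le; auto].
      apply Rmult_le_pos; [lra|left; apply Rinv_0_lt_compat; auto]. }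
  assert (0 <= sum1 (fun k => a k / INR k) X) by (apply sum1_ge0; intros; apply pos; lia).
  assert (/ sqrt y <= 1).
  { rewrite <- Rinv_1. apply Rinv_le_contravar; lra. }
  assert (0 < / sqrt y) by (apply Rinv_0_lt_compat; lra).
  nra.
Qed.
End LatticeSum.

(** * Savings of arbitrary powers of log T in the weighted lattice sum *)

Lemma pow_le_exp_eventually (c e : R) (n : nat) : 0 < e ->
  exists x0, 1 <= x0 /\ forall x, x0 <= x -> c * x ^ n <= exp (e * x).
Proof.
  intros He.
  set (f := INR (fact (S n))). assert (f0 : 0 < f) by apply INR_fact_lt_0.
  assert (e0 : 0 < e ^ S n) by (apply pow_lt; auto).
  exists (Rmax 1 (c * f / e ^ S n)). split; [apply Rmax_l|].
  intros x Hx.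
  assert (x1 : 1 <= x) by (eapply Rle_trans; [apply Rmax_l|apply Hx]).
  assert (x2 : c * f / e ^ S n <= x) by (eapply Rle_trans; [apply Rmax_r|apply Hx]).
  assert (xn : 0 < x ^ n) by (apply pow_lt; lra).
  apply Rle_trans with ((e * x) ^ S n / f).
  - apply Rmult_le_reg_r with f; auto. unfold Rdiv.
    rewrite (Rmult_assoc _ (/ f)), Rinv_l, Rmult_1_r by lra.
    rewrite Rpow_mult_distr. simpl (x ^ S n).
    assert (c * f <= x * e ^ S n).
    { apply Rmult_le_reg_r with (/ e ^ S n); [apply Rinv_0_lt_compat; auto|].
      rewrite (Rmult_assoc x), Rinv_r, Rmult_1_r by lra. exact x2. }
    nra.
  - eapply Rle_trans; [|apply (exp_partial_sum_le (S (S n)))]; [|nra].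
    change (sum0 ?h (S (S n))) with (sum0 h (S n) + h (S n)). cbv beta. fold f.
    assert (0 <= sum0 (fun k => (e * x) ^ k / INR (fact k)) (S n)); [|lra].
    generalize (S n). induction n0; simpl; [lra|].
    assert (0 <= (e * x) ^ n0 / INR (fact n0)); [|lra].
    apply Rmult_le_pos; [apply pow_le; nra|left; apply Rinv_0_lt_compat, INR_fact_lt_0].
Qed.

Lemma ln_pow_le_eventually (c e : R) (n : nat) : 0 < e ->
  exists x0, 1 <= x0 /\ forall x, x0 <= x -> 1 <= ln x /\ c * ln x ^ n <= e * x.
Proof.
  intros He. destruct (pow_le_exp_eventually (c / e) 1 n ltac:(lra)) as [u0 [Hu0 H]].
  exists (exp u0). split; [generalize (exp_ineq1_le u0); lra|].
  intros x Hx.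
  assert (x0 : 0 < x) by (eapply Rlt_le_trans; [apply exp_pos|apply Hx]).
  assert (u : u0 <= ln x).
  { rewrite <- (ln_exp u0). apply ln_le; [apply exp_pos|auto]. }
  split; [lra|].
  specialize (H _ u). rewrite Rmult_1_l, exp_ln in H by auto.
  apply Rmult_le_reg_l with (/ e); [apply Rinv_0_lt_compat; auto|].
  rewrite <- Rmult_assoc, <- (Rmult_assoc (/ e) e), Rinv_l, Rmult_1_l by lra.
  unfold Rdiv in H. lra.
Qed.

Lemma nat_ceil (x : R) : 0 <= x -> exists n : nat, x <= INR n <= x + 1.
Proof.
  intros Hx. exists (Z.to_nat (up x)). destruct (archimed x) as [H1 H2].
  rewrite INR_IZR_INZ, Z2Nat.id; [lra|]. apply le_IZR. lra.
Qed.

(** With z = min (sqrt y, exp (eta L)) the trivial count is O(L / z). Truncating the divisor weights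
    at V = sqrt z leaves O(L / V) from the small weights, and V is at least L^(M + Cn) because y >=
    L^(4 (M + Cn)). *)
Lemma lattice_sum_small_large_y (B Cn P : nat) (eta : R) : 0 < eta <= 1 ->
  exists C1 : nat, exists K L0, 1 <= L0 /\ forall L y tau (X : nat), L0 <= L ->
    L ^ C1 <= y -> y <= exp (4 * L) -> (1 <= X)%nat -> ln (INR X) <= INR P * L ->
    0 <= tau <= exp (- (eta * L)) * sqrt y ->
    sum1 (fun k => sum1 (fun l =>
      lattice_weight y tau k l * (INR (ndiv k) * INR (ndiv l)) ^ B) X) X <= K / L ^ Cn.
Proof.
  intros Heta.
  (* This [p] ensures sqrt y V <= V^p for all y up to exp (4 L). If V^2 = sqrt y it needs p >= 3; if
     V = exp (eta L / 2) it needs eta (p - 1) >= 4. *)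
  destruct (nat_ceil (3 + 4 / eta)) as [p [Hp _]].
  { assert (0 < 4 / eta) by (apply Rdiv_lt_0_compat; lra). lra. }
  assert (p4 : 4 <= eta * (INR p - 1)).
  { replace 4 with (eta * (4 / eta)) by (field; lra). apply Rmult_le_compat_l; lra. }
  assert (p3 : (3 <= p)%nat).
  { apply INR_le. simpl. assert (0 < 4 / eta) by (apply Rdiv_lt_0_compat; lra). lra. }
  set (M := (2 ^ (2 * (B * S p)))%nat).
  assert (M1 : (1 <= M)%nat) by (apply Nat.neq_0_lt_0, Nat.pow_nonzero; lia).
  destruct (pow_le_exp_eventually 1 eta (2 * (M + Cn)) ltac:(lra)) as [L1 [HL1 E1]].
  exists (4 * (M + Cn))%nat, (12 * (1 + INR P) ^ M), L1. split; auto.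
  intros L y tau X HL Hy1 Hy2 HX HlX Htau.
  assert (L1' : 1 <= L) by lra.
  assert (P0 : 0 <= INR P) by apply pos_INR.
  assert (y1 : 1 <= y) by (eapply Rle_trans; [|apply Hy1]; apply pow_R1_Rle; auto).
  assert (sy1 : 1 <= sqrt y) by (rewrite <- sqrt_1; apply sqrt_le_1; lra).
  set (ex := exp (eta * L)).
  assert (ex1 : 1 <= ex) by (unfold ex; generalize (exp_ineq1_le (eta * L)); nra).
  assert (exi : exp (- (eta * L)) = / ex) by (unfold ex; apply exp_Ropp).
  rewrite exi in Htau.
  assert (exi1 : 0 < / ex <= 1).
  { split; [apply Rinv_0_lt_compat; lra|]. rewrite <- Rinv_1. apply Rinv_le_contravar; lra. }
  assert (tauy : tau <= sqrt y) by nra.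
  set (z := Rmin (sqrt y) ex).
  assert (z1 : 1 <= z) by (apply Rmin_glb; auto).
  assert (zy : z <= sqrt y) by apply Rmin_l.
  assert (zx : z <= ex) by apply Rmin_r.
  set (V := sqrt z).
  assert (V1 : 1 <= V) by (unfold V; rewrite <- sqrt_1; apply sqrt_le_1; lra).
  assert (VV : V * V = z) by (apply sqrt_sqrt; lra).
  set (A := (1 + INR P) * L).
  assert (A1 : 1 <= A) by (unfold A; nra).
  assert (lX0 : 0 <= ln (INR X)).
  { rewrite <- ln_1. apply ln_le; [lra|]. apply (le_INR 1); auto. }
  assert (AX : 1 + ln (INR X) <= A) by (unfold A; nra).
  assert (HW : sum1 (fun k => sum1 (fun l => lattice_weight y tau k l) X) X <= 3 * A / z).
  { eapply Rle_trans; [apply lattice_weight_sum_trivial; auto; lra|].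
    apply Rle_trans with (A * (3 / z)); [|right; unfold Rdiv; ring].
    apply Rmult_le_compat; try lra.
    - apply Rmult_le_pos; [lra|left; apply Rinv_0_lt_compat; lra].
    - apply Rle_trans with (2 * / ex + / sqrt y).
      + apply Rmult_le_reg_r with (sqrt y); [lra|]. unfold Rdiv.
        replace ((2 * tau + 1) * / sqrt y * sqrt y) with (2 * tau + 1) by (field; lra).
        replace ((2 * / ex + / sqrt y) * sqrt y) with (2 * (/ ex * sqrt y) + 1) by (field; lra).
        lra.
      + assert (/ ex <= / z) by (apply Rinv_le_contravar; lra).
        assert (/ sqrt y <= / z) by (apply Rinv_le_contravar; lra).
        unfold Rdiv. lra. }
  assert (main := lattice_truncated_le y tau X y1 (proj1 Htau) tauy HX B p V (3 * A / z)
                    ltac:(lra) HW).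
  fold M in main.
  assert (syV : sqrt y * V <= V ^ p).
  { replace p with (S (p - 1)) by lia. simpl pow. rewrite (Rmult_comm (sqrt y)).
    apply Rmult_le_compat_l; [lra|].
    destruct (Rle_dec (sqrt y) ex) as [Hle|Hnle].
    - assert (zE : z = sqrt y) by (apply Rmin_left; auto).
      rewrite <- zE, <- VV. replace (V * V) with (V ^ 2) by ring.
      apply Rle_pow; auto; lia.
    - assert (zE : z = ex) by (apply Rmin_right; lra).
      assert (VE : V = exp (eta * L / 2)).
      { unfold V. rewrite zE. unfold ex. replace (eta * L) with (eta * L / 2 + eta * L / 2) by field.
        rewrite exp_plus. rewrite sqrt_square by (left; apply exp_pos). f_equal. field. }
      rewrite VE, exp_INR_pow.
      apply Rle_trans with (exp (2 * L)).
      + assert (Es : exp (4 * L) = exp (2 * L) * exp (2 * L)) by (rewrite <- exp_plus; f_equal; ring).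
        rewrite <- (sqrt_square (exp (2 * L))) by (left; apply exp_pos).
        apply sqrt_le_1; lra.
      + apply exp_le. rewrite minus_INR by lia. simpl (INR 1). nra. }
  assert (Vbig : L ^ (M + Cn) <= V).
  { unfold V. rewrite <- (sqrt_square (L ^ (M + Cn))) by (apply pow_le; lra).
    assert (LL : 0 <= L ^ (M + Cn)) by (apply pow_le; lra).
    apply sqrt_le_1; [nra|lra|]. unfold z. apply Rmin_glb.
    - rewrite <- (sqrt_square (L ^ (M + Cn) * L ^ (M + Cn))) by nra.
      apply sqrt_le_1; [nra|lra|]. rewrite <- !pow_add.
      eapply Rle_trans; [|apply Hy1]. right. f_equal. lia.
    - rewrite <- pow_add. specialize (E1 L HL). rewrite Rmult_1_l in E1.
      replace (M + Cn + (M + Cn))%nat with (2 * (M + Cn))%nat by lia. exact E1. }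
  eapply Rle_trans; [apply main|].
  assert (AM : A <= A ^ M).
  { rewrite <- (pow_1 A) at 1. apply Rle_pow; auto. }
  assert (AM' : (1 + ln (INR X)) ^ M <= A ^ M) by (apply pow_incr; lra).
  apply Rle_trans with (12 * A ^ M / V).
  - assert (T1 : V * (3 * A / z) = 3 * A / V) by (rewrite <- VV; field; lra).
    rewrite T1.
    assert (Vp : 0 < V ^ p) by (apply pow_lt; lra).
    assert (T2 : 9 * sqrt y * (1 + ln (INR X)) ^ M / V ^ p <= 9 * A ^ M / V).
    { apply Rmult_le_reg_r with (V ^ p * V); [apply Rmult_lt_0_compat; lra|].
      replace (9 * sqrt y * (1 + ln (INR X)) ^ M / V ^ p * (V ^ p * V))
        with (9 * ((1 + ln (INR X)) ^ M * (sqrt y * V))) by (field; lra).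
      replace (9 * A ^ M / V * (V ^ p * V)) with (9 * (A ^ M * V ^ p)) by (field; lra).
      apply Rmult_le_compat_l; [lra|]. apply Rmult_le_compat; auto.
      - apply pow_le; lra.
      - apply Rmult_le_pos; lra. }
    assert (T3 : 3 * A / V <= 3 * A ^ M / V).
    { apply Rmult_le_compat_r; [left; apply Rinv_0_lt_compat; lra|lra]. }
    unfold Rdiv in *. lra.
  - assert (LM : 0 < L ^ M) by (apply pow_lt; lra).
    assert (LC : 0 < L ^ Cn) by (apply pow_lt; lra).
    assert (PM : 0 <= (1 + INR P) ^ M) by (apply pow_le; lra).
    apply Rle_trans with (12 * A ^ M / L ^ (M + Cn)).
    + apply Rmult_le_compat_l; [assert (0 <= A ^ M) by (apply pow_le; lra); lra|].
      apply Rinv_le_contravar; auto. apply pow_lt; lra.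
    + unfold A. rewrite Rpow_mult_distr, pow_add. right. field. lra.
Qed.

(** Both [d] and any relevant [e] are bounded by powers of L, so e / d has height exp m with m of
    size ln L. The gap exp (- m^50) then exceeds the strip width, which is exp (- eta L) up to a
    power of L. *)
Lemma exp_2PI_lattice_gap (C1 g : nat) (eta : R) : 0 < eta <= 1 ->
  exists L0, 1 <= L0 /\ forall L (nu G : nat) tau, L0 <= L -> (1 <= nu)%nat ->
    exp (2 * PI * INR nu) <= L ^ C1 -> INR G <= L ^ g + 1 ->
    0 <= tau <= exp (- (eta * L)) * sqrt (exp (2 * PI * INR nu)) ->
    tau < / 2 /\
    forall d e : nat, (1 <= d <= G)%nat -> (1 <= e)%nat ->
      2 * tau < Rabs (INR e - INR d * exp (2 * PI * INR nu)).
Proof.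
  intros Heta. destruct exp_2PI_irrationality_measure as [m0 Hm0].
  (* The product d y is at most about L^(g + C1). The extra 2 absorbs constants, as L >= 3, and
     keeps [nu + 1] below [m]. *)
  set (c0 := (g + C1 + 2)%nat).
  destruct (ln_pow_le_eventually (INR (c0 + 1) ^ 50) (eta / 2) 50 ltac:(lra)) as [La [HLa Ea]].
  destruct (pow_le_exp_eventually 8 (eta / 2) C1 ltac:(lra)) as [Lb [HLb Eb]].
  exists (Rmax (Rmax La Lb) (Rmax (exp (INR m0)) 3)). split.
  { eapply Rle_trans; [apply HLa|]. eapply Rle_trans; apply Rmax_l. }
  intros L nu G tau HL Hnu Hy HG Htau.
  assert (HLa' : La <= L) by (eapply Rle_trans; [|apply HL]; eapply Rle_trans; [apply Rmax_l|apply Rmax_l]).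
  assert (HLb' : Lb <= L) by (eapply Rle_trans; [|apply HL]; eapply Rle_trans; [apply Rmax_r|apply Rmax_l]).
  assert (HLm : exp (INR m0) <= L) by (eapply Rle_trans; [|apply HL]; eapply Rle_trans; [apply Rmax_l|apply Rmax_r]).
  assert (HL3 : 3 <= L) by (eapply Rle_trans; [|apply HL]; eapply Rle_trans; [apply Rmax_r|apply Rmax_r]).
  destruct (Ea L HLa') as [ln1 Ea']. specialize (Eb L HLb').
  set (y := exp (2 * PI * INR nu)) in *.
  assert (nu1 : 1 <= INR nu) by (apply (le_INR 1); auto).
  assert (pi3 : 3 < PI) by (generalize PI2_3_2; lra).
  assert (y7 : 7 <= y) by (unfold y; generalize (exp_ineq1_le (2 * PI * INR nu)); nra).
  assert (sy : sqrt y <= y).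
  { rewrite <- (sqrt_square y) at 2 by lra. apply sqrt_le_1; nra. }
  assert (sy0 : 0 < sqrt y) by (apply sqrt_lt_R0; lra).
  assert (E0 : 0 < exp (- (eta * L))) by apply exp_pos.
  assert (tb : 2 * tau <= exp (- (eta / 2 * L)) / 4).
  { assert (tau <= exp (- (eta * L)) * L ^ C1) by nra.
    assert (Es : exp (- (eta * L)) * exp (eta / 2 * L) = exp (- (eta / 2 * L)))
      by (rewrite <- exp_plus; f_equal; field).
    rewrite <- Es. nra. }
  assert (eh : exp (- (eta / 2 * L)) <= 1).
  { rewrite <- exp_0. apply exp_le. nra. }
  split; [lra|].
  intros d e Hd He. apply Rnot_le_lt. intros Hle.
  set (lL := ln L) in *.
  assert (LE : L = exp lL) by (unfold lL; rewrite exp_ln; lra).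
  destruct (nat_ceil (INR c0 * lL)) as [m [Hm1 Hm2]].
  { apply Rmult_le_pos; [apply pos_INR|lra]. }
  assert (d1 : 1 <= INR d) by (apply (le_INR 1); lia).
  assert (dG : INR d <= L ^ g + 1) by (eapply Rle_trans; [apply le_INR|apply HG]; lia).
  apply Rabs_le_between in Hle.
  assert (Lg : 1 <= L ^ g) by (apply pow_R1_Rle; lra).
  assert (LC : 1 <= L ^ C1) by (apply pow_R1_Rle; lra).
  assert (big : L ^ c0 <= exp (INR m)).
  { rewrite LE, exp_INR_pow. apply exp_le. lra. }
  assert (Ec0 : L ^ c0 = L ^ g * L ^ C1 * (L * L)) by (unfold c0; rewrite !pow_add; simpl; ring).
  assert (gc : 1 <= L ^ g * L ^ C1) by nra.
  assert (c0big : 9 * (L ^ g * L ^ C1) <= L ^ c0) by (rewrite Ec0; assert (9 <= L * L) by nra; rewrite Rmult_comm; apply Rmult_le_compat_l; lra).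
  assert (eb : INR e <= exp (INR m)).
  { eapply Rle_trans; [|apply big]. eapply Rle_trans; [|apply c0big]. nra. }
  assert (db : INR d <= exp (INR m)).
  { eapply Rle_trans; [|apply big]. eapply Rle_trans; [|apply c0big]. nra. }
  assert (m0m : (m0 <= m)%nat).
  { apply INR_le. assert (INR m0 <= lL).
    { unfold lL. rewrite <- (ln_exp (INR m0)). apply ln_le; [apply exp_pos|auto]. }
    assert (1 <= INR c0) by (apply (le_INR 1); unfold c0; lia). nra. }
  assert (num : (nu + 1 <= m)%nat).
  { apply INR_le. rewrite plus_INR. simpl (INR 1).
    assert (2 * PI * INR nu <= INR C1 * lL).
    { rewrite <- (ln_exp (2 * PI * INR nu)). fold y.
      rewrite <- (ln_exp (INR C1 * lL)). apply ln_le; [lra|].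
      rewrite <- exp_INR_pow, <- LE. exact Hy. }
    assert (INR c0 = INR g + INR C1 + 2) by (unfold c0; rewrite !plus_INR; simpl; ring).
    assert (0 <= INR g) by apply pos_INR. assert (0 <= INR C1) by apply pos_INR.
    nra. }
  assert (key := Hm0 m nu e d m0m Hnu num He (proj1 Hd) eb db). fold y in key.
  assert (Rabs (y - INR e / INR d) <= 2 * tau).
  { replace (y - INR e / INR d) with (- ((INR e - INR d * y) / INR d)) by (field; lra).
    rewrite Rabs_Ropp. unfold Rdiv. rewrite Rabs_mult, (Rabs_right (/ INR d)).
    - assert (Rabs (INR e - INR d * y) <= 2 * tau) by (apply Rabs_le; lra).
      assert (0 < / INR d <= 1).
      { split; [apply Rinv_0_lt_compat; lra|]. rewrite <- Rinv_1. apply Rinv_le_contravar; lra. }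
      generalize (Rabs_pos (INR e - INR d * y)). nra.
    - left. apply Rinv_0_lt_compat; lra. }
  assert (mb : INR m ^ 50 <= eta / 2 * L).
  { eapply Rle_trans; [|apply Ea']. rewrite <- Rpow_mult_distr. apply pow_incr.
    split; [apply pos_INR|]. rewrite plus_INR. simpl (INR 1). nra. }
  assert (exp (- (eta / 2 * L)) <= exp (- INR m ^ 50)) by (apply exp_le; lra).
  assert (0 < exp (- (eta / 2 * L))) by apply exp_pos.
  lra.
Qed.

Lemma lattice_sum_small (B Cn P : nat) (eta : R) : 0 < eta <= 1 ->
  exists K L0, 1 <= L0 /\ forall L (nu X : nat) tau, L0 <= L -> (1 <= nu)%nat ->
    exp (2 * PI * INR nu) <= exp (4 * L) -> (1 <= X)%nat -> ln (INR X) <= INR P * L ->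
    0 <= tau <= exp (- (eta * L)) * sqrt (exp (2 * PI * INR nu)) ->
    sum1 (fun k => sum1 (fun l => lattice_weight (exp (2 * PI * INR nu)) tau k l
       * (INR (ndiv k) * INR (ndiv l)) ^ B) X) X <= K / L ^ Cn.
Proof.
  intros Heta.
  destruct (lattice_sum_small_large_y B Cn P eta Heta) as [C1 [K1 [L1 [HL1 H1]]]].
  set (M := (2 ^ (2 * (B * 2)))%nat).
  (* Truncation at L^v brings the second moment term, of size L^(C1 + M), down to L^(-Cn). The block
     length L^g pays for the truncation level, for the logarithm of the harmonic sum and for the
     same saving. *)
  set (v := (C1 + M + Cn)%nat).
  set (g := (v + 1 + Cn)%nat).
  destruct (exp_2PI_lattice_gap C1 g eta Heta) as [L2 [HL2 H2]].
  set (K2 := 2 * (1 + INR P) + 9 * (1 + INR P) ^ M).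
  exists (Rmax K1 K2), (Rmax L1 L2). split; [eapply Rle_trans; [apply HL1|apply Rmax_l]|].
  intros L nu X tau HL Hnu Hy HX HlX Htau.
  assert (HL1' : L1 <= L) by (eapply Rle_trans; [apply Rmax_l|apply HL]).
  assert (HL2' : L2 <= L) by (eapply Rle_trans; [apply Rmax_r|apply HL]).
  assert (L1' : 1 <= L) by lra.
  assert (LC0 : 0 < L ^ Cn) by (apply pow_lt; lra).
  set (y := exp (2 * PI * INR nu)) in *.
  destruct (Rle_dec (L ^ C1) y) as [Hbig|Hsmall].
  { apply Rle_trans with (K1 / L ^ Cn).
    - apply H1; auto.
    - apply Rmult_le_compat_r; [left; apply Rinv_0_lt_compat; auto|apply Rmax_l]. }
  apply Rnot_le_lt in Hsmall.
  assert (P0 : 0 <= INR P) by apply pos_INR.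
  assert (nu1 : 1 <= INR nu) by (apply (le_INR 1); auto).
  assert (pi3 : 3 < PI) by (generalize PI2_3_2; lra).
  assert (y1 : 1 <= y) by (unfold y; generalize (exp_ineq1_le (2 * PI * INR nu)); nra).
  assert (sy : sqrt y <= y).
  { rewrite <- (sqrt_square y) at 2 by lra. apply sqrt_le_1; nra. }
  assert (sy0 : 0 < sqrt y) by (apply sqrt_lt_R0; lra).
  assert (tauy : tau <= sqrt y).
  { assert (exp (- (eta * L)) <= 1) by (rewrite <- exp_0; apply exp_le; nra). nra. }
  destruct (nat_ceil (L ^ g)) as [G [HG1 HG2]]; [apply pow_le; lra|].
  assert (Lg1 : 1 <= L ^ g) by (apply pow_R1_Rle; lra).
  assert (G1 : (1 <= G)%nat) by (apply INR_le; simpl; lra).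
  destruct (H2 L nu G tau HL2' Hnu ltac:(fold y; lra) HG2 Htau) as [t2 gap].
  assert (HW := lattice_weight_sum_gap y tau X y1 (proj1 Htau) HX G G1 t2 gap).
  assert (L0v : 0 < L ^ v) by (apply pow_lt; lra).
  assert (main := lattice_truncated_le y tau X y1 (proj1 Htau) tauy HX B 1 (L ^ v) _ L0v HW).
  fold M in main. rewrite pow_1 in main.
  eapply Rle_trans; [apply main|].
  set (A := (1 + INR P) * L).
  assert (lX0 : 0 <= ln (INR X)).
  { rewrite <- ln_1. apply ln_le; [lra|]. apply (le_INR 1); auto. }
  assert (AX : 1 + ln (INR X) <= A) by (unfold A; nra).
  apply Rle_trans with (K2 / L ^ Cn).
  2:{ apply Rmult_le_compat_r; [left; apply Rinv_0_lt_compat; auto|apply Rmax_r]. }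
  unfold K2, Rdiv. rewrite Rmult_plus_distr_r. apply Rplus_le_compat.
  - apply Rle_trans with (L ^ v * (2 * A * / L ^ g)).
    + apply Rmult_le_compat_l; [lra|]. apply Rmult_le_compat; try lra.
      * left. apply Rinv_0_lt_compat. lra.
      * apply Rinv_le_contravar; lra.
    + unfold g, A. rewrite !pow_add, pow_1. right. field. repeat split; lra.
  - apply Rle_trans with (9 * L ^ C1 * A ^ M * / L ^ v).
    + apply Rmult_le_compat_r; [left; apply Rinv_0_lt_compat; auto|].
      apply Rmult_le_compat; try lra.
      * apply pow_le; lra.
      * apply pow_incr; lra.
    + assert (0 < L ^ C1) by (apply pow_lt; lra). assert (0 < L ^ M) by (apply pow_lt; lra).
      unfold v, A. rewrite !pow_add, Rpow_mult_distr. right. field. repeat split; lra.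
Qed.

(** * Smooth approximation of zeta on the critical line *)

Lemma polar_form (p q : R) : 0 < p ->
  exists r b, 0 < r /\ Rabs q <= r /\ p = r * cos b /\ q = r * sin b.
Proof.
  intros Hp. exists (sqrt (p * p + q * q)), (atan (q / p)).
  assert (P : 0 < p * p + q * q) by nra.
  assert (S0 : 0 < sqrt (p * p + q * q)) by (apply sqrt_lt_R0; auto).
  assert (E : sqrt (1 + (q / p)²) = sqrt (p * p + q * q) / p).
  { replace (1 + (q / p)²) with ((p * p + q * q) / (p * p)) by (unfold Rsqr; field; lra).
    rewrite sqrt_div_alt by nra. rewrite sqrt_square by lra. reflexivity. }
  repeat split; auto.
  - rewrite <- sqrt_Rsqr_abs. apply sqrt_le_1; unfold Rsqr; nra.
  - rewrite cos_atan, E. field. lra.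
  - rewrite sin_atan, E. field. lra.
Qed.

(** The real part of u^(a + i t) exp (i c). Phases 0 and pi / 2 give the real and imaginary parts of
    u^(a - i t), so one real function with a free phase carries the complex computations. *)
Definition osc (t a c u : R) : R := exp (a * ln u) * cos (t * ln u + c).

Lemma osc_le t a c u : Rabs (osc t a c u) <= exp (a * ln u).
Proof.
  unfold osc. rewrite Rabs_mult, Rabs_right by (left; apply exp_pos).
  assert (Rabs (cos (t * ln u + c)) <= 1) by (apply Rabs_le, COS_bound).
  generalize (exp_pos (a * ln u)). nra.
Qed.

Lemma is_derive_osc t a c u : 0 < u ->
  is_derive (osc t a c) u
    (exp ((a - 1) * ln u) * (a * cos (t * ln u + c) - t * sin (t * ln u + c))).
Proof.
  intros Hu. unfold osc. auto_derive; auto.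
  replace ((a - 1) * ln u) with (a * ln u + - ln u) by ring.
  rewrite exp_plus, exp_Ropp, exp_ln by auto. field. lra.
Qed.

Lemma osc_derivative_le t a c u :
  Rabs (exp ((a - 1) * ln u) * (a * cos (t * ln u + c) - t * sin (t * ln u + c)))
  <= (Rabs a + Rabs t) * exp ((a - 1) * ln u).
Proof.
  rewrite Rabs_mult, Rabs_right by (left; apply exp_pos).
  rewrite (Rmult_comm (Rabs a + Rabs t)). apply Rmult_le_compat_l; [left; apply exp_pos|].
  apply cos_sin_combination_le.
Qed.

(** Integrating u^(a + i t) divides by a + 1 + i t = r exp (i b): the modulus divides the amplitude
    and the argument shifts the phase. *)
Lemma osc_antiderivative t a : 0 < a + 1 -> exists r b, 0 < r /\ Rabs t <= r /\
  forall c u, 0 < u -> is_derive (fun v => osc t (a + 1) (c - b) v / r) u (osc t a c u).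
Proof.
  intros Ha. destruct (polar_form (a + 1) t Ha) as [r [b [Hr [Ht [E1 E2]]]]].
  exists r, b. split; [auto|split; [auto|]]. intros c u Hu.
  assert (D := is_derive_osc t (a + 1) (c - b) u Hu).
  apply (is_derive_scal _ _ (/ r)) in D.
  apply is_derive_ext with (fun x => / r * osc t (a + 1) (c - b) x).
  { intros v. unfold Rdiv. apply Rmult_comm. }
  match type of D with is_derive _ _ ?d => replace (osc t a c u) with d; [exact D|] end.
  replace (a + 1 - 1) with a by ring. unfold osc.
  set (z := t * ln u + (c - b)).
  replace (t * ln u + c) with (z + b) by (unfold z; ring).
  rewrite cos_plus. clearbody z. rewrite E1. rewrite E2 at 1. field. lra.
Qed.

Lemma increment_minus_derivative_le (F f df : R -> R) (v M : R) :
  (forall u, v <= u <= v + 1 -> is_derive F u (f u)) ->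
  (forall u, v <= u <= v + 1 -> is_derive f u (df u)) ->
  (forall u, v <= u <= v + 1 -> Rabs (df u) <= M) ->
  forall w, v <= w <= v + 1 -> Rabs (F (v + 1) - F v - f w) <= M.
Proof.
  intros HF Hf Hdf w Hw.
  assert (mvt : forall (g dg : R -> R) a b, v <= a -> b <= v + 1 -> a <= b ->
     (forall u, v <= u <= v + 1 -> is_derive g u (dg u)) ->
     exists z, a <= z <= b /\ g b - g a = dg z * (b - a)).
  { intros g dg a b Ha Hb Hab Hg.
    destruct (MVT_gen g a b dg) as [z [Hz E]].
    - rewrite Rmin_left, Rmax_right by lra. intros x Hx. apply Hg. lra.
    - rewrite Rmin_left, Rmax_right by lra. intros x Hx. apply continuity_pt_filterlim.
      apply (ex_derive_continuous g x). exists (dg x). apply Hg. lra.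
    - rewrite Rmin_left, Rmax_right in Hz by lra. exists z. auto. }
  destruct (mvt F f v (v + 1)) as [z [Hz E]]; try lra; auto.
  rewrite E. replace (f z * (v + 1 - v) - f w) with (f z - f w) by ring.
  assert (M0 : 0 <= M) by (eapply Rle_trans; [apply Rabs_pos|apply (Hdf v); lra]).
  assert (gen : forall a b, v <= a -> b <= v + 1 -> a <= b -> Rabs (f b - f a) <= M).
  { intros a b Ha Hb Hab. destruct (mvt f df a b) as [x [Hx Ex]]; auto.
    rewrite Ex, Rabs_mult, (Rabs_right (b - a)) by lra.
    assert (Rabs (df x) <= M) by (apply Hdf; lra). generalize (Rabs_pos (df x)). nra. }
  destruct (Rle_dec w z).
  - apply gen; lra.
  - rewrite Rabs_minus_sym. apply gen; lra.
Qed.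

(** The sequence c - D v increases, c + D v decreases, and they enclose c and have a common limit;
    this yields the limit and the rate at once. *)
Lemma cv_of_dominated_increments (c v : nat -> R) (D : R) : 0 <= D ->
  (forall n, Rabs (c (S n) - c n) <= D * (v n - v (S n))) ->
  (forall n, 0 <= v n) -> Un_cv v 0 ->
  exists l, Un_cv c l /\ forall n, Rabs (c n - l) <= D * v n.
Proof.
  intros HD Hc Hv Hcv.
  assert (up : Un_growing (fun n => c n - D * v n)).
  { intros n. specialize (Hc n). apply Rabs_le_between in Hc. lra. }
  assert (down : Un_decreasing (fun n => c n + D * v n)).
  { intros n. specialize (Hc n). apply Rabs_le_between in Hc. lra. }
  destruct (growing_cv _ up) as [l Hl].
  { exists (c O + D * v O). intros x [n ->].
    assert (c n + D * v n <= c O + D * v O).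
    { induction n; [lra|]. specialize (down n). lra. }
    assert (0 <= D * v n) by (apply Rmult_le_pos; auto). lra. }
  assert (Dv : Un_cv (fun n => D * v n) 0).
  { rewrite <- (Rmult_0_r D). apply CV_mult; auto.
    intros e He. exists O. intros n _. unfold Rdist. rewrite Rminus_diag, Rabs_R0. auto. }
  assert (Hcl : Un_cv c l).
  { rewrite <- (Rplus_0_r l). eapply Un_cv_ext; [|apply (CV_plus _ _ _ _ Hl Dv)].
    intros n. simpl. ring. }
  exists l. split; auto. intros n. apply Rabs_le. split.
  - assert (H : l <= c n + D * v n); [|lra].
    assert (Hd : Un_cv (fun n => c n + D * v n) l).
    { rewrite <- (Rplus_0_r l). apply (CV_plus _ _ _ _ Hcl Dv). }
    apply (decreasing_ineq _ _ down Hd).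
  - assert (H := growing_ineq _ _ up Hl n). simpl in H. lra.
Qed.

Lemma exp_ln_neg_half u : 0 < u -> exp (-1 / 2 * ln u) = / sqrt u.
Proof.
  intros Hu. assert (S0 : 0 < sqrt u) by (apply sqrt_lt_R0; auto).
  rewrite <- (exp_ln (/ sqrt u)) by (apply Rinv_0_lt_compat; auto).
  f_equal. rewrite ln_Rinv by auto.
  rewrite <- (sqrt_sqrt u) at 1 by lra. rewrite ln_mult by auto. field.
Qed.

Lemma exp_ln_half u : 0 < u -> exp (1 / 2 * ln u) = sqrt u.
Proof.
  intros Hu. assert (S0 : 0 < sqrt u) by (apply sqrt_lt_R0; auto).
  rewrite <- (exp_ln (sqrt u)) by auto. f_equal.
  rewrite <- (sqrt_sqrt u) at 1 by lra. rewrite ln_mult by auto. field.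
Qed.

Definition zsum (t c : R) (N : nat) : R := sum1 (fun n => osc t (-1 / 2) c (INR n)) N.

Lemma inv_sqrt_telescope n : (1 <= n)%nat ->
  exp (-3 / 2 * ln (INR n)) <= 4 * (/ sqrt (INR n) - / sqrt (INR (S n))).
Proof.
  intros Hn. assert (n1 : 1 <= INR n) by (apply (le_INR 1); auto). rewrite S_INR.
  set (x := INR n) in *.
  replace (-3 / 2 * ln x) with (-1 / 2 * ln x + - ln x) by field.
  rewrite exp_plus, exp_Ropp, exp_ln, exp_ln_neg_half by lra.
  set (a := sqrt x). set (b := sqrt (x + 1)).
  assert (a1 : 1 <= a) by (unfold a; rewrite <- sqrt_1; apply sqrt_le_1; lra).
  assert (aa : a * a = x) by (apply sqrt_sqrt; lra).
  assert (bb : b * b = x + 1) by (apply sqrt_sqrt; lra).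
  assert (ab : a <= b) by (apply sqrt_le_1; lra).
  (* Since x >= 1, sqrt (x + 1) is at most 3/2 sqrt x, so (a + b) b is at most 15/4 a^2. This is the
     source of the constant 4. *)
  assert (b32 : b <= 3 / 2 * a) by (apply Rsqr_incr_0_var; unfold Rsqr; nra).
  rewrite <- aa.
  replace (4 * (/ a - / b)) with (4 * ((b * b - a * a) / ((a + b) * (a * b)))) by (field; nra).
  replace (b * b - a * a) with 1 by lra.
  replace (/ a * / (a * a)) with (/ (a * a * a)) by (field; lra).
  unfold Rdiv. rewrite Rmult_1_l.
  replace (4 * / ((a + b) * (a * b))) with (/ ((a + b) * (a * b) / 4)) by (field; nra).
  apply Rinv_le_contravar; [nra|].
  assert ((a + b) * b <= 4 * (a * a)) by nra. nra.
Qed.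

(** First-order Euler summation: the partial sum minus an antiderivative of its terms has increments
    O((1 + |t|) n^(-3/2)), which telescope. The modulus [r] and argument [b] of 1/2 + i t serve all
    phases; the constant [l] depends on [c] and will be identified with a coordinate of zeta. *)
Lemma zsum_asymptotic (t : R) : exists r b, 0 < r /\ Rabs t <= r /\
  forall c, exists l, forall n, (1 <= n)%nat ->
    Rabs (zsum t c n - osc t (1 / 2) (c - b) (INR n) / r - l)
    <= 4 * (1 / 2 + Rabs t) / sqrt (INR n).
Proof.
  destruct (osc_antiderivative t (-1 / 2)) as [r [b [Hr [Ht D]]]]; [lra|].
  exists r, b. split; [auto|split; [auto|]]. intros c.
  replace (-1 / 2 + 1) with (1 / 2) in D by field.
  set (G := fun v => osc t (1 / 2) (c - b) v / r) in *.
  destruct (cv_of_dominated_increments (fun n => zsum t c (S n) - G (INR (S n)))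
     (fun n => / sqrt (INR (S n))) (4 * (1 / 2 + Rabs t))) as [l [_ Hl]].
  - generalize (Rabs_pos t). lra.
  - intros n.
    replace (zsum t c (S (S n))) with (zsum t c (S n) + osc t (-1 / 2) c (INR (S n) + 1))
      by (unfold zsum; rewrite <- (S_INR (S n)); reflexivity).
    rewrite (S_INR (S n)).
    match goal with |- Rabs ?e <= _ => replace e
      with (- (G (INR (S n) + 1) - G (INR (S n)) - osc t (-1 / 2) c (INR (S n) + 1))) by ring end.
    rewrite <- (S_INR (S n)) at 3.
    rewrite Rabs_Ropp.
    assert (n1 : 1 <= INR (S n)) by (apply (le_INR 1); lia).
    apply Rle_trans with ((1 / 2 + Rabs t) * exp (-3 / 2 * ln (INR (S n)))).
    + apply (increment_minus_derivative_le G (osc t (-1 / 2) c)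
        (fun u => exp ((-1 / 2 - 1) * ln u) * (-1 / 2 * cos (t * ln u + c) - t * sin (t * ln u + c))));
        try lra.
      * intros u Hu. apply D. lra.
      * intros u Hu. apply is_derive_osc. lra.
      * intros u Hu. eapply Rle_trans; [apply osc_derivative_le|].
        replace (Rabs (-1 / 2)) with (1 / 2) by (rewrite Rabs_left; lra).
        apply Rmult_le_compat_l; [generalize (Rabs_pos t); lra|].
        apply exp_le. replace (-1 / 2 - 1) with (-3 / 2) by field.
        assert (ln (INR (S n)) <= ln u) by (apply ln_le; lra). lra.
    + assert (T := inv_sqrt_telescope (S n) ltac:(lia)).
      replace (4 * (1 / 2 + Rabs t) * (/ sqrt (INR (S n)) - / sqrt (INR (S (S n)))))
        with ((1 / 2 + Rabs t) * (4 * (/ sqrt (INR (S n)) - / sqrt (INR (S (S n)))))) by ring.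
      apply Rmult_le_compat_l; auto. generalize (Rabs_pos t); lra.
  - intros n. left. apply Rinv_0_lt_compat, sqrt_lt_R0, lt_0_INR. lia.
  - intros e He. destruct (archimed_cor1 (e * e)) as [N [HN1 HN2]]; [nra|].
    exists N. intros n Hn. unfold Rdist. rewrite Rminus_0_r.
    assert (N0 : 0 < INR N) by (apply lt_0_INR; lia).
    assert (nN : INR N <= INR (S n)) by (apply le_INR; lia).
    assert (s0 : 0 < sqrt (INR (S n))) by (apply sqrt_lt_R0; lra).
    rewrite Rabs_right by (left; apply Rinv_0_lt_compat; auto).
    apply Rsqr_incrst_0; [|left; apply Rinv_0_lt_compat; auto|lra].
    unfold Rsqr. rewrite <- Rinv_mult, sqrt_sqrt by lra.
    eapply Rle_lt_trans; [|apply HN1]. apply Rinv_le_contravar; lra.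
  - exists l. intros n Hn. destruct n as [|n]; [lia|]. exact (Hl n).
Qed.

Lemma zsum_phase t c n : zsum t c n = cos c * zsum t 0 n + sin c * zsum t (PI / 2) n.
Proof.
  unfold zsum. rewrite <- !sum1_scal, <- sum1_plus. apply sum1_ext. intros k _.
  unfold osc. rewrite Rplus_0_r, (cos_plus _ c), (cos_plus _ (PI / 2)), cos_PI2, sin_PI2. ring.
Qed.

Definition esum (t c : R) (N : nat) : R :=
  sum1 (fun n => (-1) ^ (n - 1) * osc t (-1 / 2) c (INR n)) N.

(** The alternating sum is the full sum minus twice its even terms, and 2 (2 k)^(-s) = 2^(1 - s)
    k^(-s). On the critical line the factor 2^(1 - s) is sqrt 2 together with a phase shift by t ln
    2. *)
Lemma esum_even t c n :
  esum t c (2 * n) = zsum t c (2 * n) - sqrt 2 * zsum t (c + t * ln 2) n.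
Proof.
  unfold esum, zsum. induction n as [|n IH]; [simpl; ring|].
  replace (2 * S n)%nat with (S (S (2 * n))) by lia.
  change (sum1 ?h (S (S (2 * n)))) with (sum1 h (2 * n) + h (S (2 * n)) + h (S (S (2 * n)))).
  change (sum1 ?h (S n)) with (sum1 h n + h (S n)). cbv beta. rewrite IH.
  replace (S (2 * n) - 1)%nat with (2 * n)%nat by lia.
  replace (S (S (2 * n)) - 1)%nat with (S (2 * n)) by lia.
  rewrite pow_1_even, pow_1_odd.
  assert (n0 : 0 < INR (S n)) by (apply lt_0_INR; lia).
  assert (s20 : 0 < sqrt 2) by (apply sqrt_lt_R0; lra).
  assert (s2 : sqrt 2 * sqrt 2 = 2) by (apply sqrt_sqrt; lra).
  assert (E : 2 * osc t (-1 / 2) c (INR (S (S (2 * n))))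
    = sqrt 2 * osc t (-1 / 2) (c + t * ln 2) (INR (S n))).
  { replace (S (S (2 * n))) with (2 * S n)%nat by lia.
    rewrite mult_INR. change (INR 2) with 2. unfold osc.
    rewrite !exp_ln_neg_half by nra.
    rewrite ln_mult, sqrt_mult by lra.
    replace (t * (ln 2 + ln (INR (S n))) + c) with (t * ln (INR (S n)) + (c + t * ln 2)) by ring.
    assert (0 < sqrt (INR (S n))) by (apply sqrt_lt_R0; auto).
    rewrite <- s2 at 1. field. lra. }
  lra.
Qed.

Lemma Un_cv_even_odd (u : nat -> R) (l : R) (e : nat -> R) :
  Un_cv (fun n => u (2 * n)%nat) l -> Un_cv e 0 ->
  (forall n, Rabs (u (S n) - u n) <= e n) -> Un_cv u l.
Proof.
  intros Hu He Hd eps Heps.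
  destruct (Hu (eps / 2)) as [N1 HN1]; [lra|]. destruct (He (eps / 2)) as [N2 HN2]; [lra|].
  exists (2 * N1 + N2 + 2)%nat. intros n Hn.
  destruct (Nat.Even_or_Odd n) as [[k ->]|[k ->]].
  - assert (Rdist (u (2 * k)%nat) l < eps / 2) by (apply HN1; lia). lra.
  - assert (H1 : Rdist (u (2 * k)%nat) l < eps / 2) by (apply HN1; lia).
    assert (H2 : Rdist (e (2 * k)%nat) 0 < eps / 2) by (apply HN2; lia).
    specialize (Hd (2 * k)%nat). unfold Rdist in *. rewrite Rminus_0_r in H2.
    replace (2 * k + 1)%nat with (S (2 * k)) by lia.
    replace (u (S (2 * k)) - l) with ((u (S (2 * k)) - u (2 * k)%nat) + (u (2 * k)%nat - l)) by ring.
    eapply Rle_lt_trans; [apply Rabs_triang|].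
    assert (e (2 * k)%nat <= Rabs (e (2 * k)%nat)) by apply Rle_abs. lra.
Qed.

Lemma inv_sqrt_cv_0 : Un_cv (fun n => / sqrt (INR (S n))) 0.
Proof.
  intros e He. destruct (archimed_cor1 (e * e)) as [N [HN1 HN2]]; [nra|].
  exists N. intros n Hn. unfold Rdist. rewrite Rminus_0_r.
  assert (N0 : 0 < INR N) by (apply lt_0_INR; lia).
  assert (nN : INR N <= INR (S n)) by (apply le_INR; lia).
  assert (s0 : 0 < sqrt (INR (S n))) by (apply sqrt_lt_R0; lra).
  rewrite Rabs_right by (left; apply Rinv_0_lt_compat; auto).
  apply Rsqr_incrst_0; [|left; apply Rinv_0_lt_compat; auto|lra].
  unfold Rsqr. rewrite <- Rinv_mult, sqrt_sqrt by lra.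
  eapply Rle_lt_trans; [|apply HN1]. apply Rinv_le_contravar; lra.
Qed.

Lemma eta_partial_components t N :
  fst (eta_partial (crit t) N) = esum t 0 N /\
  snd (eta_partial (crit t) N) = esum t (PI / 2) N.
Proof.
  unfold eta_partial, esum.
  assert (H : forall k m,
    fst (Csum (fun n => Cscale ((-1) ^ (n - 1)%nat) (cpow_nat n (Copp (crit t)))) (seq (S m) k))
     = sum1 (fun n => (-1) ^ (m + n - 1) * osc t (-1 / 2) 0 (INR (m + n))) k /\
    snd (Csum (fun n => Cscale ((-1) ^ (n - 1)%nat) (cpow_nat n (Copp (crit t)))) (seq (S m) k))
     = sum1 (fun n => (-1) ^ (m + n - 1) * osc t (-1 / 2) (PI / 2) (INR (m + n))) k).
  { induction k as [|k IH]; intros m; [simpl; auto|].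
    rewrite !sum1_recl. destruct (IH (S m)) as [IH1 IH2].
    change (seq (S m) (S k)) with (S m :: seq (S (S m)) k).
    change (Csum ?f (?x :: ?l)) with (Cadd (f x) (Csum f l)). cbv beta.
    unfold Cadd. simpl fst. simpl snd.
    rewrite IH1, IH2.
    replace (m + 1)%nat with (S m) by lia.
    assert (E1 : Rpower (INR (S m)) (- (1 / 2)) = exp (-1 / 2 * ln (INR (S m)))).
    { unfold Rpower. f_equal. field. }
    change (match m with 0%nat => 1 | S _ => INR m + 1 end) with (INR (S m)).
    rewrite E1. unfold osc.
    rewrite (cos_plus (t * ln (INR (S m))) (PI / 2)), sin_PI2, cos_PI2, Rplus_0_r.
    replace (- t * ln (INR (S m))) with (- (t * ln (INR (S m)))) by ring.
    rewrite cos_neg, sin_neg.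
    replace (m - 0)%nat with (S m - 1)%nat by lia.
    split; f_equal; try ring; apply sum1_ext; intros n _;
      replace (S m + n)%nat with (m + S n)%nat by lia; reflexivity. }
  destruct (H N O) as [H1 H2]. rewrite H1, H2. split; apply sum1_ext; intros; reflexivity.
Qed.

(* [eta (2n) = S (2n) - 2^(1-s) S (n)], where the main terms of [zsum] cancel. *)
Lemma zeta_crit_limit (t : R) : exists r b, 0 < r /\ Rabs t <= r /\
  forall n, (1 <= n)%nat ->
    Rabs (zsum t 0 n - osc t (1 / 2) (0 - b) (INR n) / r - fst (zeta (crit t)))
      <= 4 * (1 / 2 + Rabs t) / sqrt (INR n) /\
    Rabs (zsum t (PI / 2) n - osc t (1 / 2) (PI / 2 - b) (INR n) / r - snd (zeta (crit t)))
      <= 4 * (1 / 2 + Rabs t) / sqrt (INR n).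
Proof.
  destruct (zsum_asymptotic t) as [r [b [Hr [Ht Hz]]]].
  exists r, b. split; [auto|split; [auto|]].
  destruct (Hz 0) as [l0 H0]. destruct (Hz (PI / 2)) as [l1 H1].
  set (D := 4 * (1 / 2 + Rabs t)) in *.
  assert (D0 : 0 <= D) by (unfold D; generalize (Rabs_pos t); lra).
  (* The constant for phase [c] is the real part of (l0 + i l1) exp (- i c), since the sums rotate
     in the same way. *)
  set (lc := fun c => cos c * l0 + sin c * l1).
  assert (osc_phase : forall c u, osc t (1 / 2) (c - b) u
     = cos c * osc t (1 / 2) (0 - b) u + sin c * osc t (1 / 2) (PI / 2 - b) u).
  { intros c u. unfold osc.
    replace (t * ln u + (c - b)) with ((t * ln u - b) + c) by ring.
    replace (t * ln u + (0 - b)) with (t * ln u - b) by ring.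
    replace (t * ln u + (PI / 2 - b)) with ((t * ln u - b) + PI / 2) by ring.
    rewrite (cos_plus _ c), (cos_plus _ (PI / 2)), cos_PI2, sin_PI2. ring. }
  assert (Hc : forall c n, (1 <= n)%nat ->
    Rabs (zsum t c n - osc t (1 / 2) (c - b) (INR n) / r - lc c) <= 2 * D / sqrt (INR n)).
  { intros c n Hn. rewrite zsum_phase, osc_phase. unfold lc.
    specialize (H0 n Hn). specialize (H1 n Hn).
    set (A := zsum t 0 n - osc t (1 / 2) (0 - b) (INR n) / r - l0) in *.
    set (B := zsum t (PI / 2) n - osc t (1 / 2) (PI / 2 - b) (INR n) / r - l1) in *.
    match goal with |- Rabs ?e <= _ => replace e with (cos c * A + sin c * B) by (unfold A, B; field; lra) end.
    eapply Rle_trans; [apply Rabs_triang|]. rewrite !Rabs_mult.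
    assert (Rabs (cos c) <= 1) by (apply Rabs_le, COS_bound).
    assert (Rabs (sin c) <= 1) by (apply Rabs_le, SIN_bound).
    replace (2 * D / sqrt (INR n)) with (D / sqrt (INR n) + D / sqrt (INR n)) by (unfold Rdiv; ring).
    generalize (Rabs_pos A) (Rabs_pos B) (Rabs_pos (cos c)) (Rabs_pos (sin c)). nra. }
  set (tau := t * ln 2).
  set (ec := fun c => lc c - sqrt 2 * lc (c + tau)).
  assert (s20 : 0 < sqrt 2) by (apply sqrt_lt_R0; lra).
  assert (s2 : sqrt 2 * sqrt 2 = 2) by (apply sqrt_sqrt; lra).
  assert (s23 : sqrt 2 <= 2) by nra.
  assert (Hev : forall c, Un_cv (esum t c) (ec c)).
  { intros c.
    apply Un_cv_even_odd with (fun n => / sqrt (INR (S n))).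
    - intros e He.
      destruct (inv_sqrt_cv_0 (e / (6 * D + 1))) as [N HN].
      { apply Rdiv_lt_0_compat; lra. }
      exists (S N). intros n Hn.
      assert (n1 : (1 <= n)%nat) by lia.
      assert (n0 : 0 < INR n) by (apply lt_0_INR; lia).
      specialize (HN (n - 1)%nat ltac:(lia)).
      replace (S (n - 1)) with n in HN by lia.
      unfold Rdist in *. rewrite Rminus_0_r in HN.
      assert (i0 : 0 < / sqrt (INR n)) by (apply Rinv_0_lt_compat, sqrt_lt_R0; auto).
      rewrite Rabs_right in HN by lra.
      rewrite esum_even. fold tau. unfold ec.
      assert (A1 := Hc c (2 * n)%nat ltac:(lia)).
      assert (A2 := Hc (c + tau) n n1).
      assert (M : osc t (1 / 2) (c - b) (INR (2 * n)) = sqrt 2 * osc t (1 / 2) (c + tau - b) (INR n)).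
      { rewrite mult_INR. change (INR 2) with 2. unfold osc. rewrite !exp_ln_half by nra.
        rewrite ln_mult, sqrt_mult by lra.
        replace (t * (ln 2 + ln (INR n)) + (c - b)) with (t * ln (INR n) + (c + tau - b))
          by (unfold tau; ring). ring. }
      rewrite M in A1.
      assert (A3 : 2 * D / sqrt (INR (2 * n)) <= 2 * D / sqrt (INR n)).
      { apply Rmult_le_compat_l; [lra|]. apply Rinv_le_contravar; [apply sqrt_lt_R0; auto|].
        apply sqrt_le_1; try lra; [rewrite mult_INR; simpl; lra|]. apply le_INR; lia. }
      set (P := zsum t c (2 * n) - sqrt 2 * osc t (1 / 2) (c + tau - b) (INR n) / r - lc c) in *.
      set (Q := zsum t (c + tau) n - osc t (1 / 2) (c + tau - b) (INR n) / r - lc (c + tau)) in *.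
      match goal with |- Rabs ?e < _ => replace e with (P - sqrt 2 * Q) by (unfold P, Q; field; lra) end.
      eapply Rle_lt_trans; [apply Rabs_triang|]. rewrite Rabs_Ropp, Rabs_mult, (Rabs_right (sqrt 2)) by lra.
      assert (sqrt 2 * Rabs Q <= 2 * (2 * D / sqrt (INR n))).
      { apply Rmult_le_compat; auto; [lra|apply Rabs_pos]. }
      apply Rle_lt_trans with (6 * D * / sqrt (INR n)); [unfold Rdiv in *; lra|].
      apply Rle_lt_trans with ((6 * D + 1) * / sqrt (INR n)); [nra|].
      apply Rlt_le_trans with ((6 * D + 1) * (e / (6 * D + 1))).
      + apply Rmult_lt_compat_l; lra.
      + right. field. lra.
    - exact inv_sqrt_cv_0.
    - intros n. unfold esum. change (sum1 ?h (S n)) with (sum1 h n + h (S n)). cbv beta.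
      match goal with |- Rabs (?a + ?x - ?a) <= _ => replace (a + x - a) with x by ring end.
      rewrite Rabs_mult, pow_1_abs || idtac.
      rewrite <- RPow_abs, Rabs_Ropp, Rabs_R1, pow1, Rmult_1_l || idtac.
      rewrite Rmult_1_l || idtac.
      eapply Rle_trans; [apply osc_le|]. rewrite exp_ln_neg_half; [lra|].
      apply lt_0_INR; lia. }
  assert (Heta : eta (crit t) = (ec 0, ec (PI / 2))).
  { assert (ex : Cconv (eta_partial (crit t)) (ec 0, ec (PI / 2))).
    { split; simpl.
      - eapply Un_cv_ext; [|apply (Hev 0)]. intros n. symmetry. apply eta_partial_components.
      - eapply Un_cv_ext; [|apply (Hev (PI / 2))]. intros n. symmetry. apply eta_partial_components. }
    unfold eta.
    (* A limit exists by [Hev], so the value picked by [epsilon] is a limit, and uniqueness of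
       limits identifies it. *)
    assert (sp := ClassicalEpsilon.epsilon_spec (inhabits (0, 0)) _ (ex_intro _ _ ex)).
    set (w := ClassicalEpsilon.epsilon (inhabits (0, 0)) (fun l => Cconv (eta_partial (crit t)) l)) in *.
    destruct sp as [S1 S2]. destruct ex as [E1 E2].
    rewrite (surjective_pairing w). f_equal; eapply UL_sequence; eauto. }
  assert (Hzeta : zeta (crit t) = (l0, l1)).
  { unfold zeta. rewrite Heta.
    assert (Hp : cpow_nat 2 (Csub (1, 0) (crit t)) = (sqrt 2 * cos tau, - (sqrt 2 * sin tau))).
    { unfold cpow_nat, Csub, Cadd, Copp, Cscale, crit. simpl fst. simpl snd. change (INR 2) with 2. replace (1 + 1) with 2 by ring.
      replace (0 + - t) with (- t) by ring.
      replace (- t * ln 2) with (- tau) by (unfold tau; ring).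
      rewrite cos_neg, sin_neg.
      assert (Rpower 2 (1 + - (1 / 2)) = sqrt 2) as ->.
      { unfold Rpower. rewrite <- exp_ln_half by lra. f_equal. field. }
      f_equal. ring. }
    rewrite Hp.
    unfold ec, lc. rewrite !cos_plus, !sin_plus, cos_0, sin_0, cos_PI2, sin_PI2.
    unfold Csub, Cadd, Copp, Cinv, Cmul, Cnorm2. simpl fst. simpl snd.
    set (C := cos tau). set (S := sin tau).
    assert (CS : C * C + S * S = 1) by (generalize (sin2_cos2 tau); unfold Rsqr, C, S; lra).
    set (q := sqrt 2) in *.
    (* This is |1 - 2^(1 - s)|^2 >= (sqrt 2 - 1)^2 on the critical line, so the division in the
       definition of [zeta] is by a nonzero number. *)
    assert (N : 0 < (1 + - (q * C)) ^ 2 + (0 + - - (q * S)) ^ 2).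
    { assert (C <= 1) by (apply COS_bound).
      replace ((1 + - (q * C)) ^ 2 + (0 + - - (q * S)) ^ 2)
        with (1 - 2 * (q * C) + q * q * (C * C + S * S)) by ring.
      rewrite CS, s2. assert (q * C <= q) by nra.
      assert (2 * q < 3) by nra. lra. }
    f_equal; field; lra. }
  intros n Hn. rewrite Hzeta. simpl fst. simpl snd. auto.
Qed.

(** * Smoothed cutoffs and repeated averages of partial sums *)

(** The indicator of m <= L averaged [A] times over the shifts 1, ..., H. It is 1 up to L - A H and
    0 beyond L, and its A-th difference is O(H^(-A)). [backavg] is the same averaging applied to
    functions of the end point. *)
Fixpoint cutoff (H A L m : nat) : R :=
  match A with
  | O => if Nat.leb m L then 1 else 0
  | S A' => / INR H * sum1 (fun h => cutoff H A' L (m + h)) H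
  end.

Fixpoint backavg (H A : nat) (g : nat -> R) (L : nat) : R :=
  match A with
  | O => g L
  | S A' => / INR H * sum1 (fun h => backavg H A' g (L - h)) H
  end.

(** Moving the argument forward amounts to moving the end point back. Truncated subtraction may stop
    at 0; the hypothesis [1 <= m] makes both sides agree there. *)
Lemma cutoff_shift H A L m h : (1 <= m)%nat -> cutoff H A L (m + h) = cutoff H A (L - h) m.
Proof.
  revert m. induction A as [|A IH]; intros m Hm; simpl.
  - destruct (Nat.leb_spec (m + h) L), (Nat.leb_spec m (L - h)); auto; lia.
  - f_equal. apply sum1_ext. intros k Hk.
    replace (m + h + k)%nat with ((m + k) + h)%nat by lia. apply IH. lia.
Qed.

Lemma cutoff_bounds H A L m : (1 <= H)%nat -> 0 <= cutoff H A L m <= 1.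
Proof.
  intros HH. assert (H0 : 0 < INR H) by (apply lt_0_INR; lia).
  revert m. induction A as [|A IH]; intros m; simpl.
  - destruct (Nat.leb m L); lra.
  - split.
    + apply Rmult_le_pos; [left; apply Rinv_0_lt_compat; auto|].
      apply sum1_ge0. intros; apply IH.
    + apply Rmult_le_reg_l with (INR H); auto.
      rewrite <- Rmult_assoc, Rinv_r, Rmult_1_l, Rmult_1_r by lra.
      rewrite <- (Rmult_1_r (INR H)), <- sum1_const. apply sum1_le. intros; apply IH.
Qed.

Lemma cutoff_eq0 H A L m : (L < m)%nat -> cutoff H A L m = 0.
Proof.
  revert m. induction A as [|A IH]; intros m Hm; simpl.
  - destruct (Nat.leb_spec m L); auto; lia.
  - rewrite (sum1_ext _ (fun _ => 0)); [rewrite sum1_zero; ring|]. intros; apply IH; lia.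
Qed.

Lemma cutoff_eq1 H A L m : (1 <= H)%nat -> (m + A * H <= L)%nat -> cutoff H A L m = 1.
Proof.
  intros HH. assert (H0 : 0 < INR H) by (apply lt_0_INR; lia).
  revert m. induction A as [|A IH]; intros m Hm; simpl.
  - destruct (Nat.leb_spec m L); auto; lia.
  - rewrite (sum1_ext _ (fun _ => 1)); [rewrite sum1_const; field; lra|].
    intros k Hk. apply IH. simpl in Hm. lia.
Qed.

Lemma backavg_ext H A g g' L : (forall u, g u = g' u) -> backavg H A g L = backavg H A g' L.
Proof.
  intros E. revert L. induction A as [|A IH]; intros L; simpl; auto.
  f_equal. apply sum1_ext. auto.
Qed.

(** Summation by parts in disguise: cancellation in averages of sharp partial sums over nearby end
    points transfers to the smoothed sum. *)
Lemma sum_cutoff_eq_backavg H A L N F : (L <= N)%nat ->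
  sum1 (fun m => cutoff H A L m * F m) N = backavg H A (sum1 F) L.
Proof.
  revert L. induction A as [|A IH]; intros L HL.
  - simpl. rewrite (sum1_extend _ L N HL).
    + apply sum1_ext. intros k Hk. destruct (Nat.leb_spec k L); [ring|lia].
    + intros k Hk. destruct (Nat.leb_spec k L); [lia|ring].
  - simpl. rewrite <- (sum1_ext _ _ H (fun h _ => IH (L - h)%nat ltac:(lia))).
    rewrite <- sum1_scal.
    rewrite (sum1_ext (fun k => / INR H * sum1 (fun m => cutoff H A (L - k) m * F m) N)
       (fun k => sum1 (fun m => / INR H * (cutoff H A (L - k) m * F m)) N))
      by (intros; rewrite sum1_scal; auto).
    rewrite sum1_swap. apply sum1_ext. intros m Hm.
    rewrite <- sum1_scal, <- sum1_scal_r. apply sum1_ext. intros h Hh.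
    rewrite cutoff_shift by lia. ring.
Qed.

Lemma backavg_plus H A g g' L :
  backavg H A (fun u => g u + g' u) L = backavg H A g L + backavg H A g' L.
Proof.
  revert L. induction A as [|A IH]; intros L; simpl; auto.
  rewrite <- Rmult_plus_distr_l, <- sum1_plus. f_equal. apply sum1_ext. auto.
Qed.

Lemma backavg_scal H A c g L : backavg H A (fun u => c * g u) L = c * backavg H A g L.
Proof.
  revert L. induction A as [|A IH]; intros L; simpl; auto.
  rewrite (sum1_ext _ (fun h => c * backavg H A g (L - h))) by auto.
  rewrite sum1_scal. ring.
Qed.

Lemma backavg_abs_le H A g L M : (1 <= H)%nat ->
  (forall u, (L - A * H <= u <= L)%nat -> Rabs (g u) <= M) -> Rabs (backavg H A g L) <= M.
Proof.
  intros HH. assert (H0 : 0 < INR H) by (apply lt_0_INR; lia).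
  revert L. induction A as [|A IH]; intros L Hg; simpl.
  - apply Hg. lia.
  - rewrite Rabs_mult, (Rabs_right (/ INR H)) by (left; apply Rinv_0_lt_compat; auto).
    apply Rmult_le_reg_l with (INR H); auto.
    rewrite <- Rmult_assoc, Rinv_r, Rmult_1_l by lra.
    apply sum1_abs_bound. intros h Hh. apply IH. intros u Hu. apply Hg. simpl. lia.
Qed.

Lemma backavg_shift H A g L k :
  backavg H A g (L - k) = backavg H A (fun u => g (u - k)%nat) L.
Proof.
  revert L. induction A as [|A IH]; intros L; simpl; auto.
  f_equal. apply sum1_ext. intros h _.
  replace (L - k - h)%nat with (L - h - k)%nat by lia. apply IH.
Qed.

Lemma backavg_S H A g L :
  backavg H (S A) g L = backavg H A (fun u => / INR H * sum1 (fun h => g (u - h)%nat) H) L.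
Proof.
  revert L. induction A as [|A IH]; intros L; [reflexivity|].
  change (backavg H (S (S A)) g L) with (/ INR H * sum1 (fun h => backavg H (S A) g (L - h)) H).
  rewrite (sum1_ext _ _ H (fun h _ => IH (L - h)%nat)). reflexivity.
Qed.

Lemma backavg_const H A c L : (1 <= H)%nat -> backavg H A (fun _ => c) L = c.
Proof.
  intros HH. assert (H0 : 0 < INR H) by (apply lt_0_INR; lia).
  revert L. induction A as [|A IH]; intros L; simpl; auto.
  rewrite (sum1_ext _ (fun _ => c)) by auto. rewrite sum1_const. field. lra.
Qed.

Lemma sum1_telescope_back (G : nat -> R) (u N : nat) : (N <= u)%nat ->
  sum1 (fun h => G (u - h + 1)%nat - G (u - h)%nat) N = G u - G (u - N)%nat.
Proof.
  induction N as [|N IH]; intros HN.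
  - simpl. rewrite Nat.sub_0_r. ring.
  - change (sum1 ?f (S N)) with (sum1 f N + f (S N)). cbv beta. rewrite IH by lia.
    replace (u - S N + 1)%nat with (u - N)%nat by lia. ring.
Qed.

(* Each average gains a factor [1 / t] from the antiderivative of the oscillation. *)
Lemma backavg_osc_le (A q : nat) : (1 <= q)%nat -> forall a, 1 / 2 <= a ->
  exists K, 0 <= K /\ forall t c (N L : nat), 1 <= t -> (1 <= N)%nat ->
    ((A + 1) * N <= L <= q * N)%nat ->
    Rabs (backavg N A (fun u => osc t a c (INR u)) L)
      <= K * exp (a * ln (INR N)) * (/ t ^ A + t / INR N).
Proof.
  intros Hq. assert (q1 : 1 <= INR q) by (apply (le_INR 1); auto).
  assert (lq : 0 <= ln (INR q)) by (rewrite <- ln_1; apply ln_le; lra).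
  induction A as [|A IH]; intros a Ha.
  - exists (exp (a * ln (INR q))). split; [left; apply exp_pos|].
    intros t c N L Ht HN HL. simpl.
    assert (N1 : 1 <= INR N) by (apply (le_INR 1); auto).
    assert (L1 : INR N <= INR L) by (apply le_INR; lia).
    eapply Rle_trans; [apply osc_le|].
    apply Rle_trans with (exp (a * ln (INR q)) * exp (a * ln (INR N)) * 1).
    + rewrite Rmult_1_r, <- exp_plus. apply exp_le.
      rewrite <- Rmult_plus_distr_l, <- ln_mult by lra. apply Rmult_le_compat_l; [lra|].
      apply ln_le; [lra|]. rewrite <- mult_INR. apply le_INR; lia.
    + apply Rmult_le_compat_l.
      * left. apply Rmult_lt_0_compat; apply exp_pos.
      * rewrite Rinv_1. assert (0 <= t / INR N); [|lra].
        apply Rmult_le_pos; [lra|left; apply Rinv_0_lt_compat; lra].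
  - destruct (IH (a + 1)) as [K [HK0 HK]]; [lra|].
    set (K2 := (a + 1) * exp (Rabs (a - 1) * ln (INR q))).
    assert (K20 : 0 <= K2) by (apply Rmult_le_pos; [lra|left; apply exp_pos]).
    exists (2 * K + K2). split; [lra|].
    intros t c N L Ht HN HL.
    assert (N1 : 1 <= INR N) by (apply (le_INR 1); auto).
    destruct (osc_antiderivative t a) as [r [b [Hr [Htr D]]]]; [lra|].
    rewrite Rabs_right in Htr by lra.
    set (G := fun v => osc t (a + 1) (c - b) v / r) in *.
    set (E := exp (a * ln (INR N))).
    assert (E0 : 0 < E) by apply exp_pos.
    set (M := K2 * E * (t / INR N)).
    (* The error of replacing a mean over N consecutive integers by the increment of the
       antiderivative [G]. All arguments lie between N and q N, so u^(a - 1) is comparable with N^(a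
       - 1). *)
    set (e := fun u : nat => / INR N * sum1 (fun h => osc t a c (INR (u - h))) N
       - / INR N * (G (INR u) - G (INR (u - N)))).
    assert (He : forall u, (L - A * N <= u <= L)%nat -> Rabs (e u) <= M).
    { intros u Hu. unfold e.
      rewrite <- (sum1_telescope_back (fun k => G (INR k)) u N) by nia.
      rewrite <- Rmult_minus_distr_l, <- sum1_minus, Rabs_mult.
      rewrite (Rabs_right (/ INR N)) by (left; apply Rinv_0_lt_compat; lra).
      apply Rmult_le_reg_l with (INR N); [lra|].
      rewrite <- Rmult_assoc, Rinv_r, Rmult_1_l by lra.
      apply sum1_abs_bound. intros h Hh.
      rewrite plus_INR. change (INR 1) with 1.
      set (x := INR (u - h)).
      assert (xN : INR N <= x) by (apply le_INR; nia).
      assert (xq : x + 1 <= INR q * INR N).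
      { unfold x. rewrite <- S_INR, <- mult_INR. apply le_INR. nia. }
      rewrite Rabs_minus_sym.
      apply (increment_minus_derivative_le G (osc t a c)
        (fun v => exp ((a - 1) * ln v) * (a * cos (t * ln v + c) - t * sin (t * ln v + c)))); try lra.
      - intros v Hv. apply D. lra.
      - intros v Hv. apply is_derive_osc. lra.
      - intros v Hv. eapply Rle_trans; [apply osc_derivative_le|].
        rewrite !Rabs_right by lra. unfold M, K2.
        apply Rle_trans with ((a + 1) * t * exp ((a - 1) * ln v)).
        + apply Rmult_le_compat_r; [left; apply exp_pos|]. nra.
        + assert (B : exp ((a - 1) * ln v) <= exp (Rabs (a - 1) * ln (INR q)) * (E * / INR N)).
          { unfold E. rewrite <- (exp_ln (/ INR N)) by (apply Rinv_0_lt_compat; lra).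
            rewrite ln_Rinv by lra. rewrite <- !exp_plus. apply exp_le.
            assert (l1 : ln (INR N) <= ln v) by (apply ln_le; lra).
            assert (l2 : ln v <= ln (INR q) + ln (INR N)).
            { rewrite <- ln_mult by lra. apply ln_le; lra. }
            assert ((a - 1) * (ln v - ln (INR N)) <= Rabs (a - 1) * ln (INR q)); [|lra].
            apply Rle_trans with (Rabs (a - 1) * (ln v - ln (INR N))).
            - apply Rmult_le_compat_r; [lra|apply Rle_abs].
            - apply Rmult_le_compat_l; [apply Rabs_pos|lra]. }
          replace ((a + 1) * exp (Rabs (a - 1) * ln (INR q)) * E * (t / INR N))
            with ((a + 1) * t * (exp (Rabs (a - 1) * ln (INR q)) * (E * / INR N)))
            by (unfold Rdiv; ring).
          apply Rmult_le_compat_l; [nra|exact B]. }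
    (* One average becomes the difference of the antiderivative at u and u - N, divided by r N. Its
       exponent a + 1 gives back the factor N, so the net gain is 1 / r <= 1 / t. *)
    assert (dec : backavg N (S A) (fun u => osc t a c (INR u)) L
      = / (r * INR N) * backavg N A (fun u => osc t (a + 1) (c - b) (INR u)) L
        + (- / (r * INR N) * backavg N A (fun u => osc t (a + 1) (c - b) (INR u)) (L - N)
           + backavg N A e L)).
    { rewrite backavg_S, backavg_shift, <- !backavg_scal, <- !backavg_plus.
      apply backavg_ext. intros u. unfold e, G. field. lra. }
    rewrite dec.
    assert (A1 := HK t (c - b) N L Ht HN ltac:(nia)).
    assert (A2 := HK t (c - b) N (L - N)%nat Ht HN ltac:(nia)).
    assert (A3 := backavg_abs_le N A e L M HN He).
    assert (t0 : 0 < / t ^ A) by (apply Rinv_0_lt_compat, pow_lt; lra).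
    assert (tN : 0 <= t / INR N).
    { apply Rmult_le_pos; [lra|left; apply Rinv_0_lt_compat; lra]. }
    assert (EN : exp ((a + 1) * ln (INR N)) = E * INR N).
    { unfold E. replace ((a + 1) * ln (INR N)) with (a * ln (INR N) + ln (INR N)) by ring.
      rewrite exp_plus, exp_ln by lra. reflexivity. }
    rewrite EN in A1, A2.
    set (Q := K * (E * INR N) * (/ t ^ A + t / INR N)) in *.
    assert (Q0 : 0 <= Q).
    { eapply Rle_trans; [|apply A1]. apply Rabs_pos. }
    assert (rN : 0 < / (r * INR N) <= / (t * INR N)).
    { split; [apply Rinv_0_lt_compat; nra|]. apply Rinv_le_contravar; nra. }
    eapply Rle_trans; [apply Rabs_triang|].
    eapply Rle_trans; [apply Rplus_le_compat_l, Rabs_triang|].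
    rewrite !Rabs_mult, Rabs_Ropp, (Rabs_right (/ (r * INR N))) by lra.
    assert (S1 : forall w, Rabs w <= Q -> / (r * INR N) * Rabs w <= / (t * INR N) * Q).
    { intros w Hw. apply Rmult_le_compat; auto; [lra|apply Rabs_pos|lra]. }
    apply S1 in A1. apply S1 in A2.
    assert (QE : / (t * INR N) * Q = K * E * (/ t ^ S A + / INR N)).
    { unfold Q. simpl pow. field. repeat split; try lra. apply pow_nonzero; lra. }
    assert (iN : / INR N <= t / INR N).
    { unfold Rdiv. rewrite <- (Rmult_1_l (/ INR N)) at 1.
      apply Rmult_le_compat_r; [left; apply Rinv_0_lt_compat|]; lra. }
    assert (tS : 0 < / t ^ S A) by (apply Rinv_0_lt_compat, pow_lt; lra).
    assert (KE : 0 <= K * E) by (apply Rmult_le_pos; lra).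
    assert (K * E * (/ t ^ S A + / INR N) <= K * E * (/ t ^ S A + t / INR N))
      by (apply Rmult_le_compat_l; lra).
    assert (M <= K2 * E * (/ t ^ S A + t / INR N)).
    { unfold M. apply Rmult_le_compat_l; [apply Rmult_le_pos; lra|lra]. }
    replace ((2 * K + K2) * E * (/ t ^ S A + t / INR N))
      with (K * E * (/ t ^ S A + t / INR N) + (K * E * (/ t ^ S A + t / INR N)
            + K2 * E * (/ t ^ S A + t / INR N))) by ring.
    lra.
Qed.

(** Averaging the asymptotic formula of the partial sums keeps the constant, which is zeta, and
    reduces the oscillating main term from sqrt N / t to sqrt N / t^(A + 1), up to errors O(t / sqrt
    N). Hence N may be any power of t, provided [A] is large. The end point (A + 1) N keeps all
    averaged sums at length N or more. *)
Lemma zeta_smooth_approx (A : nat) : exists K, 0 <= K /\ forall t (N : nat),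
  1 <= t -> (1 <= N)%nat ->
  let L := ((A + 1) * N)%nat in
  Rabs (sum1 (fun m => cutoff N A L m * osc t (-1 / 2) 0 (INR m)) L - fst (zeta (crit t)))
    <= K * (sqrt (INR N) / t ^ S A + t / sqrt (INR N)) /\
  Rabs (sum1 (fun m => cutoff N A L m * osc t (-1 / 2) (PI / 2) (INR m)) L - snd (zeta (crit t)))
    <= K * (sqrt (INR N) / t ^ S A + t / sqrt (INR N)).
Proof.
  destruct (backavg_osc_le A (A + 1) ltac:(lia) (1 / 2) ltac:(lra)) as [K [HK0 HK]].
  exists (K + 6). split; [lra|]. intros t N Ht HN L.
  destruct (zeta_crit_limit t) as [r [b [Hr [Htr Hz]]]].
  rewrite (Rabs_right t) in Htr, Hz by lra.
  assert (N1 : 1 <= INR N) by (apply (le_INR 1); auto).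
  assert (sN : 0 < sqrt (INR N)) by (apply sqrt_lt_R0; lra).
  assert (gen : forall c z, (forall n, (1 <= n)%nat ->
      Rabs (zsum t c n - osc t (1 / 2) (c - b) (INR n) / r - z) <= 4 * (1 / 2 + t) / sqrt (INR n)) ->
    Rabs (sum1 (fun m => cutoff N A L m * osc t (-1 / 2) c (INR m)) L - z)
    <= (K + 6) * (sqrt (INR N) / t ^ S A + t / sqrt (INR N))).
  { intros c z Hcz. rewrite sum_cutoff_eq_backavg by lia.
    set (e := fun u : nat => zsum t c u - osc t (1 / 2) (c - b) (INR u) / r - z).
    assert (dec : backavg N A (sum1 (fun m => osc t (-1 / 2) c (INR m))) L - z
      = / r * backavg N A (fun u => osc t (1 / 2) (c - b) (INR u)) L + backavg N A e L).
    { rewrite <- (backavg_const N A z L HN) at 1.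
      unfold Rminus. rewrite <- (Rmult_1_l (backavg N A (fun _ => z) L)), <- Ropp_mult_distr_l_reverse.
      rewrite <- !backavg_scal, <- !backavg_plus. apply backavg_ext.
      intros u. unfold e, zsum. change (c + - b) with (c - b). field. lra. }
    rewrite dec. eapply Rle_trans; [apply Rabs_triang|].
    assert (B1 := HK t (c - b) N L Ht HN ltac:(unfold L; lia)).
    rewrite exp_ln_half in B1 by lra.
    assert (B2 : Rabs (backavg N A e L) <= 6 * (t / sqrt (INR N))).
    { apply backavg_abs_le; auto. intros u Hu.
      assert (uN : (N <= u)%nat) by (unfold L in Hu; nia).
      eapply Rle_trans; [apply Hcz; lia|].
      apply Rle_trans with (6 * t / sqrt (INR N)); [|unfold Rdiv; lra].
      apply Rmult_le_compat; [lra| |lra|].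
      - left. apply Rinv_0_lt_compat, sqrt_lt_R0, lt_0_INR. lia.
      - apply Rinv_le_contravar; auto. apply sqrt_le_1; try lra; [apply pos_INR|apply le_INR; auto]. }
    rewrite Rabs_mult, (Rabs_right (/ r)) by (left; apply Rinv_0_lt_compat; auto).
    assert (B3 : / r * Rabs (backavg N A (fun u => osc t (1 / 2) (c - b) (INR u)) L)
      <= / t * (K * sqrt (INR N) * (/ t ^ A + t / INR N))).
    { apply Rmult_le_compat; auto; [left; apply Rinv_0_lt_compat; auto|apply Rabs_pos|].
      apply Rinv_le_contravar; lra. }
    assert (E : / t * (K * sqrt (INR N) * (/ t ^ A + t / INR N))
      = K * (sqrt (INR N) / t ^ S A + / sqrt (INR N))).
    { simpl pow. rewrite <- (sqrt_sqrt (INR N)) at 2 by lra.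
      field. repeat split; try lra. apply pow_nonzero; lra. }
    rewrite E in B3.
    assert (i1 : / sqrt (INR N) <= t / sqrt (INR N)).
    { unfold Rdiv. rewrite <- (Rmult_1_l (/ sqrt (INR N))) at 1.
      apply Rmult_le_compat_r; [left; apply Rinv_0_lt_compat|]; lra. }
    assert (p1 : 0 <= sqrt (INR N) / t ^ S A).
    { apply Rmult_le_pos; [lra|left; apply Rinv_0_lt_compat, pow_lt; lra]. }
    assert (p2 : 0 < / sqrt (INR N)) by (apply Rinv_0_lt_compat; auto).
    nra. }
  split; apply gen; intros n Hn; apply Hz; auto.
Qed.

(** * Cosine transforms of smooth functions *)

(** Finite order of smoothness on the half-line beyond [lo], which leaves room for multipliers such
    as 1 / x. In [vanish_on] the derivatives of order below [n] also vanish at both end points: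
    exactly what [n] integrations by parts over [a, b] consume. *)
Fixpoint smooth_on (lo : R) (n : nat) (f : R -> R) : Prop :=
  match n with
  | O => forall x, lo < x -> continuous f x
  | S k => exists f', (forall x, lo < x -> is_derive f x (f' x)) /\ smooth_on lo k f'
  end.

Fixpoint vanish_on (lo a b : R) (n : nat) (f : R -> R) : Prop :=
  match n with
  | O => forall x, lo < x -> continuous f x
  | S k => f a = 0 /\ f b = 0 /\
           exists f', (forall x, lo < x -> is_derive f x (f' x)) /\ vanish_on lo a b k f'
  end.

Lemma is_derive_continuous (f : R -> R) x l : is_derive f x l -> continuous f x.
Proof. intros H. apply (ex_derive_continuous f x). exists l. exact H. Qed.

Lemma smooth_on_continuous lo n f : smooth_on lo n f -> forall x, lo < x -> continuous f x.
Proof.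
  destruct n; simpl; auto. intros [f' [H _]] x Hx. apply is_derive_continuous with (f' x); auto.
Qed.

Lemma vanish_on_continuous lo a b n f : vanish_on lo a b n f -> forall x, lo < x -> continuous f x.
Proof.
  destruct n; simpl; auto.
  intros [_ [_ [f' [H _]]]] x Hx. apply is_derive_continuous with (f' x); auto.
Qed.

Lemma smooth_on_weaken lo n f : smooth_on lo (S n) f -> smooth_on lo n f.
Proof.
  revert f. induction n as [|n IH]; intros f H.
  - simpl. apply (smooth_on_continuous lo 1 f H).
  - destruct H as [f' [H1 H2]]. exists f'. split; auto.
Qed.

Lemma vanish_on_weaken lo a b n f : vanish_on lo a b (S n) f -> vanish_on lo a b n f.
Proof.
  revert f. induction n as [|n IH]; intros f H.
  - simpl. apply (vanish_on_continuous lo a b 1 f H).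
  - destruct H as [Ha [Hb [f' [H1 H2]]]]. repeat split; auto. exists f'. split; auto.
Qed.

Lemma is_derive_Rmult (f g : R -> R) x df dg : is_derive f x df -> is_derive g x dg ->
  is_derive (fun y => f y * g y) x (df * g x + f x * dg).
Proof. intros H1 H2. apply (is_derive_mult f g x df dg H1 H2). intros; apply Rmult_comm. Qed.

Lemma is_derive_Rplus (f g : R -> R) x df dg : is_derive f x df -> is_derive g x dg ->
  is_derive (fun y => f y + g y) x (df + dg).
Proof. intros H1 H2. apply (is_derive_plus f g x df dg H1 H2). Qed.

Lemma continuous_Rmult (f g : R -> R) x : continuous f x -> continuous g x ->
  continuous (fun y => f y * g y) x.
Proof. intros H1 H2. apply (continuous_mult f g x H1 H2). Qed.

Lemma continuous_Rplus (f g : R -> R) x : continuous f x -> continuous g x ->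
  continuous (fun y => f y + g y) x.
Proof. intros H1 H2. apply (continuous_plus f g x H1 H2). Qed.

Lemma smooth_on_plus lo n : forall f g, smooth_on lo n f -> smooth_on lo n g ->
  smooth_on lo n (fun x => f x + g x).
Proof.
  induction n as [|n IH]; intros f g Hf Hg.
  - simpl in *. intros x Hx. apply continuous_Rplus; auto.
  - destruct Hf as [f' [F1 F2]]. destruct Hg as [g' [G1 G2]].
    exists (fun x => f' x + g' x). split; auto. intros x Hx. apply is_derive_Rplus; auto.
Qed.

Lemma vanish_on_plus lo a b n : forall f g, vanish_on lo a b n f -> vanish_on lo a b n g ->
  vanish_on lo a b n (fun x => f x + g x).
Proof.
  induction n as [|n IH]; intros f g Hf Hg.
  - simpl in *. intros x Hx. apply continuous_Rplus; auto.
  - destruct Hf as [Fa [Fb [f' [F1 F2]]]]. destruct Hg as [Ga [Gb [g' [G1 G2]]]].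
    simpl. rewrite Fa, Fb, Ga, Gb. split; [ring|split; [ring|]].
    exists (fun x => f' x + g' x). split; auto. intros x Hx. apply is_derive_Rplus; auto.
Qed.

Lemma smooth_on_mult lo n : forall f g, smooth_on lo n f -> smooth_on lo n g ->
  smooth_on lo n (fun x => f x * g x).
Proof.
  induction n as [|n IH]; intros f g Hf Hg.
  - simpl in *. intros x Hx. apply continuous_Rmult; auto.
  - assert (Hf' := smooth_on_weaken _ _ _ Hf). assert (Hg' := smooth_on_weaken _ _ _ Hg).
    destruct Hf as [f' [F1 F2]]. destruct Hg as [g' [G1 G2]].
    exists (fun x => f' x * g x + f x * g' x). split.
    + intros x Hx. apply is_derive_Rmult; auto.
    + apply smooth_on_plus; apply IH; auto.
Qed.

Lemma vanish_on_mult lo a b n : forall g f, smooth_on lo n g -> vanish_on lo a b n f ->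
  vanish_on lo a b n (fun x => g x * f x).
Proof.
  induction n as [|n IH]; intros g f Hg Hf.
  - simpl in *. intros x Hx. apply continuous_Rmult; auto.
  - assert (Hg' := smooth_on_weaken _ _ _ Hg). assert (Hf' := vanish_on_weaken _ _ _ _ _ Hf).
    destruct Hf as [Fa [Fb [f' [F1 F2]]]]. destruct Hg as [g' [G1 G2]].
    simpl. rewrite Fa, Fb. split; [ring|split; [ring|]].
    exists (fun x => g' x * f x + g x * f' x). split.
    + intros x Hx. apply is_derive_Rmult; auto.
    + apply vanish_on_plus; apply IH; auto.
Qed.

Lemma smooth_on_const lo n c : smooth_on lo n (fun _ => c).
Proof.
  revert c. induction n as [|n IH]; intros c.
  - intros x _. apply continuous_const.
  - exists (fun _ => 0). split; auto. intros x _. apply (is_derive_const c x).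
Qed.

Lemma smooth_on_id lo n : smooth_on lo n (fun x => x).
Proof.
  destruct n.
  - intros x _. apply continuous_id.
  - exists (fun _ => 1). split; [|apply smooth_on_const]. intros x _. apply (is_derive_id x).
Qed.

Lemma smooth_on_pow lo n k : smooth_on lo n (fun x => x ^ k).
Proof.
  induction k as [|k IH]; simpl.
  - apply smooth_on_const.
  - apply (smooth_on_mult lo n (fun x => x)); auto. apply smooth_on_id.
Qed.

Lemma smooth_on_exp lo n c : smooth_on lo n (fun x => exp (c * x)).
Proof.
  induction n as [|n IH].
  - intros x _. apply is_derive_continuous with (c * exp (c * x)). auto_derive; auto; ring.
  - exists (fun x => c * exp (c * x)). split.
    + intros x _. auto_derive; auto; ring.
    + apply (smooth_on_mult lo n (fun _ => c)); auto. apply smooth_on_const.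
Qed.

Lemma smooth_on_inv n : smooth_on 0 n (fun x => / x).
Proof.
  induction n as [|n IH].
  - intros x Hx. apply is_derive_continuous with (- (1) / x ^ 2).
    auto_derive; [lra|field; lra].
  - exists (fun x => -1 * (/ x * / x)). split.
    + intros x Hx. auto_derive; [lra|]. field. lra.
    + apply (smooth_on_mult 0 n (fun _ => -1)); [apply smooth_on_const|].
      apply smooth_on_mult; auto.
Qed.

Lemma vanish_on_power lo a b n h : smooth_on lo n h -> h a = 0 -> h b = 0 ->
  vanish_on lo a b n (fun x => h x ^ n).
Proof.
  intros Hh Ha Hb. revert Hh. induction n as [|n IH]; intros Hh.
  - simpl. intros x _. apply continuous_const.
  - assert (Hh' := smooth_on_weaken _ _ _ Hh). destruct Hh as [h' [H1 H2]].
    simpl. rewrite Ha, Hb. split; [ring|split; [ring|]].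
    exists (fun x => (INR (S n) * h' x) * h x ^ n). split.
    + intros x Hx. specialize (H1 x Hx).
      assert (D := is_derive_pow h (S n) x (h' x) H1). simpl pred in D.
      eapply is_derive_ext; [|replace (INR (S n) * h' x * h x ^ n) with (INR (S n) * h' x * h x ^ n) by ring; exact D].
      intros y. reflexivity.
    + apply vanish_on_mult; auto.
      apply (smooth_on_mult lo n (fun _ => INR (S n))); auto. apply smooth_on_const.
Qed.

Lemma continuous_bounded (f : R -> R) a b : a <= b ->
  (forall x, a <= x <= b -> continuous f x) ->
  exists M, 0 <= M /\ forall x, a <= x <= b -> Rabs (f x) <= M.
Proof.
  intros Hab Hc.
  destruct (continuity_ab_maj (fun x => Rabs (f x)) a b Hab) as [m [Hm _]].
  - intros c Hcab. apply continuity_pt_filterlim.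
    apply (continuous_comp f Rabs); auto. apply continuous_Rabs.
  - exists (Rabs (f m)). split; [apply Rabs_pos|auto].
Qed.

Lemma ex_RInt_cont (f : R -> R) a b : a <= b ->
  (forall x, a <= x <= b -> continuous f x) -> ex_RInt f a b.
Proof.
  intros Hab H. apply (ex_RInt_continuous (V := R_CompleteNormedModule)).
  rewrite Rmin_left, Rmax_right by lra. auto.
Qed.

Lemma RInt_abs_le (f : R -> R) a b M : a <= b ->
  (forall x, a <= x <= b -> continuous f x) ->
  (forall x, a <= x <= b -> Rabs (f x) <= M) -> Rabs (RInt f a b) <= (b - a) * M.
Proof.
  intros Hab Hc HM. apply (abs_RInt_le_const f a b M Hab); auto. apply ex_RInt_cont; auto.
Qed.

Lemma RInt_abs_le_RInt (f g : R -> R) a b : a <= b ->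
  (forall x, a <= x <= b -> continuous f x) -> (forall x, a <= x <= b -> continuous g x) ->
  (forall x, a <= x <= b -> Rabs (f x) <= g x) -> Rabs (RInt f a b) <= RInt g a b.
Proof.
  intros Hab Hf Hg H.
  eapply Rle_trans; [apply (abs_RInt_le f a b Hab); apply ex_RInt_cont; auto|].
  apply RInt_le; auto.
  - apply ex_RInt_cont; auto. intros x Hx. apply (continuous_comp f Rabs); auto. apply continuous_Rabs.
  - apply ex_RInt_cont; auto.
  - intros x Hx. apply H. lra.
Qed.

Lemma RInt_by_parts (f g f' g' : R -> R) a b : a <= b ->
  (forall x, a <= x <= b -> is_derive f x (f' x)) ->
  (forall x, a <= x <= b -> is_derive g x (g' x)) ->
  (forall x, a <= x <= b -> continuous f' x) -> (forall x, a <= x <= b -> continuous g' x) ->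
  f a = 0 -> f b = 0 ->
  RInt (fun x => f x * g' x) a b = - RInt (fun x => f' x * g x) a b.
Proof.
  intros Hab Hf Hg Cf' Cg' Ha Hb.
  assert (Cf : forall x, a <= x <= b -> continuous f x)
    by (intros x Hx; apply is_derive_continuous with (f' x); auto).
  assert (Cg : forall x, a <= x <= b -> continuous g x)
    by (intros x Hx; apply is_derive_continuous with (g' x); auto).
  assert (H : is_RInt (fun x => f' x * g x + f x * g' x) a b (f b * g b - f a * g a)).
  { apply (is_RInt_derive (fun x => f x * g x)); rewrite Rmin_left, Rmax_right by lra.
    - intros x Hx. apply is_derive_Rmult; auto.
    - intros x Hx. apply continuous_Rplus; apply continuous_Rmult; auto. }
  apply (is_RInt_unique (V := R_CompleteNormedModule)) in H. rewrite Ha, Hb in H.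
  assert (P : RInt (fun x => f' x * g x + f x * g' x) a b
     = RInt (fun x => f' x * g x) a b + RInt (fun x => f x * g' x) a b).
  { apply (RInt_plus (V := R_CompleteNormedModule)); apply ex_RInt_cont; auto;
      intros x Hx; apply continuous_Rmult; auto. }
  lra.
Qed.

Lemma cos_second_order z w : Rabs (cos (z + w) - cos z + w * sin z) <= w * w.
Proof.
  assert (mvt : forall (f df : R -> R) a b, (forall x, is_derive f x (df x)) ->
     exists c, Rmin a b <= c <= Rmax a b /\ f b - f a = df c * (b - a)).
  { intros f df a b H. apply MVT_gen; auto.
    intros x _. apply continuity_pt_filterlim. apply is_derive_continuous with (df x); auto. }
  destruct (mvt cos (fun x => - sin x) z (z + w)) as [c [Hc E]].
  { intros x. auto_derive; auto; ring. }
  destruct (mvt sin cos z c) as [d [_ E']].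
  { intros x. auto_derive; auto; ring. }
  replace (cos (z + w) - cos z + w * sin z) with (- w * (sin c - sin z))
    by (rewrite E; ring).
  rewrite E', !Rabs_mult, Rabs_Ropp.
  assert (Rabs (cos d) <= 1) by (apply Rabs_le, COS_bound).
  assert (Rabs (c - z) <= Rabs w).
  { unfold Rmin, Rmax in Hc. destruct (Rle_dec z (z + w)).
    - rewrite !Rabs_right; lra.
    - rewrite (Rabs_left w) by lra. apply Rabs_le. lra. }
  assert (Rabs (cos d) * Rabs (c - z) <= Rabs w).
  { generalize (Rabs_pos (c - z)) (Rabs_pos (cos d)). nra. }
  replace (w * w) with (Rabs w * Rabs w) by (rewrite <- Rabs_mult; apply Rabs_right; nra).
  apply Rmult_le_compat_l; auto. apply Rabs_pos.
Qed.

Lemma is_derive_quadratic (F : R -> R) s l K :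
  (forall h, Rabs (F (s + h) - F s - h * l) <= K * (h * h)) -> is_derive F s l.
Proof.
  intros H. apply is_derive_Reals. intros eps Heps.
  assert (d0 : 0 < eps / (Rabs K + 1)) by (apply Rdiv_lt_0_compat; auto; generalize (Rabs_pos K); lra).
  exists (mkposreal _ d0). intros h Hh Hd. simpl in Hd.
  replace ((F (s + h) - F s) / h - l) with ((F (s + h) - F s - h * l) / h) by (field; auto).
  unfold Rdiv. rewrite Rabs_mult, Rabs_inv.
  assert (h0 : 0 < Rabs h) by (apply Rabs_pos_lt; auto).
  apply Rmult_lt_reg_r with (Rabs h); auto.
  rewrite Rmult_assoc, Rinv_l, Rmult_1_r by lra.
  eapply Rle_lt_trans; [apply H|].
  replace (h * h) with (Rabs h * Rabs h) by (rewrite <- Rabs_mult; apply Rabs_right; nra).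
  rewrite <- Rmult_assoc. apply Rmult_lt_compat_r; auto.
  assert (K1 : K <= Rabs K) by apply Rle_abs.
  apply Rle_lt_trans with (Rabs K * Rabs h); [apply Rmult_le_compat_r; lra|].
  apply Rle_lt_trans with ((Rabs K + 1) * Rabs h); [nra|].
  apply Rlt_le_trans with ((Rabs K + 1) * (eps / (Rabs K + 1))).
  - apply Rmult_lt_compat_l; auto. generalize (Rabs_pos K); lra.
  - right. field. generalize (Rabs_pos K); lra.
Qed.

(** The free phase [c] closes the family under differentiation and integration by parts, which
    exchange cosines and sines. *)
Definition ct (f : R -> R) (c s : R) : R := RInt (fun u => f u * cos (u * s + c)) 1 2.

Lemma continuous_cos_lin s c u : continuous (fun u => cos (u * s + c)) u.
Proof. apply is_derive_continuous with (- (s * sin (u * s + c))). auto_derive; auto; ring. Qed.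

(** Differentiation under the integral sign, through a quadratic remainder: the second-order
    expansion of the cosine is uniform for u <= 2, and [f] is bounded on [1, 2]. *)
Lemma ct_derive (f : R -> R) c s : (forall x, 0 < x -> continuous f x) ->
  is_derive (ct f c) s (ct (fun u => u * f u) (c + PI / 2) s).
Proof.
  intros Hf.
  destruct (continuous_bounded f 1 2) as [M [M0 HM]]; [lra|intros; apply Hf; lra|].
  apply is_derive_quadratic with (4 * M). intros h. unfold ct.
  assert (Cf : forall x, 1 <= x <= 2 -> continuous f x) by (intros; apply Hf; lra).
  assert (C1 : forall c' s' x, 1 <= x <= 2 -> continuous (fun u => f u * cos (u * s' + c')) x).
  { intros. apply continuous_Rmult; auto. apply continuous_cos_lin. }
  assert (C2 : forall c' s' x, 1 <= x <= 2 -> continuous (fun u => u * f u * cos (u * s' + c')) x).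
  { intros. apply continuous_Rmult; [|apply continuous_cos_lin].
    apply continuous_Rmult; auto. apply continuous_id. }
  rewrite <- (RInt_scal (V := R_CompleteNormedModule)) by (apply ex_RInt_cont; [lra|auto]).
  rewrite <- (RInt_minus (V := R_CompleteNormedModule)) by (apply ex_RInt_cont; [lra|auto]).
  rewrite <- (RInt_minus (V := R_CompleteNormedModule)).
  2:{ apply ex_RInt_cont; [lra|]. intros x Hx. apply (continuous_minus (V := R_NormedModule)); auto. }
  2:{ apply ex_RInt_cont; [lra|]. intros x Hx. apply (continuous_scal_r (V := R_NormedModule) h); auto. }
  replace (4 * M * (h * h)) with ((2 - 1) * (4 * M * (h * h))) by ring.
  apply RInt_abs_le; [lra| |].
  - intros x Hx. apply (continuous_minus (V := R_NormedModule)).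
    + apply (continuous_minus (V := R_NormedModule)); auto.
    + apply (continuous_scal_r (V := R_NormedModule) h); auto.
  - intros x Hx.
    change (Rabs (f x * cos (x * (s + h) + c) - f x * cos (x * s + c)
             - h * (x * f x * cos (x * s + (c + PI / 2)))) <= 4 * M * (h * h)).
    replace (cos (x * s + (c + PI / 2))) with (- sin (x * s + c)).
    2:{ replace (x * s + (c + PI / 2)) with ((x * s + c) + PI / 2) by ring.
        rewrite cos_plus, cos_PI2, sin_PI2. ring. }
    replace (x * (s + h) + c) with ((x * s + c) + x * h) by ring.
    set (z := x * s + c).
    replace (f x * cos (z + x * h) - f x * cos z - h * (x * f x * - sin z))
      with (f x * (cos (z + x * h) - cos z + (x * h) * sin z)) by ring.
    rewrite Rabs_mult.
    assert (B := cos_second_order z (x * h)).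
    assert (B2 : x * h * (x * h) <= 4 * (h * h)).
    { replace (x * h * (x * h)) with ((x * x) * (h * h)) by ring.
      apply Rmult_le_compat_r; nra. }
    specialize (HM x Hx). generalize (Rabs_pos (f x)).
    assert (0 <= h * h) by nra.
    generalize (Rabs_pos (cos (z + x * h) - cos z + x * h * sin z)).
    intros P1 P2.
    apply Rle_trans with (M * (4 * (h * h))); [|lra].
    apply Rmult_le_compat; lra.
Qed.

Lemma ct_ext f g c s : (forall u, 1 <= u <= 2 -> f u = g u) -> ct f c s = ct g c s.
Proof.
  intros H. unfold ct. apply RInt_ext. rewrite Rmin_left, Rmax_right by lra.
  intros x Hx. rewrite H by lra. reflexivity.
Qed.

Lemma ct_decay (j : nat) : forall f, vanish_on 0 1 2 j f ->
  exists K, 0 <= K /\ forall c s, Rabs s ^ j * Rabs (ct f c s) <= K.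
Proof.
  induction j as [|j IH]; intros f Hf.
  - destruct (continuous_bounded f 1 2) as [M [M0 HM]]; [lra|intros; apply Hf; lra|].
    exists M. split; auto. intros c s. simpl. rewrite Rmult_1_l.
    replace M with ((2 - 1) * M) by ring. apply RInt_abs_le; [lra| |].
    + intros x Hx. apply continuous_Rmult; [apply Hf; lra|apply continuous_cos_lin].
    + intros x Hx. rewrite Rabs_mult.
      assert (Rabs (cos (x * s + c)) <= 1) by (apply Rabs_le, COS_bound).
      specialize (HM x Hx). generalize (Rabs_pos (f x)). nra.
  - assert (Cf := vanish_on_continuous _ _ _ _ _ Hf).
    destruct Hf as [Fa [Fb [f' [F1 F2]]]].
    destruct (IH f' F2) as [K [K0 HK]]. exists K. split; auto. intros c s.
    assert (E : s * ct f c s = - ct f' (c - PI / 2) s).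
    { unfold ct.
      rewrite <- (RInt_scal (V := R_CompleteNormedModule)).
      2:{ apply ex_RInt_cont; [lra|]. intros x Hx.
          apply continuous_Rmult; [apply Cf; lra|apply continuous_cos_lin]. }
      rewrite (RInt_ext _ (fun u => f u * (s * cos (u * s + c)))).
      2:{ intros x _. change (s * (f x * cos (x * s + c)) = f x * (s * cos (x * s + c)) :> R). ring. }
      rewrite (RInt_by_parts f (fun u => cos (u * s + (c - PI / 2))) f'); auto; try lra.
      - intros x Hx. apply F1. lra.
      - intros x Hx. auto_derive; auto.
        replace (x * s + (c - PI / 2)) with ((x * s + c) - PI / 2) by ring.
        rewrite sin_minus, cos_PI2, sin_PI2. ring.
      - intros x Hx. apply (vanish_on_continuous _ _ _ _ _ F2). lra.
      - intros x Hx. apply (continuous_scal_r (V := R_NormedModule) s). apply continuous_cos_lin. }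
    simpl. rewrite (Rmult_comm (Rabs s)), Rmult_assoc, <- Rabs_mult, E, Rabs_Ropp. apply HK.
Qed.

Definition csupp (f : R -> R) : Prop := forall n, vanish_on 0 1 2 n f.

Lemma continuous_zero_extends (f : R -> R) x : continuous f x ->
  (forall d, 0 < d -> exists y, Rabs (y - x) < d /\ f y = 0) -> f x = 0.
Proof.
  intros Hc H. destruct (Req_dec (f x) 0) as [E|E]; auto. exfalso.
  assert (P : 0 < Rabs (f x)) by (apply Rabs_pos_lt; auto).
  apply continuity_pt_filterlim in Hc. destruct (Hc (Rabs (f x)) P) as [d [d0 Hd]].
  destruct (H d d0) as [y [Hy Fy]].
  destruct (Req_dec x y) as [<-|Ne]; auto.
  assert (Q : Rabs (f y - f x) < Rabs (f x)).
  { apply (Hd y). split; [split; [exact I|auto]|exact Hy]. }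
  rewrite Fy in Q. replace (0 - f x) with (- f x) in Q by ring. rewrite Rabs_Ropp in Q. lra.
Qed.

(** Every derivative of [phi] vanishes on the open complement of [1, 2], and at 1 and 2 by
    continuity. *)
Lemma smooth_csupp phi : smooth phi -> (forall x, x < 1 \/ 2 < x -> phi x = 0) -> csupp phi.
Proof.
  intros [D [D0 HD]] H0.
  assert (HD' : forall k x, is_derive (D k) x (D (S k) x)) by (intros; apply is_derive_Reals; auto).
  assert (Z : forall k x, x < 1 \/ 2 < x -> D k x = 0).
  { induction k as [|k IH]; intros x Hx; [rewrite D0; auto|].
    rewrite <- (is_derive_unique _ _ _ (HD' k x)).
    apply is_derive_unique. apply is_derive_ext_loc with (fun _ => 0).
    2: apply (is_derive_const 0 x).
    destruct Hx as [Hx|Hx].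
    - exists (mkposreal (1 - x) ltac:(lra)). intros y Hy. symmetry. apply IH. left.
      unfold ball in Hy. simpl in Hy. unfold AbsRing_ball, abs, minus, plus, opp in Hy. simpl in Hy.
      apply Rabs_def2 in Hy. lra.
    - exists (mkposreal (x - 2) ltac:(lra)). intros y Hy. symmetry. apply IH. right.
      unfold ball in Hy. simpl in Hy. unfold AbsRing_ball, abs, minus, plus, opp in Hy. simpl in Hy.
      apply Rabs_def2 in Hy. lra. }
  assert (C : forall k x, continuous (D k) x) by (intros; apply is_derive_continuous with (D (S k) x); auto).
  assert (Z1 : forall k, D k 1 = 0 /\ D k 2 = 0).
  { intros k. split; apply continuous_zero_extends; auto; intros d d0.
    - exists (1 - d / 2). split; [|apply Z; lra].
      replace (1 - d / 2 - 1) with (- (d / 2)) by ring. rewrite Rabs_Ropp, Rabs_right; lra.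
    - exists (2 + d / 2). split; [|apply Z; lra].
      replace (2 + d / 2 - 2) with (d / 2) by ring. rewrite Rabs_right; lra. }
  assert (G : forall n k, vanish_on 0 1 2 n (D k)).
  { induction n as [|n IH]; intros k; simpl; auto.
    destruct (Z1 k). repeat split; auto. exists (D (S k)). auto. }
  intros n. rewrite <- D0. apply G.
Qed.

Lemma csupp_mult f g : (forall n, smooth_on 0 n g) -> csupp f -> csupp (fun u => g u * f u).
Proof. intros Hg Hf n. apply vanish_on_mult; auto. Qed.

Lemma csupp_continuous f : csupp f -> forall x, 0 < x -> continuous f x.
Proof. intros H. apply (H O). Qed.

Lemma ct_quadratic_decay f : csupp f ->
  exists K, 0 <= K /\ forall c s, Rabs (ct f c s) <= K / (1 + s * s).
Proof.
  intros Hf. destruct (ct_decay 0 f (Hf _)) as [K1 [P1 H1]].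
  destruct (ct_decay 2 f (Hf _)) as [K2 [P2 H2]].
  exists (K1 + K2). split; [lra|]. intros c s.
  specialize (H1 c s). specialize (H2 c s). simpl in H1, H2.
  apply Rmult_le_reg_r with (1 + s * s); [nra|].
  unfold Rdiv. rewrite Rmult_assoc, Rinv_l by nra.
  replace (Rabs s * (Rabs s * 1)) with (s * s) in H2
    by (rewrite Rmult_1_r, <- Rabs_mult, Rabs_right; nra).
  lra.
Qed.

Lemma ct_scaled_derive f c T s : csupp f ->
  is_derive (fun s => ct f c (T * s)) s (T * ct (fun u => u * f u) (c + PI / 2) (T * s)).
Proof.
  intros Hf. apply (is_derive_comp (ct f c) (fun s => T * s)).
  - apply ct_derive. apply csupp_continuous; auto.
  - auto_derive; auto; ring.
Qed.

Lemma ct_scaled_continuous f c T s : csupp f -> continuous (fun s => ct f c (T * s)) s.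
Proof. intros H. eapply is_derive_continuous. apply ct_scaled_derive; auto. Qed.

(** The Fourier integral at frequency [k] of the summand in n, after the substitution v = z exp s:
    [xi] is k z, and [q] collects the Jacobian and the cutoff. *)
Definition osc_int (q psi : R -> R) (c' c T xi : R) : R :=
  RInt (fun s => q s * (T * ct psi c' (T * s)) * cos (2 * PI * xi * exp s + c)) (-1) 1.

Lemma continuous_cos_exp xi c s : continuous (fun s => cos (2 * PI * xi * exp s + c)) s.
Proof.
  apply is_derive_continuous with (- (2 * PI * xi * exp s * sin (2 * PI * xi * exp s + c))).
  auto_derive; auto; ring.
Qed.

Lemma continuous_osc_weight q psi c' T s : continuous q s -> csupp psi ->
  continuous (fun s => q s * (T * ct psi c' (T * s))) s.
Proof.
  intros Hq Hp. apply continuous_Rmult; auto.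
  apply (continuous_Rmult (fun _ => T)); [apply continuous_const|apply ct_scaled_continuous; auto].
Qed.

(** The kernel T ct (T s) is O(T / (1 + (T s)^2)), whose integral is at most pi for every T. *)
Lemma osc_int_bounded q psi : (forall x, -2 < x -> continuous q x) -> csupp psi ->
  exists K, 0 <= K /\ forall T xi c' c, 1 <= T -> Rabs (osc_int q psi c' c T xi) <= K.
Proof.
  intros Hq Hp.
  destruct (continuous_bounded q (-1) 1) as [M [M0 HM]]; [lra|intros; apply Hq; lra|].
  destruct (ct_quadratic_decay psi Hp) as [K [K0 HK]].
  exists (M * K * PI). split; [generalize PI_RGT_0; intros; apply Rmult_le_pos; nra|].
  intros T xi c' c HT.
  assert (AT : is_RInt (fun s => M * K * (T / (1 + (T * s) * (T * s)))) (-1) 1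
                 (M * K * atan (T * 1) - M * K * atan (T * -1))).
  { apply (is_RInt_derive (fun s => M * K * atan (T * s))).
    - intros x _. auto_derive; auto. simpl. field. nra.
    - intros x _. apply (continuous_Rmult (fun _ => M * K)); [apply continuous_const|].
      eapply is_derive_continuous. auto_derive; [|reflexivity]. nra. }
  assert (IB : RInt (fun s => M * K * (T / (1 + (T * s) * (T * s)))) (-1) 1 <= M * K * PI).
  { rewrite (is_RInt_unique (V := R_CompleteNormedModule) _ _ _ _ AT).
    assert (0 <= M * K) by nra. generalize (atan_bound (T * 1)) (atan_bound (T * -1)). nra. }
  eapply Rle_trans; [|exact IB]. apply RInt_abs_le_RInt; [lra| | |].
  - intros x Hx. apply continuous_Rmult; [|apply continuous_cos_exp].
    apply continuous_osc_weight; auto. apply Hq. lra.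
  - intros x _. apply (continuous_Rmult (fun _ => M * K)); [apply continuous_const|].
    eapply is_derive_continuous. auto_derive; [|reflexivity]. nra.
  - intros x Hx. rewrite !Rabs_mult, (Rabs_right T) by lra.
    specialize (HM x Hx). specialize (HK c' (T * x)).
    assert (B : Rabs (cos (2 * PI * xi * exp x + c)) <= 1) by (apply Rabs_le, COS_bound).
    assert (P := Rabs_pos (ct psi c' (T * x))). assert (P1 := Rabs_pos (q x)).
    assert (P2 := Rabs_pos (cos (2 * PI * xi * exp x + c))).
    apply Rle_trans with (Rabs (q x) * (T * Rabs (ct psi c' (T * x))) * 1).
    { apply Rmult_le_compat_l; auto. apply Rmult_le_pos; auto. nra. }
    rewrite Rmult_1_r.
    replace (M * K * (T / (1 + T * x * (T * x)))) with (M * (T * (K / (1 + T * x * (T * x)))))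
      by (unfold Rdiv; ring).
    apply Rmult_le_compat; auto; nra.
Qed.

(** Integration by parts against exp s cos (2 pi xi exp s): each step gains 1 / xi and loses at most
    a factor T, when the derivative falls on ct (T s). The factor exp (- s) put into [q] compensates
    for the inner derivative. *)
Lemma osc_int_decay j : forall q psi, vanish_on (-2) (-1) 1 j q -> csupp psi ->
  exists K, 0 <= K /\ forall T xi c' c, 1 <= T -> 0 < xi ->
    Rabs (osc_int q psi c' c T xi) <= K * (T / xi) ^ j.
Proof.
  induction j as [|j IH]; intros q psi Hq Hp.
  - destruct (osc_int_bounded q psi Hq Hp) as [K [K0 HK]].
    exists K. split; auto. intros. simpl. rewrite Rmult_1_r. auto.
  - assert (Hq' : vanish_on (-2) (-1) 1 (S j) (fun s => exp (-1 * s) * q s))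
      by (apply vanish_on_mult; auto; apply smooth_on_exp).
    assert (Hq'' := vanish_on_weaken _ _ _ _ _ Hq').
    assert (CQ := vanish_on_continuous _ _ _ _ _ Hq).
    assert (CQ' := vanish_on_continuous _ _ _ _ _ Hq').
    destruct Hq' as [Qa [Qb [q' [Q1 Q2]]]].
    assert (Hu : csupp (fun u => u * psi u))
      by (apply (csupp_mult psi (fun u => u)); auto; intros; apply smooth_on_id).
    destruct (IH q' psi Q2 Hp) as [K1 [P1 H1]].
    destruct (IH _ _ Hq'' Hu) as [K2 [P2 H2]].
    exists (K1 + K2). split; [lra|]. intros T xi c' c HT Hxi.
    assert (PI1 : 1 <= PI) by (generalize PI2_1; lra).
    set (k := 2 * PI * xi).
    assert (k0 : 0 < k) by (unfold k; nra).
    assert (E : k * osc_int q psi c' c T xi =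
      - (osc_int q' psi c' (c - PI / 2) T xi
         + T * osc_int (fun s => exp (-1 * s) * q s) (fun u => u * psi u) (c' + PI / 2) (c - PI / 2) T xi)).
    { unfold osc_int. fold k.
      assert (CC : forall f g c1 c2 x, continuous f x -> csupp g ->
        continuous (fun s => f s * (T * ct g c1 (T * s)) * cos (k * exp s + c2)) x).
      { intros. apply continuous_Rmult; [apply continuous_osc_weight; auto|apply continuous_cos_exp]. }
      rewrite <- (RInt_scal (V := R_CompleteNormedModule)).
      2:{ apply ex_RInt_cont; [lra|]. intros x Hx. apply CC; auto. apply CQ; lra. }
      rewrite <- (RInt_scal (V := R_CompleteNormedModule)).
      2:{ apply ex_RInt_cont; [lra|]. intros x Hx. apply CC; auto. apply CQ'; lra. }
      rewrite <- (RInt_plus (V := R_CompleteNormedModule)).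
      2:{ apply ex_RInt_cont; [lra|]. intros x Hx. apply CC; auto.
          apply (vanish_on_continuous _ _ _ _ _ Q2); lra. }
      2:{ apply ex_RInt_cont; [lra|]. intros x Hx.
          apply (continuous_scal_r (V := R_NormedModule) T). apply CC; auto. apply CQ'; lra. }
      set (f := fun s => exp (-1 * s) * q s * (T * ct psi c' (T * s))).
      set (f' := fun s => q' s * (T * ct psi c' (T * s))
         + exp (-1 * s) * q s * (T * (T * ct (fun u => u * psi u) (c' + PI / 2) (T * s)))).
      rewrite (RInt_ext _ (fun s => f s * (k * exp s * cos (k * exp s + c)))).
      2:{ intros x _. unfold f.
          change (k * (q x * (T * ct psi c' (T * x)) * cos (k * exp x + c)) =
            exp (-1 * x) * q x * (T * ct psi c' (T * x)) * (k * exp x * cos (k * exp x + c)) :> R).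
          replace (-1 * x) with (- x) by ring. rewrite exp_Ropp. field.
          apply Rgt_not_eq, exp_pos. }
      rewrite (RInt_by_parts f (fun s => cos (k * exp s + (c - PI / 2))) f'); try lra.
      - f_equal. apply RInt_ext. intros x _. unfold f'.
        change ((q' x * (T * ct psi c' (T * x)) + exp (-1 * x) * q x *
           (T * (T * ct (fun u => u * psi u) (c' + PI / 2) (T * x)))) * cos (k * exp x + (c - PI / 2))
          = q' x * (T * ct psi c' (T * x)) * cos (k * exp x + (c - PI / 2)) +
            T * (exp (-1 * x) * q x * (T * ct (fun u => u * psi u) (c' + PI / 2) (T * x))
              * cos (k * exp x + (c - PI / 2))) :> R). ring.
      - intros x Hx. unfold f, f'.
        apply (is_derive_Rmult (fun s => exp (-1 * s) * q s) (fun s => T * ct psi c' (T * s))); [apply Q1; lra|].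
        apply (is_derive_scal (fun s => ct psi c' (T * s)) x T). apply ct_scaled_derive; auto.
      - intros x Hx. auto_derive; auto.
        replace (k * exp x + (c - PI / 2)) with ((k * exp x + c) - PI / 2) by ring.
        rewrite sin_minus, cos_PI2, sin_PI2. ring.
      - intros x Hx. unfold f'. apply continuous_Rplus.
        + apply continuous_osc_weight; auto. apply (vanish_on_continuous _ _ _ _ _ Q2); lra.
        + apply continuous_Rmult; [apply CQ'; lra|].
          apply (continuous_Rmult (fun _ => T)); [apply continuous_const|].
          apply (continuous_Rmult (fun _ => T)); [apply continuous_const|].
          apply ct_scaled_continuous; auto.
      - intros x Hx. apply continuous_Rmult; [|apply continuous_cos_exp].
        eapply is_derive_continuous. auto_derive; auto.
      - unfold f. rewrite Qa. ring.
      - unfold f. rewrite Qb. ring. }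
    specialize (H1 T xi c' (c - PI / 2) HT Hxi).
    specialize (H2 T xi (c' + PI / 2) (c - PI / 2) HT Hxi).
    apply Rmult_le_reg_l with k; auto.
    rewrite <- (Rabs_right k) at 1 by lra. rewrite <- Rabs_mult, E, Rabs_Ropp.
    eapply Rle_trans; [apply Rabs_triang|]. rewrite Rabs_mult, (Rabs_right T) by lra.
    set (r := (T / xi) ^ j) in *.
    assert (r0 : 0 <= r) by (apply pow_le; apply Rlt_le, Rdiv_lt_0_compat; lra).
    replace (k * ((K1 + K2) * (T / xi) ^ S j)) with (2 * PI * (T * ((K1 + K2) * r)))
      by (unfold k, r; simpl; field; lra).
    assert (0 <= K1 * r) by (apply Rmult_le_pos; auto).
    assert (0 <= K2 * r) by (apply Rmult_le_pos; auto).
    apply Rle_trans with (T * ((K1 + K2) * r)); [nra|].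
    assert (0 <= T * ((K1 + K2) * r)) by (apply Rmult_le_pos; nra). nra.
Qed.

(** At frequency 0 the integration by parts goes the other way: T ct psi (T s) is itself the
    derivative of a transform of psi / u, smooth because the support avoids 0, and each derivative
    moved onto [q] gains 1 / T. *)
Lemma osc_int_mean_decay j : forall q psi, vanish_on (-2) (-1) 1 j q -> csupp psi ->
  exists K, 0 <= K /\ forall T c', 1 <= T -> Rabs (osc_int q psi c' 0 T 0) <= K / T ^ j.
Proof.
  induction j as [|j IH]; intros q psi Hq Hp.
  - destruct (osc_int_bounded q psi Hq Hp) as [K [K0 HK]].
    exists K. split; auto. intros. simpl. rewrite Rdiv_1_r. auto.
  - assert (CQ := vanish_on_continuous _ _ _ _ _ Hq).
    destruct Hq as [Qa [Qb [q' [Q1 Q2]]]].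
    assert (Hu : csupp (fun u => / u * psi u))
      by (apply (csupp_mult psi (fun u => / u)); auto; intros; apply smooth_on_inv).
    destruct (IH _ _ Q2 Hu) as [K [K0 HK]]. exists K. split; auto. intros T c' HT.
    assert (E : T * osc_int q psi c' 0 T 0 = - osc_int q' (fun u => / u * psi u) (c' - PI / 2) 0 T 0).
    { unfold osc_int.
      assert (E1 : forall f, RInt (fun s => f s * cos (2 * PI * 0 * exp s + 0)) (-1) 1 = RInt f (-1) 1).
      { intros f. apply RInt_ext. intros x _.
        replace (2 * PI * 0 * exp x + 0) with 0 by ring. rewrite cos_0.
        change (f x * 1 = f x :> R). ring. }
      rewrite (E1 (fun s => q s * (T * ct psi c' (T * s)))).
      rewrite (E1 (fun s => q' s * (T * ct (fun u => / u * psi u) (c' - PI / 2) (T * s)))).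
      rewrite (RInt_by_parts q (fun s => ct (fun u => / u * psi u) (c' - PI / 2) (T * s)) q'); try lra; auto.
      - replace (T * - RInt (fun x => q' x * ct (fun u => / u * psi u) (c' - PI / 2) (T * x)) (-1) 1)
          with (- (T * RInt (fun x => q' x * ct (fun u => / u * psi u) (c' - PI / 2) (T * x)) (-1) 1)) by ring.
        f_equal. rewrite <- (RInt_scal (V := R_CompleteNormedModule)).
        + apply RInt_ext. intros x _.
          change (T * (q' x * ct (fun u => / u * psi u) (c' - PI / 2) (T * x)) =
                  q' x * (T * ct (fun u => / u * psi u) (c' - PI / 2) (T * x)) :> R). ring.
        + apply ex_RInt_cont; [lra|]. intros x Hx. apply continuous_Rmult.
          * apply (vanish_on_continuous _ _ _ _ _ Q2); lra.
          * apply ct_scaled_continuous; auto.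
      - intros x Hx. apply Q1; lra.
      - intros x Hx. assert (D := ct_scaled_derive _ (c' - PI / 2) T x Hu).
        replace (T * ct psi c' (T * x)) with
          (T * ct (fun u => u * (/ u * psi u)) (c' - PI / 2 + PI / 2) (T * x)); auto.
        f_equal. replace (c' - PI / 2 + PI / 2) with c' by ring.
        apply ct_ext. intros u Hu'. field. lra.
      - intros x Hx. apply (vanish_on_continuous _ _ _ _ _ Q2); lra.
      - intros x Hx. apply (continuous_Rmult (fun _ => T)); [apply continuous_const|].
        apply ct_scaled_continuous; auto. }
    specialize (HK T (c' - PI / 2) HT).
    apply Rmult_le_reg_l with T; [lra|].
    rewrite <- (Rabs_right T) at 1 by lra. rewrite <- Rabs_mult, E, Rabs_Ropp.
    replace (T * (K / T ^ S j)) with (K / T ^ j); auto.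
    simpl. field. split; [apply pow_nonzero; lra|lra].
Qed.

(** The exponential is the Jacobian of v = z exp s against v^(-1/2). The other factor is a
    polynomial cutoff, vanishing to order [A] at both ends and equal to 1 + O(s^(2 B)) near 0; this
    is enough because ct (T s) is negligible away from 0. *)
Definition bump (A B : nat) (s : R) : R := exp (1 / 2 * s) * (1 - s ^ (2 * B)) ^ A.

Lemma bump_vanish A B : (1 <= B)%nat -> vanish_on (-2) (-1) 1 A (bump A B).
Proof.
  intros HB. unfold bump. apply vanish_on_mult; [apply smooth_on_exp|].
  apply (vanish_on_power (-2) (-1) 1 A (fun s => 1 - s ^ (2 * B))).
  - assert (H : smooth_on (-2) A (fun s => 1 + -1 * s ^ (2 * B))).
    { apply (smooth_on_plus (-2) A (fun _ => 1)); [apply smooth_on_const|].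
      apply (smooth_on_mult (-2) A (fun _ => -1)); [apply smooth_on_const|apply smooth_on_pow]. }
    revert H. clear. revert A. assert (G : forall n f g, (forall x, f x = g x) -> smooth_on (-2) n f -> smooth_on (-2) n g).
    { intros [|n] f g E; simpl.
      - intros H x Hx. apply (continuous_ext f g x E); auto.
      - intros [f' [H1 H2]]. exists f'. split; auto. intros x Hx. apply (is_derive_ext f); auto. }
    intros A. apply G. intros x. ring.
  - rewrite pow_1_even. ring.
  - rewrite pow1. ring.
Qed.

(** * Poisson summation with Fejer weights *)

Lemma continuous_sum1 (g : nat -> R -> R) n x :
  (forall k, (1 <= k <= n)%nat -> continuous (g k) x) ->
  continuous (fun v => sum1 (fun k => g k v) n) x.
Proof.
  induction n as [|n IH]; intros H; simpl; [apply continuous_const|].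
  apply continuous_Rplus; [apply IH; intros; apply H; lia|apply H; lia].
Qed.

Lemma RInt_sum1 (g : nat -> R -> R) n a b : a <= b ->
  (forall k x, (1 <= k <= n)%nat -> a <= x <= b -> continuous (g k) x) ->
  RInt (fun v => sum1 (fun k => g k v) n) a b = sum1 (fun k => RInt (g k) a b) n.
Proof.
  intros Hab. induction n as [|n IH]; intros H; simpl.
  - rewrite RInt_const. unfold scal. simpl. unfold mult. simpl. ring.
  - rewrite <- IH by (intros; apply H; auto; lia).
    apply (RInt_plus (V := R_CompleteNormedModule)); apply ex_RInt_cont; auto.
    + intros x Hx. apply continuous_sum1. intros k Hk. apply H; auto; lia.
    + intros x Hx. apply H; auto; lia.
Qed.

Lemma RInt_Rscal (f : R -> R) c a b : a <= b -> (forall x, a <= x <= b -> continuous f x) ->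
  RInt (fun v => c * f v) a b = c * RInt f a b.
Proof.
  intros Hab H. apply (RInt_scal (V := R_CompleteNormedModule)). apply ex_RInt_cont; auto.
Qed.

Lemma RInt_Rplus (f g : R -> R) a b : a <= b -> (forall x, a <= x <= b -> continuous f x) ->
  (forall x, a <= x <= b -> continuous g x) ->
  RInt (fun v => f v + g v) a b = RInt f a b + RInt g a b.
Proof.
  intros Hab Hf Hg. apply (RInt_plus (V := R_CompleteNormedModule)); apply ex_RInt_cont; auto.
Qed.

Lemma RInt_Rminus (f g : R -> R) a b : a <= b -> (forall x, a <= x <= b -> continuous f x) ->
  (forall x, a <= x <= b -> continuous g x) ->
  RInt (fun v => f v - g v) a b = RInt f a b - RInt g a b.
Proof.
  intros Hab Hf Hg. apply (RInt_minus (V := R_CompleteNormedModule)); apply ex_RInt_cont; auto.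
Qed.

Lemma RInt_Chasles_cont (f : R -> R) a b c : a <= b <= c ->
  (forall x, a <= x <= c -> continuous f x) -> RInt f a c = RInt f a b + RInt f b c.
Proof.
  intros H Hf. symmetry. apply (RInt_Chasles (V := R_CompleteNormedModule));
    apply ex_RInt_cont; try lra; intros; apply Hf; lra.
Qed.

Lemma sin_ge_mul_cos y : 0 <= y <= PI -> y * cos y <= sin y.
Proof.
  intros Hy.
  assert (H : sin 0 - 0 * cos 0 <= sin y - y * cos y).
  { apply (nonneg_derivative_le (fun y => sin y - y * cos y) (fun y => y * sin y)); [lra| |].
    - intros x Hx. auto_derive; auto; ring.
    - intros x Hx. assert (0 <= sin x) by (apply sin_ge_0; lra). nra. }
  rewrite sin_0 in H. lra.
Qed.

Lemma sin_ge_half x : 0 <= x <= PI / 2 -> x / 2 <= sin x.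
Proof.
  intros Hx. replace (sin x) with (sin (2 * (x / 2))) by (f_equal; field). rewrite sin_2a.
  assert (P := PI_RGT_0).
  assert (H := sin_ge_mul_cos (x / 2) ltac:(lra)).
  assert (C : sqrt 2 / 2 <= cos (x / 2)).
  { replace (sqrt 2 / 2) with (cos (PI / 4)).
    - apply cos_decr_1; lra.
    - rewrite cos_PI4. rewrite <- (sqrt_sqrt 2) at 3 by lra. field.
      apply Rgt_not_eq, sqrt_lt_R0. lra. }
  assert (S2 : sqrt 2 * sqrt 2 = 2) by (apply sqrt_sqrt; lra).
  assert (S0 : 0 < sqrt 2) by (apply sqrt_lt_R0; lra).
  assert (C2 : 1 / 2 <= cos (x / 2) * cos (x / 2)) by nra.
  apply Rle_trans with (2 * (x / 2 * cos (x / 2)) * cos (x / 2)); [nra|].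
  apply Rmult_le_compat_r; lra.
Qed.

Lemma sin_shift_INR_sqr x n : sin (x + INR n * PI) * sin (x + INR n * PI) = sin x * sin x.
Proof.
  induction n as [|n IH].
  - simpl. replace (x + 0 * PI) with x by ring. reflexivity.
  - rewrite S_INR. replace (x + (INR n + 1) * PI) with ((x + INR n * PI) + PI) by ring.
    rewrite neg_sin. rewrite <- IH. ring.
Qed.

Lemma sin_PI_mul_sqr_ge v n : Rabs (v - INR n) <= 1 / 2 ->
  (v - INR n) * (v - INR n) <= sin (PI * v) * sin (PI * v).
Proof.
  intros H.
  replace (PI * v) with (PI * (v - INR n) + INR n * PI) by ring. rewrite sin_shift_INR_sqr.
  set (u := v - INR n) in *. assert (P := PI2_1).
  assert (Q : Rabs u <= sin (PI * Rabs u)).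
  { assert (U := Rabs_pos u). eapply Rle_trans; [|apply sin_ge_half; nra]. nra. }
  replace (u * u) with (Rabs u * Rabs u) by (rewrite <- Rabs_mult; apply Rabs_right; nra).
  replace (sin (PI * u) * sin (PI * u)) with (sin (PI * Rabs u) * sin (PI * Rabs u)).
  - assert (U := Rabs_pos u). nra.
  - unfold Rabs. destruct (Rcase_abs u); auto.
    replace (PI * - u) with (- (PI * u)) by ring. rewrite sin_neg. ring.
Qed.

(** The Fejer kernel of period 1. Being positive and of mass 1 it gives a truncated Poisson formula
    for functions that are merely Lipschitz. *)
Definition fejer (K : nat) (v : R) : R :=
  1 + 2 * sum1 (fun k => (1 - INR k / INR K) * cos (2 * PI * INR k * v)) K.

Lemma dirichlet_kernel K w :
  (1 + 2 * sum1 (fun k => cos (2 * INR k * w)) K) * sin w = sin (INR (2 * K + 1) * w).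
Proof.
  induction K as [|K IH].
  - simpl. replace (1 * w) with w by ring. ring.
  - change (sum1 (fun k => cos (2 * INR k * w)) (S K))
      with (sum1 (fun k => cos (2 * INR k * w)) K + cos (2 * INR (S K) * w)).
    replace ((1 + 2 * (sum1 (fun k => cos (2 * INR k * w)) K + cos (2 * INR (S K) * w))) * sin w)
      with ((1 + 2 * sum1 (fun k => cos (2 * INR k * w)) K) * sin w
            + 2 * (cos (2 * INR (S K) * w) * sin w)) by ring.
    rewrite IH.
    replace (INR (2 * K + 1) * w) with (2 * INR (S K) * w - w)
      by (rewrite S_INR, plus_INR, mult_INR; simpl; ring).
    replace (INR (2 * S K + 1) * w) with (2 * INR (S K) * w + w)
      by (rewrite plus_INR, mult_INR; simpl (INR 2); simpl (INR 1); ring).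
    rewrite sin_minus, sin_plus. ring.
Qed.

(** Induction on [K], adding one Dirichlet kernel at a time: with p = K w, the increment of the
    right side is sin (p + w)^2 - sin (p)^2 = sin (2 p + w) sin w. *)
Lemma fejer_identity K w :
  (INR K + 2 * sum1 (fun k => (INR K - INR k) * cos (2 * INR k * w)) K) * (sin w * sin w)
  = sin (INR K * w) * sin (INR K * w).
Proof.
  induction K as [|K IH].
  - simpl. rewrite Rmult_0_l, sin_0. ring.
  - assert (D := dirichlet_kernel K w).
    assert (E : sum1 (fun k => (INR (S K) - INR k) * cos (2 * INR k * w)) (S K)
      = sum1 (fun k => (INR K - INR k) * cos (2 * INR k * w)) K + sum1 (fun k => cos (2 * INR k * w)) K).
    { change (sum1 ?f (S K)) with (sum1 f K + f (S K)). cbv beta.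
      rewrite <- sum1_plus, Rminus_diag, Rmult_0_l, Rplus_0_r.
      apply sum1_ext. intros k _. rewrite S_INR. ring. }
    rewrite E.
    replace ((INR (S K) + 2 * (sum1 (fun k => (INR K - INR k) * cos (2 * INR k * w)) K
        + sum1 (fun k => cos (2 * INR k * w)) K)) * (sin w * sin w))
      with ((INR K + 2 * sum1 (fun k => (INR K - INR k) * cos (2 * INR k * w)) K) * (sin w * sin w)
        + (1 + 2 * sum1 (fun k => cos (2 * INR k * w)) K) * sin w * sin w)
      by (rewrite S_INR; ring).
    rewrite IH, D.
    replace (INR (2 * K + 1) * w) with (INR K * w + (INR K * w + w))
      by (rewrite plus_INR, mult_INR; simpl; ring).
    replace (INR (S K) * w) with (INR K * w + w) by (rewrite S_INR; ring).
    set (p := INR K * w). rewrite (sin_plus p (p + w)), (sin_plus p w), (cos_plus p w).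
    generalize (sin2_cos2 p) (sin2_cos2 w). unfold Rsqr. intros _ E2.
    replace (sin p * sin p) with (sin p * sin p * (sin w * sin w + cos w * cos w)) at 1
      by (rewrite E2; ring). ring.
Qed.

Lemma fejer_sin_sqr K v : (1 <= K)%nat ->
  INR K * fejer K v * (sin (PI * v) * sin (PI * v)) <= 1 /\
  0 <= INR K * fejer K v * (sin (PI * v) * sin (PI * v)).
Proof.
  intros HK. assert (K0 : 0 < INR K) by (apply lt_0_INR; lia).
  assert (E : INR K * fejer K v
    = INR K + 2 * sum1 (fun k => (INR K - INR k) * cos (2 * INR k * (PI * v))) K).
  { unfold fejer. rewrite Rmult_plus_distr_l, Rmult_1_r. f_equal.
    replace (INR K * (2 * sum1 (fun k => (1 - INR k / INR K) * cos (2 * PI * INR k * v)) K))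
      with (2 * (INR K * sum1 (fun k => (1 - INR k / INR K) * cos (2 * PI * INR k * v)) K)) by ring.
    rewrite <- sum1_scal. f_equal. apply sum1_ext. intros k _.
    replace (2 * PI * INR k * v) with (2 * INR k * (PI * v)) by ring. field. lra. }
  rewrite E, fejer_identity. generalize (SIN_bound (INR K * (PI * v))). split; nra.
Qed.

Lemma fejer_bounds K v n : (1 <= K)%nat -> Rabs (v - INR n) <= 1 / 2 ->
  0 <= fejer K v /\ (v - INR n) * (v - INR n) * fejer K v <= / INR K.
Proof.
  intros HK Hv. assert (K0 : 0 < INR K) by (apply lt_0_INR; lia).
  destruct (fejer_sin_sqr K v HK) as [H1 H2]. assert (H3 := sin_PI_mul_sqr_ge v n Hv).
  set (u := v - INR n) in *. set (s2 := sin (PI * v) * sin (PI * v)) in *.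
  assert (N : 0 <= fejer K v).
  { destruct (Req_dec u 0) as [E|E].
    - unfold fejer. rewrite (sum1_ext _ (fun k => 1 - INR k / INR K)).
      + apply Rplus_le_le_0_compat; [lra|]. apply Rmult_le_pos; [lra|]. apply sum1_ge0.
        intros k Hk. assert (INR k <= INR K) by (apply le_INR; lia).
        assert (INR k / INR K <= 1); [|lra].
        apply Rmult_le_reg_r with (INR K); auto. unfold Rdiv. rewrite Rmult_assoc, Rinv_l; lra.
      + intros k _. replace (2 * PI * INR k * v) with (0 + 2 * INR (k * n) * PI).
        * rewrite cos_period, cos_0. ring.
        * rewrite mult_INR. unfold u in E. replace v with (INR n) by lra. ring.
    - assert (0 < u * u) by (destruct (Rtotal_order u 0) as [?|[?|?]]; nra).
      apply Rmult_le_reg_l with (INR K * s2); [apply Rmult_lt_0_compat; lra|].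
      rewrite Rmult_0_r. replace (INR K * s2 * fejer K v) with (INR K * fejer K v * s2) by ring. auto. }
  split; auto.
  apply Rmult_le_reg_l with (INR K); auto. rewrite Rinv_r by lra.
  eapply Rle_trans; [|exact H1].
  replace (INR K * (u * u * fejer K v)) with (INR K * fejer K v * (u * u)) by ring.
  apply Rmult_le_compat_l; auto. apply Rmult_le_pos; lra.
Qed.

Lemma continuous_cos_freq k v : continuous (fun v => cos (2 * PI * INR k * v)) v.
Proof.
  eapply is_derive_continuous. auto_derive; auto.
Qed.

Lemma continuous_fejer K v : continuous (fejer K) v.
Proof.
  unfold fejer. apply continuous_Rplus; [apply continuous_const|].
  apply (continuous_Rmult (fun _ => 2)); [apply continuous_const|].
  apply continuous_sum1. intros k _.
  apply (continuous_Rmult (fun _ => 1 - INR k / INR K)); [apply continuous_const|].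
  apply continuous_cos_freq.
Qed.

Lemma RInt_fejer K (n : nat) : RInt (fejer K) (INR n - 1 / 2) (INR n + 1 / 2) = 1.
Proof.
  unfold fejer.
  rewrite (RInt_Rplus (fun _ => 1)); [| lra | intros; apply continuous_const |].
  2:{ intros x _. apply (continuous_Rmult (fun _ => 2)); [apply continuous_const|].
      apply continuous_sum1. intros k _.
      apply (continuous_Rmult (fun _ => 1 - INR k / INR K)); [apply continuous_const|].
      apply continuous_cos_freq. }
  rewrite RInt_Rscal; [|lra|].
  2:{ intros x _. apply continuous_sum1. intros k _.
      apply (continuous_Rmult (fun _ => 1 - INR k / INR K)); [apply continuous_const|].
      apply continuous_cos_freq. }
  rewrite RInt_sum1; [|lra|].
  2:{ intros k x _ _. apply (continuous_Rmult (fun _ => 1 - INR k / INR K)); [apply continuous_const|].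
      apply continuous_cos_freq. }
  rewrite (sum1_ext _ (fun _ => 0)).
  - rewrite sum1_zero, RInt_const. unfold scal. simpl. unfold mult. simpl. lra.
  - intros k Hk. rewrite RInt_Rscal; [|lra|intros; apply continuous_cos_freq].
    assert (k0 : 0 < INR k) by (apply lt_0_INR; lia). assert (P := PI_RGT_0).
    assert (H : is_RInt (fun v => cos (2 * PI * INR k * v)) (INR n - 1 / 2) (INR n + 1 / 2)
      (sin (2 * PI * INR k * (INR n + 1 / 2)) / (2 * PI * INR k)
       - sin (2 * PI * INR k * (INR n - 1 / 2)) / (2 * PI * INR k))).
    { apply (is_RInt_derive (fun v => sin (2 * PI * INR k * v) / (2 * PI * INR k))).
      - intros x _. auto_derive; auto. field. split; lra.
      - intros x _. apply continuous_cos_freq. }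
    rewrite (is_RInt_unique (V := R_CompleteNormedModule) _ _ _ _ H).
    replace (2 * PI * INR k * (INR n + 1 / 2)) with (2 * PI * INR k * (INR n - 1 / 2) + 2 * INR k * PI)
      by field. rewrite sin_period. ring.
Qed.

(** With d = K^(-1/2) the Lipschitz bound is split by |u| <= d + u^2 / d. The kernel has mass 1 over
    the unit interval and u^2 times the kernel is at most 1 / K, so each part contributes d. *)
Lemma fejer_poisson_local (f : R -> R) (n K : nat) Lam : (1 <= K)%nat -> 0 <= Lam ->
  (forall v, INR n - 1 / 2 <= v <= INR n + 1 / 2 -> continuous f v) ->
  (forall v, Rabs (v - INR n) <= 1 / 2 -> Rabs (f v - f (INR n)) <= Lam * Rabs (v - INR n)) ->
  Rabs (f (INR n) - RInt (fun v => f v * fejer K v) (INR n - 1 / 2) (INR n + 1 / 2))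
    <= Lam * (2 / sqrt (INR K)).
Proof.
  intros HK HL Hc Hf. assert (K0 : 0 < INR K) by (apply lt_0_INR; lia).
  assert (s0 : 0 < sqrt (INR K)) by (apply sqrt_lt_R0; auto).
  assert (ss : sqrt (INR K) * sqrt (INR K) = INR K) by (apply sqrt_sqrt; lra).
  set (a := INR n - 1 / 2) in *. set (b := INR n + 1 / 2) in *.
  assert (ab : a <= b) by (unfold a, b; lra).
  set (d := / sqrt (INR K)).
  assert (d0 : 0 < d) by (apply Rinv_0_lt_compat; auto).
  replace (f (INR n)) with (f (INR n) * RInt (fejer K) a b) at 1 by (unfold a, b; rewrite RInt_fejer; ring).
  rewrite <- RInt_Rscal, <- RInt_Rminus; auto.
  2:{ intros; apply (continuous_Rmult (fun _ => f (INR n))); [apply continuous_const|apply continuous_fejer]. }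
  2:{ intros; apply continuous_Rmult; auto. apply continuous_fejer. }
  2:{ intros; apply continuous_fejer. }
  apply Rle_trans with (RInt (fun v => Lam * (d * fejer K v + d)) a b).
  - apply RInt_abs_le_RInt; auto.
    + intros x Hx. apply (continuous_minus (V := R_NormedModule)).
      * apply (continuous_Rmult (fun _ => f (INR n))); [apply continuous_const|apply continuous_fejer].
      * apply continuous_Rmult; auto. apply continuous_fejer.
    + intros x _. apply (continuous_Rmult (fun _ => Lam)); [apply continuous_const|].
      apply continuous_Rplus; [|apply continuous_const].
      apply (continuous_Rmult (fun _ => d)); [apply continuous_const|apply continuous_fejer].
    + intros x Hx.
      assert (U : Rabs (x - INR n) <= 1 / 2) by (apply Rabs_le; unfold a, b in Hx; lra).
      destruct (fejer_bounds K x n HK U) as [F0 F1]. specialize (Hf x U).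
      replace (f (INR n) * fejer K x - f x * fejer K x) with (- (f x - f (INR n)) * fejer K x) by ring.
      rewrite Rabs_mult, Rabs_Ropp, (Rabs_right (fejer K x)) by lra.
      set (u := x - INR n) in *.
      apply Rle_trans with (Lam * Rabs u * fejer K x); [apply Rmult_le_compat_r; auto|].
      rewrite Rmult_assoc. apply Rmult_le_compat_l; auto.
      assert (E : sqrt (INR K) * (u * u * fejer K x) <= d).
      { apply Rle_trans with (sqrt (INR K) * / INR K); [apply Rmult_le_compat_l; lra|].
        right. unfold d. rewrite <- ss at 2. field. lra. }
      assert (E2 : Rabs u <= d + sqrt (INR K) * (u * u)).
      { replace (u * u) with (Rabs u * Rabs u) by (rewrite <- Rabs_mult; apply Rabs_right; nra).
        assert (dq : sqrt (INR K) * d = 1) by (unfold d; field; lra).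
        assert (U0 := Rabs_pos u). set (r := sqrt (INR K)) in *. set (w := Rabs u) in *.
        destruct (Rle_dec w d); [nra|]. assert (1 <= r * w) by nra. nra. }
      apply Rle_trans with ((d + sqrt (INR K) * (u * u)) * fejer K x); [apply Rmult_le_compat_r; auto|].
      lra.
  - rewrite RInt_Rscal; auto.
    + rewrite RInt_Rplus; auto.
      * rewrite RInt_Rscal; auto; [|intros; apply continuous_fejer].
        unfold a, b. rewrite RInt_fejer, RInt_const. unfold scal. simpl. unfold mult. simpl.
        right. unfold d. field. lra.
      * intros. apply (continuous_Rmult (fun _ => d)); [apply continuous_const|apply continuous_fejer].
      * intros; apply continuous_const.
    + intros x _. apply continuous_Rplus; [|apply continuous_const].
      apply (continuous_Rmult (fun _ => d)); [apply continuous_const|apply continuous_fejer].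
Qed.

Lemma fejer_poisson (f : R -> R) (N K : nat) Lam : (1 <= K)%nat -> 0 <= Lam ->
  (forall v, 1 / 2 <= v -> continuous f v) ->
  (forall v w, 1 / 2 <= v -> 1 / 2 <= w -> Rabs (f v - f w) <= Lam * Rabs (v - w)) ->
  Rabs (sum1 (fun n => f (INR n)) N
        - (RInt f (1 / 2) (INR N + 1 / 2)
           + 2 * sum1 (fun k => (1 - INR k / INR K)
                * RInt (fun v => f v * cos (2 * PI * INR k * v)) (1 / 2) (INR N + 1 / 2)) K))
    <= INR N * (Lam * (2 / sqrt (INR K))).
Proof.
  intros HK HL Hc Hf.
  assert (cF : forall x, 1 / 2 <= x -> continuous (fun v => f v * fejer K v) x).
  { intros x Hx. apply continuous_Rmult; auto. apply continuous_fejer. }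
  assert (cC : forall k x, 1 / 2 <= x -> continuous (fun v => f v * cos (2 * PI * INR k * v)) x).
  { intros k x Hx. apply continuous_Rmult; auto. apply continuous_cos_freq. }
  assert (cS : forall k x, 1 / 2 <= x ->
     continuous (fun v => (1 - INR k / INR K) * (f v * cos (2 * PI * INR k * v))) x).
  { intros k x Hx. apply (continuous_Rmult (fun _ => 1 - INR k / INR K)); auto. apply continuous_const. }
  assert (hb : 1 / 2 <= INR N + 1 / 2) by (generalize (pos_INR N); lra).
  replace (RInt f (1 / 2) (INR N + 1 / 2)
           + 2 * sum1 (fun k => (1 - INR k / INR K)
                * RInt (fun v => f v * cos (2 * PI * INR k * v)) (1 / 2) (INR N + 1 / 2)) K)
    with (RInt (fun v => f v * fejer K v) (1 / 2) (INR N + 1 / 2)).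
  - clear hb. induction N as [|N IH].
    + simpl. rewrite Rplus_0_l, RInt_point.
      change (Rabs (0 - 0) <= 0 * (Lam * (2 / sqrt (INR K)))).
      rewrite Rminus_0_r, Rabs_R0. lra.
    + change (sum1 (fun n => f (INR n)) (S N)) with (sum1 (fun n => f (INR n)) N + f (INR (S N))).
      rewrite (RInt_Chasles_cont _ (1 / 2) (INR N + 1 / 2)).
      2:{ rewrite S_INR. generalize (pos_INR N). lra. }
      2:{ intros; apply cF; lra. }
      assert (n1 : 1 <= INR (S N)) by (apply (le_INR 1); lia).
      assert (L := fejer_poisson_local f (S N) K Lam HK HL).
      replace (INR N + 1 / 2) with (INR (S N) - 1 / 2) in * by (rewrite S_INR; field).
      replace (INR (S N) * (Lam * (2 / sqrt (INR K))))
        with (INR N * (Lam * (2 / sqrt (INR K))) + Lam * (2 / sqrt (INR K))) by (rewrite (S_INR N); ring).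
      eapply Rle_trans; [|apply Rplus_le_compat; [exact IH|apply L]].
      * match goal with |- Rabs (?a + ?b - (?c + ?d)) <= _ =>
          replace (a + b - (c + d)) with ((a - c) + (b - d)) by ring end. apply Rabs_triang.
      * intros v Hv. apply Hc; lra.
      * intros v Hv. apply Hf; try lra. apply Rabs_le_between in Hv. lra.
  - rewrite (RInt_ext _ (fun v => f v + 2 * sum1 (fun k => (1 - INR k / INR K) * (f v * cos (2 * PI * INR k * v))) K)).
    + rewrite RInt_Rplus; auto.
      * rewrite RInt_Rscal; auto.
        -- rewrite RInt_sum1; auto.
           ++ f_equal. f_equal. apply sum1_ext. intros k _. apply RInt_Rscal; auto. intros; apply cC; lra.
           ++ intros; apply cS; lra.
        -- intros; apply continuous_sum1. intros; apply cS; lra.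
      * intros; apply Hc; lra.
      * intros; apply (continuous_Rmult (fun _ => 2)); [apply continuous_const|].
        apply continuous_sum1. intros; apply cS; lra.
    + intros x _. unfold fejer. rewrite Rmult_plus_distr_l, Rmult_1_r.
      change (f x + f x * (2 * sum1 (fun k => (1 - INR k / INR K) * cos (2 * PI * INR k * x)) K) =
        f x + 2 * sum1 (fun k => (1 - INR k / INR K) * (f x * cos (2 * PI * INR k * x))) K :> R).
      rewrite (sum1_ext (fun k => (1 - INR k / INR K) * (f x * cos (2 * PI * INR k * x)))
        (fun k => f x * ((1 - INR k / INR K) * cos (2 * PI * INR k * x)))) by (intros; ring).
      rewrite sum1_scal. ring.
Qed.

(** * The double sum *)

Fixpoint ndiff (A : nat) (g : nat -> R) (m : nat) : R :=
  match A with
  | O => g m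
  | S A' => ndiff A' (fun k => g (S k) - g k) m
  end.

Lemma ndiff_ext A : forall f g, (forall m, f m = g m) -> forall m, ndiff A f m = ndiff A g m.
Proof.
  induction A as [|A IH]; intros f g H m; simpl; auto. apply IH. intros k. rewrite !H. reflexivity.
Qed.

Lemma ndiff_minus A : forall f g m, ndiff A (fun k => f k - g k) m = ndiff A f m - ndiff A g m.
Proof.
  induction A as [|A IH]; intros f g m; simpl; auto. rewrite <- IH. apply ndiff_ext. intros; ring.
Qed.

Lemma ndiff_scal A c : forall f m, ndiff A (fun k => c * f k) m = c * ndiff A f m.
Proof.
  induction A as [|A IH]; intros f m; simpl; auto. rewrite <- IH. apply ndiff_ext. intros; ring.
Qed.

Lemma ndiff_shift A p : forall f m, ndiff A (fun k => f (k + p)%nat) m = ndiff A f (m + p)%nat.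
Proof. induction A as [|A IH]; intros f m; simpl; auto. rewrite <- IH. reflexivity. Qed.

Lemma ndiff_eq0 A : forall g L, (forall m, (L < m)%nat -> g m = 0) ->
  forall m, (L < m)%nat -> ndiff A g m = 0.
Proof.
  induction A as [|A IH]; intros g L H m Hm; simpl; auto.
  apply (IH _ L); auto. intros k Hk. rewrite !H by lia. ring.
Qed.

Lemma abel_step (g : nat -> R) th c N :
  2 * sin (th / 2) * sum1 (fun m => g m * cos (INR m * th + c)) N =
  g (S N) * sin ((INR N + 1 / 2) * th + c) - g 1%nat * sin (1 / 2 * th + c)
  - sum1 (fun m => (g (S m) - g m) * sin ((INR m + 1 / 2) * th + c)) N.
Proof.
  induction N as [|N IH].
  - simpl. replace (0 + 1 / 2) with (1 / 2) by ring. ring.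
  - change (sum1 ?f (S N)) with (sum1 f N + f (S N)). cbv beta.
    rewrite Rmult_plus_distr_l, IH, S_INR.
    assert (E : 2 * sin (th / 2) * cos ((INR N + 1) * th + c)
      = sin ((INR N + 1 + 1 / 2) * th + c) - sin ((INR N + 1 / 2) * th + c)).
    { replace ((INR N + 1 + 1 / 2) * th + c) with ((INR N + 1) * th + c + th / 2) by field.
      replace ((INR N + 1 / 2) * th + c) with ((INR N + 1) * th + c - th / 2) by field.
      rewrite sin_plus, sin_minus. ring. }
    replace (2 * sin (th / 2) * (g (S N) * cos ((INR N + 1) * th + c)))
      with (g (S N) * (2 * sin (th / 2) * cos ((INR N + 1) * th + c))) by ring.
    rewrite E. ring.
Qed.

(** Multiplication by 2 sin (th / 2) differences the coefficients. Boundary terms vanish at each of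
    the [A] steps: on the right by bounded support, on the left because [g] is zero on the first [A]
    integers and each difference uses up one of them. *)
Lemma abel_summation_le A N th : forall g c,
  (forall m, (1 <= m <= A)%nat -> g m = 0) -> (forall m, (N < m)%nat -> g m = 0) ->
  Rabs (2 * sin (th / 2)) ^ A * Rabs (sum1 (fun m => g m * cos (INR m * th + c)) N)
  <= sum1 (fun m => Rabs (ndiff A g m)) N.
Proof.
  induction A as [|A IH]; intros g c H1 H2.
  - simpl. rewrite Rmult_1_l. eapply Rle_trans; [apply sum1_abs|]. apply sum1_le. intros m _.
    rewrite Rabs_mult. assert (Rabs (cos (INR m * th + c)) <= 1) by (apply Rabs_le, COS_bound).
    generalize (Rabs_pos (g m)). nra.
  - simpl. rewrite (Rmult_comm (Rabs _)), Rmult_assoc, <- Rabs_mult, abel_step.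
    rewrite (H1 1%nat), (H2 (S N)) by lia.
    replace (0 * sin ((INR N + 1 / 2) * th + c) - 0 * sin (1 / 2 * th + c) -
      sum1 (fun m => (g (S m) - g m) * sin ((INR m + 1 / 2) * th + c)) N)
      with (- sum1 (fun m => (g (S m) - g m) * cos (INR m * th + (1 / 2 * th + c - PI / 2))) N).
    + rewrite Rabs_Ropp. apply (IH (fun k => g (S k) - g k)).
      * intros m Hm. rewrite !H1 by lia. ring.
      * intros m Hm. rewrite !H2 by lia. ring.
    + rewrite !Rmult_0_l, Rminus_0_r, Rminus_0_l. f_equal. apply sum1_ext. intros m _. f_equal.
      replace (INR m * th + (1 / 2 * th + c - PI / 2)) with ((INR m + 1 / 2) * th + c - PI / 2) by field.
      rewrite cos_minus, cos_PI2, sin_PI2. ring.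
Qed.

Lemma sum1_shift_diff f H : sum1 (fun h => f (S h)) H - sum1 f H = f (S H) - f 1%nat.
Proof. assert (E := sum1_recl f H). simpl in E. lra. Qed.

(** One difference undoes one average: the difference of a mean over H shifts is (f (k + H + 1) - f
    (k + 1)) / H, of size 2 / H. *)
Lemma ndiff_cutoff_le H A L m : (1 <= H)%nat -> Rabs (ndiff A (cutoff H A L) m) <= (2 / INR H) ^ A.
Proof.
  intros HH. assert (H0 : 0 < INR H) by (apply lt_0_INR; lia).
  revert m. induction A as [|A IH]; intros m.
  - simpl. destruct (Nat.leb m L); rewrite ?Rabs_R1, ?Rabs_R0; lra.
  - change (ndiff (S A) (cutoff H (S A) L) m)
      with (ndiff A (fun k => cutoff H (S A) L (S k) - cutoff H (S A) L k) m).
    rewrite (ndiff_ext A _ (fun k => / INR H * (cutoff H A L (k + S H) - cutoff H A L (k + 1)))).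
    + rewrite ndiff_scal, ndiff_minus.
      rewrite (ndiff_shift A (S H) (cutoff H A L)), (ndiff_shift A 1 (cutoff H A L)).
      rewrite Rabs_mult, Rabs_right by (left; apply Rinv_0_lt_compat; auto).
      change ((2 / INR H) ^ S A) with (2 / INR H * (2 / INR H) ^ A).
      replace (2 / INR H * (2 / INR H) ^ A) with (/ INR H * ((2 / INR H) ^ A + (2 / INR H) ^ A)) by (field; lra).
      apply Rmult_le_compat_l; [left; apply Rinv_0_lt_compat; auto|].
      unfold Rminus. eapply Rle_trans; [apply Rabs_triang|]. rewrite Rabs_Ropp.
      apply Rplus_le_compat; apply IH.
    + intros k. simpl. rewrite <- Rmult_minus_distr_l. f_equal.
      assert (E := sum1_shift_diff (fun h => cutoff H A L (k + h)) H). cbv beta in E.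
      rewrite <- E. f_equal. apply sum1_ext. intros h _. f_equal. lia.
Qed.

Lemma sum_ndiff_cutoff_le H A L N : (1 <= H)%nat -> (L <= N)%nat ->
  sum1 (fun m => Rabs (ndiff A (cutoff H A L) m)) N <= INR L * (2 / INR H) ^ A.
Proof.
  intros HH HL. rewrite (sum1_extend _ L N HL).
  - rewrite <- sum1_const. apply sum1_le. intros; apply ndiff_cutoff_le; auto.
  - intros k Hk. rewrite (ndiff_eq0 A _ L); [apply Rabs_R0| |lia].
    intros m Hm. apply cutoff_eq0; auto.
Qed.

(** A smooth piece between the scales [H2] and [H1]. Both cutoffs equal 1 up to [H2], so the piece
    vanishes on an initial segment, as repeated Abel summation requires. *)
Definition band (A H1 H2 m : nat) : R :=
  cutoff H1 A ((A + 1) * H1) m - cutoff H2 A ((A + 1) * H2) m.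

Lemma band_eq0 A H1 H2 m : (1 <= H2 <= H1)%nat -> (m <= H2)%nat -> band A H1 H2 m = 0.
Proof. intros H Hm. unfold band. rewrite !cutoff_eq1 by nia. ring. Qed.

Lemma band_cos_le A H1 H2 th c : (1 <= A)%nat -> (A <= H2 <= H1)%nat ->
  Rabs (2 * sin (th / 2)) ^ A
   * Rabs (sum1 (fun m => band A H1 H2 m * cos (INR m * th + c)) ((A + 1) * H1))
  <= 2 * INR (A + 1) * 2 ^ A * (INR H2 / INR H2 ^ A).
Proof.
  intros HA HH. set (N := ((A + 1) * H1)%nat).
  assert (h2 : 0 < INR H2) by (apply lt_0_INR; lia).
  assert (h1 : INR H2 <= INR H1) by (apply le_INR; lia).
  eapply Rle_trans.
  - apply (abel_summation_le A N th (band A H1 H2) c).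
    + intros m Hm. apply band_eq0; lia.
    + intros m Hm. unfold band. rewrite !cutoff_eq0 by (unfold N in Hm; nia). ring.
  - apply Rle_trans with (INR ((A + 1) * H1) * (2 / INR H1) ^ A + INR ((A + 1) * H2) * (2 / INR H2) ^ A).
    + eapply Rle_trans; [|apply Rplus_le_compat;
        [apply (sum_ndiff_cutoff_le H1 A ((A + 1) * H1) N)|apply (sum_ndiff_cutoff_le H2 A ((A + 1) * H2) N)];
        unfold N; nia].
      rewrite <- sum1_plus. apply sum1_le. intros m _. unfold band. rewrite ndiff_minus.
      unfold Rminus. eapply Rle_trans; [apply Rabs_triang|]. rewrite Rabs_Ropp. apply Rle_refl.
    + assert (E : forall H, 0 < INR H -> INR ((A + 1) * H) * (2 / INR H) ^ A
        = INR (A + 1) * 2 ^ A * (INR H / INR H ^ A)).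
      { intros H h. rewrite mult_INR. unfold Rdiv. rewrite Rpow_mult_distr, pow_inv. ring. }
      rewrite !E by lra.
      assert (D : INR H1 / INR H1 ^ A <= INR H2 / INR H2 ^ A).
      { destruct A as [|A]; [lia|]. simpl.
        replace (INR H1 / (INR H1 * INR H1 ^ A)) with (/ INR H1 ^ A)
          by (field; split; [apply pow_nonzero|]; lra).
        replace (INR H2 / (INR H2 * INR H2 ^ A)) with (/ INR H2 ^ A)
          by (field; split; [apply pow_nonzero|]; lra).
        apply Rinv_le_contravar; [apply pow_lt; auto|]. apply pow_incr. lra. }
      assert (0 <= INR (A + 1) * 2 ^ A) by (apply Rmult_le_pos; [apply pos_INR|apply pow_le; lra]).
      nra.
Qed.

Lemma nearest_nat v : 0 <= v -> exists l : nat, Rabs (v - INR l) <= 1 / 2.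
Proof.
  intros Hv. destruct (archimed (v + 1 / 2)) as [A1 A2].
  set (z := (up (v + 1 / 2) - 1)%Z).
  assert (Hz : IZR z = IZR (up (v + 1 / 2)) - 1) by (unfold z; rewrite minus_IZR; reflexivity).
  assert (Z0 : (0 <= z)%Z).
  { assert (-1 < z)%Z; [|lia]. apply lt_IZR. rewrite Hz. lra. }
  exists (Z.to_nat z). rewrite INR_IZR_INZ, Z2Nat.id, Hz by auto. apply Rabs_le. lra.
Qed.

Lemma sin_PI_mul_ge v d : 0 <= v -> (forall l : nat, d <= Rabs (v - INR l)) ->
  d <= Rabs (2 * sin (PI * v)) /\ d <= 1 / 2.
Proof.
  intros Hv H. destruct (nearest_nat v Hv) as [l Hl]. specialize (H l). split; [|lra].
  assert (S := sin_PI_mul_sqr_ge v l Hl).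
  apply Rle_trans with (Rabs (v - INR l)); auto.
  apply Rsqr_le_abs_0. unfold Rsqr. nra.
Qed.

(** * Lipschitz bounds for the summands *)

(** A bound and a Lipschitz constant are kept together so that they propagate through products. The
    half-line starts at 1/4, while the integrals start at 1/2; the margin gives two-sided continuity
    at 1/2. *)
Definition lip (f : R -> R) (M a : R) : Prop := 0 <= a /\
  forall v w, 1 / 4 <= v -> 1 / 4 <= w -> Rabs (f v) <= M /\ Rabs (f v - f w) <= a * Rabs (v - w).

Lemma lip_bound_ge0 f M a : lip f M a -> 0 <= M.
Proof. intros [_ H]. destruct (H 1 1) as [B _]; try lra. generalize (Rabs_pos (f 1)). lra. Qed.

Lemma lip_le f M a M' a' : lip f M a -> M <= M' -> a <= a' -> lip f M' a'.
Proof.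
  intros [a0 H] H1 H2. split; [lra|]. intros v w Hv Hw. destruct (H v w Hv Hw). split; [lra|].
  eapply Rle_trans; [eassumption|]. apply Rmult_le_compat_r; [apply Rabs_pos|lra].
Qed.

Lemma lip_const c : lip (fun _ => c) (Rabs c) 0.
Proof.
  split; [lra|]. intros v w _ _. split; [lra|]. rewrite Rminus_diag, Rabs_R0. lra.
Qed.

Lemma lip_mult f g M a M' b : lip f M a -> lip g M' b ->
  lip (fun v => f v * g v) (M * M') (M * b + M' * a).
Proof.
  intros Hf Hg. assert (M0 := lip_bound_ge0 _ _ _ Hf). assert (M0' := lip_bound_ge0 _ _ _ Hg).
  destruct Hf as [a0 Hf]. destruct Hg as [b0 Hg]. split; [nra|].
  intros v w Hv Hw. destruct (Hf v w Hv Hw) as [F1 F2]. destruct (Hg v w Hv Hw) as [G1 G2].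
  destruct (Hf w w Hw Hw) as [F3 _]. destruct (Hg w w Hw Hw) as [G3 _].
  split.
  - rewrite Rabs_mult. apply Rmult_le_compat; auto; apply Rabs_pos.
  - replace (f v * g v - f w * g w) with (f v * (g v - g w) + g w * (f v - f w)) by ring.
    eapply Rle_trans; [apply Rabs_triang|]. rewrite !Rabs_mult, Rmult_plus_distr_r, !Rmult_assoc.
    apply Rplus_le_compat; apply Rmult_le_compat; auto; apply Rabs_pos.
Qed.

Lemma lip_plus f g M a M' b : lip f M a -> lip g M' b ->
  lip (fun v => f v + g v) (M + M') (a + b).
Proof.
  intros [a0 Hf] [b0 Hg]. split; [lra|].
  intros v w Hv Hw. destruct (Hf v w Hv Hw) as [F1 F2]. destruct (Hg v w Hv Hw) as [G1 G2].
  split.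
  - eapply Rle_trans; [apply Rabs_triang|]. lra.
  - replace (f v + g v - (f w + g w)) with ((f v - f w) + (g v - g w)) by ring.
    eapply Rle_trans; [apply Rabs_triang|]. lra.
Qed.

Lemma lip_pow f a n : lip f 1 a -> lip (fun v => f v ^ n) 1 (INR n * a).
Proof.
  intros Hf. induction n as [|n IH].
  - simpl. apply lip_le with (Rabs 1) 0; [apply lip_const|rewrite Rabs_R1; lra|lra].
  - change (lip (fun v => f v * f v ^ n) 1 (INR (S n) * a)). rewrite S_INR.
    eapply lip_le; [apply lip_mult; [exact Hf|exact IH]|lra|lra].
Qed.

Lemma lip_sum1 (g : nat -> R -> R) M a n :
  0 <= a -> (forall k, (1 <= k <= n)%nat -> lip (g k) M a) ->
  lip (fun v => sum1 (fun k => g k v) n) (INR n * M) (INR n * a).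
Proof.
  intros a0. induction n as [|n IH]; intros H.
  - simpl. apply lip_le with (Rabs 0) 0; [apply lip_const|rewrite Rabs_R0; lra|lra].
  - rewrite S_INR. simpl. eapply lip_le; [apply lip_plus; [apply IH; intros; apply H; lia|apply H; lia]| |]; lra.
Qed.

Lemma lip_continuous f M a x : lip f M a -> 1 / 2 <= x -> continuous f x.
Proof.
  intros [a0 H] Hx. apply continuity_pt_filterlim. intros e He.
  assert (d0 : 0 < Rmin (1 / 4) (e / (a + 1))).
  { apply Rmin_pos; [lra|]. apply Rdiv_lt_0_compat; lra. }
  exists (Rmin (1 / 4) (e / (a + 1))). split; [exact d0|].
  intros y [_ Hy]. simpl in *. unfold R_dist in *.
  assert (B1 := Rmin_l (1 / 4) (e / (a + 1))). assert (B2 := Rmin_r (1 / 4) (e / (a + 1))).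
  assert (Y : 1 / 4 <= y) by (assert (Q := Rabs_def2 _ _ Hy); lra).
  destruct (H y x) as [_ L]; try lra.
  eapply Rle_lt_trans; [exact L|].
  apply Rle_lt_trans with (a * (e / (a + 1))).
  - apply Rmult_le_compat_l; lra.
  - apply Rmult_lt_reg_r with (a + 1); [lra|]. unfold Rdiv.
    rewrite !Rmult_assoc, Rinv_l by lra. nra.
Qed.

Lemma ln_lipschitz v w : 1 / 4 <= v -> 1 / 4 <= w -> Rabs (ln v - ln w) <= 4 * Rabs (v - w).
Proof.
  assert (G : forall v w, 1 / 4 <= v <= w -> ln w - ln v <= 4 * (w - v)).
  { intros a b H. assert (L := ln_ge_1_minus_inv (a / b)). rewrite ln_div in L by lra.
    assert (0 < a / b) by (apply Rdiv_lt_0_compat; lra). specialize (L H0).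
    replace (/ (a / b)) with (b / a) in L by (field; lra).
    assert (b / a - 1 <= 4 * (b - a)); [|lra].
    apply Rmult_le_reg_r with a; [lra|].
    replace ((b / a - 1) * a) with (b - a) by (field; lra). nra. }
  intros Hv Hw. destruct (Rle_dec v w).
  - rewrite (Rabs_minus_sym v w), (Rabs_right (w - v)) by lra.
    assert (Q := G v w ltac:(lra)). assert (ln v <= ln w) by (apply ln_le; lra).
    rewrite Rabs_minus_sym, Rabs_right; lra.
  - rewrite (Rabs_right (v - w)) by lra.
    assert (Q := G w v ltac:(lra)). assert (ln w <= ln v) by (apply ln_le; lra).
    rewrite Rabs_right; lra.
Qed.

Lemma lip_inv_sqrt : lip (fun v => / sqrt v) 2 4.
Proof.
  split; [lra|].
  assert (S : forall v, 1 / 4 <= v -> 1 / 2 <= sqrt v /\ sqrt v * sqrt v = v).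
  { intros v Hv. split; [|apply sqrt_sqrt; lra].
    replace (1 / 2) with (sqrt (1 / 4)); [apply sqrt_le_1; lra|].
    replace (1 / 4) with ((1 / 2) * (1 / 2)) by field. apply sqrt_square. lra. }
  intros v w Hv Hw. destruct (S v Hv) as [v0 v1]. destruct (S w Hw) as [w0 w1].
  set (a := sqrt v) in *. set (b := sqrt w) in *.
  split.
  - rewrite Rabs_right by (left; apply Rinv_0_lt_compat; lra).
    replace 2 with (/ (1 / 2)) by field. apply Rinv_le_contravar; lra.
  - replace (v - w) with ((a - b) * (a + b)) by nra.
    replace (/ a - / b) with ((- (a - b)) / (a * b)) by (field; split; lra).
    unfold Rdiv. rewrite !Rabs_mult, Rabs_Ropp, Rabs_inv, (Rabs_right (a + b)), (Rabs_right (a * b)) by nra.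
    replace (4 * (Rabs (a - b) * (a + b))) with (Rabs (a - b) * (4 * (a + b))) by ring.
    apply Rmult_le_compat_l; [apply Rabs_pos|].
    apply Rle_trans with 4; [|nra].
    replace 4 with (/ (1 / 4)) by field. apply Rinv_le_contravar; nra.
Qed.

Definition clamp (s : R) : R := Rmax (-1) (Rmin 1 s).

Lemma clamp_bounds s : -1 <= clamp s <= 1.
Proof. unfold clamp, Rmax, Rmin. repeat destruct (Rle_dec _ _); lra. Qed.

Lemma clamp_id s : -1 <= s <= 1 -> clamp s = s.
Proof. intros H. unfold clamp, Rmax, Rmin. repeat destruct (Rle_dec _ _); lra. Qed.

Lemma clamp_lipschitz s t : Rabs (clamp s - clamp t) <= Rabs (s - t).
Proof.
  unfold clamp, Rmax, Rmin, Rabs. repeat destruct (Rle_dec _ _); repeat destruct (Rcase_abs _); lra.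
Qed.

(** The polynomial cutoff of [bump] extended by zero. The Lipschitz property of [clamp] suffices for
    the Poisson formula; derivatives are only taken in the integrals over [-1, 1]. *)
Definition plateau (A B : nat) (s : R) : R := (1 - clamp s ^ (2 * B)) ^ A.

Lemma even_pow_bounds s n : -1 <= s <= 1 -> 0 <= s ^ (2 * n) <= 1.
Proof.
  intros H. rewrite pow_mult. split; [apply pow_le; nra|].
  rewrite <- (pow1 n). apply pow_incr. nra.
Qed.

Lemma plateau_out A B s : (1 <= A)%nat -> 1 <= Rabs s -> plateau A B s = 0.
Proof.
  intros HA Hs. unfold plateau.
  assert (E : clamp s ^ (2 * B) = 1).
  { assert (C : clamp s = 1 \/ clamp s = -1).
    { unfold clamp, Rmax, Rmin, Rabs in *. repeat destruct (Rle_dec _ _); destruct (Rcase_abs s); lra. }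
    destruct C as [-> | ->]; [apply pow1|apply pow_1_even]. }
  rewrite E, Rminus_diag. apply pow_i. lia.
Qed.

Lemma one_minus_pow_ge y n : 0 <= y <= 1 -> 1 - INR n * y <= (1 - y) ^ n.
Proof.
  intros H. induction n as [|n IH]; [simpl; lra|].
  rewrite S_INR. change ((1 - y) ^ S n) with ((1 - y) * (1 - y) ^ n).
  assert (0 <= INR n) by apply pos_INR. assert (0 <= INR n * y) by nra.
  assert ((1 - y) * (1 - INR n * y) <= (1 - y) * (1 - y) ^ n) by (apply Rmult_le_compat_l; lra).
  nra.
Qed.

(** The two cutoffs may differ at any distance from s = 0, but only by O(|s|^(2 B)), which the decay
    of ct (T s) converts into a negative power of T. *)
Lemma plateau_defect_le A B s w : (1 <= A)%nat -> 0 <= w <= 1 -> (s <= 1 -> w = 1) ->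
  Rabs (w - plateau A B s) <= INR A * Rabs s ^ (2 * B).
Proof.
  intros HA Hw H1. assert (A1 : 1 <= INR A) by (apply (le_INR 1); auto).
  destruct (Rle_dec (Rabs s) 1) as [L|L].
  - assert (Hs : -1 <= s <= 1) by (apply Rabs_le_between; auto).
    rewrite H1 by lra. unfold plateau. rewrite clamp_id by auto.
    replace (Rabs s ^ (2 * B)) with (s ^ (2 * B)).
    2:{ rewrite !pow_mult. f_equal. simpl. rewrite !Rmult_1_r, <- Rabs_mult, Rabs_right; nra. }
    assert (E := even_pow_bounds s B Hs). assert (Q := one_minus_pow_ge _ A E).
    assert (P : (1 - s ^ (2 * B)) ^ A <= 1)
      by (apply Rle_trans with (1 ^ A); [apply pow_incr; lra|rewrite pow1; lra]).
    rewrite Rabs_right; lra.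
  - rewrite plateau_out by (auto; lra). rewrite Rminus_0_r, Rabs_right by lra.
    assert (1 <= Rabs s ^ (2 * B)) by (apply pow_R1_Rle; lra). nra.
Qed.

Definition bumped (phi : R -> R) (A B : nat) (T z v : R) : R :=
  / sqrt v * (plateau A B (ln (v / z)) * (T * ct phi 0 (T * ln (v / z)))).

Lemma ct_lipschitz phi : csupp phi ->
  exists K, 0 <= K /\ forall s t, Rabs (ct phi 0 s - ct phi 0 t) <= K * Rabs (s - t).
Proof.
  intros Hp.
  assert (Hu : csupp (fun u => u * phi u))
    by (apply (csupp_mult phi (fun u => u)); auto; intros; apply smooth_on_id).
  destruct (ct_decay 0 _ (Hu O)) as [K [K0 HK]]. exists K. split; auto. intros s t.
  destruct (MVT_gen (ct phi 0) t s (ct (fun u => u * phi u) (0 + PI / 2))) as [c [_ E]].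
  - intros x _. apply ct_derive. apply csupp_continuous; auto.
  - intros x _. apply continuity_pt_filterlim. eapply is_derive_continuous.
    apply ct_derive. apply csupp_continuous; auto.
  - rewrite E, Rabs_mult. apply Rmult_le_compat_r; [apply Rabs_pos|].
    specialize (HK (0 + PI / 2) c). simpl in HK. lra.
Qed.

Lemma lip_bumped phi A B : csupp phi ->
  exists K, 0 <= K /\ forall T z, 1 <= T -> 0 < z -> lip (bumped phi A B T z) (K * T) (K * (T * T)).
Proof.
  intros Hp. destruct (ct_lipschitz phi Hp) as [K1 [P1 H1]].
  destruct (ct_decay 0 phi (Hp O)) as [K0 [P0 H0]].
  assert (LP : forall z, 0 < z -> lip (fun v => plateau A B (ln (v / z))) 1 (INR A * (INR (2 * B) * 4))).
  { intros z z0. unfold plateau. apply (lip_pow (fun v => 1 - clamp (ln (v / z)) ^ (2 * B))).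
    assert (L1 : lip (fun v => clamp (ln (v / z))) 1 4).
    { split; [lra|]. intros v w Hv Hw. split; [apply Rabs_le, clamp_bounds|].
      eapply Rle_trans; [apply clamp_lipschitz|]. rewrite !ln_div by lra.
      replace (ln v - ln z - (ln w - ln z)) with (ln v - ln w) by ring. apply ln_lipschitz; auto. }
    destruct (lip_pow _ _ (2 * B) L1) as [Q0 L2]. split; auto.
    intros v w Hv Hw. destruct (L2 v w Hv Hw) as [_ L3].
    assert (E := even_pow_bounds (clamp (ln (v / z))) B (clamp_bounds _)).
    split; [apply Rabs_le; lra|].
    match goal with |- Rabs (1 - ?a - (1 - ?b)) <= _ => replace (1 - a - (1 - b)) with (- (a - b)) by ring end.
    rewrite Rabs_Ropp. auto. }
  set (a1 := INR A * (INR (2 * B) * 4)).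
  assert (a10 : 0 <= a1) by (unfold a1; generalize (pos_INR A) (pos_INR (2 * B)); intros; apply Rmult_le_pos; nra).
  exists (2 * K0 + 2 * (K1 * 4 + K0 * a1) + 4 * K0).
  assert (0 <= K0 * a1) by (apply Rmult_le_pos; auto).
  split; [nra|]. intros T z HT Hz.
  assert (LC : lip (fun v => T * ct phi 0 (T * ln (v / z))) (T * K0) (T * (K1 * (T * 4)))).
  { split; [apply Rmult_le_pos; [lra|apply Rmult_le_pos; lra]|].
    intros v w Hv Hw. split.
    - rewrite Rabs_mult, (Rabs_right T) by lra. apply Rmult_le_compat_l; [lra|].
      specialize (H0 0 (T * ln (v / z))). simpl in H0. lra.
    - rewrite <- Rmult_minus_distr_l, Rabs_mult, (Rabs_right T) by lra.
      rewrite Rmult_assoc. apply Rmult_le_compat_l; [lra|].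
      eapply Rle_trans; [apply H1|]. rewrite Rmult_assoc. apply Rmult_le_compat_l; auto.
      rewrite <- Rmult_minus_distr_l, Rabs_mult, (Rabs_right T), Rmult_assoc by lra.
      apply Rmult_le_compat_l; [lra|]. rewrite !ln_div by lra.
      replace (ln v - ln z - (ln w - ln z)) with (ln v - ln w) by ring. apply ln_lipschitz; auto. }
  unfold bumped.
  eapply lip_le; [apply lip_mult; [apply lip_inv_sqrt|apply lip_mult; [apply LP; auto|exact LC]]| |].
  - assert (0 <= T * K0) by nra. assert (0 <= T * K1) by nra. assert (0 <= T * (K0 * a1)) by nra. nra.
  - fold a1. assert (TT : T <= T * T) by nra.
    assert (T * K0 <= T * T * K0) by (apply Rmult_le_compat_r; auto).
    assert (T * (K0 * a1) <= T * T * (K0 * a1)) by (apply Rmult_le_compat_r; auto).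
    assert (0 <= T * T * K0) by (apply Rmult_le_pos; nra). nra.
Qed.

Lemma bumped_fourier phi A B T z (k N : nat) : csupp phi -> (1 <= A)%nat -> 1 <= T ->
  1 / 2 <= z * exp (-1) -> z * exp 1 <= INR N + 1 / 2 ->
  RInt (fun v => bumped phi A B T z v * cos (2 * PI * INR k * v)) (1 / 2) (INR N + 1 / 2)
  = sqrt z * osc_int (bump A B) phi 0 0 T (INR k * z).
Proof.
  intros Hp HA HT Hz1 Hz2.
  assert (e1 := exp_pos 1). assert (e2 := exp_pos (-1)).
  assert (z0 : 0 < z) by nra.
  destruct (lip_bumped phi A B Hp) as [K [K0 HL]]. specialize (HL T z HT z0).
  set (g := fun v => bumped phi A B T z v * cos (2 * PI * INR k * v)).
  assert (Cg : forall x, 1 / 2 <= x -> continuous g x).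
  { intros x Hx. unfold g. apply continuous_Rmult; [apply (lip_continuous _ _ _ x HL Hx)|apply continuous_cos_freq]. }
  assert (e12 : exp (-1) <= exp 1) by (left; apply exp_increasing; lra).
  assert (G0 : forall v, 1 / 2 <= v -> v <= z * exp (-1) \/ z * exp 1 <= v -> g v = 0).
  { intros v Hv Hc. unfold g, bumped. rewrite plateau_out; [ring|auto|].
    rewrite ln_div by lra. destruct Hc as [Hc|Hc].
    - apply ln_le in Hc; [|lra]. rewrite ln_mult, ln_exp in Hc by auto.
      rewrite Rabs_left1; lra.
    - apply ln_le in Hc; [|nra]. rewrite ln_mult, ln_exp in Hc by auto.
      rewrite Rabs_right; lra. }
  assert (Z0 : forall a b, 1 / 2 <= a <= b -> b <= z * exp (-1) \/ z * exp 1 <= a -> RInt g a b = 0).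
  { intros a b Hab Hc. rewrite (RInt_ext _ (fun _ => 0)).
    - rewrite RInt_const. unfold scal. simpl. unfold mult. simpl. ring.
    - rewrite Rmin_left, Rmax_right by lra. intros x Hx. apply G0; lra. }
  rewrite (RInt_Chasles_cont g (1 / 2) (z * exp (-1))) by (try (intros; apply Cg); nra).
  rewrite (RInt_Chasles_cont g (z * exp (-1)) (z * exp 1)) by (try (intros; apply Cg); nra).
  rewrite (Z0 (1 / 2)), (Z0 (z * exp 1)) by nra. rewrite Rplus_0_l, Rplus_0_r.
  rewrite <- (RInt_comp g (fun s => z * exp s) (fun s => z * exp s) (-1) 1).
  2:{ intros x Hx. apply Cg. rewrite Rmin_left, Rmax_right in Hx by lra.
      assert (exp (-1) <= exp x) by (apply exp_le; lra). nra. }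
  2:{ intros x Hx. split; [auto_derive; auto; ring|].
      eapply is_derive_continuous. auto_derive; auto. }
  unfold osc_int. rewrite <- RInt_Rscal; [|lra|].
  2:{ intros x Hx. apply continuous_Rmult; [|apply continuous_cos_exp].
      apply continuous_osc_weight; auto.
      apply (vanish_on_continuous (-2) (-1) 1 0). 2:lra. simpl. intros y _.
      unfold bump. eapply is_derive_continuous. auto_derive; auto. }
  apply RInt_ext. rewrite Rmin_left, Rmax_right by lra. intros s Hs.
  change (z * exp s * g (z * exp s) = sqrt z *
    (bump A B s * (T * ct phi 0 (T * s)) * cos (2 * PI * (INR k * z) * exp s + 0)) :> R).
  unfold g, bumped, bump, plateau.
  assert (es := exp_pos s).
  replace (z * exp s / z) with (exp s) by (field; lra). rewrite ln_exp, clamp_id by lra.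
  replace (2 * PI * (INR k * z) * exp s + 0) with (2 * PI * INR k * (z * exp s)) by ring.
  rewrite sqrt_mult by lra.
  replace (sqrt (exp s)) with (exp (1 / 2 * s)).
  2:{ symmetry. apply sqrt_lem_1; [lra|left; apply exp_pos|]. rewrite <- exp_plus. f_equal. field. }
  assert (E : exp s = exp (1 / 2 * s) * exp (1 / 2 * s)) by (rewrite <- exp_plus; f_equal; field).
  assert (Ez : z = sqrt z * sqrt z) by (symmetry; apply sqrt_sqrt; lra).
  assert (z1 : 0 < sqrt z) by (apply sqrt_lt_R0; auto).
  assert (h := exp_pos (1 / 2 * s)).
  set (CC := cos (2 * PI * INR k * (z * exp s))). rewrite E. rewrite Ez at 1. field. split; lra.
Qed.

(** Exchanging [w] for the plateau costs O(T^(1 - 2 B)) per term. The plateau version is Lipschitz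
    with support in [z / e, z e], so the truncated Poisson formula applies to it, and its Fourier
    integrals are the [osc_int]. *)
Lemma smoothed_sum_poisson phi A B : csupp phi -> (1 <= A)%nat ->
  exists K, 0 <= K /\ forall T z (w : nat -> R) (N Kf : nat), 1 <= T -> (1 <= Kf)%nat ->
    1 / 2 <= z * exp (-1) -> z * exp 1 <= INR N + 1 / 2 ->
    (forall n, 0 <= w n <= 1) -> (forall n, (1 <= n)%nat -> INR n <= z * exp 1 -> w n = 1) ->
    Rabs (sum1 (fun n => w n * / sqrt (INR n) * (T * ct phi 0 (T * ln (INR n / z)))) N
      - sqrt z * (osc_int (bump A B) phi 0 0 T 0
          + 2 * sum1 (fun k => (1 - INR k / INR Kf) * osc_int (bump A B) phi 0 0 T (INR k * z)) Kf))
    <= K * INR N * (T / T ^ (2 * B) + T * T / sqrt (INR Kf)).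
Proof.
  intros Hp HA. destruct (lip_bumped phi A B Hp) as [K1 [P1 HL]].
  destruct (ct_decay (2 * B) phi (Hp _)) as [K2 [P2 H2]].
  exists (INR A * K2 + 2 * K1). assert (A0 := pos_INR A).
  split; [nra|]. intros T z w N Kf HT HK Hz1 Hz2 Hw Hw1.
  assert (e1 := exp_pos 1). assert (e2 := exp_pos (-1)).
  assert (z0 : 0 < z) by nra.
  specialize (HL T z HT z0).
  assert (Kf0 : 0 < INR Kf) by (apply lt_0_INR; lia).
  assert (sk : 0 < sqrt (INR Kf)) by (apply sqrt_lt_R0; auto).
  assert (F := fejer_poisson (bumped phi A B T z) N Kf (K1 * (T * T)) HK).
  assert (F' := F ltac:(nra) (fun v Hv => lip_continuous _ _ _ v HL Hv)
    (fun v w Hv Hw => proj2 (proj2 HL v w ltac:(lra) ltac:(lra)))). clear F.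
  rewrite (RInt_ext _ (fun v => bumped phi A B T z v * cos (2 * PI * INR 0 * v))) in F'.
  2:{ intros v _. simpl. replace (2 * PI * 0 * v) with 0 by ring. rewrite cos_0.
      change (bumped phi A B T z v = bumped phi A B T z v * 1 :> R). ring. }
  rewrite bumped_fourier in F' by auto.
  rewrite (sum1_ext (fun k => (1 - INR k / INR Kf) * RInt _ _ _) (fun k => sqrt z * ((1 - INR k / INR Kf) * osc_int (bump A B) phi 0 0 T (INR k * z)))) in F'.
  2:{ intros k _. rewrite bumped_fourier by auto. ring. }
  rewrite sum1_scal in F'. simpl (INR 0) in F'. rewrite Rmult_0_l in F'.
  match goal with |- Rabs (?s - ?r) <= _ => set (S1 := s); set (R1 := r) end.
  match type of F' with Rabs (?s - ?r) <= _ => set (S2 := s) in *; replace r with R1 in F' by (unfold R1; ring) end.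
  replace (S1 - R1) with ((S1 - S2) + (S2 - R1)) by ring.
  eapply Rle_trans; [apply Rabs_triang|].
  assert (D : Rabs (S1 - S2) <= INR N * (INR A * K2 * (T / T ^ (2 * B)))).
  { unfold S1, S2. rewrite <- sum1_minus. apply sum1_abs_bound. intros n Hn.
    assert (n1 : 1 <= INR n) by (apply (le_INR 1); lia).
    unfold bumped. set (s := ln (INR n / z)).
    replace (w n * / sqrt (INR n) * (T * ct phi 0 (T * s)) -
      / sqrt (INR n) * (plateau A B s * (T * ct phi 0 (T * s))))
      with (/ sqrt (INR n) * ((w n - plateau A B s) * (T * ct phi 0 (T * s)))) by ring.
    rewrite !Rabs_mult, (Rabs_right T) by lra.
    assert (q1 : 1 <= sqrt (INR n)) by (rewrite <- sqrt_1; apply sqrt_le_1; lra).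
    assert (q2 : Rabs (/ sqrt (INR n)) <= 1).
    { rewrite Rabs_right by (left; apply Rinv_0_lt_compat; lra).
      rewrite <- Rinv_1. apply Rinv_le_contravar; lra. }
    assert (D := plateau_defect_le A B s (w n) HA (Hw n)).
    assert (D' : Rabs (w n - plateau A B s) <= INR A * Rabs s ^ (2 * B)).
    { apply D. intros Hs. apply Hw1; [lia|]. unfold s in Hs.
      rewrite ln_div in Hs by lra. apply Rnot_lt_le. intros Hc.
      apply ln_increasing in Hc; [|nra]. rewrite ln_mult, ln_exp in Hc by auto. lra. }
    specialize (H2 0 (T * s)). rewrite Rabs_mult, (Rabs_right T), Rpow_mult_distr in H2 by lra.
    assert (c0 := Rabs_pos (ct phi 0 (T * s))).
    assert (t0 : 0 < T ^ (2 * B)) by (apply pow_lt; lra).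
    assert (s0 : 0 <= Rabs s ^ (2 * B)) by (apply pow_le, Rabs_pos).
    apply Rle_trans with (1 * (INR A * Rabs s ^ (2 * B) * (T * Rabs (ct phi 0 (T * s))))).
    - apply Rmult_le_compat; auto; [apply Rabs_pos| |].
      + apply Rmult_le_pos; [apply Rabs_pos|nra].
      + apply Rmult_le_compat_r; auto. nra.
    - rewrite Rmult_1_l.
      apply Rmult_le_reg_r with (T ^ (2 * B)); auto.
      replace (INR A * K2 * (T / T ^ (2 * B)) * T ^ (2 * B)) with (INR A * T * K2) by (field; lra).
      replace (INR A * Rabs s ^ (2 * B) * (T * Rabs (ct phi 0 (T * s))) * T ^ (2 * B))
        with (INR A * T * (T ^ (2 * B) * Rabs s ^ (2 * B) * Rabs (ct phi 0 (T * s)))) by ring.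
      apply Rmult_le_compat_l; auto. nra. }
  assert (N0 := pos_INR N).
  set (p := T / T ^ (2 * B)) in *.
  assert (p0 : 0 <= p) by (apply Rlt_le, Rdiv_lt_0_compat; [lra|apply pow_lt; lra]).
  replace (INR N * (K1 * (T * T) * (2 / sqrt (INR Kf)))) with (INR N * (2 * K1 * (T * T / sqrt (INR Kf)))) in F'
    by (field; lra).
  set (r := T * T / sqrt (INR Kf)) in *.
  assert (r0 : 0 <= r) by (apply Rlt_le, Rdiv_lt_0_compat; nra).
  clearbody p r.
  assert (0 <= INR N * (INR A * K2 * r)) by (repeat apply Rmult_le_pos; auto).
  assert (0 <= INR N * (K1 * p)) by (repeat apply Rmult_le_pos; auto).
  nra.
Qed.

(** * Dual frequencies, direct terms and their common lattice sum *)

Lemma vanish_on_weaken_le lo a b n m f : (n <= m)%nat -> vanish_on lo a b m f -> vanish_on lo a b n f.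
Proof. induction 1; auto. intros H1. apply IHle. apply vanish_on_weaken; auto. Qed.

Lemma sum1_ge_term f n j : (forall k, (1 <= k <= n)%nat -> 0 <= f k) -> (1 <= j <= n)%nat ->
  f j <= sum1 f n.
Proof.
  intros H Hj.
  assert (E := sum1_delta f j n).
  rewrite (proj2 (Nat.leb_le 1 j)), (proj2 (Nat.leb_le j n)) in E by lia. simpl in E. rewrite <- E.
  apply sum1_le. intros k Hk. destruct (Nat.eqb k j); [lra|auto].
Qed.

(** The minimum of 1 and (a / m)^2 is at most 4 times a^2 (1 / (m - 1 + a) - 1 / (m + a)), a
    telescoping expression of total below a. *)
Lemma sum_min_inverse_square_le a L (g : nat -> R) K : 0 < a -> 0 <= K ->
  (forall m, (1 <= m <= L)%nat -> Rabs (g m) <= K /\ Rabs (g m) <= K * (a / INR m) ^ 2) ->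
  Rabs (sum1 g L) <= 4 * K * a.
Proof.
  intros a0 K0 H. eapply Rle_trans; [apply sum1_abs|].
  assert (S : forall N, sum1 (fun m => 4 * K * (a * a * (/ (INR m - 1 + a) - / (INR m + a)))) N
    = 4 * K * (a * a * (/ a - / (INR N + a)))).
  { induction N as [|N IH].
    - simpl. replace (0 + a) with a by ring. ring.
    - change (sum1 ?f (S N)) with (sum1 f N + f (S N)). cbv beta. rewrite IH, S_INR.
      replace (INR N + 1 - 1 + a) with (INR N + a) by ring. ring. }
  eapply Rle_trans; [apply sum1_le|rewrite S].
  - intros m Hm. destruct (H m Hm) as [H1 H2].
    assert (m1 : 1 <= INR m) by (apply (le_INR 1); lia).
    set (x := INR m) in *.
    replace (a * a * (/ (x - 1 + a) - / (x + a))) with (a * a / ((x - 1 + a) * (x + a))) by (field; lra).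
    assert (d0 : 0 < (x - 1 + a) * (x + a)) by nra.
    destruct (Rle_dec x a) as [L1|L1].
    + eapply Rle_trans; [exact H1|].
      rewrite Rmult_assoc, (Rmult_comm 4), Rmult_assoc. rewrite <- (Rmult_1_r K) at 1.
      apply Rmult_le_compat_l; auto.
      apply Rmult_le_reg_r with ((x - 1 + a) * (x + a)); auto.
      replace (a * a / ((x - 1 + a) * (x + a)) * 4 * ((x - 1 + a) * (x + a))) with (4 * (a * a))
        by (field; lra). nra.
    + eapply Rle_trans; [exact H2|].
      rewrite Rmult_assoc, (Rmult_comm 4), Rmult_assoc.
      apply Rmult_le_compat_l; auto.
      replace ((a / x) ^ 2) with (a * a / (x * x)) by (field; lra).
      apply Rmult_le_reg_r with ((x - 1 + a) * (x + a) * (x * x)); [apply Rmult_lt_0_compat; nra|].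
      replace (a * a / ((x - 1 + a) * (x + a)) * 4 * ((x - 1 + a) * (x + a) * (x * x)))
        with (a * a * (4 * (x * x))) by (field; lra).
      replace (a * a / (x * x) * ((x - 1 + a) * (x + a) * (x * x)))
        with (a * a * ((x - 1 + a) * (x + a))) by (field; lra).
      apply Rmult_le_compat_l; nra.
  - apply Rmult_le_compat_l; [lra|].
    replace (a * a * (/ a - / (INR L + a))) with (a - a * a * / (INR L + a)) by (field; generalize (pos_INR L); lra).
    assert (0 < / (INR L + a)) by (apply Rinv_0_lt_compat; generalize (pos_INR L); lra).
    assert (0 <= a * a * / (INR L + a)) by (apply Rmult_le_pos; nra). lra.
Qed.

Lemma exp_minus_1_le s : -1 <= s <= 1 -> Rabs (exp s - 1) <= 3 * Rabs s.
Proof.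
  intros H. assert (e3 := exp_le_3). assert (E0 := exp_pos s).
  assert (E1 := exp_ineq1_le s). assert (E2 := exp_ineq1_le (- s)). rewrite exp_Ropp in E2.
  assert (Es : exp s <= 3) by (apply Rle_trans with (exp 1); [apply exp_le; lra|auto]).
  assert (E3 : (1 - s) * exp s <= 1).
  { apply Rle_trans with (/ exp s * exp s); [apply Rmult_le_compat_r; lra|]. rewrite Rinv_l; lra. }
  unfold Rabs. destruct (Rcase_abs s), (Rcase_abs (exp s - 1)); nra.
Qed.

Lemma exp_neg1_ge : / 3 <= exp (-1).
Proof.
  replace (-1) with (- (1)) by ring. rewrite exp_Ropp.
  apply Rinv_le_contravar; [apply exp_pos|apply exp_le_3].
Qed.

(* Abel summation in [m] is used only when no integer is within [Z^4 / mu] of [k x]; near an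
   integer the decay of [osc_int] alone bounds the sum. *)
Lemma dual_term_le phi A B : csupp phi -> (2 <= A)%nat -> (1 <= B)%nat ->
  exists K, 0 <= K /\ forall T Z x mu Cb (gam : nat -> R) (L1 k kX lX : nat),
    1 <= T -> 3 <= Z -> INR A + 1 <= Z -> 0 < x -> 0 < mu -> mu * mu * x = T -> Z ^ 6 <= x * T ->
    Z * mu < INR kX + 1 -> Z * mu * x + Z ^ 4 / mu <= INR lX -> 0 <= Cb ->
    (forall m, Rabs (gam m) <= 1) -> (forall m, (1 <= m)%nat -> INR m <= mu -> gam m = 0) ->
    (INR A + 1 <= mu -> forall th,
       Rabs (2 * sin (th / 2)) ^ A * Rabs (sum1 (fun m => gam m * cos (INR m * th + 0)) L1)
       <= Cb * mu * (2 / mu) ^ A) ->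
    (1 <= k)%nat ->
    Rabs (sum1 (fun m => gam m * osc_int (bump A B) phi 0 0 T (INR k * (INR m * x))) L1)
    <= K * (T / (INR k * x)) * (if Nat.leb k kX then sum1 (nearb (INR k * x) (Z ^ 4 / mu)) lX else 0)
       + K * T * (INR L1 + Cb * mu) / Z ^ A.
Proof.
  intros Hp HA HB.
  assert (V := bump_vanish A B HB).
  destruct (osc_int_decay A _ _ V Hp) as [K1 [P1 H1]].
  destruct (osc_int_decay 2 _ _ (vanish_on_weaken_le _ _ _ 2 A _ HA V) Hp) as [K2 [P2 H2]].
  destruct (osc_int_bounded _ _ (vanish_on_continuous _ _ _ _ _ V) Hp) as [K0 [P0 H0]].
  destruct (ct_decay A phi (Hp A)) as [K3 [P3 H3]].
  destruct (ct_decay 0 phi (Hp O)) as [K4 [P4 H4]].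
  destruct (continuous_bounded (bump A B) (-1) 1) as [Q [Q0 HQ]];
    [lra|intros; apply (vanish_on_continuous _ _ _ _ _ V); lra|].
  assert (PQ : 0 <= 2 * Q * (K3 + K4)) by nra.
  exists (K1 + 4 * (K0 + K2) + 2 * Q * (K3 + K4)). split; [lra|].
  intros T Z x mu Cb gam L1 k kX lX HT HZ HZA Hx Hmu E HZx HkX HlX HCb G1 G2 G3 Hk.
  set (KK := K1 + 4 * (K0 + K2) + 2 * Q * (K3 + K4)).
  assert (k1 : 1 <= INR k) by (apply (le_INR 1); auto).
  assert (L10 := pos_INR L1).
  assert (ZA : 0 < Z ^ A) by (apply pow_lt; lra).
  assert (a0 : 0 < T / (INR k * x)) by (apply Rdiv_lt_0_compat; nra).
  assert (Cm : 0 <= Cb * mu) by nra.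
  assert (R0 : 0 <= KK * T * (INR L1 + Cb * mu) / Z ^ A).
  { apply Rmult_le_pos; [|left; apply Rinv_0_lt_compat; auto].
    apply Rmult_le_pos; [apply Rmult_le_pos; unfold KK; lra|lra]. }
  assert (S0 : 0 <= sum1 (nearb (INR k * x) (Z ^ 4 / mu)) lX)
    by (apply sum1_ge0; intros; apply nearb_bounds).
  assert (M0 : 0 <= KK * (T / (INR k * x)) * (if Nat.leb k kX then sum1 (nearb (INR k * x) (Z ^ 4 / mu)) lX else 0)).
  { apply Rmult_le_pos; [apply Rmult_le_pos; unfold KK; lra|]. destruct (Nat.leb k kX); lra. }
  (* For k > Z mu every surviving m exceeds mu, so k m x >= Z mu^2 x = Z T, and the decay of order
     [A] gives Z^(-A) per term. *)
  destruct (Rle_dec (INR k) (Z * mu)) as [kmu|kmu].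
  2:{ apply Rnot_le_lt in kmu.
      apply Rle_trans with (KK * T * (INR L1 + Cb * mu) / Z ^ A); [|lra].
      apply Rle_trans with (INR L1 * (K1 / Z ^ A)).
      - apply sum1_abs_bound. intros m Hm.
        assert (m1 : 1 <= INR m) by (apply (le_INR 1); lia).
        assert (B0 : 0 <= K1 / Z ^ A) by (apply Rmult_le_pos; auto; left; apply Rinv_0_lt_compat; auto).
        destruct (Rle_dec (INR m) mu) as [Hmm|Hmm].
        { rewrite G2 by (auto; lia). rewrite Rmult_0_l, Rabs_R0. auto. }
        apply Rnot_le_lt in Hmm.
        assert (xi : T * Z <= INR k * (INR m * x)).
        { rewrite <- E. apply Rle_trans with (Z * mu * (mu * x)); [right; ring|].
          apply Rmult_le_compat; [apply Rmult_le_pos; lra|apply Rmult_le_pos; lra|lra|].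
          apply Rmult_le_compat_r; lra. }
        rewrite Rabs_mult.
        apply Rle_trans with (1 * (K1 * (T / (INR k * (INR m * x))) ^ A)).
        { apply Rmult_le_compat; auto using Rabs_pos. apply H1; auto. nra. }
        rewrite Rmult_1_l. unfold Rdiv. apply Rmult_le_compat_l; auto.
        rewrite <- pow_inv. apply pow_incr. split.
        + apply Rlt_le, Rdiv_lt_0_compat; nra.
        + assert (kmx : 0 < INR k * (INR m * x)) by (repeat apply Rmult_lt_0_compat; lra).
          apply Rmult_le_reg_r with (Z * (INR k * (INR m * x))); [apply Rmult_lt_0_compat; lra|].
          replace (/ Z * (Z * (INR k * (INR m * x)))) with (INR k * (INR m * x)) by (field; lra).
          replace (T * / (INR k * (INR m * x)) * (Z * (INR k * (INR m * x)))) with (T * Z) by (field; lra).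
          auto.
      - unfold Rdiv. rewrite <- Rmult_assoc. apply Rmult_le_compat_r; [left; apply Rinv_0_lt_compat; auto|].
        apply Rle_trans with (KK * 1 * INR L1).
        + rewrite Rmult_1_r, Rmult_comm. apply Rmult_le_compat_r; auto. unfold KK. lra.
        + apply Rmult_le_compat; try lra; unfold KK; try nra. }
  assert (kk : Nat.leb k kX = true).
  { apply Nat.leb_le. assert (INR k < INR (S kX)) by (rewrite S_INR; lra).
    apply INR_lt in H. lia. }
  rewrite kk in *.
  destruct (classic (exists l, (1 <= l <= lX)%nat /\ Rabs (INR l - INR k * x) <= Z ^ 4 / mu)) as [[l [Hl Hl2]]|NL].
  - apply Rle_trans with (KK * (T / (INR k * x)) * sum1 (nearb (INR k * x) (Z ^ 4 / mu)) lX); [|lra].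
    assert (S1 : 1 <= sum1 (nearb (INR k * x) (Z ^ 4 / mu)) lX).
    { eapply Rle_trans; [|apply (sum1_ge_term _ _ l)]; auto.
      - unfold nearb. destruct (Rle_dec _ _); [lra|contradiction].
      - intros; apply nearb_bounds. }
    (* With xi = k m x the integral is O(min (1, (T / (k x m))^2)), so the whole sum over m is O(T /
       (k x)), and one nearby integer suffices to carry it. *)
    apply Rle_trans with (4 * (K0 + K2) * (T / (INR k * x))).
    + apply sum_min_inverse_square_le; [auto|lra|].
      intros m Hm. assert (m1 : 1 <= INR m) by (apply (le_INR 1); lia).
      assert (X0 : 0 < INR k * (INR m * x)) by (apply Rmult_lt_0_compat; nra).
      rewrite Rabs_mult. specialize (G1 m).
      assert (B1 := H0 T (INR k * (INR m * x)) 0 0 HT).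
      assert (B2 := H2 T (INR k * (INR m * x)) 0 0 HT X0).
      set (I := Rabs (osc_int _ _ _ _ _ _)) in *. assert (I0 : 0 <= I) by apply Rabs_pos.
      assert (GI : Rabs (gam m) * I <= I) by (generalize (Rabs_pos (gam m)); nra).
      split; [lra|].
      replace (T / (INR k * x) / INR m) with (T / (INR k * (INR m * x))) by (field; lra).
      assert (0 <= (T / (INR k * (INR m * x))) ^ 2) by (apply pow_le, Rlt_le, Rdiv_lt_0_compat; lra).
      nra.
    + apply Rle_trans with (KK * (T / (INR k * x)) * 1).
      * rewrite Rmult_1_r. apply Rmult_le_compat_r; [lra|]. unfold KK. lra.
      * apply Rmult_le_compat_l; auto. apply Rmult_le_pos; unfold KK; lra.
  - apply Rle_trans with (KK * T * (INR L1 + Cb * mu) / Z ^ A); [|lra].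
    (* The sum over m is moved inside the integral, where it becomes a trigonometric sum with angle
       2 pi k x exp s. *)
    set (W := fun s => sum1 (fun m => gam m * cos (INR m * (2 * (PI * (INR k * x * exp s))) + 0)) L1).
    assert (EX : sum1 (fun m => gam m * osc_int (bump A B) phi 0 0 T (INR k * (INR m * x))) L1
      = RInt (fun s => bump A B s * (T * ct phi 0 (T * s)) * W s) (-1) 1).
    { assert (CQ : forall s, -1 <= s <= 1 -> continuous (bump A B) s)
        by (intros; apply (vanish_on_continuous _ _ _ _ _ V); lra).
      assert (CC : forall m s, -1 <= s <= 1 -> continuous (fun s => bump A B s * (T * ct phi 0 (T * s)) *
          cos (2 * PI * (INR k * (INR m * x)) * exp s + 0)) s).
      { intros. apply continuous_Rmult; [apply continuous_osc_weight; auto|apply continuous_cos_exp]. }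
      rewrite (sum1_ext _ (fun m => RInt (fun s => gam m * (bump A B s * (T * ct phi 0 (T * s)) *
          cos (2 * PI * (INR k * (INR m * x)) * exp s + 0))) (-1) 1)).
      2:{ intros m _. unfold osc_int. symmetry. apply RInt_Rscal; [lra|]. intros; apply CC; auto. }
      rewrite <- RInt_sum1; [|lra|].
      2:{ intros m s _ Hs. apply (continuous_Rmult (fun _ => gam m)); [apply continuous_const|auto]. }
      apply RInt_ext. intros s _. unfold W. rewrite <- sum1_scal. apply sum1_ext. intros m _.
      replace (INR m * (2 * (PI * (INR k * x * exp s))) + 0) with (2 * PI * (INR k * (INR m * x)) * exp s + 0)
        by ring. ring. }
    rewrite EX.
    replace (KK * T * (INR L1 + Cb * mu) / Z ^ A) with ((1 - -1) * (KK * T * (INR L1 + Cb * mu) / Z ^ A / 2)) by (field; lra).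
    apply RInt_abs_le; [lra| |].
    { intros s Hs. apply continuous_Rmult.
      - apply continuous_osc_weight; auto. apply (vanish_on_continuous _ _ _ _ _ V); lra.
      - unfold W. apply continuous_sum1. intros m _.
        apply (continuous_Rmult (fun _ => gam m)); [apply continuous_const|].
        eapply is_derive_continuous. auto_derive; auto. }
    intros s Hs.
    assert (WB : Rabs (W s) <= INR L1).
    { rewrite <- (Rmult_1_r (INR L1)). apply sum1_abs_bound. intros m _. rewrite Rabs_mult.
      assert (C := COS_bound (INR m * (2 * (PI * (INR k * x * exp s))) + 0)). apply Rabs_le in C.
      generalize (G1 m) (Rabs_pos (gam m)) (Rabs_pos (cos (INR m * (2 * (PI * (INR k * x * exp s))) + 0))). nra. }
    assert (D : Rabs (ct phi 0 (T * s)) * Rabs (W s) <= (K3 + K4) * (INR L1 + Cb * mu) / Z ^ A).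
    { specialize (H3 0 (T * s)). specialize (H4 0 (T * s)). simpl in H4. rewrite Rmult_1_l in H4.
      assert (C0 := Rabs_pos (ct phi 0 (T * s))). assert (W0 := Rabs_pos (W s)).
      destruct (Rle_dec Z (Rabs (T * s))) as [far|near].
      - apply Rle_trans with (K3 / Z ^ A * INR L1).
        + apply Rmult_le_compat; auto.
          apply Rmult_le_reg_l with (Z ^ A); auto. replace (Z ^ A * (K3 / Z ^ A)) with K3 by (field; lra).
          eapply Rle_trans; [|exact H3]. apply Rmult_le_compat_r; auto. apply pow_incr. lra.
        + unfold Rdiv. rewrite Rmult_assoc, (Rmult_comm (/ Z ^ A)), <- Rmult_assoc.
          apply Rmult_le_compat_r; [left; apply Rinv_0_lt_compat; auto|]. nra.
      - apply Rnot_le_lt in near.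
        set (v := INR k * x * exp s). assert (es := exp_pos s).
        assert (v0 : 0 <= v) by (unfold v; apply Rmult_le_pos; nra).
        assert (xm : Z ^ 3 <= x * mu).
        { assert (x * mu * (x * mu) = x * T) by (rewrite <- E; ring).
          assert (0 < x * mu) by nra.
          apply Rsqr_incr_0; [|apply pow_le; lra|lra].
          unfold Rsqr. rewrite H. replace (Z ^ 3 * Z ^ 3) with (Z ^ 6) by ring. auto. }
        (* For |s| < Z / T the point k x exp s is within 3 Z^2 / mu of k x. No integer lies within
           Z^4 / mu of k x, so a distance Z^2 / mu from the integers survives. *)
        assert (dv : Rabs (v - INR k * x) <= 3 * (Z ^ 2 / mu)).
        { unfold v. replace (INR k * x * exp s - INR k * x) with (INR k * x * (exp s - 1)) by ring.
          rewrite Rabs_mult, Rabs_right by nra.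
          assert (BE := exp_minus_1_le s Hs).
          rewrite Rabs_mult, (Rabs_right T) in near by lra.
          apply Rle_trans with (Z * mu * x * (3 * (Z / T))).
          - apply Rmult_le_compat; [nra|apply Rabs_pos|apply Rmult_le_compat_r; lra|].
            eapply Rle_trans; [exact BE|]. apply Rmult_le_compat_l; [lra|].
            apply Rmult_le_reg_l with T; [lra|]. replace (T * (Z / T)) with Z by (field; lra). lra.
          - right. rewrite <- E. field. split; lra. }
        assert (zm : 0 < Z ^ 2 / mu) by (apply Rdiv_lt_0_compat; [apply pow_lt; lra|lra]).
        assert (z4 : 4 * (Z ^ 2 / mu) <= Z ^ 4 / mu).
        { replace (Z ^ 4 / mu) with (Z ^ 2 * (Z ^ 2 / mu)) by (field; lra).
          apply Rmult_le_compat_r; [lra|]. clear - HZ. nra. }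
        assert (dl : forall l : nat, Z ^ 2 / mu <= Rabs (v - INR l)).
        { intros l. destruct (Nat.eq_dec l 0) as [->|l0].
          (* The integer 0 is not among the counted l >= 1. It is far away because Z^6 <= x T gives
             x mu >= Z^3. *)
          - simpl. rewrite Rminus_0_r, Rabs_right by lra. unfold v.
            assert (e3 : / 3 <= exp s).
            { apply Rle_trans with (exp (-1)); [apply exp_neg1_ge|apply exp_le; lra]. }
            apply Rle_trans with (x * / 3).
            + apply Rmult_le_reg_r with mu; auto.
              apply Rle_trans with (Z * Z); [right; field; lra|].
              assert (Z * Z * 3 <= Z ^ 3) by (clear - HZ; simpl; nra). lra.
            + apply Rmult_le_compat; try lra. clear - k1 Hx. nra.
          - assert (far : Z ^ 4 / mu <= Rabs (INR l - INR k * x)).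
            { destruct (Nat.le_gt_cases l lX) as [ll|ll].
              - apply Rnot_lt_le. intros Hc. apply NL. exists l. split; [lia|lra].
              - assert (INR lX <= INR l) by (apply le_INR; lia).
                assert (INR k * x <= Z * mu * x) by (apply Rmult_le_compat_r; lra).
                rewrite Rabs_right; lra. }
            assert (Tr : Rabs (INR l - INR k * x) <= Rabs (v - INR l) + Rabs (v - INR k * x)).
            { replace (INR l - INR k * x) with (- (v - INR l) + (v - INR k * x)) by ring.
              eapply Rle_trans; [apply Rabs_triang|]. rewrite Rabs_Ropp. lra. }
            lra. }
        destruct (sin_PI_mul_ge v _ v0 dl) as [sv dh].
        (* The distance to the nearest integer never exceeds 1/2, so mu >= 2 Z^2 and the Abel bound
           for [gam] is available. *)
        assert (mu2 : INR A + 1 <= mu).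
        { apply Rmult_le_compat_r with (r := mu) in dh; [|lra].
          replace (Z ^ 2 / mu * mu) with (Z ^ 2) in dh by (field; lra).
          clear - dh HZA HZ. simpl in dh. nra. }
        specialize (G3 mu2 (2 * (PI * v))).
        replace (2 * (PI * v) / 2) with (PI * v) in G3 by field.
        assert (WZ : Rabs (W s) <= Cb * mu / Z ^ A).
        { assert (WE : W s = sum1 (fun m => gam m * cos (INR m * (2 * (PI * v)) + 0)) L1) by reflexivity.
          rewrite <- WE in G3.
          assert (pw : (Z ^ 2 / mu) ^ A <= Rabs (2 * sin (PI * v)) ^ A) by (apply pow_incr; lra).
          assert (P : (Z ^ 2 / mu) ^ A * Rabs (W s) <= Cb * mu * (2 / mu) ^ A).
          { eapply Rle_trans; [|exact G3]. apply Rmult_le_compat_r; auto. }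
          apply Rmult_le_reg_l with ((Z ^ 2 / mu) ^ A); [apply pow_lt; auto|].
          eapply Rle_trans; [exact P|].
          replace ((Z ^ 2 / mu) ^ A * (Cb * mu / Z ^ A)) with (Cb * mu * (Z / mu) ^ A).
          - apply Rmult_le_compat_l; auto. apply pow_incr. split; [apply Rlt_le, Rdiv_lt_0_compat; lra|].
            unfold Rdiv. apply Rmult_le_compat_r; [left; apply Rinv_0_lt_compat; lra|lra].
          - replace (Z ^ 2 / mu) with (Z * (Z / mu)) by (field; lra). rewrite (Rpow_mult_distr Z).
            field. lra. }
        apply Rle_trans with (K4 * (Cb * mu / Z ^ A)).
        + apply Rmult_le_compat; auto.
        + unfold Rdiv. rewrite <- Rmult_assoc.
          apply Rmult_le_compat_r; [left; apply Rinv_0_lt_compat; auto|].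
          apply Rmult_le_compat; lra. }
    rewrite !Rabs_mult, (Rabs_right T) by lra. specialize (HQ s Hs).
    apply Rle_trans with (Q * T * ((K3 + K4) * (INR L1 + Cb * mu) / Z ^ A)).
    + replace (Rabs (bump A B s) * (T * Rabs (ct phi 0 (T * s))) * Rabs (W s))
        with (Rabs (bump A B s) * T * (Rabs (ct phi 0 (T * s)) * Rabs (W s))) by ring.
      apply Rmult_le_compat; auto.
      * apply Rmult_le_pos; [apply Rabs_pos|lra].
      * apply Rmult_le_pos; apply Rabs_pos.
      * apply Rmult_le_compat_r; lra.
    + replace (Q * T * ((K3 + K4) * (INR L1 + Cb * mu) / Z ^ A))
        with (2 * Q * (K3 + K4) * (T * (INR L1 + Cb * mu) / Z ^ A / 2)) by (field; lra).
      replace (KK * T * (INR L1 + Cb * mu) / Z ^ A / 2) with (KK * (T * (INR L1 + Cb * mu) / Z ^ A / 2)) by (field; lra).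
      apply Rmult_le_compat_r; [|unfold KK; lra].
      apply Rmult_le_pos; [|lra]. apply Rmult_le_pos; [|left; apply Rinv_0_lt_compat; auto].
      apply Rmult_le_pos; lra.
Qed.

Lemma sum1_restrict_le f a n : (forall k, (1 <= k)%nat -> 0 <= f k) ->
  sum1 (fun k => if Nat.leb k a then f k else 0) n <= sum1 f a.
Proof.
  intros H. destruct (Nat.le_gt_cases n a) as [L|L].
  - eapply Rle_trans; [|apply (sum1_le_extend f n a L); intros; apply H; lia].
    apply sum1_le. intros k Hk. destruct (Nat.leb_spec k a); [lra|lia].
  - rewrite (sum1_extend _ a n); [|lia|].
    + apply sum1_le. intros k Hk. destruct (Nat.leb_spec k a); [lra|apply H; lia].
    + intros k Hk. destruct (Nat.leb_spec k a); [lia|auto].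
Qed.

Definition double_sum (phi : R -> R) (T x : R) (w1 w2 : nat -> R) (L1 L2 : nat) : R :=
  sum1 (fun m => w1 m * / sqrt (INR m) * sum1 (fun n =>
    w2 n * / sqrt (INR n) * (T * ct phi 0 (T * ln (INR n / (INR m * x))))) L2) L1.

Definition lattice_sum (x tau : R) (kX lX : nat) : R :=
  sum1 (fun k => sum1 (fun l => lattice_weight x tau k l) lX) kX.

Lemma lattice_weight_ge0 x tau k l : 0 < x -> (1 <= k)%nat -> 0 <= lattice_weight x tau k l.
Proof.
  intros Hx Hk. unfold lattice_weight. apply Rmult_le_pos; [apply nearb_bounds|].
  left. apply Rinv_0_lt_compat. apply Rmult_lt_0_compat; [apply lt_0_INR; lia|apply sqrt_lt_R0; auto].
Qed.

Lemma inv_sqrt_le_1 n : (1 <= n)%nat -> 0 < / sqrt (INR n) <= 1.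
Proof.
  intros Hn. assert (n1 : 1 <= INR n) by (apply (le_INR 1); auto).
  assert (q1 : 1 <= sqrt (INR n)) by (rewrite <- sqrt_1; apply sqrt_le_1; lra).
  split; [apply Rinv_0_lt_compat; lra|]. rewrite <- Rinv_1. apply Rinv_le_contravar; lra.
Qed.

(** If |T ln (n / (m x))| >= Z the decay of the transform suffices. Otherwise m <= Z mu puts n
    within 3 Z^2 / mu of m x, and n >= m x / e makes 1 / sqrt (m n) comparable with the lattice
    weight. *)
Lemma direct_term_le phi j : csupp phi ->
  exists K, 0 <= K /\ forall T Z x mu (kX lX m n : nat),
    1 <= T -> 3 <= Z <= T -> 0 < x -> 0 < mu -> mu * mu * x = T ->
    Z * mu < INR kX + 1 -> Z * mu * x + Z ^ 4 / mu <= INR lX ->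
    (1 <= m)%nat -> (1 <= n)%nat -> INR m <= Z * mu ->
    / sqrt (INR m) * (/ sqrt (INR n) * (T * Rabs (ct phi 0 (T * ln (INR n / (INR m * x))))))
    <= K * T * (if Nat.leb m kX then if Nat.leb n lX then lattice_weight x (Z ^ 4 / mu) m n else 0 else 0)
       + K * T / Z ^ j.
Proof.
  intros Hp. destruct (ct_decay 0 phi (Hp O)) as [K0 [P0 H0]].
  destruct (ct_decay j phi (Hp j)) as [K1 [P1 H1]].
  exists (2 * K0 + K1). split; [lra|].
  intros T Z x mu kX lX m n HT HZ Hx Hmu E HkX HlX Hm Hn mmu.
  set (s := ln (INR n / (INR m * x))).
  specialize (H0 0 (T * s)). specialize (H1 0 (T * s)). simpl in H0. rewrite Rmult_1_l in H0.
  set (c := Rabs (ct phi 0 (T * s))) in *. assert (c0 : 0 <= c) by apply Rabs_pos.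
  assert (m1 : 1 <= INR m) by (apply (le_INR 1); auto).
  assert (n1 : 1 <= INR n) by (apply (le_INR 1); auto).
  assert (Im := inv_sqrt_le_1 m Hm). assert (In := inv_sqrt_le_1 n Hn).
  assert (ZJ : 0 < Z ^ j) by (apply pow_lt; lra).
  assert (LW := lattice_weight_ge0 x (Z ^ 4 / mu) m n Hx Hm).
  assert (RR : 0 <= (2 * K0 + K1) * T / Z ^ j)
    by (apply Rmult_le_pos; [nra|left; apply Rinv_0_lt_compat; auto]).
  destruct (Rle_dec Z (Rabs (T * s))) as [far|near].
  - assert (Q : T * c <= (2 * K0 + K1) * T / Z ^ j).
    { apply Rmult_le_reg_r with (Z ^ j); auto.
      replace ((2 * K0 + K1) * T / Z ^ j * Z ^ j) with (T * (2 * K0 + K1)) by (field; lra).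
      rewrite Rmult_assoc. apply Rmult_le_compat_l; [lra|].
      apply Rle_trans with K1; [|lra]. eapply Rle_trans; [|exact H1]. rewrite Rmult_comm.
      apply Rmult_le_compat_r; auto. apply pow_incr; lra. }
    assert (0 <= T * c) by nra.
    assert (/ sqrt (INR n) * (T * c) <= T * c) by nra.
    assert (0 <= / sqrt (INR n) * (T * c)) by nra.
    assert (/ sqrt (INR m) * (/ sqrt (INR n) * (T * c)) <= T * c) by nra.
    assert (0 <= (2 * K0 + K1) * T * (if Nat.leb m kX then if Nat.leb n lX
       then lattice_weight x (Z ^ 4 / mu) m n else 0 else 0)).
    { apply Rmult_le_pos; [nra|]. destruct (Nat.leb m kX), (Nat.leb n lX); lra. }
    lra.
  - apply Rnot_le_lt in near. rewrite Rabs_mult, (Rabs_right T) in near by lra.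
    assert (sZ : Rabs s <= Z / T).
    { apply Rmult_le_reg_l with T; [lra|]. replace (T * (Z / T)) with Z by (field; lra). lra. }
    assert (s1 : -1 <= s <= 1).
    { apply Rabs_le_between. eapply Rle_trans; [exact sZ|].
      apply Rmult_le_reg_r with T; [lra|]. replace (Z / T * T) with Z by (field; lra). lra. }
    assert (mx0 : 0 < INR m * x) by nra.
    assert (En : INR n = INR m * x * exp s).
    { unfold s. rewrite exp_ln by (apply Rdiv_lt_0_compat; lra). field. lra. }
    assert (zm : 0 < Z ^ 2 / mu) by (apply Rdiv_lt_0_compat; [apply pow_lt; lra|lra]).
    assert (z4 : 3 * (Z ^ 2 / mu) <= Z ^ 4 / mu).
    { replace (Z ^ 4 / mu) with (Z ^ 2 * (Z ^ 2 / mu)) by (field; lra). apply Rmult_le_compat_r; nra. }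
    assert (near2 : Rabs (INR n - INR m * x) <= Z ^ 4 / mu).
    { eapply Rle_trans; [|exact z4]. rewrite En.
      replace (INR m * x * exp s - INR m * x) with (INR m * x * (exp s - 1)) by ring.
      rewrite Rabs_mult, (Rabs_right (INR m * x)) by lra.
      apply Rle_trans with (Z * mu * x * (3 * (Z / T))).
      - apply Rmult_le_compat; [lra|apply Rabs_pos|apply Rmult_le_compat_r; lra|].
        eapply Rle_trans; [apply exp_minus_1_le; auto|]. lra.
      - right. rewrite <- E. field. split; lra. }
    assert (mk : Nat.leb m kX = true).
    { apply Nat.leb_le. assert (H : INR m < INR (S kX)) by (rewrite S_INR; lra). apply INR_lt in H. lia. }
    assert (nl : Nat.leb n lX = true).
    { apply Nat.leb_le. apply INR_le. apply Rabs_le_between in near2.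
      assert (INR m * x <= Z * mu * x) by (apply Rmult_le_compat_r; lra). lra. }
    rewrite mk, nl. unfold lattice_weight, nearb.
    destruct (Rle_dec _ _) as [_|C]; [|exfalso; auto].
    apply Rle_trans with ((2 * K0 + K1) * T * (1 / (INR m * sqrt x))); [|lra].
    assert (sm : 0 < sqrt (INR m)) by (apply sqrt_lt_R0; lra).
    assert (sx : 0 < sqrt x) by (apply sqrt_lt_R0; lra).
    assert (smm : sqrt (INR m) * sqrt (INR m) = INR m) by (apply sqrt_sqrt; lra).
    assert (sn : sqrt (INR m) * sqrt x / 2 <= sqrt (INR n)).
    { rewrite <- sqrt_mult by lra.
      replace (sqrt (INR m * x) / 2) with (sqrt (INR m * x * (1 / 4))).
      - apply sqrt_le_1; [nra|lra|]. rewrite En. apply Rmult_le_compat_l; [lra|].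
        apply Rle_trans with (exp (-1)); [|apply exp_le; lra]. generalize exp_neg1_ge. lra.
      - rewrite sqrt_mult by lra. replace (1 / 4) with ((1 / 2) * (1 / 2)) by field.
        rewrite sqrt_square by lra. field. }
    assert (In2 : / sqrt (INR n) <= 2 / (sqrt (INR m) * sqrt x)).
    { replace (2 / (sqrt (INR m) * sqrt x)) with (/ (sqrt (INR m) * sqrt x / 2)) by (field; split; lra).
      apply Rinv_le_contravar; auto. apply Rdiv_lt_0_compat; nra. }
    apply Rle_trans with (/ sqrt (INR m) * (2 / (sqrt (INR m) * sqrt x) * (T * K0))).
    + apply Rmult_le_compat_l; [lra|].
      apply Rmult_le_compat; try lra; [apply Rmult_le_pos; lra|apply Rmult_le_compat_l; lra].
    + replace (/ sqrt (INR m) * (2 / (sqrt (INR m) * sqrt x) * (T * K0)))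
        with (2 * K0 * T * (1 / ((sqrt (INR m) * sqrt (INR m)) * sqrt x))) by (field; split; lra).
      rewrite smm. apply Rmult_le_compat_r; [|nra].
      apply Rlt_le, Rdiv_lt_0_compat; [lra|nra].
Qed.

Lemma direct_part_le phi j : csupp phi ->
  exists K, 0 <= K /\ forall T Z x mu (w1 w2 : nat -> R) (L1 L2 kX lX : nat),
    1 <= T -> 3 <= Z <= T -> 0 < x -> 0 < mu -> mu * mu * x = T ->
    Z * mu < INR kX + 1 -> Z * mu * x + Z ^ 4 / mu <= INR lX ->
    (forall m, Rabs (w1 m) <= 1) -> (forall m, Rabs (w2 m) <= 1) ->
    (forall m, Z * mu < INR m -> w1 m = 0) ->
    Rabs (double_sum phi T x w1 w2 L1 L2)
    <= K * T * lattice_sum x (Z ^ 4 / mu) kX lX + K * T * INR L1 * INR L2 / Z ^ j.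
Proof.
  intros Hp. destruct (direct_term_le phi j Hp) as [K [K0 H]]. exists K. split; auto.
  intros T Z x mu w1 w2 L1 L2 kX lX HT HZ Hx Hmu E HkX HlX W1 W2 W3.
  assert (ZJ : 0 < Z ^ j) by (apply pow_lt; lra).
  assert (TZ : 0 <= K * T / Z ^ j) by (apply Rmult_le_pos; [nra|left; apply Rinv_0_lt_compat; auto]).
  assert (LW := fun m n Hm => lattice_weight_ge0 x (Z ^ 4 / mu) m n Hx Hm).
  unfold double_sum. eapply Rle_trans; [apply sum1_abs|].
  apply Rle_trans with (sum1 (fun m => sum1 (fun n => K * T * (if Nat.leb m kX then
     if Nat.leb n lX then lattice_weight x (Z ^ 4 / mu) m n else 0 else 0) + K * T / Z ^ j) L2) L1).
  - apply sum1_le. intros m Hm. rewrite Rabs_mult.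
    assert (Im := inv_sqrt_le_1 m ltac:(lia)).
    eapply Rle_trans; [apply Rmult_le_compat_l; [apply Rabs_pos|apply sum1_abs]|].
    rewrite <- sum1_scal. apply sum1_le. intros n Hn.
    assert (In := inv_sqrt_le_1 n ltac:(lia)).
    destruct (Rle_dec (INR m) (Z * mu)) as [L|L].
    + eapply Rle_trans; [|apply (H T Z x mu); auto; lia].
      rewrite !Rabs_mult, (Rabs_right T), (Rabs_right (/ sqrt (INR m))), (Rabs_right (/ sqrt (INR n))) by lra.
      set (c := Rabs (ct phi 0 (T * ln (INR n / (INR m * x))))). assert (c0 : 0 <= c) by apply Rabs_pos.
      specialize (W1 m). specialize (W2 n). assert (a0 := Rabs_pos (w1 m)). assert (b0 := Rabs_pos (w2 n)).
      assert (P : 0 <= T * c) by nra.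
      assert (P2 : 0 <= / sqrt (INR n) * (T * c)) by nra.
      replace (Rabs (w1 m) * / sqrt (INR m) * (Rabs (w2 n) * / sqrt (INR n) * (T * c)))
        with (Rabs (w1 m) * (/ sqrt (INR m) * (Rabs (w2 n) * (/ sqrt (INR n) * (T * c))))) by ring.
      set (p := / sqrt (INR n) * (T * c)) in *. set (q := / sqrt (INR m)) in *.
      assert (Rabs (w2 n) * p <= p) by nra.
      assert (0 <= q * (Rabs (w2 n) * p)) by (apply Rmult_le_pos; nra).
      assert (q * (Rabs (w2 n) * p) <= q * p) by (apply Rmult_le_compat_l; lra). nra.
    + rewrite W3 by lra. rewrite Rmult_0_l, Rabs_R0, Rmult_0_l.
      apply Rplus_le_le_0_compat; auto. apply Rmult_le_pos; [nra|].
      destruct (Nat.leb m kX), (Nat.leb n lX); try lra. apply LW; lia.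
  - rewrite (sum1_ext _ (fun m => K * T * (if Nat.leb m kX then sum1 (fun n => if Nat.leb n lX then
        lattice_weight x (Z ^ 4 / mu) m n else 0) L2 else 0) + INR L2 * (K * T / Z ^ j))).
    + rewrite sum1_plus, sum1_const, sum1_scal. apply Rplus_le_compat; [|right; field; lra].
      apply Rmult_le_compat_l; [nra|]. unfold lattice_sum.
      eapply Rle_trans; [|apply (sum1_restrict_le _ kX L1)].
      * apply sum1_le. intros m Hm. destruct (Nat.leb m kX); [|lra].
        apply sum1_restrict_le. intros; apply LW; lia.
      * intros m Hm. apply sum1_ge0. intros; apply LW; lia.
    + intros m Hm. rewrite sum1_plus, sum1_const, sum1_scal. f_equal. f_equal.
      destruct (Nat.leb m kX); auto. apply sum1_zero.
Qed.

Lemma double_sum_minus phi T x u v w2 L1 L2 :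
  double_sum phi T x (fun m => u m - v m) w2 L1 L2
  = double_sum phi T x u w2 L1 L2 - double_sum phi T x v w2 L1 L2.
Proof. unfold double_sum. rewrite <- sum1_minus. apply sum1_ext. intros; ring. Qed.

(** Poisson summation in n gives sqrt x times the sums over m of [dual_term_le]; the zero frequency
    is negligible by [osc_int_mean_decay]. Since sqrt x times T / (k x) is T / (k sqrt x), the near
    integers again form a lattice sum, with [k] now in the place of [m]: direct and dual terms have
    one and the same bound. *)
Lemma dual_part_le phi A : csupp phi -> (2 <= A)%nat ->
  exists K, 0 <= K /\ forall T Z x mu Cb (gam : nat -> R) (L1 N2 kX lX Kf : nat),
    1 <= T -> 3 <= Z <= T -> INR A + 1 <= Z -> 0 < x -> 0 < mu -> mu * mu * x = T -> Z ^ 6 <= x * T ->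
    Z * mu < INR kX + 1 -> Z * mu * x + Z ^ 4 / mu <= INR lX -> 0 <= Cb ->
    (forall m, Rabs (gam m) <= 1) -> (forall m, (1 <= m)%nat -> INR m <= mu -> gam m = 0) ->
    (INR A + 1 <= mu -> forall th,
       Rabs (2 * sin (th / 2)) ^ A * Rabs (sum1 (fun m => gam m * cos (INR m * th + 0)) L1)
       <= Cb * mu * (2 / mu) ^ A) ->
    (1 <= Kf)%nat -> (1 <= N2)%nat -> 3 * INR L1 * x <= INR N2 ->
    let L2 := ((A + 1) * N2)%nat in
    Rabs (double_sum phi T x gam (cutoff N2 A L2) L1 L2)
    <= K * T * lattice_sum x (Z ^ 4 / mu) kX lX
       + K * (T * INR L1 * INR L2 / Z ^ A + INR L1 * INR L2 * (T * T) / sqrt (INR Kf)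
              + sqrt x * INR Kf * T * (INR L1 + Cb * mu) / Z ^ A).
Proof.
  intros Hp HA.
  destruct (smoothed_sum_poisson phi A A Hp ltac:(lia)) as [K1 [P1 H1]].
  destruct (osc_int_mean_decay A _ _ (bump_vanish A A ltac:(lia)) Hp) as [K2 [P2 H2]].
  destruct (dual_term_le phi A A Hp HA ltac:(lia)) as [K3 [P3 H3]].
  exists (K1 + K2 + 2 * K3). split; [lra|].
  intros T Z x mu Cb gam L1 N2 kX lX Kf HT HZ HZA Hx Hmu E HZx HkX HlX HCb G1 G2 G3 HKf HN2 HN L2.
  set (I := osc_int (bump A A) phi 0 0 T) in *.
  set (inner := fun m => sum1 (fun n => cutoff N2 A L2 n * / sqrt (INR n)
    * (T * ct phi 0 (T * ln (INR n / (INR m * x))))) L2).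
  set (P := fun m => I 0 + 2 * sum1 (fun k => (1 - INR k / INR Kf) * I (INR k * (INR m * x))) Kf).
  set (err := K1 * INR L2 * (T / T ^ (2 * A) + T * T / sqrt (INR Kf))).
  assert (L1p := pos_INR L1). assert (L2p := pos_INR L2).
  assert (Kf1 : 1 <= INR Kf) by (apply (le_INR 1); auto).
  assert (sk : 0 < sqrt (INR Kf)) by (apply sqrt_lt_R0; lra).
  assert (sx : 0 < sqrt x) by (apply sqrt_lt_R0; lra).
  assert (sxx : sqrt x * sqrt x = x) by (apply sqrt_sqrt; lra).
  assert (TA : 0 < T ^ (2 * A)) by (apply pow_lt; lra).
  assert (ZA : 0 < Z ^ A) by (apply pow_lt; lra).
  assert (TTA : 0 < T ^ A) by (apply pow_lt; lra).
  assert (ZT : Z ^ A <= T ^ A) by (apply pow_incr; lra).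
  assert (err0 : 0 <= err).
  { unfold err. apply Rmult_le_pos; [nra|]. apply Rplus_le_le_0_compat; apply Rlt_le, Rdiv_lt_0_compat; nra. }
  assert (xm : Z ^ 3 <= x * mu).
  { assert (EE : x * mu * (x * mu) = x * T) by (rewrite <- E; ring).
    assert (0 < x * mu) by nra.
    apply Rsqr_incr_0; [|apply pow_le; lra|lra].
    unfold Rsqr. rewrite EE. replace (Z ^ 3 * Z ^ 3) with (Z ^ 6) by ring. auto. }
  assert (z27 : 27 <= Z ^ 3) by (replace 27 with (3 ^ 3) by ring; apply pow_incr; lra).
  assert (S1 : forall m, (1 <= m <= L1)%nat ->
     Rabs (gam m * / sqrt (INR m) * inner m - sqrt x * (gam m * P m)) <= err).
  { intros m Hm. assert (m1 : 1 <= INR m) by (apply (le_INR 1); lia).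
    destruct (Rle_dec (INR m) mu) as [L|L].
    - rewrite G2 by (auto; lia).
      replace (0 * / sqrt (INR m) * inner m - sqrt x * (0 * P m)) with 0 by ring. rewrite Rabs_R0. auto.
    - apply Rnot_le_lt in L. assert (mx : 27 <= INR m * x) by nra.
      assert (mL : INR m <= INR L1) by (apply le_INR; lia).
      assert (e3 := exp_neg1_ge). assert (e4 := exp_le_3). assert (e5 := exp_pos 1).
      (* As e <= 3, the hypothesis 3 L1 x <= N2 makes the cutoff in n equal to 1 for all n up to e m
         x. *)
      assert (ze : INR m * x * exp 1 <= INR N2).
      { apply Rle_trans with (3 * INR L1 * x); auto.
        apply Rle_trans with (INR m * x * 3); [apply Rmult_le_compat_l; lra|].
        replace (3 * INR L1 * x) with (INR L1 * x * 3) by ring.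
        apply Rmult_le_compat_r; [lra|]. apply Rmult_le_compat_r; lra. }
      assert (NL : INR N2 <= INR L2) by (apply le_INR; unfold L2; nia).
      assert (Q : Rabs (inner m - sqrt (INR m * x) * P m) <= err).
      { apply (H1 T (INR m * x) (cutoff N2 A L2) L2 Kf HT HKf).
        - nra.
        - lra.
        - intros n. apply cutoff_bounds; auto.
        - intros n Hn Hn2. apply cutoff_eq1; auto.
          assert (INR n <= INR N2) by lra. apply INR_le in H. unfold L2. nia. }
      assert (sm : 0 < sqrt (INR m)) by (apply sqrt_lt_R0; lra).
      replace (gam m * / sqrt (INR m) * inner m - sqrt x * (gam m * P m))
        with (gam m * / sqrt (INR m) * (inner m - sqrt (INR m * x) * P m)).
      2:{ rewrite sqrt_mult by lra. field. lra. }
      rewrite !Rabs_mult. assert (Im := inv_sqrt_le_1 m ltac:(lia)).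
      rewrite (Rabs_right (/ sqrt (INR m))) by lra.
      specialize (G1 m). assert (g0 := Rabs_pos (gam m)).
      assert (q0 := Rabs_pos (inner m - sqrt (INR m * x) * P m)).
      assert (Rabs (gam m) * / sqrt (INR m) <= 1) by nra.
      assert (0 <= Rabs (gam m) * / sqrt (INR m)) by nra. nra. }
  assert (S2 : Rabs (double_sum phi T x gam (cutoff N2 A L2) L1 L2 - sqrt x * sum1 (fun m => gam m * P m) L1)
     <= INR L1 * err).
  { rewrite <- sum1_scal. unfold double_sum. rewrite <- sum1_minus. apply sum1_abs_bound. exact S1. }
  assert (S3 : sum1 (fun m => gam m * P m) L1 = I 0 * sum1 gam L1
     + 2 * sum1 (fun k => (1 - INR k / INR Kf) * sum1 (fun m => gam m * I (INR k * (INR m * x))) L1) Kf).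
  { unfold P.
    rewrite (sum1_ext _ (fun m => I 0 * gam m + 2 * sum1 (fun k => (1 - INR k / INR Kf) * (gam m * I (INR k * (INR m * x)))) Kf)).
    - rewrite sum1_plus, !sum1_scal, sum1_swap. f_equal. f_equal. apply sum1_ext. intros k _.
      apply sum1_scal.
    - intros m _. rewrite Rmult_plus_distr_l.
      rewrite (sum1_ext (fun k => (1 - INR k / INR Kf) * (gam m * I (INR k * (INR m * x))))
         (fun k => gam m * ((1 - INR k / INR Kf) * I (INR k * (INR m * x))))) by (intros; ring).
      rewrite sum1_scal. ring. }
  set (S_ := fun k => if Nat.leb k kX then sum1 (nearb (INR k * x) (Z ^ 4 / mu)) lX else 0).
  assert (S_0 : forall k, 0 <= S_ k).
  { intros k. unfold S_. destruct (Nat.leb k kX); [|lra]. apply sum1_ge0; intros; apply nearb_bounds. }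
  set (rr := K3 * T * (INR L1 + Cb * mu) / Z ^ A).
  assert (rr0 : 0 <= rr).
  { unfold rr. apply Rmult_le_pos; [|left; apply Rinv_0_lt_compat; auto].
    apply Rmult_le_pos; nra. }
  assert (S4 : Rabs (sum1 (fun k => (1 - INR k / INR Kf) * sum1 (fun m => gam m * I (INR k * (INR m * x))) L1) Kf)
     <= sum1 (fun k => K3 * (T / (INR k * x)) * S_ k) Kf + INR Kf * rr).
  { eapply Rle_trans; [apply sum1_abs|]. rewrite <- (sum1_const rr), <- sum1_plus. apply sum1_le.
    intros k Hk. rewrite Rabs_mult.
    assert (kk : 0 <= INR k / INR Kf <= 1).
    { split; [apply Rmult_le_pos; [apply pos_INR|left; apply Rinv_0_lt_compat; lra]|].
      apply Rmult_le_reg_r with (INR Kf); [lra|]. unfold Rdiv. rewrite Rmult_assoc, Rinv_l by lra.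
      assert (INR k <= INR Kf) by (apply le_INR; lia). lra. }
    rewrite (Rabs_right (1 - INR k / INR Kf)) by lra.
    assert (Q := H3 T Z x mu Cb gam L1 k kX lX HT ltac:(lra) HZA Hx Hmu E HZx HkX HlX HCb G1 G2 G3 ltac:(lia)).
    fold I (S_ k) rr in Q.
    assert (q0 := Rabs_pos (sum1 (fun m => gam m * I (INR k * (INR m * x))) L1)). nra. }
  assert (S5 : sqrt x * sum1 (fun k => K3 * (T / (INR k * x)) * S_ k) Kf <= K3 * T * lattice_sum x (Z ^ 4 / mu) kX lX).
  { rewrite <- sum1_scal. unfold lattice_sum. rewrite <- sum1_scal.
    eapply Rle_trans; [|apply (sum1_restrict_le _ kX Kf)].
    - apply sum1_le. intros k Hk. assert (k1 : 1 <= INR k) by (apply (le_INR 1); lia).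
      unfold S_. destruct (Nat.leb k kX); [|right; ring].
      right. unfold lattice_weight, Rdiv. rewrite sum1_scal_r.
      rewrite <- sxx at 2.
      field. lra.
    - intros k Hk. apply Rmult_le_pos; [nra|]. apply sum1_ge0. intros; apply lattice_weight_ge0; auto. }
  assert (S6 : Rabs (I 0 * sum1 gam L1) <= K2 / Z ^ A * INR L1).
  { rewrite Rabs_mult. apply Rmult_le_compat; try apply Rabs_pos.
    - eapply Rle_trans; [apply (H2 T 0 HT)|]. apply Rmult_le_compat_l; auto. apply Rinv_le_contravar; auto.
    - rewrite <- (Rmult_1_r (INR L1)). apply sum1_abs_bound. intros; apply G1. }
  rewrite S3 in S2.
  set (X1 := I 0 * sum1 gam L1) in *.
  set (X2 := sum1 (fun k => (1 - INR k / INR Kf) * sum1 (fun m => gam m * I (INR k * (INR m * x))) L1) Kf) in *.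
  set (X3 := sum1 (fun k => K3 * (T / (INR k * x)) * S_ k) Kf) in *.
  set (DS := double_sum phi T x gam (cutoff N2 A L2) L1 L2) in *.
  assert (F : Rabs DS <= INR L1 * err + sqrt x * (K2 / Z ^ A * INR L1) + 2 * (K3 * T * lattice_sum x (Z ^ 4 / mu) kX lX)
     + 2 * (sqrt x * (INR Kf * rr))).
  { replace DS with ((DS - sqrt x * (X1 + 2 * X2)) + sqrt x * (X1 + 2 * X2)) by ring.
    eapply Rle_trans; [apply Rabs_triang|]. rewrite (Rabs_mult (sqrt x)), (Rabs_right (sqrt x)) by lra.
    assert (Y : Rabs (X1 + 2 * X2) <= Rabs X1 + 2 * Rabs X2).
    { eapply Rle_trans; [apply Rabs_triang|]. rewrite (Rabs_mult 2), (Rabs_right 2) by lra. lra. }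
    assert (Y2 : sqrt x * Rabs (X1 + 2 * X2) <= sqrt x * (K2 / Z ^ A * INR L1 + 2 * (X3 + INR Kf * rr))).
    { apply Rmult_le_compat_l; lra. }
    lra. }
  eapply Rle_trans; [exact F|].
  set (LS := lattice_sum x (Z ^ 4 / mu) kX lX).
  assert (LS0 : 0 <= LS).
  { unfold LS, lattice_sum. apply sum1_ge0. intros. apply sum1_ge0. intros. apply lattice_weight_ge0; auto; lia. }
  assert (F1 : INR L1 * err <= K1 * (T * INR L1 * INR L2 / Z ^ A + INR L1 * INR L2 * (T * T) / sqrt (INR Kf))).
  { unfold err.
    replace (INR L1 * (K1 * INR L2 * (T / T ^ (2 * A) + T * T / sqrt (INR Kf))))
      with (K1 * (T * INR L1 * INR L2 / T ^ (2 * A) + INR L1 * INR L2 * (T * T) / sqrt (INR Kf))) by (field; lra).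
    apply Rmult_le_compat_l; auto. apply Rplus_le_compat_r. apply Rmult_le_compat_l.
    - apply Rmult_le_pos; nra.
    - apply Rinv_le_contravar; auto. apply Rle_trans with (T ^ A); auto. apply Rle_pow; [lra|lia]. }
  set (B1 := T * INR L1 * INR L2 / Z ^ A) in *.
  set (B2 := INR L1 * INR L2 * (T * T) / sqrt (INR Kf)) in *.
  set (B3 := sqrt x * INR Kf * T * (INR L1 + Cb * mu) / Z ^ A).
  assert (iz : 0 < / Z ^ A) by (apply Rinv_0_lt_compat; auto).
  assert (B10 : 0 <= B1) by (unfold B1; apply Rmult_le_pos; [apply Rmult_le_pos; [apply Rmult_le_pos; lra|lra]|lra]).
  assert (B20 : 0 <= B2) by (unfold B2; apply Rmult_le_pos;
    [apply Rmult_le_pos; apply Rmult_le_pos; lra|left; apply Rinv_0_lt_compat; lra]).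
  assert (Cm : 0 <= Cb * mu) by (apply Rmult_le_pos; lra).
  assert (F2 : sqrt x * (K2 / Z ^ A * INR L1) <= K2 * B3).
  { unfold B3. replace (sqrt x * (K2 / Z ^ A * INR L1)) with (K2 * (sqrt x * (1 * 1) * INR L1 * / Z ^ A)) by (field; lra).
    apply Rmult_le_compat_l; auto. unfold Rdiv. apply Rmult_le_compat_r; [lra|].
    rewrite (Rmult_assoc (sqrt x) (INR Kf)). apply Rmult_le_compat; try nra.
    apply Rmult_le_compat_l; [lra|]. apply Rmult_le_compat; lra. }
  assert (F3 : sqrt x * (INR Kf * rr) = K3 * B3) by (unfold rr, B3; field; lra).
  assert (B30 : 0 <= B3).
  { unfold B3. apply Rmult_le_pos; [|lra]. apply Rmult_le_pos; [|lra]. apply Rmult_le_pos; [apply Rmult_le_pos; lra|lra]. }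
  clearbody B1 B2 B3 LS err rr.
  assert (0 <= T * LS) by (apply Rmult_le_pos; lra). assert (0 <= K1 * B3) by (apply Rmult_le_pos; lra). assert (0 <= K2 * (T * LS)) by (apply Rmult_le_pos; lra).
  assert (0 <= K1 * (T * LS)) by (apply Rmult_le_pos; lra). assert (0 <= K2 * (B1 + B2)) by (apply Rmult_le_pos; lra). assert (0 <= K3 * (B1 + B2)) by (apply Rmult_le_pos; lra).
  lra.
Qed.

(* The terms with [m <= mu] are split off by the cutoff at [floor mu]; the rest goes to the dual side. *)
Lemma smoothed_double_sum_le phi A : csupp phi -> (2 <= A)%nat ->
  exists K, 0 <= K /\ forall T Z x mu (N1 N2 kX lX Kf : nat),
    1 <= T -> 3 <= Z <= T -> INR A + 1 <= Z -> 0 < x -> 0 < mu -> mu * mu * x = T -> Z ^ 6 <= x * T ->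
    Z * mu < INR kX + 1 -> Z * mu * x + Z ^ 4 / mu <= INR lX ->
    (1 <= Kf)%nat -> (1 <= N1)%nat -> (1 <= N2)%nat -> mu <= INR N1 ->
    let L1 := ((A + 1) * N1)%nat in let L2 := ((A + 1) * N2)%nat in
    3 * INR L1 * x <= INR N2 ->
    Rabs (double_sum phi T x (cutoff N1 A L1) (cutoff N2 A L2) L1 L2)
    <= K * T * lattice_sum x (Z ^ 4 / mu) kX lX
       + K * (T * INR L1 * INR L2 / Z ^ A + INR L1 * INR L2 * (T * T) / sqrt (INR Kf)
              + sqrt x * INR Kf * T * INR L1 / Z ^ A).
Proof.
  intros Hp HA.
  destruct (direct_part_le phi A Hp) as [K1 [P1 H1]].
  destruct (dual_part_le phi A Hp HA) as [K2 [P2 H2]].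
  set (Cb := 2 * INR (A + 1) * 2 ^ A).
  assert (Cb0 : 0 <= Cb) by (unfold Cb; apply Rmult_le_pos; [generalize (pos_INR (A + 1)); lra|apply pow_le; lra]).
  exists (K1 + K2 * (1 + Cb)). split; [nra|].
  intros T Z x mu N1 N2 kX lX Kf HT HZ HZA Hx Hmu E HZx HkX HlX HKf HN1 HN2 muN L1 L2 HN.
  destruct (nfloor_ex mu ltac:(lra)) as [M [M1 M2]].
  assert (MN : (M <= N1)%nat) by (apply INR_le; lra).
  (* The maximum with 1 only keeps the averaging length positive. For M = 0 the end point is 0, and
     [al] vanishes at every m >= 1. *)
  set (al := cutoff (Nat.max 1 M) A ((A + 1) * M)).
  set (om := cutoff N1 A L1).
  assert (al01 : forall m, 0 <= al m <= 1) by (intros; apply cutoff_bounds; lia).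
  assert (om01 : forall m, 0 <= om m <= 1) by (intros; apply cutoff_bounds; lia).
  assert (E1 : double_sum phi T x om (cutoff N2 A L2) L1 L2
    = double_sum phi T x (fun m => om m - al m) (cutoff N2 A L2) L1 L2
      + double_sum phi T x al (cutoff N2 A L2) L1 L2) by (rewrite double_sum_minus; ring).
  rewrite E1. eapply Rle_trans; [apply Rabs_triang|].
  assert (D1 := H1 T Z x mu al (cutoff N2 A L2) L1 L2 kX lX HT HZ Hx Hmu E HkX HlX).
  assert (D2 := H2 T Z x mu Cb (fun m => om m - al m) L1 N2 kX lX Kf HT HZ HZA Hx Hmu E HZx HkX HlX Cb0).
  cbv zeta in D2. fold L2 in D2.
  assert (F1 := D1 ltac:(intros; apply Rabs_le; generalize (al01 m); lra)
     ltac:(intros; apply Rabs_le; generalize (cutoff_bounds N2 A L2 m HN2); lra)). clear D1.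
  assert (G1 : forall m, Z * mu < INR m -> al m = 0).
  { intros m Hm. apply cutoff_eq0. apply INR_lt. rewrite mult_INR, plus_INR. simpl (INR 1).
    eapply Rle_lt_trans; [|exact Hm]. generalize (pos_INR A) (pos_INR M). intros. apply Rmult_le_compat; lra. }
  specialize (F1 G1).
  assert (G2 : forall m, (1 <= m)%nat -> INR m <= mu -> om m - al m = 0).
  { intros m Hm Hm2. assert (mM : (m <= M)%nat).
    { assert (H : INR m < INR (S M)) by (rewrite S_INR; lra). apply INR_lt in H. lia. }
    unfold om, al. rewrite (Nat.max_r 1 M) by lia. apply (band_eq0 A N1 M m); lia. }
  assert (G3 : INR A + 1 <= mu -> forall th,
       Rabs (2 * sin (th / 2)) ^ A * Rabs (sum1 (fun m => (om m - al m) * cos (INR m * th + 0)) L1)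
       <= Cb * mu * (2 / mu) ^ A).
  { intros Hmu1 th. assert (AM : (A <= M)%nat).
    { assert (H : INR A < INR (S M)) by (rewrite S_INR; lra). apply INR_lt in H. lia. }
    unfold om, al. rewrite (Nat.max_r 1 M) by lia.
    eapply Rle_trans; [apply (band_cos_le A N1 M th 0); lia|]. fold Cb.
    rewrite Rmult_assoc. apply Rmult_le_compat_l; auto.
    assert (a2 : 2 <= INR A) by (apply (le_INR 2); auto).
    assert (M0 : 0 < INR M) by lra.
    unfold Rdiv at 1. rewrite <- pow_inv. apply Rmult_le_compat; try lra.
    - apply pow_le. left. apply Rinv_0_lt_compat; auto.
    - apply pow_incr. split; [left; apply Rinv_0_lt_compat; auto|].
      replace (2 / mu) with (/ (mu / 2)) by (field; lra). apply Rinv_le_contravar; lra. }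
  assert (F2 := D2 ltac:(intros m; apply Rabs_le; generalize (al01 m) (om01 m); lra) G2 G3 HKf HN2 HN). clear D2.
  assert (muL : mu <= INR L1).
  { eapply Rle_trans; [exact muN|]. apply le_INR. unfold L1. nia. }
  assert (L1p := pos_INR L1). assert (L2p := pos_INR L2).
  assert (ZA : 0 < / Z ^ A) by (apply Rinv_0_lt_compat, pow_lt; lra).
  assert (Kf1 : 1 <= INR Kf) by (apply (le_INR 1); auto).
  assert (sk : 0 < / sqrt (INR Kf)) by (apply Rinv_0_lt_compat, sqrt_lt_R0; lra).
  assert (sx : 0 < sqrt x) by (apply sqrt_lt_R0; lra).
  assert (F3 : sqrt x * INR Kf * T * (INR L1 + Cb * mu) / Z ^ A <= (1 + Cb) * (sqrt x * INR Kf * T * INR L1 / Z ^ A)).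
  { replace ((1 + Cb) * (sqrt x * INR Kf * T * INR L1 / Z ^ A))
      with (sqrt x * INR Kf * T * (INR L1 + Cb * INR L1) / Z ^ A) by (unfold Rdiv; ring).
    apply Rmult_le_compat_r; [lra|]. apply Rmult_le_compat_l; [|nra].
    apply Rmult_le_pos; [nra|lra]. }
  set (LS := lattice_sum x (Z ^ 4 / mu) kX lX) in *.
  assert (LS0 : 0 <= LS).
  { unfold LS, lattice_sum. apply sum1_ge0. intros. apply sum1_ge0. intros. apply lattice_weight_ge0; auto; lia. }
  replace (K1 * T * INR L1 * INR L2 / Z ^ A) with (K1 * (T * INR L1 * INR L2 / Z ^ A)) in F1 by (unfold Rdiv; ring).
  set (B1 := T * INR L1 * INR L2 / Z ^ A) in *.
  set (B2 := INR L1 * INR L2 * (T * T) / sqrt (INR Kf)) in *.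
  set (B3 := sqrt x * INR Kf * T * INR L1 / Z ^ A) in *.
  assert (B10 : 0 <= B1) by (unfold B1; apply Rmult_le_pos; [apply Rmult_le_pos; [apply Rmult_le_pos; lra|lra]|lra]).
  assert (B20 : 0 <= B2) by (unfold B2; apply Rmult_le_pos; [apply Rmult_le_pos; apply Rmult_le_pos; lra|lra]).
  assert (B30 : 0 <= B3) by (unfold B3; apply Rmult_le_pos; [apply Rmult_le_pos; [apply Rmult_le_pos; [apply Rmult_le_pos; lra|lra]|lra]|lra]).
  set (X3 := sqrt x * INR Kf * T * (INR L1 + Cb * mu) / Z ^ A) in *.
  clearbody B1 B2 B3 LS X3.
  assert (TL : 0 <= T * LS) by (apply Rmult_le_pos; lra).
  assert (K2 * X3 <= K2 * ((1 + Cb) * B3)) by (apply Rmult_le_compat_l; lra).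
  assert (KC : 0 <= K2 * Cb) by (apply Rmult_le_pos; auto).
  assert (0 <= K2 * Cb * (T * LS)) by (apply Rmult_le_pos; auto).
  assert (0 <= K2 * Cb * (B1 + B2)) by (apply Rmult_le_pos; auto; lra).
  assert (0 <= K1 * (B2 + B3)) by (apply Rmult_le_pos; lra).
  lra.
Qed.

(** * Twisted mean squares *)

(* [c = 0] and [c = PI / 2] give the real and imaginary parts of [sum w(n) n^(-1/2-it)]. *)
Definition tpoly (w : nat -> R) (N : nat) (c t : R) : R :=
  sum1 (fun n => w n * osc t (-1 / 2) c (INR n)) N.

Lemma osc_neg_half t c n : (1 <= n)%nat ->
  osc t (-1 / 2) c (INR n) = / sqrt (INR n) * cos (t * ln (INR n) + c).
Proof.
  intros Hn. unfold osc. rewrite exp_ln_neg_half; auto. apply lt_0_INR. lia.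
Qed.

(* Real and imaginary parts of [U(t)] times the conjugate of [V(t)]. *)
Definition re_prod (u v : nat -> R) (N M : nat) (t : R) : R :=
  tpoly u N 0 t * tpoly v M 0 t + tpoly u N (PI / 2) t * tpoly v M (PI / 2) t.

Definition im_prod (u v : nat -> R) (N M : nat) (t : R) : R :=
  tpoly u N (PI / 2) t * tpoly v M 0 t - tpoly u N 0 t * tpoly v M (PI / 2) t.

(* The sine term, negligible when [u] and [v] approximate the same function, cancels the
   frequencies with [+ y]. *)
Lemma twisted_product_expand u v N M t y :
  re_prod u v N M t * cos y + im_prod u v N M t * sin y =
  sum1 (fun m => sum1 (fun n => u m * v n * (/ sqrt (INR m) * / sqrt (INR n))
     * cos (t * (ln (INR n) - ln (INR m)) - y)) M) N.
Proof.
  unfold re_prod, im_prod, tpoly. rewrite !sum1_mult, <- sum1_plus, <- sum1_minus, <- !sum1_scal_r, <- sum1_plus.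
  apply sum1_ext. intros m Hm. rewrite <- sum1_plus, <- sum1_minus, <- !sum1_scal_r, <- sum1_plus.
  apply sum1_ext. intros n Hn. rewrite !osc_neg_half by lia.
  rewrite !cos_plus, cos_0, sin_0, cos_PI2, sin_PI2.
  replace (t * (ln (INR n) - ln (INR m)) - y) with (t * ln (INR n) - t * ln (INR m) - y) by ring.
  rewrite (cos_minus (t * ln (INR n) - t * ln (INR m)) y), cos_minus, sin_minus. ring.
Qed.

Lemma im_prod_diag b N t : im_prod b b N N t = 0.
Proof. unfold im_prod. ring. Qed.

(** The products |B|^2 cos y and |B|^2 sin y are double sums in a, c by [twisted_product_expand] at
    y and y - pi / 2, since the imaginary product of B with itself is 0. Inserting them merges the
    four variables into one cosine. *)
Lemma quadruple_product_expand b Nb u v N M t y :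
  re_prod b b Nb Nb t * (re_prod u v N M t * cos y + im_prod u v N M t * sin y) =
  sum1 (fun a => sum1 (fun c => b a * b c * (/ sqrt (INR a) * / sqrt (INR c)) *
    sum1 (fun m => sum1 (fun n => u m * v n * (/ sqrt (INR m) * / sqrt (INR n))
     * cos (t * (ln (INR n) - ln (INR m)) - (y - t * (ln (INR c) - ln (INR a))))) M) N) Nb) Nb.
Proof.
  set (P := re_prod u v N M t). set (Q := im_prod u v N M t).
  rewrite (sum1_ext _ (fun a => P * sum1 (fun c => b a * b c * (/ sqrt (INR a) * / sqrt (INR c))
       * cos (t * (ln (INR c) - ln (INR a)) - y)) Nb
     + Q * sum1 (fun c => b a * b c * (/ sqrt (INR a) * / sqrt (INR c))
       * cos (t * (ln (INR c) - ln (INR a)) - (y - PI / 2))) Nb)).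
  - rewrite sum1_plus, !sum1_scal, <- !twisted_product_expand, im_prod_diag.
    rewrite (cos_minus y), cos_PI2, sin_PI2. ring.
  - intros a _. rewrite <- !sum1_scal, <- sum1_plus. apply sum1_ext. intros c _.
    rewrite <- twisted_product_expand. fold P Q.
    set (l := t * (ln (INR c) - ln (INR a))).
    replace (l - (y - PI / 2)) with (- (y - l) + PI / 2) by ring.
    replace (l - y) with (- (y - l)) by ring.
    rewrite cos_plus, cos_PI2, sin_PI2, cos_neg, sin_neg. ring.
Qed.

Lemma RInt_window phi T s (N : nat) : csupp phi -> (forall x, x < 1 \/ 2 < x -> phi x = 0) ->
  (forall x, continuous phi x) -> 1 <= T -> 2 * T <= INR N ->
  RInt (fun t => phi (t / T) * cos (t * s)) (1 / 2) (INR N + 1 / 2) = T * ct phi 0 (T * s).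
Proof.
  intros Hp H0 Hc HT HN.
  set (g := fun t => phi (t / T) * cos (t * s)).
  assert (Cg : forall x, continuous g x).
  { intros x. unfold g. apply continuous_Rmult.
    - apply (continuous_comp (fun t => t / T) phi); auto.
      eapply is_derive_continuous. auto_derive; auto.
    - eapply is_derive_continuous. auto_derive; auto. }
  assert (Z0 : forall a b, a <= b -> b <= T \/ 2 * T <= a -> RInt g a b = 0).
  { intros a b Hab Hd. rewrite (RInt_ext _ (fun _ => 0)).
    - rewrite RInt_const. unfold scal. simpl. unfold mult. simpl. ring.
    - rewrite Rmin_left, Rmax_right by lra. intros x Hx. unfold g. rewrite H0; [apply Rmult_0_l|].
      destruct Hd as [Hd|Hd].
      + left. apply Rmult_lt_reg_r with T; [lra|]. unfold Rdiv. rewrite Rmult_assoc, Rinv_l; lra.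
      + right. apply Rmult_lt_reg_r with T; [lra|]. unfold Rdiv. rewrite Rmult_assoc, Rinv_l; lra. }
  rewrite (RInt_Chasles_cont g (1 / 2) T) by (auto; lra).
  rewrite (RInt_Chasles_cont g T (2 * T)) by (auto; lra).
  rewrite (Z0 (1 / 2)), (Z0 (2 * T)) by lra. rewrite Rplus_0_l, Rplus_0_r.
  replace T with (T * 1) at 1 by ring. replace (2 * T) with (T * 2) by ring.
  rewrite <- (RInt_comp g (fun u => T * u) (fun _ => T) 1 2).
  2:{ auto. }
  2:{ intros x _. split; [auto_derive; auto; ring|apply continuous_const]. }
  unfold ct. rewrite <- RInt_Rscal; [|lra|].
  2:{ intros x Hx. apply continuous_Rmult; auto. apply continuous_cos_lin. }
  apply RInt_ext. intros x _. unfold g.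
  change (T * (phi (T * x / T) * cos (T * x * s)) = T * (phi x * cos (x * (T * s) + 0)) :> R).
  replace (T * x / T) with x by (field; lra).
  replace (x * (T * s) + 0) with (T * x * s) by ring. reflexivity.
Qed.

Lemma continuous_window phi T s x : (forall x, continuous phi x) -> continuous (fun t => phi (t / T) * cos (t * s)) x.
Proof.
  intros Hc. apply continuous_Rmult.
  - apply (continuous_comp (fun t => t / T) phi); auto.
    eapply is_derive_continuous. auto_derive; auto.
  - eapply is_derive_continuous. auto_derive; auto.
Qed.

(** The twist by [nu] joins the ratio of the four integers: every phase is t ln (n / (m x)) with x =
    (a / c) exp (2 pi nu), and its windowed integral is a value of the cosine transform of [phi]. *)
Lemma twisted_mean phi T b (Nb : nat) u v (L1 L2 nu N : nat) :
  csupp phi -> (forall x, x < 1 \/ 2 < x -> phi x = 0) ->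
  (forall x, continuous phi x) -> 1 <= T -> 2 * T <= INR N ->
  RInt (fun t => phi (t / T) * (re_prod b b Nb Nb t *
     (re_prod u v L1 L2 t * cos (2 * PI * INR nu * t) + im_prod u v L1 L2 t * sin (2 * PI * INR nu * t))))
     (1 / 2) (INR N + 1 / 2)
  = sum1 (fun a => sum1 (fun c => b a * b c * (/ sqrt (INR a) * / sqrt (INR c)) *
      double_sum phi T (INR a / INR c * exp (2 * PI * INR nu)) u v L1 L2) Nb) Nb.
Proof.
  intros Hp H0 Hc HT HN.
  assert (hN : 1 / 2 <= INR N + 1 / 2) by lra.
  set (x := fun a c => INR a / INR c * exp (2 * PI * INR nu)).
  assert (CW := fun s t => continuous_window phi T s t Hc).
  rewrite (RInt_ext _ (fun t => sum1 (fun a => sum1 (fun c => b a * b c * (/ sqrt (INR a) * / sqrt (INR c)) *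
    sum1 (fun m => u m * / sqrt (INR m) * sum1 (fun n => v n * / sqrt (INR n)
     * (phi (t / T) * cos (t * ln (INR n / (INR m * x a c))))) L2) L1) Nb) Nb)).
  - rewrite RInt_sum1; auto.
    2:{ intros. repeat (apply continuous_sum1; intros).
        apply (continuous_Rmult (fun _ => _)); [apply continuous_const|].
        repeat (apply continuous_sum1; intros).
        apply (continuous_Rmult (fun _ => _)); [apply continuous_const|].
        repeat (apply continuous_sum1; intros).
        apply (continuous_Rmult (fun _ => _)); [apply continuous_const|]. apply CW. }
    apply sum1_ext. intros a Ha. rewrite RInt_sum1; auto.
    2:{ intros. apply (continuous_Rmult (fun _ => _)); [apply continuous_const|].
        repeat (apply continuous_sum1; intros).
        apply (continuous_Rmult (fun _ => _)); [apply continuous_const|].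
        repeat (apply continuous_sum1; intros).
        apply (continuous_Rmult (fun _ => _)); [apply continuous_const|]. apply CW. }
    apply sum1_ext. intros c Hc'. rewrite RInt_Rscal; auto.
    2:{ intros. repeat (apply continuous_sum1; intros).
        apply (continuous_Rmult (fun _ => _)); [apply continuous_const|].
        repeat (apply continuous_sum1; intros).
        apply (continuous_Rmult (fun _ => _)); [apply continuous_const|]. apply CW. }
    f_equal. unfold double_sum. rewrite RInt_sum1; auto.
    2:{ intros. apply (continuous_Rmult (fun _ => _)); [apply continuous_const|].
        repeat (apply continuous_sum1; intros).
        apply (continuous_Rmult (fun _ => _)); [apply continuous_const|]. apply CW. }
    apply sum1_ext. intros m Hm. rewrite RInt_Rscal; auto.
    2:{ intros. repeat (apply continuous_sum1; intros).
        apply (continuous_Rmult (fun _ => _)); [apply continuous_const|]. apply CW. }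
    f_equal. rewrite RInt_sum1; auto.
    2:{ intros. apply (continuous_Rmult (fun _ => _)); [apply continuous_const|]. apply CW. }
    apply sum1_ext. intros n Hn. rewrite RInt_Rscal; auto.
    f_equal. rewrite RInt_window; auto.
  - intros t _. rewrite quadruple_product_expand, <- sum1_scal. apply sum1_ext. intros a Ha.
    rewrite <- sum1_scal. apply sum1_ext. intros c Hc'.
    rewrite <- !sum1_scal.
    set (bb := b a * b c * (/ sqrt (INR a) * / sqrt (INR c))).
    apply sum1_ext. intros m Hm. rewrite <- !sum1_scal. apply sum1_ext. intros n Hn.
    assert (a0 : 0 < INR a) by (apply lt_0_INR; lia). assert (c0 : 0 < INR c) by (apply lt_0_INR; lia).
    assert (m0 : 0 < INR m) by (apply lt_0_INR; lia). assert (n0 : 0 < INR n) by (apply lt_0_INR; lia).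
    assert (e0 := exp_pos (2 * PI * INR nu)).
    assert (ac : 0 < INR a / INR c) by (apply Rdiv_lt_0_compat; auto).
    unfold x. rewrite (ln_div (INR n)), (ln_mult (INR m)), (ln_mult (INR a / INR c)), ln_exp, ln_div
      by (auto; try apply Rmult_lt_0_compat; auto; apply Rmult_lt_0_compat; auto).
    replace (t * (ln (INR n) - ln (INR m)) - (2 * PI * INR nu * t - t * (ln (INR c) - ln (INR a))))
      with (t * (ln (INR n) - (ln (INR m) + (ln (INR a) - ln (INR c) + 2 * PI * INR nu)))) by ring.
    ring.
Qed.

(** Trivial bounds are affordable, because they are only weighed against the Poisson length, which
    is chosen later. *)
Lemma lip_tpoly w N c W : 0 <= W -> (forall n, (1 <= n <= N)%nat -> Rabs (w n) <= W) ->
  lip (tpoly w N c) (INR N * W) (INR N * (W * INR N)).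
Proof.
  intros W0 Hw. apply (lip_sum1 (fun n t => w n * osc t (-1 / 2) c (INR n))).
  - apply Rmult_le_pos; auto. apply pos_INR.
  - intros n Hn. assert (n1 : 1 <= INR n) by (apply (le_INR 1); lia).
    assert (nN : INR n <= INR N) by (apply le_INR; lia).
    assert (Iq := inv_sqrt_le_1 n ltac:(lia)). specialize (Hw n Hn). assert (w0 := Rabs_pos (w n)).
    split; [nra|]. intros t s _ _. rewrite !osc_neg_half by lia. split.
    + rewrite !Rabs_mult, (Rabs_right (/ sqrt (INR n))) by lra.
      assert (Cb : Rabs (cos (t * ln (INR n) + c)) <= 1) by (apply Rabs_le, COS_bound).
      assert (C0 := Rabs_pos (cos (t * ln (INR n) + c))).
      set (q := / sqrt (INR n)) in *. set (cc := Rabs (cos (t * ln (INR n) + c))) in *.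
      assert (q * cc <= 1) by nra. assert (0 <= q * cc) by nra. nra.
    + rewrite <- !Rmult_minus_distr_l, !Rabs_mult, (Rabs_right (/ sqrt (INR n))) by lra.
      assert (D : Rabs (cos (t * ln (INR n) + c) - cos (s * ln (INR n) + c)) <= INR N * Rabs (t - s)).
      { assert (l0 : 0 <= ln (INR n)) by (rewrite <- ln_1; apply ln_le; lra).
        assert (l1 : ln (INR n) <= INR N).
        { apply Rle_trans with (INR n); auto. assert (E := exp_ineq1_le (ln (INR n))).
          rewrite exp_ln in E by lra. lra. }
        destruct (MVT_gen cos (s * ln (INR n) + c) (t * ln (INR n) + c) (fun x => - sin x)) as [z [_ E]].
        - intros x _. auto_derive; auto; ring.
        - intros x _. apply continuity_cos.
        - rewrite E. replace (t * ln (INR n) + c - (s * ln (INR n) + c)) with (ln (INR n) * (t - s)) by ring.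
          rewrite !Rabs_mult, Rabs_Ropp, (Rabs_right (ln (INR n))) by lra.
          assert (Rabs (sin z) <= 1) by (apply Rabs_le, SIN_bound).
          assert (S0 := Rabs_pos (sin z)). assert (T0 := Rabs_pos (t - s)).
          assert (0 <= ln (INR n) * Rabs (t - s)) by nra.
          apply Rle_trans with (ln (INR n) * Rabs (t - s)); [nra|]. apply Rmult_le_compat_r; auto. }
      set (dd := Rabs (cos (t * ln (INR n) + c) - cos (s * ln (INR n) + c))) in *.
      assert (d0 : 0 <= dd) by apply Rabs_pos.
      rewrite Rmult_assoc. apply Rmult_le_compat; auto; [apply Rmult_le_pos; lra|]. nra.
Qed.

Lemma lip_re_prod u v N M U V : 0 <= U -> 0 <= V -> (1 <= N)%nat -> (1 <= M)%nat ->
  (forall n, (1 <= n <= N)%nat -> Rabs (u n) <= U) -> (forall n, (1 <= n <= M)%nat -> Rabs (v n) <= V) ->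
  lip (re_prod u v N M) (2 * (INR N * U * (INR M * V))) (2 * (INR N * U * (INR M * V)) * (INR N + INR M)).
Proof.
  intros U0 V0 HN HM Hu Hv. unfold re_prod.
  assert (Lu := fun c => lip_tpoly u N c U U0 Hu). assert (Lv := fun c => lip_tpoly v M c V V0 Hv).
  eapply lip_le; [apply lip_plus; apply lip_mult; auto|right; ring|right; ring].
Qed.

Lemma smooth_lipschitz phi : smooth phi -> (forall x, x < 1 \/ 2 < x -> phi x = 0) ->
  exists M, 0 <= M /\ (forall x, Rabs (phi x) <= M) /\ (forall x y, Rabs (phi x - phi y) <= M * Rabs (x - y))
    /\ (forall x, continuous phi x).
Proof.
  intros [D [D0 HD]] H0.
  assert (HD' : forall k x, is_derive (D k) x (D (S k) x)) by (intros; apply is_derive_Reals; auto).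
  assert (C : forall k x, continuous (D k) x) by (intros; apply is_derive_continuous with (D (S k) x); auto).
  assert (Hd : forall x, is_derive phi x (D 1%nat x)) by (intros; rewrite <- D0; auto).
  destruct (continuous_bounded phi 1 2) as [M1 [P1 B1]]; [lra|intros; rewrite <- D0; auto|].
  destruct (continuous_bounded (D 1%nat) 0 3) as [M2 [P2 B2]]; [lra|intros; auto|].
  assert (Z : forall x, x < 1 \/ 2 < x -> D 1%nat x = 0).
  { intros x Hx. rewrite <- (is_derive_unique _ _ _ (Hd x)).
    apply is_derive_unique. apply is_derive_ext_loc with (fun _ => 0); [|apply (is_derive_const 0 x)].
    destruct Hx as [Hx|Hx].
    - exists (mkposreal (1 - x) ltac:(lra)). intros y Hy. symmetry. apply H0. left.
      unfold ball in Hy. simpl in Hy. unfold AbsRing_ball, abs, minus, plus, opp in Hy. simpl in Hy.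
      apply Rabs_def2 in Hy. lra.
    - exists (mkposreal (x - 2) ltac:(lra)). intros y Hy. symmetry. apply H0. right.
      unfold ball in Hy. simpl in Hy. unfold AbsRing_ball, abs, minus, plus, opp in Hy. simpl in Hy.
      apply Rabs_def2 in Hy. lra. }
  exists (M1 + M2). split; [lra|]. split; [|split].
  - intros x. destruct (Rle_dec 1 x), (Rle_dec x 2); try (rewrite H0, Rabs_R0 by lra; lra).
    specialize (B1 x). lra.
  - intros x y. destruct (MVT_gen phi y x (D 1%nat)) as [c [_ E]].
    + intros; auto.
    + intros z _. apply continuity_pt_filterlim. rewrite <- D0. apply C.
    + rewrite E, Rabs_mult. apply Rmult_le_compat_r; [apply Rabs_pos|].
      destruct (Rle_dec 0 c), (Rle_dec c 3); try (rewrite Z, Rabs_R0 by lra; lra).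
      specialize (B2 c). lra.
  - intros x. rewrite <- D0. apply C.
Qed.

Lemma ndiv_le n : (1 <= n)%nat -> INR (ndiv n) <= INR n.
Proof.
  intros Hn. rewrite (ndiv_eq_sum n n) by lia.
  apply Rle_trans with (sum1 (fun _ => 1) n); [apply sum1_le; intros; apply dvdb_bounds|].
  rewrite sum1_const. lra.
Qed.

(** * Absorbing the coefficients into divisor weights *)

(** Collecting n = a k replaces the coefficient by a sum of ndiv (a)^md over a | n, which is at most
    ndiv (n)^(md + 1). *)
Lemma divisor_weight_regroup (f G : nat -> R) Kb (N Y X md : nat) : 0 <= Kb ->
  (forall a, 0 <= f a <= Kb * INR (ndiv a) ^ md) -> (forall n, 0 <= G n) -> (N * Y <= X)%nat ->
  sum1 (fun a => sum1 (fun k => f a * G (a * k)%nat) Y) N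
  <= Kb * sum1 (fun n => INR (ndiv n) ^ S md * G n) X.
Proof.
  intros K0 Hf HG HX.
  eapply Rle_trans; [apply dirichlet_regroup_le; auto; intros; apply Hf|].
  apply Rle_trans with (sum1 (fun n => Kb * (INR (ndiv n) ^ S md * G n)) (N * Y)).
  - apply sum1_le. intros n Hn. rewrite <- Rmult_assoc. apply Rmult_le_compat_r; auto.
    apply Rle_trans with (sum1 (fun a => Kb * (dvdb a n * INR (ndiv a) ^ md)) N).
    + apply sum1_le. intros a _. assert (D := dvdb_bounds a n). destruct (Hf a). nra.
    + rewrite sum1_scal. apply Rmult_le_compat_l; auto. apply sum_dvdb_ndiv_pow_le. lia.
  - rewrite sum1_scal. apply Rmult_le_compat_l; auto. apply sum1_le_extend; auto.
    intros n _. apply Rmult_le_pos; auto. apply pow_le. generalize (ndiv_ge1 n). lra.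
Qed.

Lemma lattice_weight_nonneg y tau k l : 0 < y -> 0 <= lattice_weight y tau k l.
Proof.
  intros Hy. destruct k as [|k].
  - unfold lattice_weight, Rdiv. simpl. rewrite (Rmult_0_l (sqrt y)), Rinv_0, Rmult_0_r. lra.
  - apply lattice_weight_ge0; auto. lia.
Qed.

(** The pair (a k, c l) is a lattice point for the slope y itself. The same line thus serves all a,
    c, and the coefficients survive only as divisor weights; this is done once in each
    coordinate. *)
Lemma lattice_sum_regroup (f : nat -> R) Kb y tau (N kX lX X md : nat) : 0 <= Kb -> 0 < y ->
  (forall a, 0 <= f a <= Kb * INR (ndiv a) ^ md) -> (N * kX <= X)%nat -> (N * lX <= X)%nat ->
  sum1 (fun a => sum1 (fun c => f a * f c *
    sum1 (fun k => sum1 (fun l => lattice_weight y tau (a * k) (c * l)) lX) kX) N) N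
  <= Kb * Kb * sum1 (fun k => sum1 (fun l => lattice_weight y tau k l
       * (INR (ndiv k) * INR (ndiv l)) ^ S md) X) X.
Proof.
  intros K0 Hy Hf Hk Hl.
  set (G := fun n => sum1 (fun c => sum1 (fun l => f c * lattice_weight y tau n (c * l)) lX) N).
  assert (LW := fun k l => lattice_weight_nonneg y tau k l Hy).
  assert (G0 : forall n, 0 <= G n).
  { intros n. apply sum1_ge0. intros c _. apply sum1_ge0. intros l _. apply Rmult_le_pos; auto. apply Hf. }
  rewrite (sum1_ext _ (fun a => sum1 (fun k => f a * G (a * k)%nat) kX)).
  2:{ intros a _. unfold G.
      rewrite (sum1_ext _ (fun c => sum1 (fun k => f a * sum1 (fun l => f c * lattice_weight y tau (a * k) (c * l)) lX) kX)).
      - rewrite sum1_swap. apply sum1_ext. intros k _. rewrite sum1_scal. reflexivity.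
      - intros c _. rewrite <- sum1_scal. apply sum1_ext. intros k _.
        rewrite (sum1_scal (f c)). ring. }
  eapply Rle_trans; [apply (divisor_weight_regroup f G Kb N kX X md); auto|].
  rewrite Rmult_assoc. apply Rmult_le_compat_l; auto. rewrite <- sum1_scal. apply sum1_le. intros k Hk1.
  assert (P0 : 0 <= INR (ndiv k) ^ S md) by (apply pow_le; generalize (ndiv_ge1 k); lra).
  apply Rle_trans with (INR (ndiv k) ^ S md * (Kb * sum1 (fun l => INR (ndiv l) ^ S md * lattice_weight y tau k l) X)).
  - apply Rmult_le_compat_l; auto.
    apply (divisor_weight_regroup f (fun l => lattice_weight y tau k l) Kb N lX X md); auto.
  - right. rewrite <- !sum1_scal. apply sum1_ext. intros l _. rewrite Rpow_mult_distr. ring.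
Qed.

(** Multiplying l - k (a / c) y by c gives c l - a k y, so the strip widens by the factor c, and 1 /
    sqrt (a c) turns 1 / (k sqrt (a y / c)) into 1 / (a k sqrt y). *)
Lemma lattice_sum_rescale (a c : nat) y tau tau' (kX lX : nat) : (1 <= a)%nat -> (1 <= c)%nat -> 0 < y ->
  INR c * tau' <= tau ->
  / sqrt (INR a) * / sqrt (INR c) * lattice_sum (INR a / INR c * y) tau' kX lX
  <= sum1 (fun k => sum1 (fun l => lattice_weight y tau (a * k) (c * l)) lX) kX.
Proof.
  intros Ha Hc Hy Ht. unfold lattice_sum. rewrite <- sum1_scal. apply sum1_le. intros k Hk.
  rewrite <- sum1_scal. apply sum1_le. intros l Hl.
  assert (a0 : 0 < INR a) by (apply lt_0_INR; lia). assert (c0 : 0 < INR c) by (apply lt_0_INR; lia).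
  assert (k0 : 0 < INR k) by (apply lt_0_INR; lia).
  assert (sa : 0 < sqrt (INR a)) by (apply sqrt_lt_R0; auto).
  assert (sc : 0 < sqrt (INR c)) by (apply sqrt_lt_R0; auto).
  assert (sy : 0 < sqrt y) by (apply sqrt_lt_R0; auto).
  assert (saa : sqrt (INR a) * sqrt (INR a) = INR a) by (apply sqrt_sqrt; lra).
  assert (ac : 0 < INR a / INR c) by (apply Rdiv_lt_0_compat; auto).
  unfold lattice_weight. rewrite !mult_INR.
  replace (sqrt (INR a / INR c * y)) with (sqrt (INR a) / sqrt (INR c) * sqrt y)
    by (rewrite sqrt_mult, sqrt_div by lra; reflexivity).
  replace (/ sqrt (INR a) * / sqrt (INR c) *
     (nearb (INR k * (INR a / INR c * y)) tau' l / (INR k * (sqrt (INR a) / sqrt (INR c) * sqrt y))))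
    with (nearb (INR k * (INR a / INR c * y)) tau' l / ((sqrt (INR a) * sqrt (INR a)) * INR k * sqrt y))
    by (field; repeat split; lra).
  rewrite saa. unfold Rdiv. apply Rmult_le_compat_r.
  - left. apply Rinv_0_lt_compat. repeat apply Rmult_lt_0_compat; auto.
  - unfold nearb. destruct (Rle_dec (Rabs (INR l - INR k * (INR a * / INR c * y))) tau') as [H|H].
    + destruct (Rle_dec _ _) as [_|H2]; [lra|]. exfalso. apply H2. rewrite mult_INR.
      replace (INR c * INR l - INR a * INR k * y) with (INR c * (INR l - INR k * (INR a * / INR c * y)))
        by (field; lra).
      rewrite Rabs_mult, (Rabs_right (INR c)) by lra.
      eapply Rle_trans; [|exact Ht]. apply Rmult_le_compat_l; lra.
    + destruct (Rle_dec _ _); lra.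
Qed.

Lemma exp_mul_INR x n : exp (INR n * x) = exp x ^ n.
Proof.
  induction n as [|n IH]; [simpl; rewrite Rmult_0_l; apply exp_0|].
  rewrite S_INR. replace ((INR n + 1) * x) with (x + INR n * x) by ring.
  rewrite exp_plus, IH. reflexivity.
Qed.

Lemma le_of_sqr_le a b : 0 <= b -> a * a <= b * b -> a <= b.
Proof. intros Hb H. apply Rnot_lt_le. intros Hc. nra. Qed.

(* The exponent [(1/2 - theta) / 8] leaves the factor [exp (-(1/2 - theta)/2 * L)] in the width of the
   lattice strip after the four powers of [Z] have been spent. *)
Lemma double_sum_pair_le phi theta A : csupp phi -> 0 < theta < 1 / 2 -> (2 <= A)%nat ->
  let eps := (1 / 2 - theta) / 8 in
  exists K L0, 0 <= K /\ 1 <= L0 /\ forall L y (a c N1 N2 Kf Q : nat), L0 <= L ->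
    let T := exp L in let Z := exp (eps * L) in
    1 <= y -> (1 <= a)%nat -> (1 <= c)%nat -> INR a <= exp (theta * L) -> INR c <= exp (theta * L) ->
    (1 <= Kf)%nat -> (1 <= N1)%nat -> (1 <= N2)%nat -> T <= INR N1 -> 2 * T ^ 4 <= INR Q ->
    let L1 := ((A + 1) * N1)%nat in let L2 := ((A + 1) * N2)%nat in
    3 * INR L1 * (T * y) <= INR N2 ->
    / sqrt (INR a) * / sqrt (INR c) *
      Rabs (double_sum phi T (INR a / INR c * y) (cutoff N1 A L1) (cutoff N2 A L2) L1 L2)
    <= K * T * (if Rle_dec y (T ^ 4) then
        sum1 (fun k => sum1 (fun l =>
          lattice_weight y (exp (- ((1 / 2 - theta) / 2 * L)) * sqrt y) (a * k) (c * l)) Q) Q else 0)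
       + K * (T * INR L1 * INR L2 / Z ^ A + INR L1 * INR L2 * (T * T) / sqrt (INR Kf)
              + T * y * INR Kf * T * INR L1 / Z ^ A).
Proof.
  intros Hp Hth HA eps.
  destruct (smoothed_double_sum_le phi A Hp HA) as [K [K0 HK]].
  assert (e0 : 0 < eps) by (unfold eps; lra).
  destruct (pow_le_exp_eventually (INR A + 3) eps 0 e0) as [L0 [HL0 HE]].
  exists K, L0. split; auto. split; auto.
  intros L y a c N1 N2 Kf Q HL T Z Hy Ha Hc HaT HcT HKf HN1 HN2 TN1 HQ L1 L2 HN2b.
  assert (Z3 : INR A + 3 <= Z) by (specialize (HE L HL); simpl in HE; unfold Z; lra).
  assert (A0 := pos_INR A).
  assert (T1 : 1 <= T) by (unfold T; generalize (exp_ineq1_le L); lra).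
  assert (ZT8 : Z ^ 8 <= T).
  { unfold Z. rewrite <- exp_mul_INR. unfold T. apply exp_le. simpl INR. unfold eps. nra. }
  assert (ZT : Z < T).
  { apply Rlt_le_trans with (Z ^ 8); auto. apply Rlt_le_trans with (Z ^ 2); [simpl; nra|].
    apply Rle_pow; [lra|lia]. }
  assert (Z4 : Z ^ 4 <= T) by (apply Rle_trans with (Z ^ 8); auto; apply Rle_pow; [lra|lia]).
  set (th := exp (theta * L)) in *.
  (* The choice of [eps] amounts to 2 theta + 16 eps = 1. *)
  assert (th2 : th * th * Z ^ 16 = T).
  { unfold th, Z, T. rewrite <- exp_mul_INR, <- !exp_plus. f_equal. simpl INR. unfold eps. field. }
  assert (a1 : 1 <= INR a) by (apply (le_INR 1); auto).
  assert (c1 : 1 <= INR c) by (apply (le_INR 1); auto).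
  assert (z16 : 1 <= Z ^ 16) by (apply pow_R1_Rle; lra).
  assert (z8 : 1 <= Z ^ 8) by (apply pow_R1_Rle; lra).
  assert (thT : th * th <= T) by nra.
  assert (thT' : th <= T) by nra.
  set (x := INR a / INR c * y).
  assert (x0 : 0 < x) by (unfold x; apply Rmult_lt_0_compat; [apply Rdiv_lt_0_compat; lra|lra]).
  assert (xc : x * INR c = INR a * y) by (unfold x; field; lra).
  assert (xth : y <= x * th) by nra.
  assert (xT : x <= T * y).
  { apply Rmult_le_reg_r with (INR c); [lra|]. rewrite xc.
    apply Rle_trans with (T * y * 1); [|apply Rmult_le_compat_l; nra].
    rewrite Rmult_1_r. apply Rmult_le_compat_r; lra. }
  set (mu := sqrt (T / x)).
  assert (mu0 : 0 < mu) by (apply sqrt_lt_R0, Rdiv_lt_0_compat; lra).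
  assert (mumu : mu * mu = T / x) by (apply sqrt_sqrt, Rlt_le, Rdiv_lt_0_compat; lra).
  assert (E : mu * mu * x = T) by (rewrite mumu; field; lra).
  assert (xT6 : Z ^ 6 <= x * T).
  { apply Rle_trans with (Z ^ 16); [apply Rle_pow; [lra|lia]|].
    rewrite <- th2. apply Rle_trans with (1 * Z ^ 16); [lra|].
    rewrite <- Rmult_assoc. apply Rmult_le_compat_r; [lra|]. nra. }
  assert (muT : mu <= T).
  { apply le_of_sqr_le; [lra|]. apply Rmult_le_reg_r with x; auto. rewrite E. nra. }
  assert (err : forall s, s <= T * y -> 0 <= s -> s * INR Kf * T * INR L1 / Z ^ A <= T * y * INR Kf * T * INR L1 / Z ^ A).
  { intros s Hs s0. apply Rmult_le_compat_r; [left; apply Rinv_0_lt_compat, pow_lt; lra|].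
    apply Rmult_le_compat_r; [apply pos_INR|]. apply Rmult_le_compat_r; [lra|].
    apply Rmult_le_compat_r; [apply pos_INR|auto]. }
  assert (sx : sqrt x <= T * y).
  { assert (1 <= T * y) by (clear - T1 Hy; nra).
    apply le_of_sqr_le; [lra|]. rewrite sqrt_sqrt by lra. clear - H xT. nra. }
  specialize (err (sqrt x) sx (sqrt_pos x)).
  assert (Ia := inv_sqrt_le_1 a Ha). assert (Ic := inv_sqrt_le_1 c Hc).
  assert (q1 : 0 < / sqrt (INR a) * / sqrt (INR c) <= 1).
  { split; [apply Rmult_lt_0_compat; lra|]. nra. }
  assert (HH := fun kX lX h1 h2 => HK T Z x mu N1 N2 kX lX Kf T1 ltac:(lra) ltac:(lra) x0 mu0 E xT6 h1 h2 HKf HN1 HN2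
    ltac:(lra)). cbv zeta in HH. fold L1 L2 in HH.
  assert (HN3 : 3 * INR L1 * x <= INR N2).
  { eapply Rle_trans; [|exact HN2b]. apply Rmult_le_compat_l; auto. generalize (pos_INR L1); lra. }
  set (B1 := T * INR L1 * INR L2 / Z ^ A) in *.
  set (B2 := INR L1 * INR L2 * (T * T) / sqrt (INR Kf)) in *.
  set (B3 := sqrt x * INR Kf * T * INR L1 / Z ^ A) in *.
  set (B4 := T * y * INR Kf * T * INR L1 / Z ^ A) in *.
  assert (LP1 := pos_INR L1). assert (LP2 := pos_INR L2).
  assert (ZA : 0 < / Z ^ A) by (apply Rinv_0_lt_compat, pow_lt; lra).
  assert (B10 : 0 <= B1) by (unfold B1; apply Rmult_le_pos; [apply Rmult_le_pos; [apply Rmult_le_pos; lra|lra]|lra]).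
  assert (B20 : 0 <= B2).
  { unfold B2; apply Rmult_le_pos; [apply Rmult_le_pos; apply Rmult_le_pos; lra|]. left. apply Rinv_0_lt_compat, sqrt_lt_R0, lt_0_INR. lia. }
  assert (B30 : 0 <= B3).
  { unfold B3. apply Rmult_le_pos; [|lra]. apply Rmult_le_pos; auto. apply Rmult_le_pos; [|lra].
    apply Rmult_le_pos; [apply sqrt_pos|apply pos_INR]. }
  clearbody B1 B2 B3 B4.
  set (DS := Rabs (double_sum phi T x (cutoff N1 A L1) (cutoff N2 A L2) L1 L2)) in *.
  assert (fin : forall s s', DS <= K * T * s + K * (B1 + B2 + B3) ->
     / sqrt (INR a) * / sqrt (INR c) * s <= s' ->
     / sqrt (INR a) * / sqrt (INR c) * DS <= K * T * s' + K * (B1 + B2 + B4)).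
  { intros s s' H1 H2. set (q := / sqrt (INR a) * / sqrt (INR c)) in *.
    apply Rle_trans with (q * (K * T * s + K * (B1 + B2 + B3))); [apply Rmult_le_compat_l; lra|].
    assert (0 <= K * T) by (apply Rmult_le_pos; lra).
    assert (K * T * (q * s) <= K * T * s') by (apply Rmult_le_compat_l; auto).
    assert (K * (B1 + B2 + B3) <= K * (B1 + B2 + B4)) by (apply Rmult_le_compat_l; lra).
    assert (0 <= K * (B1 + B2 + B3)) by (apply Rmult_le_pos; lra).
    assert (q * (K * (B1 + B2 + B3)) <= 1 * (K * (B1 + B2 + B3))) by (apply Rmult_le_compat_r; lra). lra. }
  destruct (Rle_dec y (T ^ 4)) as [yT|yT].
  - apply (fin (lattice_sum x (Z ^ 4 / mu) Q Q)).
    + assert (T4 : 1 <= T ^ 4) by (apply pow_R1_Rle; lra).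
      assert (x5 : x <= T ^ 5).
      { apply Rle_trans with (T * y); auto. replace (T ^ 5) with (T * T ^ 4) by ring.
        apply Rmult_le_compat_l; lra. }
      assert (mux : mu * x <= T ^ 3).
      { apply le_of_sqr_le; [apply pow_le; lra|].
        replace (mu * x * (mu * x)) with (mu * mu * x * x) by ring. rewrite E.
        replace (T ^ 3 * T ^ 3) with (T * T ^ 5) by ring. apply Rmult_le_compat_l; lra. }
      assert (im : / mu <= T ^ 2).
      { replace (/ mu) with (mu * x * / T) by (rewrite <- E at 1; field; lra).
        apply Rmult_le_reg_r with T; [lra|]. rewrite Rmult_assoc, Rinv_l, Rmult_1_r by lra.
        eapply Rle_trans; [exact mux|]. right; ring. }
      apply HH; auto.
      * apply Rle_lt_trans with (T * T); [apply Rmult_le_compat; lra|].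
        assert (T ^ 2 <= T ^ 4) by (apply Rle_pow; [lra|lia]).
        replace (T * T) with (T ^ 2) by ring. lra.
      * eapply Rle_trans; [|exact HQ].
        assert (Z * mu * x <= T * T ^ 3) by (rewrite Rmult_assoc; apply Rmult_le_compat; try lra; apply Rmult_le_pos; lra).
        assert (Z ^ 4 / mu <= T * T ^ 2).
        { apply Rmult_le_compat; auto; [apply pow_le; lra|left; apply Rinv_0_lt_compat; auto]. }
        assert (T ^ 3 <= T ^ 4) by (apply Rle_pow; [lra|lia]).
        replace (T * T ^ 2) with (T ^ 3) in * by ring. replace (T * T ^ 3) with (T ^ 4) in * by ring. lra.
    (* The half-width c Z^4 / mu has square a c y Z^8 / T, which is at most Z^(-8) y since a c <= T
       Z^(-16). *)
    + apply lattice_sum_rescale; auto; [lra|].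
      apply le_of_sqr_le; [apply Rmult_le_pos; [left; apply exp_pos|apply sqrt_pos]|].
      set (w := exp (- ((1 / 2 - theta) / 2 * L))).
      replace (w * sqrt y * (w * sqrt y)) with (w * w * (sqrt y * sqrt y)) by ring.
      rewrite sqrt_sqrt by lra.
      replace (INR c * (Z ^ 4 / mu) * (INR c * (Z ^ 4 / mu))) with (INR c * (INR c * Z ^ 8 / (mu * mu))) by (field; lra).
      rewrite mumu.
      replace (INR c * (INR c * Z ^ 8 / (T / x))) with (INR c * (x * INR c) * Z ^ 8 / T) by (field; lra).
      rewrite xc.
      assert (W3 : th * th * Z ^ 8 <= w * w * T).
      { right. unfold th, Z, w, T. rewrite <- exp_mul_INR, <- !exp_plus. f_equal. simpl INR. unfold eps. field. }
      apply Rmult_le_reg_r with T; [lra|].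
      replace (INR c * (INR a * y) * Z ^ 8 / T * T) with (INR a * INR c * Z ^ 8 * y) by (field; lra).
      replace (w * w * y * T) with (w * w * T * y) by ring.
      apply Rmult_le_compat_r; [lra|]. eapply Rle_trans; [|exact W3].
      apply Rmult_le_compat_r; [lra|]. apply Rmult_le_compat; lra.
  (* For y > T^4 one has mu T <= 1, hence Z mu < 1: no index k remains, and the lattice sum is taken
     over the empty range [kX = 0]. *)
  - apply Rnot_le_lt in yT.
    assert (x3 : T ^ 3 <= x).
    { apply Rmult_le_reg_r with th; [unfold th; apply exp_pos|].
      apply Rle_trans with (T ^ 3 * T); [apply Rmult_le_compat_l; [apply pow_le; lra|auto]|].
      simpl in *. lra. }
    destruct (nat_ceil (Z * mu * x + Z ^ 4 / mu)) as [lX [lX1 _]].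
    { apply Rplus_le_le_0_compat; [apply Rmult_le_pos; [apply Rmult_le_pos; lra|lra]|].
      apply Rmult_le_pos; [apply pow_le; lra|left; apply Rinv_0_lt_compat; auto]. }
    apply (fin (lattice_sum x (Z ^ 4 / mu) 0 lX)); [|unfold lattice_sum; simpl; lra].
    apply HH; auto. simpl. rewrite Rplus_0_l.
    assert (mT : mu * T <= 1).
    { apply le_of_sqr_le; [lra|]. apply Rmult_le_reg_r with x; auto.
      replace (mu * T * (mu * T) * x) with (mu * mu * x * (T * T)) by ring. rewrite E.
      clear - x3. simpl in x3. nra. }
    apply Rlt_le_trans with (T * mu); [apply Rmult_lt_compat_r; lra|lra].
Qed.

(** The lattice parts of all pairs (a, c) combine to one weighted lattice sum of slope exp (2 pi
    nu), where [lattice_sum_small] saves the power of L. The error terms are summed trivially, since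
    they will carry a large negative power of Z. *)
Lemma low_frequency_le phi theta (A md Cn : nat) : csupp phi -> 0 < theta < 1 / 2 -> (2 <= A)%nat ->
  let eps := (1 / 2 - theta) / 8 in
  exists K L0, 0 <= K /\ 1 <= L0 /\ forall L Kb (b : nat -> R) (nu Nb N1 N2 Kf : nat), L0 <= L ->
    let T := exp L in let Z := exp (eps * L) in let y := exp (2 * PI * INR nu) in
    (1 <= nu)%nat -> 0 <= Kb -> (forall a, Rabs (b a) <= Kb * INR (ndiv a) ^ md) ->
    (forall a, b a <> 0 -> INR a <= exp (theta * L)) -> (1 <= Nb)%nat -> INR Nb <= T ->
    (1 <= Kf)%nat -> (1 <= N1)%nat -> (1 <= N2)%nat -> T <= INR N1 ->
    let L1 := ((A + 1) * N1)%nat in let L2 := ((A + 1) * N2)%nat in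
    3 * INR L1 * (T * y) <= INR N2 ->
    Rabs (sum1 (fun a => sum1 (fun c => b a * b c * (/ sqrt (INR a) * / sqrt (INR c)) *
      double_sum phi T (INR a / INR c * y) (cutoff N1 A L1) (cutoff N2 A L2) L1 L2) Nb) Nb)
    <= K * Kb ^ 2 * (T / L ^ Cn)
       + K * (INR Nb * (INR Nb * (Kb * INR Nb ^ md) ^ 2)) *
         (T * INR L1 * INR L2 / Z ^ A + INR L1 * INR L2 * (T * T) / sqrt (INR Kf)
              + T * y * INR Kf * T * INR L1 / Z ^ A).
Proof.
  intros Hp Hth HA eps.
  destruct (double_sum_pair_le phi theta A Hp Hth HA) as [K1 [LL1 [P1 [Q1 H1]]]]. fold eps in H1.
  (* Coordinates of the lattice points reach Nb Q <= 3 T^5, safely below T^7. Regrouping raises the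
     divisor exponent to [S md]. *)
  destruct (lattice_sum_small (S md) Cn 7 ((1 / 2 - theta) / 2) ltac:(lra)) as [K2 [LL2 [Q2 H2]]].
  set (K2' := Rmax K2 0).
  exists (K1 + K1 * K2'), (Rmax 2 (Rmax LL1 LL2)).
  assert (K2p : 0 <= K2') by apply Rmax_r. assert (K2l : K2 <= K2') by apply Rmax_l.
  split; [nra|]. split; [apply Rle_trans with 2; [lra|apply Rmax_l]|].
  intros L Kb b nu Nb N1 N2 Kf HL T Z y Hnu HKb Hb Hb2 HNb NbT HKf HN1 HN2 TN1 L1 L2 HN.
  assert (HLa : 2 <= L) by (eapply Rle_trans; [apply Rmax_l|exact HL]).
  assert (HLb : LL1 <= L) by (eapply Rle_trans; [eapply Rle_trans; [apply Rmax_l|apply Rmax_r]|exact HL]).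
  assert (HLc : LL2 <= L) by (eapply Rle_trans; [eapply Rle_trans; [apply Rmax_r|apply Rmax_r]|exact HL]).
  assert (T3 : 3 <= T) by (unfold T; generalize (exp_ineq1_le L); lra).
  assert (nu1 : 1 <= INR nu) by (apply (le_INR 1); auto).
  assert (y1 : 1 <= y).
  { unfold y. generalize (exp_ineq1_le (2 * PI * INR nu)) PI_RGT_0. intros.
    assert (0 <= 2 * PI * INR nu) by (apply Rmult_le_pos; lra). lra. }
  assert (T4 : 1 <= T ^ 4) by (apply pow_R1_Rle; lra).
  destruct (nat_ceil (2 * T ^ 4)) as [Q [Qa Qb]]; [lra|].
  set (err := T * INR L1 * INR L2 / Z ^ A + INR L1 * INR L2 * (T * T) / sqrt (INR Kf)
              + T * y * INR Kf * T * INR L1 / Z ^ A).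
  assert (Z0 : 0 < Z) by apply exp_pos.
  assert (LP1 := pos_INR L1). assert (LP2 := pos_INR L2).
  assert (ZA : 0 < / Z ^ A) by (apply Rinv_0_lt_compat, pow_lt; auto).
  assert (Kfp : 0 < INR Kf) by (apply lt_0_INR; lia).
  assert (err0 : 0 <= err).
  { unfold err. apply Rplus_le_le_0_compat; [apply Rplus_le_le_0_compat|].
    - apply Rmult_le_pos; [apply Rmult_le_pos; nra|lra].
    - apply Rmult_le_pos; [apply Rmult_le_pos; nra|]. left. apply Rinv_0_lt_compat, sqrt_lt_R0; auto.
    - apply Rmult_le_pos; [|lra]. apply Rmult_le_pos; auto. apply Rmult_le_pos; [|lra].
      apply Rmult_le_pos; [nra|lra]. }
  set (tau := exp (- ((1 / 2 - theta) / 2 * L)) * sqrt y).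
  set (s := fun a c => if Rle_dec y (T ^ 4) then
        sum1 (fun k => sum1 (fun l => lattice_weight y tau (a * k) (c * l)) Q) Q else 0).
  set (f := fun a => Rabs (b a)).
  assert (f0 : forall a, 0 <= f a) by (intros; apply Rabs_pos).
  apply Rle_trans with (sum1 (fun a => sum1 (fun c => f a * f c * (K1 * T * s a c + K1 * err)) Nb) Nb).
  { eapply Rle_trans; [apply sum1_abs|]. apply sum1_le. intros a Ha.
    eapply Rle_trans; [apply sum1_abs|]. apply sum1_le. intros c Hc.
    destruct (Req_dec (b a) 0) as [E|E].
    { unfold f. rewrite E, !Rmult_0_l, Rabs_R0, !Rmult_0_l. lra. }
    destruct (Req_dec (b c) 0) as [E2|E2].
    { unfold f. rewrite E2, !Rmult_0_r, !Rmult_0_l, Rabs_R0, Rmult_0_r, Rmult_0_l. lra. }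
    assert (HH := H1 L y a c N1 N2 Kf Q HLb y1 ltac:(lia) ltac:(lia) (Hb2 a E) (Hb2 c E2) HKf HN1 HN2 TN1 Qa HN).
    cbv zeta in HH. fold T Z L1 L2 tau in HH. fold (s a c) err in HH.
    assert (Ia := inv_sqrt_le_1 a ltac:(lia)). assert (Ic := inv_sqrt_le_1 c ltac:(lia)).
    rewrite !Rabs_mult, (Rabs_right (/ sqrt (INR a))), (Rabs_right (/ sqrt (INR c))) by lra.
    rewrite (Rmult_assoc (Rabs (b a) * Rabs (b c))). apply Rmult_le_compat_l; auto.
    apply Rmult_le_pos; apply Rabs_pos. }
  rewrite (sum1_ext _ (fun a => K1 * T * sum1 (fun c => f a * f c * s a c) Nb
     + sum1 (fun c => f a * f c * (K1 * err)) Nb)).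
  2:{ intros a _. rewrite <- sum1_scal, <- sum1_plus. apply sum1_ext. intros; ring. }
  rewrite sum1_plus, sum1_scal.
  assert (M1 : sum1 (fun a => sum1 (fun c => f a * f c * s a c) Nb) Nb <= Kb ^ 2 * (K2' / L ^ Cn)).
  { assert (LC : 0 < / L ^ Cn) by (apply Rinv_0_lt_compat, pow_lt; lra).
    unfold s. destruct (Rle_dec y (T ^ 4)) as [yT|yT].
    - eapply Rle_trans; [apply (lattice_sum_regroup f Kb y tau Nb Q Q (Nb * Q) md); auto; [lra|intros; split; [auto|apply Hb]]|].
      replace (Kb ^ 2) with (Kb * Kb) by ring. apply Rmult_le_compat_l; [nra|].
      eapply Rle_trans; [apply (H2 L nu (Nb * Q)%nat tau HLc Hnu)|].
      + fold y. eapply Rle_trans; [exact yT|]. unfold T. rewrite <- exp_mul_INR. right. f_equal. simpl; ring.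
      + assert (1 <= Q)%nat; [|nia]. apply INR_le. simpl. lra.
      + rewrite mult_INR. assert (Q0 : 0 < INR Q) by lra. assert (N0 : 0 < INR Nb) by (apply lt_0_INR; lia).
        apply Rle_trans with (ln (exp (7 * L))); [|rewrite ln_exp; simpl; lra].
        apply ln_le; [nra|]. replace (7 * L) with (INR 7 * L) by (simpl; ring). rewrite exp_mul_INR. fold T.
        apply Rle_trans with (T * (3 * T ^ 4)); [apply Rmult_le_compat; lra|].
        replace (T ^ 7) with (T * (T * T * T ^ 4)) by ring. apply Rmult_le_compat_l; [lra|].
        apply Rmult_le_compat_r; nra.
      + fold y. split; [apply Rmult_le_pos; [left; apply exp_pos|apply sqrt_pos]|unfold tau; lra].
      + apply Rmult_le_compat_r; lra.
    - rewrite (sum1_ext _ (fun _ => 0)).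
      + rewrite sum1_zero. apply Rmult_le_pos; [nra|]. apply Rmult_le_pos; lra.
      + intros a _. rewrite (sum1_ext _ (fun _ => 0)); [apply sum1_zero|intros; ring]. }
  assert (M2 : sum1 (fun a => sum1 (fun c => f a * f c * (K1 * err)) Nb) Nb
    <= INR Nb * (INR Nb * ((Kb * INR Nb ^ md) ^ 2 * (K1 * err)))).
  { assert (FB : forall a, (1 <= a <= Nb)%nat -> f a <= Kb * INR Nb ^ md).
    { intros a Ha. eapply Rle_trans; [apply Hb|]. apply Rmult_le_compat_l; auto.
      apply pow_incr. split; [apply pos_INR|]. eapply Rle_trans; [apply ndiv_le; lia|]. apply le_INR; lia. }
    rewrite <- !sum1_const. apply sum1_le. intros a Ha. apply sum1_le. intros c Hc.
    apply Rmult_le_compat_r; [nra|]. simpl. rewrite Rmult_1_r.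
    apply Rmult_le_compat; auto. }
  assert (K1 * T * sum1 (fun a => sum1 (fun c => f a * f c * s a c) Nb) Nb <= K1 * T * (Kb ^ 2 * (K2' / L ^ Cn)))
    by (apply Rmult_le_compat_l; [nra|auto]).
  set (W := INR Nb * (INR Nb * (Kb * INR Nb ^ md) ^ 2)) in *.
  assert (W0 : 0 <= W).
  { unfold W. assert (N0 := pos_INR Nb). assert (0 <= (Kb * INR Nb ^ md) ^ 2) by apply pow2_ge_0.
    apply Rmult_le_pos; auto. nra. }
  replace (INR Nb * (INR Nb * ((Kb * INR Nb ^ md) ^ 2 * (K1 * err)))) with (K1 * W * err) in M2 by (unfold W; ring).
  replace (K1 * T * (Kb ^ 2 * (K2' / L ^ Cn))) with (K1 * K2' * Kb ^ 2 * (T / L ^ Cn)) in H by (unfold Rdiv; ring).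
  assert (0 <= Kb ^ 2 * (T / L ^ Cn)).
  { apply Rmult_le_pos; [apply pow2_ge_0|]. apply Rlt_le, Rdiv_lt_0_compat; [lra|apply pow_lt; lra]. }
  assert (0 <= K1 * K2' * (W * err)) by (apply Rmult_le_pos; nra).
  assert (0 <= K1 * (Kb ^ 2 * (T / L ^ Cn))) by nra.
  nra.
Qed.

(** * Reduction to positive frequencies, and the large ones *)

Definition window_class (phi : R -> R) (M : R) : Prop :=
  csupp phi /\ (forall x, x < 1 \/ 2 < x -> phi x = 0) /\ (forall x, continuous phi x) /\
  0 <= M /\ (forall x, Rabs (phi x) <= M) /\ (forall x y, Rabs (phi x - phi y) <= M * Rabs (x - y)).

Definition pair_sum (phi : R -> R) (T : R) (b : nat -> R) (Nb : nat) (u v : nat -> R) (L1 L2 nu : nat) : R :=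
  sum1 (fun a => sum1 (fun c => b a * b c * (/ sqrt (INR a) * / sqrt (INR c)) *
      double_sum phi T (INR a / INR c * exp (2 * PI * INR nu)) u v L1 L2) Nb) Nb.

Lemma window_zero phi M T t : window_class phi M -> 0 < T -> t < T \/ 2 * T < t -> phi (t / T) = 0.
Proof.
  intros (_ & H & _) HT Ht. apply H. destruct Ht as [Ht|Ht]; [left|right];
    apply Rmult_lt_reg_r with T; auto; unfold Rdiv; rewrite Rmult_assoc, Rinv_l; lra.
Qed.

Lemma lip_window phi M T : window_class phi M -> 1 <= T -> lip (fun t => phi (t / T)) M M.
Proof.
  intros (_ & _ & _ & M0 & B & Lp) HT. split; auto. intros v w _ _. split; auto.
  eapply Rle_trans; [apply Lp|]. apply Rmult_le_compat_l; auto.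
  replace (v / T - w / T) with ((v - w) * / T) by (unfold Rdiv; ring).
  rewrite Rabs_mult, (Rabs_right (/ T)) by (left; apply Rinv_0_lt_compat; lra).
  assert (/ T <= 1) by (rewrite <- Rinv_1; apply Rinv_le_contravar; lra).
  generalize (Rabs_pos (v - w)). nra.
Qed.

(** The zero frequency of the Poisson formula is the integral, and each k >= 1 gives a [pair_sum]:
    for equal factors the imaginary product vanishes, so the sine term may be added. Fejer weights
    lie between 0 and 1. *)
Lemma poisson_reduction phi M T b (Nb : nat) w (L1 N V : nat) Wb :
  window_class phi M -> 1 <= T -> 2 * T <= INR N -> (1 <= V)%nat -> (1 <= Nb)%nat -> (1 <= L1)%nat ->
  0 <= Wb -> (forall n, (1 <= n <= Nb)%nat -> Rabs (b n) <= Wb) -> (forall n, Rabs (w n) <= 1) ->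
  let F1 := fun t => phi (t / T) * (re_prod b b Nb Nb t * re_prod w w L1 L1 t) in
  Rabs (sum1 (fun n => F1 (INR n)) N - RInt F1 (1 / 2) (INR N + 1 / 2))
  <= INR N * (M * (2 * (INR Nb * Wb * (INR Nb * Wb))) * (2 * (INR L1 * INR L1)) * (2 * INR L1 + 2 * INR Nb + 1)
       * (2 / sqrt (INR V)))
     + 2 * sum1 (fun nu => Rabs (pair_sum phi T b Nb w w L1 L1 nu)) V.
Proof.
  intros HP HT HN HV HNb HL1 HWb Hb Hw F1.
  assert (Lphi := lip_window phi M T HP HT).
  assert (Lb := lip_re_prod b b Nb Nb Wb Wb HWb HWb HNb HNb Hb Hb).
  assert (Lw := lip_re_prod w w L1 L1 1 1 ltac:(lra) ltac:(lra) HL1 HL1 (fun n _ => Hw n) (fun n _ => Hw n)).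
  assert (LF : lip F1 (M * (2 * (INR Nb * Wb * (INR Nb * Wb)) * (2 * (INR L1 * INR L1))))
     (M * (2 * (INR Nb * Wb * (INR Nb * Wb))) * (2 * (INR L1 * INR L1)) * (2 * INR L1 + 2 * INR Nb + 1))).
  { eapply lip_le; [apply lip_mult; [exact Lphi|apply lip_mult; [exact Lb|exact Lw]]|right; ring|right; ring]. }
  assert (CF := fun v Hv => lip_continuous _ _ _ v LF Hv).
  set (Lam := M * (2 * (INR Nb * Wb * (INR Nb * Wb))) * (2 * (INR L1 * INR L1)) * (2 * INR L1 + 2 * INR Nb + 1)) in *.
  assert (FP := fejer_poisson F1 N V Lam HV (proj1 LF) CF
     (fun v w Hv Hw => proj2 (proj2 LF v w ltac:(lra) ltac:(lra)))).
  destruct HP as (P1 & P2 & P3 & _).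
  assert (EF : forall k, RInt (fun v => F1 v * cos (2 * PI * INR k * v)) (1 / 2) (INR N + 1 / 2)
     = pair_sum phi T b Nb w w L1 L1 k).
  { intros k. unfold pair_sum. rewrite <- (twisted_mean phi T b Nb w w L1 L1 k N P1 P2 P3 HT HN).
    apply RInt_ext. intros t _. rewrite im_prod_diag. unfold F1.
    change (phi (t / T) * (re_prod b b Nb Nb t * re_prod w w L1 L1 t) * cos (2 * PI * INR k * t) =
      phi (t / T) * (re_prod b b Nb Nb t * (re_prod w w L1 L1 t * cos (2 * PI * INR k * t)
        + 0 * sin (2 * PI * INR k * t))) :> R). ring. }
  set (I0 := RInt F1 (1 / 2) (INR N + 1 / 2)) in *.
  rewrite (sum1_ext (fun k => (1 - INR k / INR V) * RInt _ _ _)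
    (fun k => (1 - INR k / INR V) * pair_sum phi T b Nb w w L1 L1 k)) in FP by (intros; rewrite EF; reflexivity).
  set (SS := sum1 (fun n => F1 (INR n)) N) in *.
  set (X := sum1 (fun k => (1 - INR k / INR V) * pair_sum phi T b Nb w w L1 L1 k) V) in *.
  assert (XB : Rabs X <= sum1 (fun nu => Rabs (pair_sum phi T b Nb w w L1 L1 nu)) V).
  { eapply Rle_trans; [apply sum1_abs|]. apply sum1_le. intros k Hk. rewrite Rabs_mult.
    assert (V0 : 0 < INR V) by (apply lt_0_INR; lia).
    assert (kk : 0 <= INR k / INR V <= 1).
    { split; [apply Rmult_le_pos; [apply pos_INR|left; apply Rinv_0_lt_compat; lra]|].
      apply Rmult_le_reg_r with (INR V); [lra|]. unfold Rdiv. rewrite Rmult_assoc, Rinv_l by lra.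
      assert (INR k <= INR V) by (apply le_INR; lia). lra. }
    rewrite Rabs_right by lra. generalize (Rabs_pos (pair_sum phi T b Nb w w L1 L1 k)). nra. }
  replace (SS - I0) with ((SS - (I0 + 2 * X)) + 2 * X) by ring.
  eapply Rle_trans; [apply Rabs_triang|]. rewrite (Rabs_mult 2), (Rabs_right 2) by lra. lra.
Qed.

Lemma RInt_window_le (g : R -> R) phi M T E (N : nat) : window_class phi M -> 1 <= T -> 0 <= E ->
  ex_RInt (fun t => phi (t / T) * g t) (1 / 2) (INR N + 1 / 2) ->
  (forall t, T <= t <= 2 * T -> Rabs (g t) <= E) ->
  Rabs (RInt (fun t => phi (t / T) * g t) (1 / 2) (INR N + 1 / 2)) <= INR N * (M * E).
Proof.
  intros HP HT HE Hex Hg.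
  assert (hN : 1 / 2 <= INR N + 1 / 2) by (generalize (pos_INR N); lra).
  replace (INR N) with (INR N + 1 / 2 - 1 / 2) at 2 by ring.
  apply abs_RInt_le_const; auto. intros t Ht.
  assert (HP' := HP). destruct HP' as (_ & _ & _ & M0 & B & _).
  destruct (Rle_dec T t), (Rle_dec t (2 * T)).
  - rewrite Rabs_mult. apply Rmult_le_compat; auto using Rabs_pos.
  - rewrite (window_zero phi M) by (auto; lra). rewrite Rmult_0_l, Rabs_R0. apply Rmult_le_pos; auto.
  - rewrite (window_zero phi M) by (auto; lra). rewrite Rmult_0_l, Rabs_R0. apply Rmult_le_pos; auto.
  - rewrite (window_zero phi M) by (auto; lra). rewrite Rmult_0_l, Rabs_R0. apply Rmult_le_pos; auto.
Qed.

Lemma continuous_im_prod u v N M : (1 <= N)%nat -> (1 <= M)%nat ->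
  (forall n, Rabs (u n) <= 1) -> (forall n, Rabs (v n) <= 1) -> forall t, 1 / 2 <= t -> continuous (im_prod u v N M) t.
Proof.
  intros HN HM Hu Hv t Ht.
  assert (Lu := fun c => lip_tpoly u N c 1 ltac:(lra) (fun n _ => Hu n)).
  assert (Lv := fun c => lip_tpoly v M c 1 ltac:(lra) (fun n _ => Hv n)).
  unfold im_prod. apply (continuous_minus (V := R_NormedModule)); apply continuous_Rmult;
    eapply lip_continuous; eauto.
Qed.

(** Allows the second zeta polynomial to have another length. If the two polynomials differ by at
    most [d] on the window, the real product changes by O(Dm d), and the imaginary product, zero for
    equal factors, is itself O(Dm d). *)
Lemma pair_sum_replace phi M T b (Nb : nat) w w2 (L1 L2 N nu : nat) Wb Dm d :
  window_class phi M -> 1 <= T -> 2 * T <= INR N -> (1 <= Nb)%nat -> (1 <= L1)%nat -> (1 <= L2)%nat ->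
  0 <= Wb -> (forall n, (1 <= n <= Nb)%nat -> Rabs (b n) <= Wb) ->
  (forall n, Rabs (w n) <= 1) -> (forall n, Rabs (w2 n) <= 1) ->
  (forall t c, T <= t <= 2 * T -> c = 0 \/ c = PI / 2 ->
     Rabs (tpoly w L1 c t) <= Dm /\ Rabs (tpoly w L1 c t - tpoly w2 L2 c t) <= d) ->
  Rabs (pair_sum phi T b Nb w w L1 L1 nu - pair_sum phi T b Nb w w2 L1 L2 nu)
  <= INR N * (M * (2 * (INR Nb * Wb * (INR Nb * Wb)) * (4 * (Dm * d)))).
Proof.
  intros HP HT HN HNb HL1 HL2 HWb Hb Hw Hw2 HD.
  assert (HP' := HP). destruct HP' as (P1 & P2 & P3 & M0 & MB & _).
  unfold pair_sum. rewrite <- !(twisted_mean phi T b Nb) with (N := N) by auto.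
  assert (Lphi := lip_window phi M T HP HT).
  assert (Lb := lip_re_prod b b Nb Nb Wb Wb HWb HWb HNb HNb Hb Hb).
  assert (Lw := lip_re_prod w w L1 L1 1 1 ltac:(lra) ltac:(lra) HL1 HL1 (fun n _ => Hw n) (fun n _ => Hw n)).
  assert (Lw2 := lip_re_prod w w2 L1 L2 1 1 ltac:(lra) ltac:(lra) HL1 HL2 (fun n _ => Hw n) (fun n _ => Hw2 n)).
  assert (Lc := fun f Q a x (H : lip f Q a) (Hx : 1 / 2 <= x) => lip_continuous f Q a x H Hx).
  assert (hN : 1 / 2 <= INR N + 1 / 2) by (generalize (pos_INR N); lra).
  assert (CC : forall x, continuous (fun t => cos (2 * PI * INR nu * t)) x) by (intros; apply continuous_cos_freq).
  assert (CS : forall x, continuous (fun t => sin (2 * PI * INR nu * t)) x).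
  { intros x. eapply is_derive_continuous. auto_derive; auto. }
  assert (C1 : forall v L, (1 <= L)%nat -> (forall n, Rabs (v n) <= 1) -> forall x, 1 / 2 <= x <= INR N + 1 / 2 ->
    continuous (fun t => phi (t / T) * (re_prod b b Nb Nb t * (re_prod w v L1 L t * cos (2 * PI * INR nu * t)
      + im_prod w v L1 L t * sin (2 * PI * INR nu * t)))) x).
  { intros v L HL Hv x Hx. assert (Hx' : 1 / 2 <= x) by lra.
    apply continuous_Rmult; [eapply Lc; eauto|]. apply continuous_Rmult; [eapply Lc; eauto|].
    apply continuous_Rplus; apply continuous_Rmult; auto.
    - apply (Lc _ _ _ _ (lip_re_prod w v L1 L 1 1 ltac:(lra) ltac:(lra) HL1 HL (fun n _ => Hw n) (fun n _ => Hv n)) Hx').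
    - apply continuous_im_prod; auto. }
  rewrite <- RInt_Rminus; auto.
  rewrite (RInt_ext _ (fun t => phi (t / T) * (re_prod b b Nb Nb t *
     ((re_prod w w L1 L1 t - re_prod w w2 L1 L2 t) * cos (2 * PI * INR nu * t)
       - im_prod w w2 L1 L2 t * sin (2 * PI * INR nu * t))))).
  2:{ intros t _. rewrite im_prod_diag.
      match goal with |- ?a = ?b => change (a = b :> R) end. ring. }
  assert (D0 : 0 <= Dm * d).
  { destruct (HD T 0) as [Q1 Q2]; [lra|auto|].
    generalize (Rabs_pos (tpoly w L1 0 T)) (Rabs_pos (tpoly w L1 0 T - tpoly w2 L2 0 T)). nra. }
  apply RInt_window_le; auto.
  - assert (0 <= INR Nb * Wb * (INR Nb * Wb)) by nra. nra.
  - apply ex_RInt_cont; auto. intros x Hx. assert (Hx' : 1 / 2 <= x) by lra.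
    apply continuous_Rmult; [eapply Lc; eauto|]. apply continuous_Rmult; [eapply Lc; eauto|].
    apply (continuous_minus (V := R_NormedModule)); apply continuous_Rmult; auto.
    + apply (continuous_minus (V := R_NormedModule)); eapply Lc; eauto.
    + apply continuous_im_prod; auto.
  - intros t Ht. rewrite Rabs_mult. apply Rmult_le_compat; try apply Rabs_pos.
    + destruct Lb as [_ Lb]. apply (Lb t t); lra.
    + destruct (HD t 0 Ht (or_introl eq_refl)) as [A1 A2].
      destruct (HD t (PI / 2) Ht (or_intror eq_refl)) as [A3 A4].
      unfold re_prod, im_prod.
      set (u := tpoly w L1 0 t) in *. set (v := tpoly w L1 (PI / 2) t) in *.
      set (u2 := tpoly w2 L2 0 t) in *. set (v2 := tpoly w2 L2 (PI / 2) t) in *.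
      assert (B1 : Rabs (u * (u - u2)) <= Dm * d) by (rewrite Rabs_mult; apply Rmult_le_compat; auto using Rabs_pos).
      assert (B2 : Rabs (v * (v - v2)) <= Dm * d) by (rewrite Rabs_mult; apply Rmult_le_compat; auto using Rabs_pos).
      assert (B3 : Rabs (u * (v - v2)) <= Dm * d) by (rewrite Rabs_mult; apply Rmult_le_compat; auto using Rabs_pos).
      assert (B4 : Rabs (v * (u - u2)) <= Dm * d) by (rewrite Rabs_mult; apply Rmult_le_compat; auto using Rabs_pos).
      replace (u * u + v * v - (u * u2 + v * v2)) with (u * (u - u2) + v * (v - v2)) by ring.
      replace (v * u2 - u * v2) with (u * (v - v2) - v * (u - u2)) by ring.
      assert (X1 : Rabs (u * (u - u2) + v * (v - v2)) <= 2 * (Dm * d))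
        by (eapply Rle_trans; [apply Rabs_triang|]; lra).
      assert (X2 : Rabs (u * (v - v2) - v * (u - u2)) <= 2 * (Dm * d)).
      { unfold Rminus at 1. eapply Rle_trans; [apply Rabs_triang|]. rewrite Rabs_Ropp. lra. }
      assert (c1 : Rabs (cos (2 * PI * INR nu * t)) <= 1) by (apply Rabs_le, COS_bound).
      assert (s1 : Rabs (sin (2 * PI * INR nu * t)) <= 1) by (apply Rabs_le, SIN_bound).
      unfold Rminus at 1. eapply Rle_trans; [apply Rabs_triang|]. rewrite Rabs_Ropp, !Rabs_mult.
      set (p := Rabs (u * (u - u2) + v * (v - v2))) in *. set (p2 := Rabs (u * (v - v2) - v * (u - u2))) in *.
      assert (0 <= p) by apply Rabs_pos. assert (0 <= p2) by apply Rabs_pos.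
      generalize (Rabs_pos (cos (2 * PI * INR nu * t))) (Rabs_pos (sin (2 * PI * INR nu * t))). intros.
      assert (p * Rabs (cos (2 * PI * INR nu * t)) <= p) by nra.
      assert (p2 * Rabs (sin (2 * PI * INR nu * t)) <= p2) by nra. lra.
Qed.

(** When 2 pi nu exceeds ln Nb + ln L1 + 1, every term has ln (n / (m x)) <= -1, so the transform is
    evaluated at distance at least T from 0 and decays like T^(-j). *)
Lemma high_frequency_le phi j : csupp phi ->
  exists K, 0 <= K /\ forall T b (Nb : nat) w (L1 nu : nat) Wb, 1 <= T ->
    0 <= Wb -> (forall n, (1 <= n <= Nb)%nat -> Rabs (b n) <= Wb) -> (forall n, Rabs (w n) <= 1) ->
    (1 <= L1)%nat -> (1 <= Nb)%nat -> 1 + ln (INR Nb) + ln (INR L1) <= 2 * PI * INR nu ->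
    Rabs (pair_sum phi T b Nb w w L1 L1 nu)
    <= K * (INR Nb * Wb * (INR Nb * Wb)) * (INR L1 * INR L1) * (T / T ^ j).
Proof.
  intros Hp. destruct (ct_decay j phi (Hp j)) as [K [K0 HK]]. exists K. split; auto.
  intros T b Nb w L1 nu Wb HT HWb Hb Hw HL1 HNb Hnu.
  assert (Tj : 0 < T ^ j) by (apply pow_lt; lra).
  assert (DS : forall a c, (1 <= a <= Nb)%nat -> (1 <= c <= Nb)%nat ->
    Rabs (double_sum phi T (INR a / INR c * exp (2 * PI * INR nu)) w w L1 L1) <= INR L1 * (INR L1 * (K * (T / T ^ j)))).
  { intros a c Ha Hc. unfold double_sum. apply sum1_abs_bound. intros m Hm.
    assert (Im := inv_sqrt_le_1 m ltac:(lia)).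
    assert (IS : Rabs (sum1 (fun n => w n * / sqrt (INR n) * (T * ct phi 0 (T * ln (INR n / (INR m * (INR a / INR c * exp (2 * PI * INR nu))))))) L1)
       <= INR L1 * (K * (T / T ^ j))).
    { apply sum1_abs_bound. intros n Hn. assert (In := inv_sqrt_le_1 n ltac:(lia)).
      assert (a0 : 0 < INR a) by (apply lt_0_INR; lia). assert (c0 : 0 < INR c) by (apply lt_0_INR; lia).
      assert (m1 : 1 <= INR m) by (apply (le_INR 1); lia). assert (n0 : 0 < INR n) by (apply lt_0_INR; lia).
      assert (a1 : 1 <= INR a) by (apply (le_INR 1); lia).
      assert (e0 := exp_pos (2 * PI * INR nu)).
      assert (ac : 0 < INR a / INR c) by (apply Rdiv_lt_0_compat; auto).
      set (s := ln (INR n / (INR m * (INR a / INR c * exp (2 * PI * INR nu))))).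
      assert (Es : s = ln (INR n) - (ln (INR m) + (ln (INR a) - ln (INR c) + 2 * PI * INR nu))).
      { assert (x0 : 0 < INR a / INR c * exp (2 * PI * INR nu)) by (apply Rmult_lt_0_compat; auto).
        unfold s. rewrite (ln_div (INR n)), (ln_mult (INR m)), (ln_mult (INR a / INR c)), ln_exp, ln_div;
          auto; try lra. apply Rmult_lt_0_compat; lra. }
      assert (l1 : ln (INR n) <= ln (INR L1)) by (apply ln_le; auto; apply le_INR; lia).
      assert (l2 : ln (INR c) <= ln (INR Nb)) by (apply ln_le; auto; apply le_INR; lia).
      assert (l3 : 0 <= ln (INR m)) by (rewrite <- ln_1; apply ln_le; lra).
      assert (l4 : 0 <= ln (INR a)) by (rewrite <- ln_1; apply ln_le; lra).
      assert (s1 : 1 <= Rabs s) by (rewrite Rabs_left1; lra).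
      specialize (HK 0 (T * s)). rewrite Rabs_mult, (Rabs_right T), Rpow_mult_distr in HK by lra.
      set (c' := Rabs (ct phi 0 (T * s))) in *. assert (c'0 : 0 <= c') by apply Rabs_pos.
      assert (sj : 1 <= Rabs s ^ j) by (apply pow_R1_Rle; auto).
      assert (Bc : T * c' <= K * (T / T ^ j)).
      { apply Rmult_le_reg_r with (T ^ j); auto.
        replace (K * (T / T ^ j) * T ^ j) with (T * K) by (field; lra).
        rewrite Rmult_assoc. apply Rmult_le_compat_l; [lra|].
        eapply Rle_trans; [|exact HK]. rewrite Rmult_comm. apply Rmult_le_compat_r; auto. nra. }
      rewrite !Rabs_mult, (Rabs_right T), (Rabs_right (/ sqrt (INR n))) by lra. fold c'.
      specialize (Hw n). assert (w0 := Rabs_pos (w n)). assert (0 <= T * c') by nra.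
      assert (0 <= Rabs (w n) * / sqrt (INR n) <= 1) by (split; nra). nra. }
    rewrite !Rabs_mult, (Rabs_right (/ sqrt (INR m))) by lra.
    specialize (Hw m). assert (w0 := Rabs_pos (w m)).
    assert (0 <= Rabs (w m) * / sqrt (INR m) <= 1) by (split; nra).
    match type of IS with ?q <= _ => assert (0 <= q) by apply Rabs_pos end. nra. }
  unfold pair_sum.
  replace (K * (INR Nb * Wb * (INR Nb * Wb)) * (INR L1 * INR L1) * (T / T ^ j))
    with (INR Nb * (INR Nb * (Wb * Wb * (INR L1 * (INR L1 * (K * (T / T ^ j))))))) by ring.
  apply sum1_abs_bound. intros a Ha. apply sum1_abs_bound. intros c Hc.
  specialize (DS a c Ha Hc). assert (B1 := Hb a Ha). assert (B2 := Hb c Hc).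
  assert (Ia := inv_sqrt_le_1 a ltac:(lia)). assert (Ic := inv_sqrt_le_1 c ltac:(lia)).
  rewrite !Rabs_mult, (Rabs_right (/ sqrt (INR a))), (Rabs_right (/ sqrt (INR c))) by lra.
  apply Rmult_le_compat; auto using Rabs_pos.
  - apply Rmult_le_pos; [apply Rmult_le_pos; apply Rabs_pos|apply Rmult_le_pos; lra].
  - assert (0 <= / sqrt (INR a) * / sqrt (INR c) <= 1) by (split; nra).
    assert (P := Rabs_pos (b a)). assert (P2 := Rabs_pos (b c)).
    assert (Rabs (b a) * Rabs (b c) <= Wb * Wb) by (apply Rmult_le_compat; auto).
    assert (0 <= Rabs (b a) * Rabs (b c)) by nra. nra.
Qed.

(** * Sizes as powers of Z, and the discrepancy bound *)

(** In the final argument sizes are bounded by fixed powers of Z. Together with the next two lemmas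
    this reduces the comparison of sizes to linear arithmetic of exponents. *)
Lemma le_pow_mult Z x y a b : 0 <= x <= Z ^ a -> 0 <= y <= Z ^ b -> 0 <= x * y <= Z ^ (a + b).
Proof. intros Hx Hy. split; [nra|]. rewrite pow_add. apply Rmult_le_compat; lra. Qed.

Lemma le_pow_weaken Z x a b : 1 <= Z -> 0 <= x <= Z ^ a -> (a <= b)%nat -> 0 <= x <= Z ^ b.
Proof. intros HZ Hx Hab. split; [lra|]. eapply Rle_trans; [apply Hx|]. apply Rle_pow; auto. Qed.

Lemma le_pow_div Z x a c b : 1 <= Z -> 0 <= x <= Z ^ a -> (a + c <= b)%nat -> 0 <= x / Z ^ b <= / Z ^ c.
Proof.
  intros HZ Hx Hab. assert (0 < Z ^ b) by (apply pow_lt; lra). assert (0 < Z ^ c) by (apply pow_lt; lra).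
  split; [apply Rmult_le_pos; [lra|left; apply Rinv_0_lt_compat; auto]|].
  apply Rmult_le_reg_r with (Z ^ b * Z ^ c); [apply Rmult_lt_0_compat; auto|].
  replace (x / Z ^ b * (Z ^ b * Z ^ c)) with (x * Z ^ c) by (field; lra).
  replace (/ Z ^ c * (Z ^ b * Z ^ c)) with (Z ^ b) by (field; lra).
  apply Rle_trans with (Z ^ a * Z ^ c); [apply Rmult_le_compat_r; lra|].
  rewrite <- pow_add. apply Rle_pow; auto.
Qed.

(** The even exponent gives sqrt N >= Z^h, and one further factor Z absorbs the rounding up. *)
Lemma nat_near_pow Z h : 2 <= Z -> exists N : nat, (1 <= N)%nat /\ Z ^ (2 * h) <= INR N /\
  0 <= INR N <= Z ^ (2 * h + 1) /\ Z ^ h <= sqrt (INR N).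
Proof.
  intros HZ. assert (P : 1 <= Z ^ (2 * h)) by (apply pow_R1_Rle; lra).
  destruct (nat_ceil (Z ^ (2 * h))) as [N [N1 N2]]; [lra|].
  exists N. repeat split.
  - apply INR_le. simpl. lra.
  - auto.
  - apply pos_INR.
  - rewrite pow_add, pow_1. nra.
  - apply le_of_sqr_le; [apply sqrt_pos|]. rewrite sqrt_sqrt by lra.
    rewrite <- pow_add. replace (h + h)%nat with (2 * h)%nat by lia. auto.
Qed.

Lemma Csum_seq f N m : fst (Csum f (seq (S m) N)) = sum1 (fun n => fst (f (m + n)%nat)) N /\
  snd (Csum f (seq (S m) N)) = sum1 (fun n => snd (f (m + n)%nat)) N.
Proof.
  revert m. induction N as [|N IH]; intros m; [simpl; auto|].
  destruct (IH (S m)) as [E1 E2]. rewrite !sum1_recl.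
  change (Csum f (seq (S m) (S N))) with (Cadd (f (S m)) (Csum f (seq (S (S m)) N))).
  unfold Cadd. simpl fst. simpl snd. rewrite E1, E2. replace (m + 1)%nat with (S m) by lia.
  split; f_equal; apply sum1_ext; intros k _; f_equal; f_equal; lia.
Qed.

(** Zero outside 1 <= n <= Y, so that the coefficient bounds hold at every index, including 0, where
    nothing is known about [b]. *)
Definition trunc_coef (b : nat -> R) (Y : R) (n : nat) : R :=
  if Nat.leb 1 n then if Rle_dec (INR n) Y then b n else 0 else 0.

Lemma Bpoly_crit b T theta t :
  fst (Bpoly b T theta (crit t)) = tpoly (trunc_coef b (Rpower T theta)) (Z.to_nat (up (Rpower T theta))) 0 t /\
  snd (Bpoly b T theta (crit t)) = tpoly (trunc_coef b (Rpower T theta)) (Z.to_nat (up (Rpower T theta))) (PI / 2) t.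
Proof.
  unfold Bpoly. set (f := fun n => _). destruct (Csum_seq f (Z.to_nat (up (Rpower T theta))) 0) as [E1 E2].
  rewrite E1, E2. unfold tpoly.
  assert (G : forall n, (1 <= n)%nat ->
    fst (f n) = trunc_coef b (Rpower T theta) n * osc t (-1 / 2) 0 (INR n) /\
    snd (f n) = trunc_coef b (Rpower T theta) n * osc t (-1 / 2) (PI / 2) (INR n)).
  { intros n Hn. unfold f, trunc_coef. rewrite (proj2 (Nat.leb_le 1 n) Hn).
    destruct (Rle_dec _ _); [|simpl; split; ring].
    unfold osc, cpow_nat, Cscale, Copp, crit, Rpower. simpl fst. simpl snd.
    replace (- t * ln (INR n)) with (- (t * ln (INR n))) by ring.
    rewrite cos_neg, sin_neg, Rplus_0_r, cos_plus, cos_PI2, sin_PI2.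
    replace (- (1 / 2)) with (-1 / 2) by field. split; ring. }
  split; apply sum1_ext; intros n Hn; simpl; apply G; lia.
Qed.

Lemma fold_right_Rplus_seq (g : nat -> R) n m :
  fold_right Rplus 0 (map g (seq m n)) = sum1 (fun k => g (m + k - 1)%nat) n.
Proof.
  revert m. induction n as [|n IH]; intros m; [reflexivity|].
  rewrite sum1_recl. simpl seq. simpl map. simpl fold_right. rewrite IH.
  f_equal; [f_equal; lia|]. apply sum1_ext. intros k _. f_equal. lia.
Qed.

Lemma Zsum_window f S (N : nat) : (forall l : Z, (l <= 0)%Z \/ (Z.of_nat N < l)%Z -> f l = 0) ->
  Zsum_is f S -> S = sum1 (fun n => f (Z.of_nat n)) N.
Proof.
  intros H0 HS. apply (UL_sequence (symsum f)); auto.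
  intros e He. exists N. intros n Hn. unfold Rdist.
  assert (E : symsum f n = sum1 (fun n => f (Z.of_nat n)) N); [|rewrite E, Rminus_diag, Rabs_R0; auto].
  unfold symsum. rewrite fold_right_Rplus_seq. replace (2 * n + 1)%nat with ((n + 1) + n)%nat by lia.
  rewrite sum1_add. rewrite (sum1_ext _ (fun _ => 0) (n + 1)).
  - rewrite sum1_zero, Rplus_0_l. rewrite (sum1_extend _ N n) by (try lia; intros; apply H0; lia).
    apply sum1_ext. intros k Hk. f_equal. lia.
  - intros k Hk. apply H0. lia.
Qed.

(** Integrability over the window is extracted from the assumed existence of the integral. It later
    allows the integral of the function containing zeta to be compared with that of its
    approximation. *)
Lemma Rint_window f I (N : nat) : (forall t, t <= 1 / 2 \/ INR N + 1 / 2 <= t -> f t = 0) ->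
  Rint_is f I -> ex_RInt f (1 / 2) (INR N + 1 / 2) /\ I = RInt f (1 / 2) (INR N + 1 / 2).
Proof.
  intros H0 [pr HI].
  assert (EX : forall n, (N < n)%nat -> ex_RInt f (- INR n) (INR n)) by (intros; apply ex_RInt_Reals_1; auto).
  assert (SUB : forall n, (N < n)%nat -> ex_RInt f (1 / 2) (INR N + 1 / 2) /\
     RiemannInt (pr (INR n)) = RInt f (1 / 2) (INR N + 1 / 2)).
  { intros n Hn. specialize (EX n Hn).
    assert (Nn : INR N + 1 <= INR n) by (rewrite <- S_INR; apply le_INR; lia).
    assert (N0 := pos_INR N).
    assert (X1 : ex_RInt f (1 / 2) (INR n)) by (apply (ex_RInt_Chasles_2 (V := R_CompleteNormedModule)) with (- INR n); auto; lra).
    assert (X2 : ex_RInt f (1 / 2) (INR N + 1 / 2)) by (apply (ex_RInt_Chasles_1 (V := R_CompleteNormedModule)) with (INR n); auto; lra).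
    assert (X3 : ex_RInt f (- INR n) (1 / 2)) by (apply (ex_RInt_Chasles_1 (V := R_CompleteNormedModule)) with (INR n); auto; lra).
    assert (X4 : ex_RInt f (INR N + 1 / 2) (INR n)) by (apply (ex_RInt_Chasles_2 (V := R_CompleteNormedModule)) with (1 / 2); auto; lra).
    split; auto. rewrite <- RInt_Reals.
    rewrite <- (RInt_Chasles (V := R_CompleteNormedModule) f (- INR n) (1 / 2) (INR n)) by auto.
    rewrite <- (RInt_Chasles (V := R_CompleteNormedModule) f (1 / 2) (INR N + 1 / 2) (INR n)) by auto.
    assert (Z1 : RInt f (- INR n) (1 / 2) = 0).
    { rewrite (RInt_ext _ (fun _ => 0)).
      - rewrite RInt_const. unfold scal. simpl. unfold mult. simpl. ring.
      - rewrite Rmin_left, Rmax_right by lra. intros x Hx. apply H0. lra. }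
    assert (Z2 : RInt f (INR N + 1 / 2) (INR n) = 0).
    { rewrite (RInt_ext _ (fun _ => 0)).
      - rewrite RInt_const. unfold scal. simpl. unfold mult. simpl. ring.
      - rewrite Rmin_left, Rmax_right by lra. intros x Hx. apply H0. lra. }
    rewrite Z1, Z2.
    change (0 + (RInt f (1 / 2) (INR N + 1 / 2) + 0) = RInt f (1 / 2) (INR N + 1 / 2) :> R). ring. }
  split; [apply (SUB (S N)); lia|].
  apply (UL_sequence (fun n => RiemannInt (pr (INR n)))); auto.
  intros e He. exists (S N). intros n Hn. unfold Rdist.
  destruct (SUB n ltac:(lia)) as [_ ->]. rewrite Rminus_diag, Rabs_R0. auto.
Qed.

Lemma tpoly_cutoff_le H A L N c t : (1 <= H)%nat -> 1 <= t -> Rabs (tpoly (cutoff H A L) N c t) <= INR N.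
Proof.
  intros HH Ht.
  assert (W : forall n, (1 <= n <= N)%nat -> Rabs (cutoff H A L n) <= 1)
    by (intros; apply Rabs_le; generalize (cutoff_bounds H A L n HH); lra).
  destruct (lip_tpoly (cutoff H A L) N c 1 ltac:(lra) W) as [_ Q].
  destruct (Q t t ltac:(lra) ltac:(lra)). lra.
Qed.

(** For N about Z^(2 h) the first error sqrt N / t^(A + 1) is made small by A >= 3 h, the second t /
    sqrt N is at most 2 Z^(q - h), and Z^3 absorbs the constants. *)
Lemma zeta_approx_pow A Kz Z T (q h N : nat) t : 0 <= Kz <= Z -> 3 <= Z <= T -> T <= Z ^ q -> T <= t <= 2 * T ->
  (3 * h <= A)%nat -> (1 <= N)%nat -> 0 <= INR N <= Z ^ (2 * h + 1) -> Z ^ h <= sqrt (INR N) ->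
  Kz * (sqrt (INR N) / t ^ S A + t / sqrt (INR N)) <= Z ^ (q + 3) / Z ^ h.
Proof.
  intros HK HZ HT Ht HA HN NZ sN.
  assert (N1 : 1 <= INR N) by (apply (le_INR 1); auto).
  assert (Zh : 0 < Z ^ h) by (apply pow_lt; lra).
  assert (Zq : 1 <= Z ^ q) by (apply pow_R1_Rle; lra).
  assert (s1 : sqrt (INR N) <= INR N).
  { apply le_of_sqr_le; [lra|]. rewrite sqrt_sqrt by lra. nra. }
  assert (tA : Z ^ S A <= t ^ S A) by (apply pow_incr; lra).
  assert (ZA : 0 < Z ^ S A) by (apply pow_lt; lra).
  assert (B1 : sqrt (INR N) / t ^ S A <= / Z ^ h).
  { apply Rle_trans with (INR N / Z ^ S A).
    - apply Rmult_le_compat; auto; [apply sqrt_pos|left; apply Rinv_0_lt_compat; lra|].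
      apply Rinv_le_contravar; auto.
    - apply (le_pow_div Z (INR N) (2 * h + 1) h (S A)); [lra|auto|lia]. }
  assert (B2 : t / sqrt (INR N) <= 2 * Z ^ q / Z ^ h).
  { apply Rmult_le_compat; [lra|left; apply Rinv_0_lt_compat; lra|lra|]. apply Rinv_le_contravar; auto. }
  assert (iz : 0 < / Z ^ h) by (apply Rinv_0_lt_compat; auto).
  apply Rle_trans with (Z * (3 * Z ^ q * / Z ^ h)).
  - apply Rmult_le_compat; try lra.
    + apply Rplus_le_le_0_compat; apply Rmult_le_pos; try lra; try apply sqrt_pos; left; apply Rinv_0_lt_compat; [apply pow_lt|]; lra.
    + unfold Rdiv in *. nra.
  - unfold Rdiv. rewrite <- Rmult_assoc. apply Rmult_le_compat_r; [lra|].
    rewrite pow_add. replace (Z ^ 3) with (Z * Z * Z) by ring.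
    assert (Z * 3 <= Z * Z * Z) by nra.
    replace (Z * (3 * Z ^ q)) with (Z ^ q * (Z * 3)) by ring. apply Rmult_le_compat_l; lra.
Qed.

Lemma add_one_le_mul Z x P : 2 <= Z -> 1 <= P -> x <= P -> x + 1 <= Z * P.
Proof. intros. nra. Qed.

Lemma square_diff_le z u d B : Rabs (u - z) <= d -> Rabs z <= B -> Rabs u <= B -> Rabs (z * z - u * u) <= d * (2 * B).
Proof.
  intros H1 H2 H3. replace (z * z - u * u) with (- ((u - z) * (z + u))) by ring.
  rewrite Rabs_Ropp, Rabs_mult. apply Rmult_le_compat; auto using Rabs_pos.
  eapply Rle_trans; [apply Rabs_triang|]. lra.
Qed.

(* All parameters are powers of [Z = T^eps]; [A] is chosen last and beats every fixed power of [Z]. *)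
Lemma discrepancy_le phi M theta (md Cn : nat) Kb : window_class phi M -> 0 < theta < 1 / 2 -> 1 <= Kb ->
  exists K L0, 0 <= K /\ 2 <= L0 /\ forall L (b : nat -> R) (Nb N : nat), L0 <= L ->
    let T := exp L in
    (forall a, Rabs (b a) <= Kb * INR (ndiv a) ^ md) ->
    (forall a, b a <> 0 -> INR a <= exp (theta * L)) -> (1 <= Nb)%nat -> INR Nb <= T ->
    2 * T <= INR N <= 2 * T + 1 ->
    let F := fun t => phi (t / T) * (re_prod b b Nb Nb t *
       (fst (zeta (crit t)) * fst (zeta (crit t)) + snd (zeta (crit t)) * snd (zeta (crit t)))) in
    ex_RInt F (1 / 2) (INR N + 1 / 2) ->
    Rabs (sum1 (fun n => F (INR n)) N - RInt F (1 / 2) (INR N + 1 / 2)) <= K * (T / L ^ Cn).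
Proof.
  intros HP Hth HKb.
  set (eps := (1 / 2 - theta) / 8). assert (e0 : 0 < eps <= 1) by (unfold eps; lra).
  (* Chosen so that T <= Z^q. *)
  destruct (nat_ceil (/ eps)) as [q [q1 _]]; [left; apply Rinv_0_lt_compat; lra|].
  assert (qe : 1 <= INR q * eps).
  { apply Rmult_le_compat_r with (r := eps) in q1; [|lra]. rewrite Rinv_l in q1 by lra. lra. }
  assert (named : forall x : nat, exists y, y = x) by eauto.
  (* Exponents of Z, each fixed by the earlier ones: [eb] for the coefficients, [eB] for |B|^2, [ez]
     for zeta on the window, [h1] for the short zeta polynomial, [hV] for the number of outer
     frequencies, [j] for the decay order at high frequencies. Then [c0 L] bounds the frequencies
     that matter, [ey] the values exp (2 pi nu) among them, [h2] is for the long zeta polynomial,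
     [hK] for the inner Poisson length, and [A] is the order of smoothing. *)
  destruct (named (1 + q * md)%nat) as [eb Eeb].
  destruct (named (1 + 2 * (q + eb))%nat) as [eB EeB].
  destruct (named (2 * q + 9)%nat) as [ez Eez].
  destruct (named (2 * q + eB + ez + 14)%nat) as [h1 Eh1].
  destruct (named (2 * q + eB + 6 * h1 + 11)%nat) as [hV EhV].
  destruct (named (2 * hV + eB + 4 * h1 + q + 6)%nat) as [j Ej].
  destruct (named (q + 2 * h1 + 4)%nat) as [c0 Ec0].
  destruct (named (8 * c0 * q)%nat) as [ey Eey].
  destruct (named (h1 + q + ey + 3)%nat) as [h2 Eh2].
  destruct (named (2 * h1 + 2 * h2 + 2 * q + eB + 9)%nat) as [hK EhK].
  destruct (named (3 * h2 + 3 * h1 + 3 * (q + 3) + 2 * q + ey + 2 * hK + 2 * h1 + 2 * h2 + eB + 20)%nat) as [A EA].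
  clear named.
  assert (Hcs : csupp phi) by apply HP.
  destruct (zeta_smooth_approx A) as [Kz [Kz0 Hz]].
  (* One power of L more than claimed is saved per frequency, because O(L) frequencies are added
     up. *)
  destruct (low_frequency_le phi theta A md (S Cn) Hcs Hth ltac:(lia)) as [Kl [Ll [Kl0 [Ll1 Hl]]]]. fold eps in Hl.
  destruct (high_frequency_le phi j Hcs) as [Kh [Kh0 Hh]].
  assert (M0 : 0 <= M) by apply HP.
  (* For large L the number Z exceeds these constants, and also c0 L, so that each of them counts as
     one power of Z. *)
  set (Kc := 10 + INR A + M + Kb + Kz + Kh + Kl + INR c0).
  destruct (pow_le_exp_eventually Kc eps 1 ltac:(lra)) as [LA [LA1 HLA]].
  destruct (pow_le_exp_eventually 1 1 Cn ltac:(lra)) as [LB [LB1 HLB]].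
  exists (15 + 2 * INR c0 * Kl * Kb ^ 2), (LA + LB + Ll).
  assert (A0 := pos_INR A). assert (C0 := pos_INR c0).
  split; [assert (0 <= INR c0 * Kl * Kb ^ 2) by (apply Rmult_le_pos; [apply Rmult_le_pos; lra|apply pow2_ge_0]); lra|].
  split; [lra|].
  intros L b Nb N HL T Hb Hb2 HNb NbT HN F HexF.
  assert (L1' : 1 <= L) by lra.
  set (Z := exp (eps * L)) in *.
  assert (ZK : Kc * L <= Z) by (specialize (HLA L ltac:(lra)); simpl in HLA; unfold Z; lra).
  assert (ZKc : Kc <= Z) by (assert (10 <= Kc) by (unfold Kc; lra); nra).
  assert (Z10 : 10 <= Z /\ INR A + 1 <= Z /\ M <= Z /\ Kb <= Z /\ Kz <= Z /\ Kh <= Z /\ Kl <= Z)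
    by (unfold Kc in ZKc; repeat split; lra).
  destruct Z10 as (Z10 & ZA & ZM & ZKb & ZKz & ZKh & ZKl).
  assert (Zc0 : INR c0 * L <= Z) by (assert (INR c0 * L <= Kc * L) by (apply Rmult_le_compat_r; unfold Kc; lra); lra).
  assert (TC : 1 <= T / L ^ Cn).
  { assert (P : 0 < L ^ Cn) by (apply pow_lt; lra). specialize (HLB L ltac:(lra)).
    rewrite !Rmult_1_l in HLB. fold T in HLB. apply Rmult_le_reg_r with (L ^ Cn); auto.
    unfold Rdiv. rewrite Rmult_assoc, Rinv_l; lra. }
  assert (ZT : Z <= T) by (unfold Z, T; apply exp_le; apply Rle_trans with (1 * L); [apply Rmult_le_compat_r; lra|lra]).
  assert (TZ : T <= Z ^ q) by (unfold Z; rewrite <- exp_mul_INR; unfold T; apply exp_le;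
    rewrite <- Rmult_assoc; apply Rle_trans with (1 * L); [lra|apply Rmult_le_compat_r; lra]).
  assert (T1 : 1 <= T) by lra.
  assert (Tq : 0 <= T <= Z ^ q) by lra.
  assert (Z1 : 1 <= Z) by lra.
  assert (PZ : forall n, 0 < Z ^ n) by (intros; apply pow_lt; lra).
  assert (ONE : 0 <= 1 <= Z ^ 0) by (simpl; lra).
  assert (cst : forall x, 0 <= x <= Z -> 0 <= x <= Z ^ 1) by (intros; simpl; lra).
  assert (Nq : 0 <= INR N <= Z ^ (q + 1)).
  { split; [apply pos_INR|]. rewrite pow_add, pow_1.
    apply Rle_trans with (T * 3); [lra|apply Rmult_le_compat; lra]. }
  assert (Nbq : 0 <= INR Nb <= Z ^ q) by (split; [apply pos_INR|lra]).
  set (Wb := Kb * INR Nb ^ md).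
  assert (Wbq : 0 <= Wb <= Z ^ eb).
  { unfold Wb. rewrite Eeb. apply le_pow_mult; [apply cst; lra|].
    split; [apply pow_le, pos_INR|]. rewrite pow_mult. apply pow_incr; auto. }
  assert (HbW : forall n, (1 <= n <= Nb)%nat -> Rabs (b n) <= Wb).
  { intros n Hn. eapply Rle_trans; [apply Hb|]. unfold Wb. apply Rmult_le_compat_l; [lra|].
    apply pow_incr. split; [apply pos_INR|]. eapply Rle_trans; [apply ndiv_le; lia|]. apply le_INR; lia. }
  set (NW := INR Nb * Wb * (INR Nb * Wb)).
  assert (NWq' : 0 <= NW <= Z ^ (2 * (q + eb))).
  { unfold NW. replace (2 * (q + eb))%nat with ((q + eb) + (q + eb))%nat by lia.
    apply le_pow_mult; apply le_pow_mult; auto. }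
  assert (NWq : 0 <= 2 * NW <= Z ^ eB) by (rewrite EeB; apply le_pow_mult; [apply cst; lra|auto]).
  assert (NWq2 : 0 <= NW <= Z ^ eB) by lra.
  set (zr := fun t => fst (zeta (crit t))) in *. set (zi := fun t => snd (zeta (crit t))) in *.
  assert (HZ : forall h (n : nat), (3 * h <= A)%nat -> (1 <= n)%nat -> 0 <= INR n <= Z ^ (2 * h + 1) ->
    Z ^ h <= sqrt (INR n) -> forall t, T <= t <= 2 * T ->
    Rabs (tpoly (cutoff n A ((A + 1) * n)) ((A + 1) * n) 0 t - zr t) <= Z ^ (q + 3) / Z ^ h /\
    Rabs (tpoly (cutoff n A ((A + 1) * n)) ((A + 1) * n) (PI / 2) t - zi t) <= Z ^ (q + 3) / Z ^ h).
  { intros h n Hh1 Hn1 Hn2 Hn3 t Ht. destruct (Hz t n ltac:(lra) Hn1) as [X1 X2].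
    assert (B := zeta_approx_pow A Kz Z T q h n t ltac:(lra) ltac:(lra) TZ Ht Hh1 Hn1 Hn2 Hn3).
    split; eapply Rle_trans; eauto. }
  (* A crude bound for zeta on the window: the length of an approximating polynomial with h = q + 3,
     for which the approximation error is 1. *)
  assert (ZB : forall t, T <= t <= 2 * T -> Rabs (zr t) <= Z ^ ez /\ Rabs (zi t) <= Z ^ ez).
  { intros t Ht. destruct (nat_near_pow Z (q + 3) ltac:(lra)) as [n (n1 & n2 & n3 & n4)].
    destruct (HZ (q + 3)%nat n ltac:(lia) n1 n3 n4 t Ht) as [X1 X2].
    replace (Z ^ (q + 3) / Z ^ (q + 3)) with 1 in * by (field; apply Rgt_not_eq, PZ).
    assert (Bq : INR ((A + 1) * n) + 1 <= Z ^ ez).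
    { assert (Q : 0 <= INR ((A + 1) * n) <= Z ^ (1 + (2 * (q + 3) + 1))).
      { rewrite mult_INR. apply le_pow_mult; auto. apply cst. rewrite plus_INR. simpl (INR 1). lra. }
      replace ez with (1 + (1 + (2 * (q + 3) + 1)))%nat by lia. rewrite pow_add, pow_1.
      apply add_one_le_mul; [lra|apply pow_R1_Rle; lra|lra]. }
    assert (Y := fun c => tpoly_cutoff_le n A ((A + 1) * n) ((A + 1) * n) c t n1 ltac:(lra)).
    assert (Y0 := Y 0). assert (Y1 := Y (PI / 2)).
    split.
    - replace (zr t) with (tpoly (cutoff n A ((A + 1) * n)) ((A + 1) * n) 0 t -
        (tpoly (cutoff n A ((A + 1) * n)) ((A + 1) * n) 0 t - zr t)) by ring.
      unfold Rminus at 1. eapply Rle_trans; [apply Rabs_triang|]. rewrite Rabs_Ropp. lra.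
    - replace (zi t) with (tpoly (cutoff n A ((A + 1) * n)) ((A + 1) * n) (PI / 2) t -
        (tpoly (cutoff n A ((A + 1) * n)) ((A + 1) * n) (PI / 2) t - zi t)) by ring.
      unfold Rminus at 1. eapply Rle_trans; [apply Rabs_triang|]. rewrite Rabs_Ropp. lra. }
  destruct (nat_near_pow Z h1 ltac:(lra)) as [N1 (N1a & N1b & N1c & N1d)].
  destruct (nat_near_pow Z h2 ltac:(lra)) as [N2 (N2a & N2b & N2c & N2d)].
  destruct (nat_near_pow Z hK ltac:(lra)) as [Kf (Kfa & Kfb & Kfc & Kfd)].
  destruct (nat_near_pow Z hV ltac:(lra)) as [V (Va & Vb & Vc & Vd)].
  set (L1 := ((A + 1) * N1)%nat). set (L2 := ((A + 1) * N2)%nat).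
  set (w1 := cutoff N1 A L1). set (w2 := cutoff N2 A L2).
  assert (w1B : forall n, Rabs (w1 n) <= 1) by (intros; apply Rabs_le; generalize (cutoff_bounds N1 A L1 n N1a); unfold w1; lra).
  assert (w2B : forall n, Rabs (w2 n) <= 1) by (intros; apply Rabs_le; generalize (cutoff_bounds N2 A L2 n N2a); unfold w2; lra).
  assert (LP1 : (1 <= L1)%nat) by (unfold L1; nia). assert (LP2 : (1 <= L2)%nat) by (unfold L2; nia).
  assert (AZ : 0 <= INR (A + 1) <= Z ^ 1) by (apply cst; rewrite plus_INR; simpl (INR 1); lra).
  assert (L1q : 0 <= INR L1 <= Z ^ (2 * h1 + 2)).
  { unfold L1. rewrite mult_INR. replace (2 * h1 + 2)%nat with (1 + (2 * h1 + 1))%nat by lia. apply le_pow_mult; auto. }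
  assert (L2q : 0 <= INR L2 <= Z ^ (2 * h2 + 2)).
  { unfold L2. rewrite mult_INR. replace (2 * h2 + 2)%nat with (1 + (2 * h2 + 1))%nat by lia. apply le_pow_mult; auto. }
  set (d1 := Z ^ (q + 3) / Z ^ h1). set (d2 := Z ^ (q + 3) / Z ^ h2).
  assert (D1 := HZ h1 N1 ltac:(lia) N1a N1c N1d). assert (D2 := HZ h2 N2 ltac:(lia) N2a N2c N2d).
  fold L1 w1 d1 in D1. fold L2 w2 d2 in D2.
  assert (Zq3 : 0 <= Z ^ (q + 3) <= Z ^ (q + 3)) by (generalize (PZ (q + 3)%nat); lra).
  assert (d1q : 0 <= d1 <= / Z ^ (h1 - (q + 3))) by (apply (le_pow_div Z _ (q + 3)); auto; lia).
  assert (d2q : 0 <= d2 <= / Z ^ (h1 - (q + 3))) by (apply (le_pow_div Z _ (q + 3)); auto; lia).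
  set (hd := (h1 - (q + 3))%nat) in *.
  assert (invhd : / Z ^ hd <= 1) by (rewrite <- Rinv_1; apply Rinv_le_contravar; [lra|apply pow_R1_Rle; auto]).
  set (Dm := Z ^ (ez + 1)).
  assert (Dmz : Z ^ ez + 1 <= Dm).
  { unfold Dm. rewrite pow_add, pow_1, Rmult_comm. apply add_one_le_mul; [lra|apply pow_R1_Rle; lra|lra]. }
  assert (T1B : forall t c, T <= t <= 2 * T -> c = 0 \/ c = PI / 2 -> Rabs (tpoly w1 L1 c t) <= Dm).
  { intros t c Ht Hc. destruct (D1 t Ht) as [X1 X2]. destruct (ZB t Ht) as [Y1 Y2].
    destruct Hc as [-> | ->].
    - replace (tpoly w1 L1 0 t) with ((tpoly w1 L1 0 t - zr t) + zr t) by ring.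
      eapply Rle_trans; [apply Rabs_triang|]. lra.
    - replace (tpoly w1 L1 (PI / 2) t) with ((tpoly w1 L1 (PI / 2) t - zi t) + zi t) by ring.
      eapply Rle_trans; [apply Rabs_triang|]. lra. }
  (* Both copies of zeta are first replaced by the same polynomial, so that [F1] is a real product
     to which Poisson summation applies; sum and integral change by at most 1 each. *)
  set (F1 := fun t => phi (t / T) * (re_prod b b Nb Nb t * re_prod w1 w1 L1 L1 t)).
  set (EF := 2 * NW * (2 * (d1 * (2 * Dm)))).
  assert (Lb := lip_re_prod b b Nb Nb Wb Wb ltac:(lra) ltac:(lra) HNb HNb HbW HbW). fold NW in Lb.
  assert (GD : forall t, T <= t <= 2 * T ->
     Rabs (re_prod b b Nb Nb t * (zr t * zr t + zi t * zi t - re_prod w1 w1 L1 L1 t)) <= EF).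
  { intros t Ht. rewrite Rabs_mult. unfold EF. apply Rmult_le_compat; auto using Rabs_pos.
    - destruct Lb as [_ Lb]. apply (Lb t t); lra.
    - destruct (D1 t Ht) as [X1 X2]. destruct (ZB t Ht) as [Y1 Y2].
      assert (S1 := square_diff_le (zr t) _ d1 Dm X1 ltac:(lra) (T1B t 0 Ht (or_introl eq_refl))).
      assert (S2 := square_diff_le (zi t) _ d1 Dm X2 ltac:(lra) (T1B t (PI / 2) Ht (or_intror eq_refl))).
      unfold re_prod.
      match goal with |- Rabs (?p + ?q' - (?r + ?s)) <= _ => replace (p + q' - (r + s)) with ((p - r) + (q' - s)) by ring end.
      eapply Rle_trans; [apply Rabs_triang|]. lra. }
  assert (EF0 : 0 <= EF).
  { unfold EF. apply Rmult_le_pos; [lra|]. apply Rmult_le_pos; [lra|]. apply Rmult_le_pos; [lra|].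
    assert (P := PZ (ez + 1)%nat). unfold Dm. lra. }
  assert (EFN : INR N * (M * EF) <= 1).
  { assert (Q : 0 <= INR N * (M * (2 * NW * (2 * (2 * Dm)))) <= Z ^ ((q + 1) + (1 + (eB + (1 + (1 + (ez + 1))))))).
    { repeat apply le_pow_mult; auto; try (apply cst; lra). split; [left; apply PZ|unfold Dm; lra]. }
    set (X := INR N * (M * (2 * NW * (2 * (2 * Dm))))) in *.
    replace (INR N * (M * EF)) with (X * d1) by (unfold X, EF; ring).
    assert (Q2 : X * d1 <= Z ^ hd * / Z ^ hd).
    { apply Rmult_le_compat; try lra. eapply Rle_trans; [apply Q|]. apply Rle_pow; auto. unfold hd. lia. }
    rewrite Rinv_r in Q2 by (apply Rgt_not_eq, PZ). auto. }
  assert (hN : 1 / 2 <= INR N + 1 / 2) by lra.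
  assert (S1 : Rabs (sum1 (fun n => F (INR n)) N - sum1 (fun n => F1 (INR n)) N) <= 1).
  { rewrite <- sum1_minus. eapply Rle_trans; [apply sum1_abs_bound with (M := M * EF)|exact EFN].
    intros n Hn. unfold F, F1. fold (zr (INR n)) (zi (INR n)).
    replace (phi (INR n / T) * (re_prod b b Nb Nb (INR n) * (zr (INR n) * zr (INR n) + zi (INR n) * zi (INR n))) -
      phi (INR n / T) * (re_prod b b Nb Nb (INR n) * re_prod w1 w1 L1 L1 (INR n)))
      with (phi (INR n / T) * (re_prod b b Nb Nb (INR n) * (zr (INR n) * zr (INR n) + zi (INR n) * zi (INR n)
         - re_prod w1 w1 L1 L1 (INR n)))) by ring.
    destruct (Rle_dec T (INR n)), (Rle_dec (INR n) (2 * T));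
      try (rewrite (window_zero phi M) by (auto; lra); rewrite Rmult_0_l, Rabs_R0; apply Rmult_le_pos; auto).
    rewrite Rabs_mult. apply Rmult_le_compat; auto using Rabs_pos. apply HP. }
  assert (CF1 : forall x, 1 / 2 <= x <= INR N + 1 / 2 -> continuous F1 x).
  { intros x Hx. assert (Hx' : 1 / 2 <= x) by lra.
    assert (Lw := lip_re_prod w1 w1 L1 L1 1 1 ltac:(lra) ltac:(lra) LP1 LP1 (fun n _ => w1B n) (fun n _ => w1B n)).
    unfold F1. apply continuous_Rmult; [eapply lip_continuous; [apply (lip_window phi M T HP T1)|auto]|].
    apply continuous_Rmult; [apply (lip_continuous _ _ _ x Lb Hx')|apply (lip_continuous _ _ _ x Lw Hx')]. }
  assert (S2 : Rabs (RInt F (1 / 2) (INR N + 1 / 2) - RInt F1 (1 / 2) (INR N + 1 / 2)) <= 1).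
  { assert (XF1 : ex_RInt F1 (1 / 2) (INR N + 1 / 2)) by (apply ex_RInt_cont; auto).
    assert (EE : RInt F (1 / 2) (INR N + 1 / 2) - RInt F1 (1 / 2) (INR N + 1 / 2)
      = RInt (fun t => F t - F1 t) (1 / 2) (INR N + 1 / 2)).
    { symmetry. apply (RInt_minus (V := R_CompleteNormedModule)); auto. }
    assert (XD : ex_RInt (fun t => F t - F1 t) (1 / 2) (INR N + 1 / 2))
      by (apply (ex_RInt_minus (V := R_NormedModule)); auto).
    assert (PT : forall t, F t - F1 t = phi (t / T) * (re_prod b b Nb Nb t * (zr t * zr t + zi t * zi t - re_prod w1 w1 L1 L1 t))).
    { intros t. unfold F, F1, zr, zi. ring. }
    rewrite EE. rewrite (RInt_ext _ _ _ _ (fun t _ => PT t)).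
    eapply Rle_trans; [apply (RInt_window_le (fun t => re_prod b b Nb Nb t * (zr t * zr t + zi t * zi t - re_prod w1 w1 L1 L1 t)) phi M T EF N HP T1 EF0)|exact EFN]; auto.
    apply (ex_RInt_ext (fun t => F t - F1 t)); auto. }
  assert (S3 := poisson_reduction phi M T b Nb w1 L1 N V Wb HP T1 ltac:(lra) Va HNb LP1 ltac:(lra) HbW w1B).
  cbv zeta in S3. fold NW in S3. fold F1 in S3.
  assert (PB : INR N * (M * (2 * NW) * (2 * (INR L1 * INR L1)) * (2 * INR L1 + 2 * INR Nb + 1) * (2 / sqrt (INR V))) <= 1).
  { assert (Q0 : 0 <= 2 * INR L1 + 2 * INR Nb + 1 <= Z ^ (2 * h1 + q + 3)).
    { split; [lra|]. assert (X1 := le_pow_weaken Z _ _ (2 * h1 + q + 2) Z1 L1q ltac:(lia)).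
      assert (X2 := le_pow_weaken Z _ _ (2 * h1 + q + 2) Z1 Nbq ltac:(lia)).
      replace (2 * h1 + q + 3)%nat with (1 + (2 * h1 + q + 2))%nat by lia. rewrite pow_add, pow_1.
      assert (P1 : 1 <= Z ^ (2 * h1 + q + 2)) by (apply pow_R1_Rle; auto).
      apply Rle_trans with (5 * Z ^ (2 * h1 + q + 2)); [lra|apply Rmult_le_compat_r; lra]. }
    assert (Q : 0 <= INR N * (M * (2 * NW) * (2 * (INR L1 * INR L1)) * (2 * INR L1 + 2 * INR Nb + 1) * 2) <=
       Z ^ ((q + 1) + ((((1 + eB) + (1 + ((2 * h1 + 2) + (2 * h1 + 2)))) + (2 * h1 + q + 3)) + 1))).
    { repeat apply le_pow_mult; auto; try (apply cst; lra). }
    set (X := INR N * (M * (2 * NW) * (2 * (INR L1 * INR L1)) * (2 * INR L1 + 2 * INR Nb + 1) * 2)) in *.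
    assert (sV : 0 < sqrt (INR V)) by (generalize (PZ hV); lra).
    replace (INR N * (M * (2 * NW) * (2 * (INR L1 * INR L1)) * (2 * INR L1 + 2 * INR Nb + 1) * (2 / sqrt (INR V))))
      with (X / sqrt (INR V)) by (unfold X; field; lra).
    apply Rmult_le_reg_r with (sqrt (INR V)); auto. unfold Rdiv. rewrite Rmult_assoc, Rinv_l, Rmult_1_r, Rmult_1_l by lra.
    eapply Rle_trans; [apply Q|]. eapply Rle_trans; [|exact Vd]. apply Rle_pow; auto. lia. }
  (* In units of L, ln Nb is at most q and ln L1 at most 2 h1 + 2, and one more unit covers the
     constant 1; beyond [nu0] the high-frequency bound applies. *)
  destruct (nat_ceil (INR (q + 2 * h1 + 3) * L)) as [nu0 [nu0a nu0b]]; [apply Rmult_le_pos; [apply pos_INR|lra]|].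
  assert (nu0c : INR nu0 <= INR c0 * L).
  { rewrite Ec0. replace (q + 2 * h1 + 4)%nat with (S (q + 2 * h1 + 3)) by lia. rewrite S_INR. lra. }
  assert (nu0Z : 0 <= INR nu0 <= Z ^ 1) by (apply cst; split; [apply pos_INR|lra]).
  assert (HI : forall nu, (nu0 < nu)%nat -> Rabs (pair_sum phi T b Nb w1 w1 L1 L1 nu)
     <= Kh * NW * (INR L1 * INR L1) * (T / T ^ j)).
  { intros nu Hnu. apply Hh; auto; try lra.
    assert (nn : INR nu0 <= INR nu) by (apply le_INR; lia).
    assert (lnZ : forall x e, 1 <= x -> x <= Z ^ e -> ln x <= INR e * L).
    { intros x e Hx1 Hx2. apply Rle_trans with (ln (Z ^ e)); [apply ln_le; lra|].
      unfold Z. rewrite <- exp_mul_INR, ln_exp. apply Rmult_le_compat_l; [apply pos_INR|].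
      apply Rle_trans with (1 * L); [apply Rmult_le_compat_r; lra|lra]. }
    assert (l1 : ln (INR Nb) <= INR q * L) by (apply lnZ; [apply (le_INR 1); auto|lra]).
    assert (l2 : ln (INR L1) <= INR (2 * h1 + 2) * L) by (apply lnZ; [apply (le_INR 1); auto|lra]).
    assert (E : INR (q + 2 * h1 + 3) = 1 + INR q + INR (2 * h1 + 2)).
    { replace (q + 2 * h1 + 3)%nat with (1 + q + (2 * h1 + 2))%nat by lia. rewrite !plus_INR. simpl (INR 1). ring. }
    assert (P2 : 1 <= 2 * PI) by (generalize PI2_1; lra).
    assert (nup : 0 <= INR nu) by apply pos_INR.
    apply Rle_trans with (INR nu0).
    - rewrite E, !Rmult_plus_distr_r, Rmult_1_l in nu0a. lra.
    - apply Rle_trans with (1 * INR nu); [lra|apply Rmult_le_compat_r; auto]. }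
  assert (HIs : INR V * (Kh * NW * (INR L1 * INR L1) * (T / T ^ j)) <= 1).
  { assert (Q : 0 <= INR V * (Kh * NW * (INR L1 * INR L1) * T) <= Z ^ ((2 * hV + 1) + (((1 + eB) + ((2 * h1 + 2) + (2 * h1 + 2))) + q))).
    { repeat apply le_pow_mult; auto; try (apply cst; lra). }
    set (X := INR V * (Kh * NW * (INR L1 * INR L1) * T)) in *.
    assert (Tj : Z ^ j <= T ^ j) by (apply pow_incr; lra). assert (Zj := PZ j).
    replace (INR V * (Kh * NW * (INR L1 * INR L1) * (T / T ^ j))) with (X / T ^ j) by (unfold X, Rdiv; ring).
    apply Rmult_le_reg_r with (T ^ j); [lra|]. unfold Rdiv. rewrite Rmult_assoc, Rinv_l, Rmult_1_r, Rmult_1_l by lra.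
    eapply Rle_trans; [apply Q|]. eapply Rle_trans; [|exact Tj]. apply Rle_pow; auto. lia. }
  set (err := fun y => T * INR L1 * INR L2 / Z ^ A + INR L1 * INR L2 * (T * T) / sqrt (INR Kf)
              + T * y * INR Kf * T * INR L1 / Z ^ A).
  set (G := Kl * Kb ^ 2 * (T / L ^ S Cn)).
  (* As 2 pi <= 8 and nu <= c0 L, exp (2 pi nu) is at most T^(8 c0). The condition 3 L1 T y <= N2 on
     the long polynomial therefore only asks for a fixed power of Z. *)
  assert (LO : forall nu, (1 <= nu <= nu0)%nat -> Rabs (pair_sum phi T b Nb w1 w2 L1 L2 nu) <= G + 3 / Z ^ 2).
  { intros nu Hnu. set (y := exp (2 * PI * INR nu)).
    assert (nn : INR nu <= INR nu0) by (apply le_INR; lia).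
    assert (y1 : 0 <= y <= Z ^ ey).
    { split; [left; apply exp_pos|]. rewrite Eey, pow_mult.
      apply Rle_trans with (T ^ (8 * c0)).
      - unfold T, y. rewrite <- exp_mul_INR. apply exp_le. rewrite mult_INR.
        replace (INR 8) with 8 by (simpl; ring).
        assert (P4 := PI_4). apply Rle_trans with (8 * INR nu); [|lra].
        apply Rmult_le_compat_r; [apply pos_INR|lra].
      - replace ((Z ^ (8 * c0)) ^ q) with ((Z ^ q) ^ (8 * c0)) by (rewrite <- !pow_mult; f_equal; lia).
        apply pow_incr. lra. }
    assert (LL : 3 * INR L1 * (T * y) <= INR N2).
    { assert (Q : 0 <= 3 * INR L1 * (T * y) <= Z ^ ((1 + (2 * h1 + 2)) + (q + ey))).
      { repeat apply le_pow_mult; auto; try (apply cst; lra). }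
      eapply Rle_trans; [apply Q|]. eapply Rle_trans; [|exact N2b]. apply Rle_pow; auto. lia. }
    assert (TN1 : T <= INR N1).
    { eapply Rle_trans; [exact TZ|]. eapply Rle_trans; [|exact N1b]. apply Rle_pow; auto. lia. }
    assert (H := Hl L Kb b nu Nb N1 N2 Kf ltac:(lra) ltac:(lia) ltac:(lra) Hb Hb2 HNb NbT Kfa N1a N2a TN1 LL).
    cbv zeta in H. fold T Z y L1 L2 w1 w2 in H. fold (err y) in H. fold G in H.
    eapply Rle_trans; [exact H|]. apply Rplus_le_compat_l.
    replace (INR Nb * (INR Nb * (Kb * INR Nb ^ md) ^ 2)) with NW by (unfold NW, Wb; ring).
    assert (KN : 0 <= Kl * NW <= Z ^ (1 + eB)) by (apply le_pow_mult; auto; apply cst; lra).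
    assert (E1 : Kl * NW * (T * INR L1 * INR L2 / Z ^ A) <= / Z ^ 2).
    { replace (Kl * NW * (T * INR L1 * INR L2 / Z ^ A)) with (Kl * NW * (T * INR L1 * INR L2) / Z ^ A) by (unfold Rdiv; ring).
      apply (le_pow_div Z _ ((1 + eB) + ((q + (2 * h1 + 2)) + (2 * h2 + 2))) 2 A); auto; [|lia].
      repeat apply le_pow_mult; auto; apply cst; lra. }
    assert (E2 : Kl * NW * (INR L1 * INR L2 * (T * T) / sqrt (INR Kf)) <= / Z ^ 2).
    { apply Rle_trans with (Kl * NW * (INR L1 * INR L2 * (T * T)) / Z ^ hK).
      - assert (0 <= INR L1 * INR L2 * (T * T)) by (repeat apply Rmult_le_pos; lra).
        unfold Rdiv. rewrite <- Rmult_assoc. apply Rmult_le_compat_l; [apply Rmult_le_pos; lra|].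
        apply Rinv_le_contravar; auto.
      - apply (le_pow_div Z _ ((1 + eB) + (((2 * h1 + 2) + (2 * h2 + 2)) + (q + q))) 2 hK); auto; [|lia].
        repeat apply le_pow_mult; auto; apply cst; lra. }
    assert (E3 : Kl * NW * (T * y * INR Kf * T * INR L1 / Z ^ A) <= / Z ^ 2).
    { replace (Kl * NW * (T * y * INR Kf * T * INR L1 / Z ^ A)) with (Kl * NW * (T * y * INR Kf * T * INR L1) / Z ^ A) by (unfold Rdiv; ring).
      apply (le_pow_div Z _ ((1 + eB) + ((((q + ey) + (2 * hK + 1)) + q) + (2 * h1 + 2))) 2 A); auto; [|lia].
      repeat apply le_pow_mult; auto; apply cst; lra. }
    unfold err. rewrite !Rmult_plus_distr_l. unfold Rdiv at 4. lra. }
  (* The cost per frequency of passing from (w1, w1), which Poisson summation produces, to (w1, w2),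
     which the low-frequency bound requires. *)
  set (rp := INR N * (M * (2 * NW * (4 * (Dm * (d1 + d2)))))).
  assert (RP : forall nu, Rabs (pair_sum phi T b Nb w1 w1 L1 L1 nu - pair_sum phi T b Nb w1 w2 L1 L2 nu) <= rp).
  { intros nu. apply pair_sum_replace; auto; try lra.
    intros t c Ht Hc. split; [apply T1B; auto|].
    destruct (D1 t Ht) as [X1 X2]. destruct (D2 t Ht) as [Y1 Y2]. destruct Hc as [-> | ->].
    - replace (tpoly w1 L1 0 t - tpoly w2 L2 0 t) with ((tpoly w1 L1 0 t - zr t) + - (tpoly w2 L2 0 t - zr t)) by ring.
      eapply Rle_trans; [apply Rabs_triang|]. rewrite Rabs_Ropp. lra.
    - replace (tpoly w1 L1 (PI / 2) t - tpoly w2 L2 (PI / 2) t)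
        with ((tpoly w1 L1 (PI / 2) t - zi t) + - (tpoly w2 L2 (PI / 2) t - zi t)) by ring.
      eapply Rle_trans; [apply Rabs_triang|]. rewrite Rabs_Ropp. lra. }
  assert (rpB : 0 <= rp <= / Z ^ 1).
  { assert (Q : 0 <= INR N * (M * (2 * NW * (4 * (Dm * 2)))) <= Z ^ ((q + 1) + (1 + (eB + (1 + ((ez + 1) + 1)))))).
    { repeat apply le_pow_mult; auto; try (apply cst; lra). split; [left; apply PZ|unfold Dm; lra]. }
    set (X := INR N * (M * (2 * NW * (4 * (Dm * 2))))) in *.
    replace rp with (X * ((d1 + d2) / 2)) by (unfold X, rp; field).
    assert (Q2 := le_pow_div Z X _ 1 hd Z1 Q ltac:(unfold hd; lia)).
    split; [apply Rmult_le_pos; lra|].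
    eapply Rle_trans; [|apply Q2]. apply Rmult_le_compat_l; lra. }
  assert (G0 : 0 <= G).
  { unfold G. apply Rmult_le_pos; [apply Rmult_le_pos; [lra|apply pow2_ge_0]|].
    apply Rlt_le, Rdiv_lt_0_compat; [lra|apply pow_lt; lra]. }
  assert (iZ : 0 < / Z <= / 10) by (split; [apply Rinv_0_lt_compat; lra|apply Rinv_le_contravar; lra]).
  assert (SU : sum1 (fun nu => Rabs (pair_sum phi T b Nb w1 w1 L1 L1 nu)) V <=
     INR nu0 * (G + / Z + / Z) + 1).
  { apply Rle_trans with (sum1 (fun nu => (if Nat.leb nu nu0 then G + / Z + / Z else 0) +
       Kh * NW * (INR L1 * INR L1) * (T / T ^ j)) V).
    - apply sum1_le. intros nu Hnu.
      assert (HH0 : 0 <= Kh * NW * (INR L1 * INR L1) * (T / T ^ j)).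
      { apply Rmult_le_pos; [apply Rmult_le_pos; apply Rmult_le_pos; lra|]. apply Rlt_le, Rdiv_lt_0_compat; [lra|apply pow_lt; lra]. }
      destruct (Nat.leb_spec nu nu0) as [Hle|Hle]; [|specialize (HI nu Hle); lra].
      specialize (LO nu ltac:(lia)). specialize (RP nu).
      assert (E3 : 3 / Z ^ 2 <= / Z).
      { replace (/ Z) with (Z / Z ^ 2) by (field; lra). apply Rmult_le_compat_r; [left; apply Rinv_0_lt_compat, PZ|lra]. }
      rewrite pow_1 in rpB.
      replace (pair_sum phi T b Nb w1 w1 L1 L1 nu) with ((pair_sum phi T b Nb w1 w1 L1 L1 nu -
        pair_sum phi T b Nb w1 w2 L1 L2 nu) + pair_sum phi T b Nb w1 w2 L1 L2 nu) by ring.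
      eapply Rle_trans; [apply Rabs_triang|]. lra.
    - rewrite sum1_plus, sum1_const. apply Rplus_le_compat; [|exact HIs].
      rewrite <- sum1_const. apply (sum1_restrict_le (fun _ => G + / Z + / Z)). intros; lra. }
  assert (nZ : INR nu0 * / Z <= 1).
  { apply Rmult_le_reg_r with Z; [lra|]. rewrite Rmult_assoc, Rinv_l by lra. lra. }
  assert (nG : INR nu0 * G <= INR c0 * Kl * Kb ^ 2 * (T / L ^ Cn)).
  { apply Rle_trans with (INR c0 * L * G); [apply Rmult_le_compat_r; auto|].
    right. unfold G. simpl. field. split; [apply pow_nonzero; lra|lra]. }
  set (X := T / L ^ Cn) in *.
  set (sF := sum1 (fun n => F (INR n)) N) in *. set (sF1 := sum1 (fun n => F1 (INR n)) N) in *.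
  set (iF := RInt F (1 / 2) (INR N + 1 / 2)) in *. set (iF1 := RInt F1 (1 / 2) (INR N + 1 / 2)) in *.
  replace (sF - iF) with ((sF - sF1) + ((sF1 - iF1) + - (iF - iF1))) by ring.
  eapply Rle_trans; [apply Rabs_triang|].
  assert (TR : Rabs ((sF1 - iF1) + - (iF - iF1)) <= Rabs (sF1 - iF1) + Rabs (iF - iF1)).
  { eapply Rle_trans; [apply Rabs_triang|]. rewrite Rabs_Ropp. lra. }
  assert (c0K : 0 <= INR c0 * Kl * Kb ^ 2) by (apply Rmult_le_pos; [apply Rmult_le_pos; lra|apply pow2_ge_0]).
  rewrite !Rmult_plus_distr_l in SU.
  replace ((15 + 2 * INR c0 * Kl * Kb ^ 2) * X) with (15 * X + 2 * (INR c0 * Kl * Kb ^ 2 * X)) by ring.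
  lra.
Qed.

(** * From the discrepancy bound to the asymptotic formula *)

Theorem theorem1 :
  forall (A theta : R) (phi : R -> R) (K0 C : R),
    0 < A -> 0 < theta < 1 / 2 ->
    smooth phi -> (forall x, x < 1 \/ 2 < x -> phi x = 0) ->
    0 < C ->
    exists K T0 : R, 2 <= T0 /\
      forall (T : R) (b : nat -> R),
        T0 <= T ->
        (forall n : nat, (1 <= n)%nat -> Rabs (b n) <= K0 * dA A n) ->
        forall S I : R,
          Zsum_is (fun l : Z =>
            Cnorm2 (Cmul (zeta (crit (IZR l))) (Bpoly b T theta (crit (IZR l))))
            * phi (IZR l / T)) S ->
          Rint_is (fun t : R =>
            Cnorm2 (Cmul (zeta (crit t)) (Bpoly b T theta (crit t)))
            * phi (t / T)) I ->
          Rabs (S - I) <= K * T * Rpower (ln T) (- C).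
Proof.
  intros A theta phi K0 C HA Hth Hsm Hsupp HC.
  (* Integer exponents above A and C: the first bounds [dA] by a power of [ndiv], the second gives
     at least the required saving because ln T >= 1. *)
  destruct (nat_ceil A ltac:(lra)) as [md [Hmd _]].
  destruct (nat_ceil C ltac:(lra)) as [Cn [HCn _]].
  destruct (smooth_lipschitz phi Hsm Hsupp) as [M [M0 [MB [ML MC]]]].
  set (Kb := Rmax K0 1).
  assert (Kb1 : 1 <= Kb) by apply Rmax_r. assert (KbK : K0 <= Kb) by apply Rmax_l.
  assert (HP : window_class phi M).
  { split; [apply smooth_csupp; auto|]. repeat split; auto. }
  destruct (discrepancy_le phi M theta md Cn Kb HP Hth Kb1) as [K [L0 [Kp [L02 HD]]]].
  exists K, (exp L0). split; [generalize (exp_ineq1_le L0); lra|].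
  intros T b HT Hb S I HS HI.
  assert (T0 : 0 < T) by (generalize (exp_pos L0); lra).
  set (L := ln T). assert (EL : exp L = T) by (apply exp_ln; auto).
  assert (HL : L0 <= L).
  { unfold L. rewrite <- (ln_exp L0). apply ln_le; auto. apply exp_pos. }
  set (Y := exp (theta * L)).
  assert (EY : Rpower T theta = Y) by reflexivity.
  assert (Y1 : 1 <= Y).
  { unfold Y. assert (0 <= theta * L) by (apply Rmult_le_pos; lra). generalize (exp_ineq1_le (theta * L)). lra. }
  set (Nb := Z.to_nat (up Y)). destruct (archimed Y) as [u1 u2].
  assert (ENb : INR Nb = IZR (up Y)) by (unfold Nb; rewrite INR_IZR_INZ, Z2Nat.id; auto; apply le_IZR; lra).
  assert (HNb : (1 <= Nb)%nat) by (apply INR_le; rewrite ENb; simpl; lra).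
  (* Since theta < 1/2, Y is at most sqrt T, and sqrt T >= 2, so Y + 1 <= T. *)
  assert (NbT : INR Nb <= exp L).
  { rewrite ENb. apply Rle_trans with (Y + 1); [lra|].
    assert (Ys : Y <= exp (L / 2)) by (apply exp_le; nra).
    assert (s2 : 2 <= exp (L / 2)) by (generalize (exp_ineq1_le (L / 2)); lra).
    replace (exp L) with (exp (L / 2) * exp (L / 2)) by (rewrite <- exp_plus; f_equal; field). nra. }
  set (b' := trunc_coef b Y).
  assert (Hb1 : forall a, Rabs (b' a) <= Kb * INR (ndiv a) ^ md).
  { intros a. assert (P : 0 <= Kb * INR (ndiv a) ^ md).
    { apply Rmult_le_pos; [lra|]. apply pow_le. generalize (ndiv_ge1 a). lra. }
    unfold b', trunc_coef. destruct (Nat.leb_spec 1 a) as [Ha|Ha]; [|rewrite Rabs_R0; auto].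
    destruct (Rle_dec (INR a) Y); [|rewrite Rabs_R0; auto].
    eapply Rle_trans; [apply Hb; auto|].
    destruct (dA_le_ndiv_pow A md a HA Hmd Ha) as [d0 d1].
    apply Rle_trans with (Kb * dA A a); [apply Rmult_le_compat_r; auto|apply Rmult_le_compat_l; lra]. }
  assert (Hb2 : forall a, b' a <> 0 -> INR a <= exp (theta * L)).
  { intros a. unfold b', trunc_coef. destruct (Nat.leb 1 a); [|lra].
    destruct (Rle_dec (INR a) Y); [auto|lra]. }
  destruct (nat_ceil (2 * T) ltac:(lra)) as [N HN]. rewrite <- EL in HN.
  set (F := fun t => phi (t / exp L) * (re_prod b' b' Nb Nb t *
       (fst (zeta (crit t)) * fst (zeta (crit t)) + snd (zeta (crit t)) * snd (zeta (crit t))))).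
  assert (EF : forall t, Cnorm2 (Cmul (zeta (crit t)) (Bpoly b T theta (crit t))) * phi (t / T) = F t).
  { intros t. unfold F, re_prod. rewrite EL. destruct (Bpoly_crit b T theta t) as [E1 E2].
    rewrite EY in E1, E2. fold b' Nb in E1, E2. rewrite <- E1, <- E2.
    unfold Cnorm2, Cmul. simpl fst. simpl snd. ring. }
  assert (F0 : forall t, t < T \/ 2 * T < t -> F t = 0).
  { intros t Ht. unfold F. rewrite EL, (window_zero phi M T t HP T0 Ht). ring. }
  rewrite EL in HN.
  assert (T1 : 1 <= T) by (generalize (exp_ineq1_le L0); lra).
  assert (ES : S = sum1 (fun n => F (INR n)) N).
  { rewrite (Zsum_window _ S N) with (2 := HS).
    - apply sum1_ext. intros n _. rewrite <- INR_IZR_INZ. apply EF.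
    - intros l Hl. rewrite EF. apply F0. destruct Hl as [Hl|Hl].
      + left. apply IZR_le in Hl. lra.
      + right. apply IZR_lt in Hl. rewrite <- INR_IZR_INZ in Hl. lra. }
  assert (W0 : forall t, t <= 1 / 2 \/ INR N + 1 / 2 <= t ->
    Cnorm2 (Cmul (zeta (crit t)) (Bpoly b T theta (crit t))) * phi (t / T) = 0)
    by (intros t Ht; rewrite EF; apply F0; lra).
  destruct (Rint_window _ I N W0 HI) as [Hex EI].
  assert (FE : (fun t => Cnorm2 (Cmul (zeta (crit t)) (Bpoly b T theta (crit t))) * phi (t / T)) = F)
    by (apply functional_extensionality; exact EF).
  rewrite FE in Hex, EI.
  assert (HH := HD L b' Nb N HL Hb1 Hb2 HNb NbT ltac:(rewrite EL; lra) Hex).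
  cbv zeta in HH. fold F in HH. rewrite EL in HH. rewrite ES, EI.
  eapply Rle_trans; [exact HH|]. rewrite Rmult_assoc. apply Rmult_le_compat_l; auto.
  apply Rmult_le_compat_l; [lra|]. fold L.
  rewrite <- (Rpower_pow Cn L), <- Rpower_Ropp by lra. apply Rle_Rpower; lra.
Qed.
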